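(* For every nontrivial knot or link $K$ in $S^3$, $q(K) < c(K)$, where $c(K)$ is the (ordinary) crossing number of $K$ and $q(K)$ is its quadruple crossing number.
   Context: A quadruple crossing in a projection of a knot or link is a singular point of the projection through which exactly four strands of the knot pass straight through (each strand crossing the point transversally, with four distinct heights assigned to the four strands). A quadruple crossing projection of $K$ is a projection in which every singular point is a quadruple crossing. Every knot and link has a quadruple crossing projection, and $q(K)$ (also written $c_4(K)$) denotes the minimal number of quadruple crossings over all quadruple crossing projections of $K$. $c(K)$ denotes the usual crossing number (minimal number of ordinary double crossings in a regular projection). *)

(* Defs.v *)
(* Knots/links are modelled as polygonal (PL) links in R^3 (= S^3 minus a point),
   knot type = ambient isotopy class, projections = orthogonal projection to the
   xy-plane of isotopic polygonal representatives. *)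
From HB Require Import structures.
From mathcomp Require Import all_boot all_order all_algebra.
From mathcomp Require Import all_classical all_reals all_analysis.
Set Implicit Arguments. Unset Strict Implicit. Unset Printing Implicit Defensive.
Import Order.TTheory GRing.Theory Num.Theory.
Import numFieldNormedType.Exports.
Local Open Scope classical_set_scope.
Local Open Scope ring_scope.

Section Knots.
Variable R : realType.

Local Notation pt := 'M[R]_(1,3).

Definition i0 : 'I_3 := @Ordinal 3 0 isT.
Definition i1 : 'I_3 := @Ordinal 3 1 isT.
Definition i2 : 'I_3 := @Ordinal 3 2 isT.

Definition seg (a b : pt) : set pt :=
  [set x | exists t : R, 0 <= t <= 1 /\ x = (1 - t) *: a + t *: b].

Definition vtx (p : seq pt) (i : nat) : pt := nth 0 p (i %% size p).
Definition edge (p : seq pt) (i : nat) : set pt := seg (vtx p i) (vtx p i.+1).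
Definition polyset (p : seq pt) : set pt :=
  \bigcup_(i in [set i | (i < size p)%N]) edge p i.

Definition simple_polygon (p : seq pt) : Prop :=
  [/\ (3 <= size p)%N,
      (forall i, (i < size p)%N -> vtx p i <> vtx p i.+1) &
      (forall i j, (i < size p)%N -> (j < size p)%N -> i <> j ->
         edge p i `&` edge p j =
           if j == (i.+1 %% size p)%N then [set vtx p j]
           else if i == (j.+1 %% size p)%N then [set vtx p i] else set0)].

Definition comp (L : seq (seq pt)) (k : nat) : seq pt := nth [::] L k.
Definition linkset (L : seq (seq pt)) : set pt :=
  \bigcup_(k in [set k | (k < size L)%N]) polyset (comp L k).
Definition polygonal_link (L : seq (seq pt)) : Prop :=
  [/\ (0 < size L)%N,
      (forall k, (k < size L)%N -> simple_polygon (comp L k)) &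
      (forall k l, (k < size L)%N -> (l < size L)%N -> k <> l ->
         polyset (comp L k) `&` polyset (comp L l) = set0)].

Definition homeomorphism (f : pt -> pt) : Prop :=
  continuous f /\ exists g : pt -> pt, [/\ continuous g, cancel f g & cancel g f].
Definition ambient_isotopic (A B : set pt) : Prop :=
  exists H : pt -> R -> pt,
    [/\ continuous (fun q : pt * R => H q.1 q.2),
        (forall t, homeomorphism (fun x => H x t)),
        (forall x, H x 0 = x) &
        (fun x => H x 1) @` A = B].

Definition trivial_link (K : set pt) : Prop :=
  exists L, [/\ polygonal_link L, (forall v, linkset L v -> v ord0 i2 = 0) &
               ambient_isotopic K (linkset L)].

Definition proj (v : pt) : R * R := (v ord0 i0, v ord0 i1).
Definition fiber (L : seq (seq pt)) (x : R * R) : set pt :=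
  [set v | linkset L v /\ proj v = x].
Definition is_vertex (L : seq (seq pt)) (v : pt) : Prop :=
  exists k i, [/\ (k < size L)%N, (i < size (comp L k))%N & v = vtx (comp L k) i].
Definition on_edge (L : seq (seq pt)) (v a b : pt) : Prop :=
  exists k i, [/\ (k < size L)%N, (i < size (comp L k))%N,
                  a = vtx (comp L k) i, b = vtx (comp L k) i.+1 & seg a b v].
Definition det2 (u w : R * R) : R := u.1 * w.2 - u.2 * w.1.
Definition transverse (L : seq (seq pt)) (v w : pt) : Prop :=
  forall a b c d, on_edge L v a b -> on_edge L w c d ->
    det2 (proj (b - a)) (proj (d - c)) != 0.

Definition singular (L : seq (seq pt)) (x : R * R) : Prop :=
  exists v w, [/\ fiber L x v, fiber L x w & v <> w].
Definition multi_crossing (L : seq (seq pt)) (m : nat) (x : R * R) : Prop :=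
  exists s : seq pt, [/\ uniq s, size s = m,
    (forall v, fiber L x v <-> v \in s),
    (forall v, v \in s -> ~ is_vertex L v) &
    (forall v w, v \in s -> w \in s -> v != w -> transverse L v w)].
Definition num_singular (L : seq (seq pt)) (n : nat) : Prop :=
  exists s : seq (R * R), [/\ uniq s, size s = n & forall x, singular L x <-> x \in s].

Definition regular_projection (L : seq (seq pt)) : Prop :=
  (exists n, num_singular L n) /\ forall x, singular L x -> multi_crossing L 2 x.
Definition quadruple_projection (L : seq (seq pt)) : Prop :=
  (exists n, num_singular L n) /\ forall x, singular L x -> multi_crossing L 4 x.

Definition crossing_counts (K : set pt) : set nat :=
  [set n | exists L, [/\ polygonal_link L, ambient_isotopic K (linkset L),
                         regular_projection L & num_singular L n]].
Definition quadruple_counts (K : set pt) : set nat :=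
  [set n | exists L, [/\ polygonal_link L, ambient_isotopic K (linkset L),
                         quadruple_projection L & num_singular L n]].

(* minimum of a set of naturals (0 if empty) *)
Definition setmin (A : set nat) : nat :=
  xget 0%N [set n | A n /\ forall m, A m -> (n <= m)%N].

Definition crossing_number (K : set pt) : nat := setmin (crossing_counts K).
Definition quadruple_crossing_number (K : set pt) : nat := setmin (quadruple_counts K).

End Knots.

(* Main.v *)
(** Up to isotopy a link is determined by its finite list of oriented edges, and the multiplicity
    of a point of a projection is the number of half-open projected edges that contain it.

    A strand that is above (or below) everything over a segment can be lifted there and put down
    again along any other path with the same ends, whatever this path crosses.  Take a regular
    projection with the least number c of crossings.  A projection without singular points is
    flattened by a vertical isotopy, so c > 0.  Colour the faces like a checkerboard; walking
    straight through crossings one stays in faces of one colour.  In the graph whose vertices are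
    the faces of a well-chosen colour and whose edges are the crossings there is a loop or a cycle
    of even length: a crossing p together with k other crossings q_1, ..., q_k, where k = 0 or k is
    odd, and a closed walk from p to p through distinct faces that passes straight through the q_i.
    If k = 0, one strand at p is rerouted along the walk, and p disappears.  If k is odd, both
    strands at p are: the second path meets the first one only at the q_i and changes sides at
    each of them, which fits the position of its two ends exactly when k is odd.  Now p has
    disappeared and the q_i have become quadruple.  Every remaining double crossing is made
    quadruple by a finger of one strand that passes twice more through it, which leaves c - 1
    quadruple crossings. *)
Require Import Defs.
From mathcomp Require Import all_boot all_order all_algebra.
From mathcomp Require Import all_classical all_reals all_analysis.
From mathcomp Require Import ring lra zify.
Set Implicit Arguments. Unset Strict Implicit. Unset Printing Implicit Defensive.
Import Order.TTheory GRing.Theory Num.Theory.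
Import numFieldNormedType.Exports.
Local Open Scope classical_set_scope.
Local Open Scope ring_scope.
Local Notation proj := (@Defs.proj _).

(** No Jordan curve theorem is used. A face is a class of the relation [conn], polygonal paths off
    the diagram, and the colouring supplies the separation that is needed: points on the two sides
    of an edge lie in different faces. The obstacle is the second path at p, which has to run
    through faces already cut by the first one. Its connections are therefore written down as the
    first path pushed off itself, sides become signs of determinants, and the parity of k appears as
    a sign that has to return to itself around the walk. Half-open edges turn the bookkeeping into
    arithmetic: a vertex lies on exactly one of them, multiplicities are additive and do not change
    when an edge is cut, so a list of edges is embedded when all counts are at most 1, and the
    multiplicities after a surgery come out of one equation. Crossings must be passed straight and
    in pairwise different directions. Hence the pieces of a path in consecutive faces get prescribed
    opposite germs at the crossing between them and are merged there into one edge, and these germs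
    are fixed vectors in the coordinates given by the two old strands. *)

Section IntervalInduction.
Variable R : realType.

(** Connectedness of the unit interval in the form of all later local-to-global arguments: the
    supremum of the b with [Q 0 b] is attained and cannot be less than 1. Locally [Q a b] is asked
    only for a <= x <= b, so it suffices to compare with the point x itself. *)
Lemma interval_induction (Q : R -> R -> Prop) :
  (forall a b c, a <= b -> b <= c -> Q a b -> Q b c -> Q a c) ->
  (forall x, 0 <= x <= 1 -> exists2 d, 0 < d & forall a b, 0 <= a -> a <= x -> x <= b ->
     b <= 1 -> x - d < a -> b < x + d -> Q a b) ->
  Q 0 1.
Proof.
move=> Qtrans Qloc.
pose S := [set b : R | 0 <= b <= 1 /\ Q 0 b].
have S0 : S 0.
  split; first by rewrite lexx ler01.
  have [|d d0 H] := Qloc 0; first by rewrite lexx ler01.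
  by apply: H; lra.
have hS : has_sup S.
  by split; [exists 0 | exists 1 => b [] /andP[]].
have ub : forall b, S b -> b <= sup S by move=> b Sb; apply: sup_upper_bound.
have s0 : 0 <= sup S by apply: ub.
have s1 : sup S <= 1 by apply: (ge_sup (x := 1)); [exists 0 | move=> b [] /andP[]].
have [|d d0 H] := Qloc (sup S); first by rewrite s0 s1.
have [b Sb bs] := sup_adherent d0 hS.
have bm := ub _ Sb.
have [/andP[b0 b1] Qb] := Sb.
have [le1|gt1] := leP 1 (sup S + d / 2).
  by apply: (Qtrans _ b) => //; apply: H; lra.
have : S (sup S + d / 2).
  split; first lra.
  by apply: (Qtrans _ b) => //; [lra | apply: H; lra].
by move/ub => ?; exfalso; lra.
Qed.

End IntervalInduction.

(** * Edge lists *)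

Section Lists.
Variable A : eqType.
Implicit Types (s u v : seq A) (x y a : A).

Definition consec s : seq (A * A) := zip s (behead s).

Definition cyc_edges s : seq (A * A) :=
  if s is x :: _ then consec (rcons s x) else [::].

Lemma consec_cat u a v : consec (u ++ a :: v) = consec (rcons u a) ++ consec (a :: v).
Proof.
elim: u => [|x u IH] //=.
case: u IH => [|y u] IH //=.
by rewrite /consec /= in IH *; case: IH => ->.
Qed.

Lemma consec_cons2 x y s : consec (x :: y :: s) = (x, y) :: consec (y :: s).
Proof. by []. Qed.

Lemma consec_rcons2 s x y : consec (rcons (rcons s x) y) = rcons (consec (rcons s x)) (x, y).
Proof. by rewrite -cats1 -cat_rcons ?cat_rcons consec_cat /= cats1. Qed.

Lemma consec_map (B : eqType) (f : A -> B) s :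
  zip (map f s) (behead (map f s)) = map (fun e => (f e.1, f e.2)) (consec s).
Proof. by elim: s => [|x [|y s] IH] //=; rewrite /consec /= in IH *; rewrite IH. Qed.

Lemma size_cyc_edges s : size (cyc_edges s) = size s.
Proof. by case: s => [|x s] //=; rewrite /consec size_zip /= size_rcons; lia. Qed.

Lemma nth_cyc_edges d s i : (i < size s)%N ->
  nth (d, d) (cyc_edges s) i = (nth d s (i %% size s), nth d s (i.+1 %% size s)).
Proof.
case: s => [|x s] // Hi; rewrite /cyc_edges /consec nth_zip_cond.
have -> : (i < size (zip (rcons (x :: s) x) (behead (rcons (x :: s) x))))%N.
  by rewrite size_zip /= size_rcons; move: Hi => /=; lia.
rewrite modn_small //= -rcons_cons nth_rcons Hi; congr (_, _).
rewrite nth_rcons; move: Hi => /=; rewrite ltnS leq_eqVlt => /orP[/eqP ->|Hi].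
  by rewrite ltnn eqxx modnn.
by rewrite Hi modn_small.
Qed.

Lemma perm_consec_rot u v :
  perm_eq (cyc_edges (u ++ v)) (cyc_edges (v ++ u)).
Proof.
case: u => [|a u]; first by rewrite cats0.
case: v => [|b v]; first by rewrite cats0.
rewrite /cyc_edges /= -!cats1 /= -!catA /=.
rewrite -!cat_cons !consec_cat -!cats1 /=.
by rewrite perm_catC.
Qed.

Definition link_edges (L : seq (seq A)) : seq (A * A) := flatten (map cyc_edges L).

(** Surgery is done on unordered lists of oriented edges; this predicate remembers that they fit
    together to closed polygons. The bound 3 is the one that [simple_polygon] demands. *)
Definition closed_edges (S : seq (A * A)) : Prop :=
  exists L, [/\ (0 < size L)%N, (forall k, (k < size L)%N -> (3 <= size (nth [::] L k))%N) &
               perm_eq (link_edges L) S].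

Lemma closed_edges_perm S S' : perm_eq S S' -> closed_edges S -> closed_edges S'.
Proof. by move=> SS' [L [L0 L3 LS]]; exists L; split => //; apply: perm_trans LS SS'. Qed.

(** The polygon is rotated until the edge (a, b) closes it. The second alternative is the polygon
    with a single vertex, whose only edge is a loop. *)
Lemma cyc_edges_split s a b : (a, b) \in cyc_edges s ->
  exists w, perm_eq (cyc_edges s) (cyc_edges (b :: rcons w a)) /\ size s = (size w).+2 \/
            (a = b /\ s = [:: a]).
Proof.
case: s => [|x s] //.
move=> H; have: exists u v, rcons (x :: s) x = u ++ a :: b :: v.
  move: H; rewrite /cyc_edges; elim: (rcons _ _) => [|y t IH] //.
  case: t IH => [|z t] IH //; rewrite consec_cons2 inE => /orP[/eqP[-> ->]|/IH [u [v ->]]].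
    by exists [::], t.
  by exists (y :: u), v.
move=> [u [v E]].
case/lastP: v E => [|v z].
  rewrite -(cat1s a) catA cats1 /= => E.
  have E' : rcons (x :: s) x = rcons (u ++ [:: a]) b by rewrite /= E.
  move/rcons_inj: E' => [E' bx]; subst b.
  case: u E E' => [|y u] E /= => [[xa ->]|[xy E']].
    by exists [::]; right; subst.
  subst y; exists u; left; split; last by rewrite /= E' size_cat /= addn1.
  by rewrite E' cats1.
rewrite -!rcons_cons -rcons_cat => /rcons_inj [E zx]; subst z;
case: u E => [|y u] /= [-> ->].
  exists v; left; split => //.
  have E1 : consec (b :: rcons (rcons v a) b) = rcons (consec (b :: rcons v a)) (a, b).
    by rewrite -!rcons_cons consec_rcons2.
  by rewrite E1 rcons_cons consec_cons2 perm_sym perm_rcons.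
exists (v ++ y :: u); left; split; last by rewrite !size_cat /=; lia.
have E1 : y :: u ++ [:: a, b & v] = rcons (y :: u) a ++ b :: v by rewrite cat_rcons.
have E2 : b :: rcons (v ++ y :: u) a = (b :: v) ++ rcons (y :: u) a by rewrite /= rcons_cat.
by rewrite -/(cyc_edges (y :: _)) -/(cyc_edges (b :: rcons (v ++ y :: u) a)) E1 E2; apply: perm_consec_rot.
Qed.

(** Every cutting of an edge and every rerouting of a strand is an instance of this replacement of
    an edge by a path with the same ends. *)
Lemma closed_edges_insert a b xs S :
  closed_edges ((a, b) :: S) -> closed_edges (consec (a :: rcons xs b) ++ S).
Proof.
move=> [L [L0 L3 LS]].
have : (a, b) \in link_edges L by rewrite (perm_mem LS) mem_head.
move=> /flatten_mapP [p pL abp].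
have [L' PL] : exists L', perm_eq L (p :: L') by exists (rem p L); apply: perm_to_rem.
have p3 : (3 <= size p)%N.
  by rewrite -(nth_index [::] pL); apply: L3; rewrite index_mem.
have [w [[Pp sp]|[_ ep]]] := cyc_edges_split abp; last by rewrite ep in p3.
exists ((b :: w ++ a :: xs) :: L'); split => //.
  move=> [|k] /= kl; first by rewrite size_cat /=; lia.
  have qL : nth [::] L' k \in L by rewrite (perm_mem PL) inE mem_nth ?orbT.
  by rewrite -(nth_index [::] qL); apply: L3; rewrite index_mem.
have HL : perm_eq (link_edges L) (cyc_edges p ++ link_edges L').
  by rewrite /link_edges; apply: (perm_flatten (perm_map _ PL)).
have E1 : cyc_edges (b :: rcons w a) = consec (b :: rcons w a) ++ [:: (a, b)].
  by rewrite /cyc_edges -!rcons_cons consec_rcons2 cats1.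
have E2 : cyc_edges (b :: w ++ a :: xs) = consec (b :: rcons w a) ++ consec (a :: rcons xs b).
  by rewrite /cyc_edges /= rcons_cat /= -cat_cons consec_cat rcons_cons.
have -> : link_edges ((b :: w ++ a :: xs) :: L') = cyc_edges (b :: w ++ a :: xs) ++ link_edges L' by [].
rewrite E2.
have : perm_eq (consec (b :: rcons w a) ++ link_edges L') S.
  rewrite -(perm_cons (a, b)); apply: perm_trans LS.
  rewrite perm_sym; apply: (perm_trans HL).
  apply: (perm_trans (_ : perm_eq _ (cyc_edges (b :: rcons w a) ++ link_edges L'))).
    by rewrite perm_cat2r.
  by rewrite E1 -catA (perm_catCA _ [:: (a, b)]).
move=> H; rewrite -catA perm_catCA perm_cat2l.
exact: H.
Qed.

End Lists.

Section CountLemmas.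
Variable A : eqType.

Lemma count_ge2_nth (P : pred A) d s i j : (i < size s)%N -> (j < size s)%N -> i != j ->
  P (nth d s i) -> P (nth d s j) -> (2 <= count P s)%N.
Proof.
wlog ij : i j / (i < j)%N.
  move=> H si sj nij Pi Pj; have := nij; rewrite neq_ltn => /orP[] ?.
    exact: (H i j).
  by apply: (H j i) => //; rewrite eq_sym.
move=> si sj _ Pi Pj; rewrite -(cat_take_drop j s) count_cat.
have h1 : (0 < count P (take j s))%N.
  rewrite -has_count; apply/(has_nthP d); exists i; last by rewrite nth_take.
  by rewrite size_take; case: ifP => //; lia.
have h2 : (0 < count P (drop j s))%N.
  by rewrite -has_count (drop_nth d) //= Pj.
lia.
Qed.

Lemma count_le1_eq (P : pred A) s x y : (count P s <= 1)%N -> x \in s -> y \in s -> P x -> P y -> x = y.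
Proof.
move=> c1 xs ys Px Py; apply/eqP/negPn/negP => xy.
have := @count_ge2_nth P x s (index x s) (index y s).
rewrite !index_mem !nth_index // => /(_ xs ys) H.
suff /H : index x s != index y s by move=> /(_ Px Py); lia.
apply: contraNneq xy => E; by rewrite -(nth_index x xs) E nth_index.
Qed.

Lemma count_ge2_ex (P : pred A) s : uniq s -> (2 <= count P s)%N ->
  exists x y, [/\ x \in s, y \in s, x != y, P x & P y].
Proof.
move=> us; rewrite -size_filter; have := filter_uniq P us.
have : all P (seq.filter P s) by apply: filter_all.
have : {subset seq.filter P s <= s} by apply: mem_subseq; apply: filter_subseq.
case: (seq.filter P s) => [|x [|y t]] //= sub /and3P[Px Py _] /andP[]; rewrite inE negb_or => /andP[xy _] _ _.
by exists x, y; split => //; apply: sub; rewrite !inE eqxx ?orbT.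
Qed.

Lemma count_eq0 (P : pred A) s : (forall x, x \in s -> ~ P x) -> count P s = 0%N.
Proof. by move=> H; apply/eqP; rewrite -leqn0 leqNgt -has_count; apply/hasPn => x /H /negP. Qed.

Lemma count_gt0 (P : pred A) s : (0 < count P s)%N -> exists2 x, x \in s & P x.
Proof. by rewrite -has_count => /hasP. Qed.

Lemma count_le1_nth (P : pred A) d s :
  (forall i j, (i < j)%N -> (j < size s)%N -> P (nth d s i) -> P (nth d s j) -> False) -> (count P s <= 1)%N.
Proof.
elim: s => [|x s IH] //= H.
have c1 : (count P s <= 1)%N by apply: IH => i j ij js; apply: (H i.+1 j.+1).
case Px: (P x) => //=.
suff -> : count P s = 0%N by [].
apply: count_eq0 => y ys Py; apply: (H 0%N (index y s).+1) => //; first by rewrite ltnS index_mem.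
by rewrite /= nth_index.
Qed.

Lemma count_flatten_le1 (B : eqType) (P : pred A) (F : B -> seq A) d (s : seq B) :
  (forall i, (i < size s)%N -> (count P (F (nth d s i)) <= 1)%N) ->
  (forall i j, (i < j)%N -> (j < size s)%N ->
     has P (F (nth d s i)) -> has P (F (nth d s j)) -> False) ->
  (count P (flatten (map F s)) <= 1)%N.
Proof.
elim: s => [|x s IH] //= H1 H2; rewrite count_cat.
have c1 : (count P (flatten (map F s)) <= 1)%N.
  by apply: IH => [i si|i j ij js]; [apply: (H1 i.+1) | apply: (H2 i.+1 j.+1)].
case Px: (has P (F x)); last by move: Px; rewrite has_count; case: count.
suff -> : count P (flatten (map F s)) = 0%N by rewrite addn0; apply: (H1 0%N).
apply: count_eq0 => y /flatten_mapP [b bs yb] Py.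
apply: (H2 0%N (index b s).+1) => //=; first by rewrite ltnS index_mem.
by rewrite nth_index //; apply/hasP; exists y.
Qed.

End CountLemmas.

(** * Links as lists of half-open edges *)

Section LinkEdges.
Variable R : realType.
Local Notation pt := 'M[R]_(1,3).
Implicit Types (S : seq (pt * pt)) (L : seq (seq pt)) (e : pt * pt).

(** The end is left out: it is the start of the next edge, so that a vertex of a polygon is counted
    once. *)
Definition hseg e : set pt := [set x | exists t : R, 0 <= t < 1 /\ x = e.1 + t *: (e.2 - e.1)].
Definition hcount S (x : pt) := count (fun e => `[< hseg e x >]) S.
(** For closed lists this is equivalent to the polygons being simple and disjoint ([polygonal_good],
    [good_polygonal]), but unlike that condition it depends only on the multiset of edges. *)
Definition good S := (forall e, e \in S -> e.1 <> e.2) /\ forall x, (hcount S x <= 1)%N.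
Definition support S : set pt := [set x | exists2 e, e \in S & hseg e x].

Lemma good_perm S S' : perm_eq S S' -> good S -> good S'.
Proof.
move=> SS' [g1 g2]; split => [e|x]; first by rewrite -(perm_mem SS'); apply: g1.
by rewrite /hcount -(permP SS'); apply: g2.
Qed.

Lemma support_perm S S' : perm_eq S S' -> support S = support S'.
Proof. by move=> SS'; apply/seteqP; split => x [e eS ex]; exists e => //; rewrite ?(perm_mem SS') // -(perm_mem SS'). Qed.

Lemma seg_hseg a b : seg a b = hseg (a, b) `|` [set b].
Proof.
have E (t : R) : (1 - t) *: a + t *: b = a + t *: (b - a).
  by rewrite scalerBl scale1r scalerBr addrA addrAC.
apply/seteqP; split => x.
  move=> [t [/andP[t0 t1] ->]]; move: t1; rewrite le_eqVlt => /orP[/eqP ->|t1].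
    by right => /=; rewrite subrr scale0r scale1r add0r.
  by left; exists t; rewrite t0 t1 E.
move=> [[t [/andP[t0 t1] ->]]|->] /=.
  by exists t; rewrite t0 ltW // E.
by exists 1; rewrite ler01 lexx subrr scale0r scale1r add0r.
Qed.

Lemma hseg0 a b : hseg (a, b) a.
Proof. by exists 0; rewrite lexx ltr01 scale0r addr0. Qed.

Lemma hsegN1 a b : a <> b -> ~ hseg (a, b) b.
Proof.
move=> ab [t [/andP[_ t1] /=]].
move/eqP; rewrite addrC -subr_eq -{1}[b - a]scale1r -subr_eq0 -scalerBl scaler_eq0 => /orP[|].
  by rewrite subr_eq0 => /eqP t1'; rewrite -t1' ltxx in t1.
by rewrite subr_eq0 => /eqP E; apply: ab.
Qed.

Lemma mem_link_edges L a b : (a, b) \in link_edges L <->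
  exists k i, [/\ (k < size L)%N, (i < size (Defs.comp L k))%N, a = vtx (Defs.comp L k) i & b = vtx (Defs.comp L k) i.+1].
Proof.
split.
  move=> /flatten_mapP [p pL abp]; exists (index p L), (index (a, b) (cyc_edges p)).
  rewrite /Defs.comp nth_index // index_mem pL.
  have ip : (index (a, b) (cyc_edges p) < size p)%N by rewrite -size_cyc_edges index_mem.
  have := nth_cyc_edges 0 ip; rewrite nth_index // => -[Ea Eb].
  by split.
move=> [k [i [kL ip -> ->]]]; apply/flatten_mapP; exists (Defs.comp L k); first exact: mem_nth.
by rewrite -(nth_cyc_edges 0 ip) mem_nth // size_cyc_edges.
Qed.

(** Closed and half-open edges cover the same set, as the missing end of an edge is the start of the
    next one. *)
Lemma linkset_support L : (forall k, (k < size L)%N -> (3 <= size (Defs.comp L k))%N) ->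
  linkset L = support (link_edges L).
Proof.
move=> L3; apply/seteqP; split => x.
  move=> [k /= kL [i /= iL]]; rewrite /edge seg_hseg => -[h|->].
    by exists (vtx (Defs.comp L k) i, vtx (Defs.comp L k) i.+1) => //; apply/mem_link_edges; exists k, i.
  have sz : (0 < size (Defs.comp L k))%N by have := L3 _ kL; lia.
  set j := (i.+1 %% size (Defs.comp L k))%N.
  have jL : (j < size (Defs.comp L k))%N by apply: ltn_pmod.
  have Ej : vtx (Defs.comp L k) i.+1 = vtx (Defs.comp L k) j by rewrite /vtx modn_mod.
  exists (vtx (Defs.comp L k) j, vtx (Defs.comp L k) j.+1); last by rewrite Ej; apply: hseg0.
  by apply/mem_link_edges; exists k, j.
move=> [[a b] /mem_link_edges [k [i [kL iL -> ->]]] h].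
by exists k => //; exists i => //; rewrite /edge seg_hseg; left.
Qed.

Lemma vertexP L v : is_vertex L v <-> exists2 e, e \in link_edges L & v = e.1.
Proof.
split=> [[k [i [kL iL ->]]]|[[a b] /mem_link_edges [k [i [kL iL -> _]]] ->]].
  by exists (vtx (Defs.comp L k) i, vtx (Defs.comp L k) i.+1) => //; apply/mem_link_edges; exists k, i.
by exists k, i.
Qed.

Lemma on_edgeP L v a b : on_edge L v a b <-> (a, b) \in link_edges L /\ seg a b v.
Proof.
split=> [[k [i [kL iL -> -> sv]]]|[/mem_link_edges [k [i [kL iL -> ->]]] sv]].
  by split => //; apply/mem_link_edges; exists k, i.
by exists k, i.
Qed.

Lemma polygonal_good L : polygonal_link L -> good (link_edges L).
Proof.
move=> [L0 Lp Ld]; split.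
  by move=> [a b] /mem_link_edges [k [i [kL iL -> ->]]] /=; have [_ + _] := Lp _ kL; apply.
move=> x; apply: (@count_flatten_le1 _ _ _ _ [::]).
  move=> k kL; have [sz nd dj] := Lp _ kL; rewrite -/(Defs.comp L k).
  apply: (@count_le1_nth _ _ (0, 0)); rewrite size_cyc_edges => i j ij jp.
  have ip := ltn_trans ij jp; rewrite !nth_cyc_edges // => /asboolP hi /asboolP hj.
  have : (edge (Defs.comp L k) i `&` edge (Defs.comp L k) j) x.
    by rewrite /edge !seg_hseg; split; left.
  rewrite (dj i j) //; last lia.
  case: eqP => [ej|_].
    move=> /= xj; apply: (@hsegN1 (vtx (Defs.comp L k) i) (vtx (Defs.comp L k) i.+1)); first exact: nd.
    move: hi; rewrite xj ej /vtx modn_mod; exact.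
  case: eqP => // [ei] /= xi; apply: (@hsegN1 (vtx (Defs.comp L k) j) (vtx (Defs.comp L k) j.+1)); first exact: nd.
  move: hj; rewrite xi ei /vtx modn_mod; exact.
move=> k l kl lL /hasP [[a b] ab /asboolP hx] /hasP [[c d] cd /asboolP hy].
have kL := ltn_trans kl lL.
have inp m a' b' : (m < size L)%N -> (a', b') \in cyc_edges (nth [::] L m) -> hseg (a', b') x ->
    polyset (Defs.comp L m) x.
  move=> mL ab' h; have := ab'; rewrite -index_mem size_cyc_edges => im.
  exists (index (a', b') (cyc_edges (nth [::] L m))) => //=.
  have := nth_cyc_edges 0 im; rewrite nth_index // => -[Ea Eb].
  by rewrite /edge seg_hseg; left; rewrite /vtx /Defs.comp -Ea -Eb.
have : (polyset (Defs.comp L k) `&` polyset (Defs.comp L l)) x by split; [apply: inp hx|apply: inp hy].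
by rewrite (Ld k l) //; lia.
Qed.

Lemma polygonal_closed L : polygonal_link L -> closed_edges (link_edges L).
Proof. by move=> [L0 Lp _]; exists L; split => // k kL; have [] := Lp _ kL. Qed.

Lemma good_polygonal L : (0 < size L)%N -> (forall k, (k < size L)%N -> (3 <= size (Defs.comp L k))%N) ->
  good (link_edges L) -> polygonal_link L.
Proof.
move=> L0 L3 [gn gc].
have nd k i : (k < size L)%N -> (i < size (Defs.comp L k))%N ->
    vtx (Defs.comp L k) i <> vtx (Defs.comp L k) i.+1.
  by move=> kL iL; apply: (gn (_, _)); apply/mem_link_edges; exists k, i.
have mem k i : (k < size L)%N -> (i < size (Defs.comp L k))%N ->
    (vtx (Defs.comp L k) i, vtx (Defs.comp L k) i.+1) \in cyc_edges (Defs.comp L k).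
  by move=> kL iL; rewrite -(nth_cyc_edges 0 iL) mem_nth // size_cyc_edges.
have djk k l x : (k < size L)%N -> (l < size L)%N -> k <> l ->
    polyset (Defs.comp L k) x -> polyset (Defs.comp L l) x -> False.
  have [F HF] : exists F : nat -> seq (pt * pt), F = fun k => cyc_edges (Defs.comp L k) by eexists.
  have HL : flatten (map F (iota 0 (size L))) = link_edges L.
    have E : L = map (nth [::] L) (iota 0 (size L)) by rewrite -[LHS](mkseq_nth [::]).
    by rewrite HF /link_edges [in RHS]E -map_comp.
  have hasF m : (m < size L)%N -> polyset (Defs.comp L m) x -> has (fun e => `[<hseg e x>]) (F m).
    move=> mL [i /= iL]; rewrite /edge seg_hseg HF => -[h|->]; apply/hasP.
      by exists (vtx (Defs.comp L m) i, vtx (Defs.comp L m) i.+1); [apply: mem | apply/asboolP].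
    have sz : (0 < size (Defs.comp L m))%N by have := L3 _ mL; lia.
    set j := (i.+1 %% size (Defs.comp L m))%N.
    have jL : (j < size (Defs.comp L m))%N by apply: ltn_pmod.
    have Ej : vtx (Defs.comp L m) i.+1 = vtx (Defs.comp L m) j by rewrite /vtx modn_mod.
    exists (vtx (Defs.comp L m) j, vtx (Defs.comp L m) j.+1); first exact: mem.
    by rewrite Ej; apply/asboolP/hseg0.
  wlog kl : k l / (k < l)%N.
    move=> W kL lL kl; have /eqP := kl; rewrite neq_ltn => /orP[] h pk pl.
      exact: (W k l).
    by apply: (W l k) => // ?; apply: kl.
  move=> kL lL _ pk pl; have := gc x; rewrite /hcount -HL.
  have -> : iota 0 (size L) = iota 0 l ++ l :: iota l.+1 (size L - l.+1).
    have {1}-> : size L = (l + (size L - l.+1).+1)%N by lia.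
    by rewrite iotaD.
  rewrite map_cat flatten_cat count_cat /= count_cat.
  have : has (fun e => `[<hseg e x>]) (flatten (map F (iota 0 l))).
    have /hasP [e eF ex] := hasF _ kL pk; apply/hasP; exists e => //.
    by apply/flatten_mapP; exists k => //; rewrite mem_iota.
  have := hasF _ lL pl; rewrite !has_count; lia.
split => // [k kL|k l kL lL kl]; last first.
  by apply/seteqP; split => x // -[pk pl]; apply: (djk k l x).
have sz := L3 _ kL.
split; [exact: sz | by move=> i; apply: nd | ].
move=> i j iL jL ij; set p := Defs.comp L k.
have p0 : (0 < size p)%N by rewrite /p; lia.
have hh a b x : (a < size p)%N -> (b < size p)%N -> hseg (vtx p a, vtx p a.+1) x -> hseg (vtx p b, vtx p b.+1) x -> a = b.
  move=> ap bp ha hb; apply/eqP/negPn/negP => ab.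
  have c1 : (count (fun e => `[<hseg e x>]) (cyc_edges p) <= 1)%N.
    have [L' PL] : exists L', perm_eq L (p :: L').
      by exists (rem p L); apply: perm_to_rem; rewrite /p /Defs.comp mem_nth.
    have := gc x; rewrite /hcount /link_edges (permP (perm_flatten (perm_map _ PL))) /= count_cat.
    lia.
  have := @count_ge2_nth _ (fun e => `[<hseg e x>]) (0, 0) (cyc_edges p) a b.
  rewrite size_cyc_edges !nth_cyc_edges // => /(_ ap bp ab).
  by move=> H; have := leq_trans (H (asboolT ha) (asboolT hb)) c1; rewrite ltnn.
have vm m : vtx p m = vtx p (m %% size p) by rewrite /vtx modn_mod.
have hm m : hseg (vtx p (m %% size p), vtx p (m %% size p).+1) (vtx p m).
  by rewrite (vm m); apply: hseg0.
have lm m : (m %% size p < size p)%N by apply: ltn_pmod.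
(* A point x of a closed edge is on the half-open edge or is the start of the next one. The
   half-open edge through x is unique, so two edges that share x are neighbours and x is their
   common vertex. *)
have main a b x : (a < size p)%N -> (b < size p)%N -> a <> b -> edge p a x -> edge p b x ->
    (b = a.+1 %% size p)%N /\ x = vtx p b \/ (a = b.+1 %% size p)%N /\ x = vtx p a.
  move=> ap bp ab; rewrite /edge !seg_hseg => -[ha|/= xa] [hb|/= xb].
  - by case: ab; apply: (hh a b x).
  - right; have E : a = (b.+1 %% size p)%N by apply: (hh a _ x) => //; rewrite xb; apply: hm.
    by split => //; rewrite xb (vm b.+1) -E.
  - left; have E : b = (a.+1 %% size p)%N by apply: (hh b _ x) => //; rewrite xa; apply: hm.
    by split => //; rewrite xa (vm a.+1) -E.
  - exfalso; apply: ab; have : (a.+1 %% size p = b.+1 %% size p)%N.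
      by apply: (hh _ _ x) => //; [rewrite xa | rewrite xb]; apply: hm.
    case: (ltnP a.+1 (size p)) => ha; case: (ltnP b.+1 (size p)) => hb.
    + by rewrite !modn_small //; lia.
    + have -> : b.+1 = size p by lia.
      by rewrite modnn modn_small.
    + have -> : a.+1 = size p by lia.
      by rewrite modnn modn_small.
    + by lia.
case: eqP => [ej|nj].
  apply/seteqP; split => x /=; last first.
    by move=> ->; rewrite /edge !seg_hseg; split; [right; rewrite /= (vm i.+1) -ej | left; apply: hseg0].
  move=> [hi hj]; case: (main i j x iL jL ij hi hj) => [[_ //]|[ei _]].
  exfalso; move: ej ei; rewrite -/p in iL jL sz *.
  case: (ltnP i.+1 (size p)) => ha; case: (ltnP j.+1 (size p)) => hb.
  - by rewrite !modn_small //; lia.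
  - have -> : j.+1 = size p by lia.
    by rewrite modnn modn_small //; lia.
  - have -> : i.+1 = size p by lia.
    by rewrite modnn modn_small //; lia.
  - by lia.
case: eqP => [ei|ni].
  apply/seteqP; split => x /=; last first.
    by move=> ->; rewrite /edge !seg_hseg; split; [left; apply: hseg0 | right; rewrite /= (vm j.+1) -ei].
  by move=> [hi hj]; case: (main i j x iL jL ij hi hj) => [[//]|[_ //]].
apply/seteqP; split => x // [hi hj]; case: (main i j x iL jL ij hi hj) => [[]|[]] //.
Qed.

Lemma closed_good_polygonal S : closed_edges S -> good S ->
  exists L, [/\ polygonal_link L, perm_eq (link_edges L) S & linkset L = support S].
Proof.
move=> [L [L0 L3 LS]] gS; have gL : good (link_edges L) by apply: good_perm gS; rewrite perm_sym.
exists L; split => //; first exact: good_polygonal.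
by rewrite linkset_support //; apply: support_perm.
Qed.

End LinkEdges.

(** * Coordinates, continuity and isotopies *)

Section Coord.
Variable R : realType.
Local Notation pt := 'M[R]_(1,3).

Definition mk3 (x y z : R) : pt := \row_(j < 3) nth 0 [:: x; y; z] j.
Local Notation X v := (v ord0 i0).
Local Notation Y v := (v ord0 i1).
Local Notation Z v := (v ord0 i2).

Lemma mk3X x y z : X (mk3 x y z) = x. Proof. by rewrite mxE. Qed.
Lemma mk3Y x y z : Y (mk3 x y z) = y. Proof. by rewrite mxE. Qed.
Lemma mk3Z x y z : Z (mk3 x y z) = z. Proof. by rewrite mxE. Qed.
Definition mk3E := (mk3X, mk3Y, mk3Z).

Lemma pt_eqP (v w : pt) : [/\ X v = X w, Y v = Y w & Z v = Z w] <-> v = w.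
Proof.
split=> [[x y z]|-> //]; apply/rowP => -[[|[|[|//]]] Hi].
- by move: x; congr (_ = _); congr (_ _ _); apply: val_inj.
- by move: y; congr (_ = _); congr (_ _ _); apply: val_inj.
- by move: z; congr (_ = _); congr (_ _ _); apply: val_inj.
Qed.

Lemma mk3_eta (v : pt) : mk3 (X v) (Y v) (Z v) = v.
Proof. by apply/pt_eqP; rewrite !mk3E. Qed.

Section Continuity.
Variable T : topologicalType.
Implicit Types f g h : T -> R.

Lemma continuous_add f g : continuous f -> continuous g -> continuous (fun q => f q + g q).
Proof. by move=> cf cg q; apply: cvgD; [apply: cf | apply: cg]. Qed.

Lemma continuous_opp f : continuous f -> continuous (fun q => - f q).
Proof. by move=> cf q; apply: cvgN; apply: cf. Qed.

Lemma continuous_mul f g : continuous f -> continuous g -> continuous (fun q => f q * g q).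
Proof. by move=> cf cg q; apply: cvgM; [apply: cf | apply: cg]. Qed.

Lemma continuous_inv f : (forall q, f q != 0) -> continuous f -> continuous (fun q => (f q)^-1).
Proof. by move=> f0 cf q; apply: cvgV; [apply: f0 | apply: cf]. Qed.

Lemma continuous_norm f : continuous f -> continuous (fun q => `|f q|).
Proof. by move=> cf q; apply: cvg_norm; apply: cf. Qed.

Lemma continuous_cst (k : R) : continuous (fun _ : T => k).
Proof. by move=> q; apply: cvg_cst. Qed.

Lemma continuous_maxr f g : continuous f -> continuous g -> continuous (fun q => Num.max (f q) (g q)).
Proof.
move=> cf cg.
have -> : (fun q => Num.max (f q) (g q)) = (fun q => (f q + g q + `|f q - g q|) * 2^-1).
  by apply/funext => q; rewrite maxr_absE.
apply: continuous_mul; last exact: continuous_cst.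
apply: continuous_add; first exact: continuous_add.
by apply: continuous_norm; apply: continuous_add => //; apply: continuous_opp.
Qed.

Lemma continuous_minr f g : continuous f -> continuous g -> continuous (fun q => Num.min (f q) (g q)).
Proof.
move=> cf cg.
have -> : (fun q => Num.min (f q) (g q)) = (fun q => (f q + g q - `|f q - g q|) * 2^-1).
  by apply/funext => q; rewrite minr_absE.
apply: continuous_mul; last exact: continuous_cst.
apply: continuous_add; first exact: continuous_add.
by apply/continuous_opp/continuous_norm; apply: continuous_add => //; apply: continuous_opp.
Qed.

Lemma continuous_mk3 f g h :
  continuous f -> continuous g -> continuous h -> continuous (fun q => mk3 (f q) (g q) (h q)).
Proof.
move=> cf cg ch q.
have E : (fun q => mk3 (f q) (g q) (h q)) =
  (fun q => f q *: mk3 1 0 0 + g q *: mk3 0 1 0 + h q *: mk3 0 0 1).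
  by apply/funext => p; apply/pt_eqP; split; rewrite !mxE /=; ring.
rewrite E.
apply: cvgD; first apply: cvgD.
- by apply: cvgZ; [apply: cf | apply: cvg_cst].
- by apply: cvgZ; [apply: cg | apply: cvg_cst].
- by apply: cvgZ; [apply: ch | apply: cvg_cst].
Qed.

End Continuity.

Lemma continuous_coord (i : 'I_3) : continuous (fun v : pt => v ord0 i).
Proof. exact: coord_continuous. Qed.

Lemma continuous_coord1 (i : 'I_3) : continuous (fun q : pt * R => q.1 ord0 i).
Proof.
move=> q; apply: (@continuous_comp _ _ _ fst (fun v : pt => v ord0 i)); first exact: cvg_fst.
exact: coord_continuous.
Qed.

Lemma continuous_time : continuous (fun q : pt * R => q.2).
Proof. by move=> q; apply: cvg_snd. Qed.

Lemma continuous_comp_fun (T U V : topologicalType) (f : T -> U) (g : U -> V) :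
  continuous f -> continuous g -> continuous (fun q => g (f q)).
Proof. by move=> cf cg q; apply: (@continuous_comp _ _ _ f g); [apply: cf | apply: cg]. Qed.

Lemma continuous_pair (T U V : topologicalType) (f : T -> U) (g : T -> V) :
  continuous f -> continuous g -> continuous (fun q => (f q, g q)).
Proof. by move=> cf cg q; apply: (cvg_pair (cf q) (cg q)). Qed.

Lemma continuous_pairl (T U : topologicalType) (u : U) : continuous (fun x : T => (x, u)).
Proof. by move=> x; apply: (@cvg_pair _ _ _ _ _ _ _ _ _ id (fun=> u)); [apply: cvg_id | apply: cvg_cst]. Qed.

Lemma continuous_id (T : topologicalType) : continuous (fun x : T => x).
Proof. by move=> q; apply: cvg_id. Qed.

Lemma continuous_fst (T U : topologicalType) : continuous (fun x : T * U => x.1).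
Proof. by move=> q; apply: cvg_fst. Qed.

Lemma continuous_snd (T U : topologicalType) : continuous (fun x : T * U => x.2).
Proof. by move=> q; apply: cvg_snd. Qed.

Lemma isotopic_by (F G : R -> pt -> pt) (A : set pt) :
  continuous (fun q : pt * R => F q.2 q.1) -> (forall t, continuous (G t)) ->
  (forall t, cancel (F t) (G t)) -> (forall t, cancel (G t) (F t)) -> (forall x, F 0 x = x) ->
  ambient_isotopic A (F 1 @` A).
Proof.
move=> cF cG FG GF F0; exists (fun x t => F t x); split => //.
move=> t; split; last by exists (G t); split => //; apply: cG.
apply: (@continuous_comp_fun _ _ _ (fun x : pt => (x, t)) (fun q : pt * R => F q.2 q.1)) => //.
exact: continuous_pairl.
Qed.

Lemma isotopic_trans (A B C : set pt) :
  ambient_isotopic A B -> ambient_isotopic B C -> ambient_isotopic A C.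
Proof.
move=> [H [cH hH H0 HAB]] [K [cK hK K0 KBC]].
exists (fun x t => K (H x t) t); split.
- apply: (@continuous_comp_fun _ _ _ (fun q : pt * R => (H q.1 q.2, q.2)) (fun q : pt * R => K q.1 q.2)) => //.
  by apply (continuous_pair cH (@continuous_snd _ _)).
- move=> t; have [cHt [h [ch Hh hH']]] := hH t; have [cKt [k [ck Kk kK]]] := hK t; split.
    exact: (continuous_comp_fun cHt cKt).
  exists (fun x => h (k x)); split; first exact: (continuous_comp_fun ck ch).
    by move=> x; rewrite Kk Hh.
  by move=> x; rewrite hH' kK.
- by move=> x; rewrite H0 K0.
- rewrite -KBC -HAB; apply/seteqP; split => x.
    by move=> [y Ay <-]; exists (H y 1) => //; exists y.
  by move=> [_ [y Ay <-] <-]; exists y.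
Qed.

Lemma isotopic_refl (A : set pt) : ambient_isotopic A A.
Proof.
have := @isotopic_by (fun _ x => x) (fun _ x => x) A.
rewrite image_id; apply => //; first exact: continuous_fst.
by move=> t; apply: continuous_id.
Qed.

(** Reflection in the plane of projection; it reduces the moves of a strand below everything to
    those of a strand above everything. *)
Definition mirror (v : pt) : pt := mk3 (X v) (Y v) (- Z v).

Lemma mirrorK : involutive mirror.
Proof. by move=> v; apply/pt_eqP; rewrite !mk3E opprK. Qed.

Lemma continuous_mirror : continuous mirror.
Proof.
by apply: continuous_mk3; [| |apply: continuous_opp]; apply: continuous_coord.
Qed.

Lemma isotopic_mirror (A B : set pt) :
  ambient_isotopic A B -> ambient_isotopic (mirror @` A) (mirror @` B).
Proof.
move=> [H [cH hH H0 HAB]]; exists (fun x t => mirror (H (mirror x) t)); split.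
- apply: (@continuous_comp_fun _ _ _ (fun q : pt * R => H (mirror q.1) q.2)); last exact: continuous_mirror.
  apply: (@continuous_comp_fun _ _ _ (fun q : pt * R => (mirror q.1, q.2)) (fun q : pt * R => H q.1 q.2)) => //.
  have c1 : continuous (fun q : pt * R => mirror q.1).
    by apply: (@continuous_comp_fun _ _ _ (fun q : pt * R => q.1)); [exact: continuous_fst | exact: continuous_mirror].
  by apply (continuous_pair c1 (@continuous_snd _ _)).
- move=> t; have [cHt [h [ch Hh hH']]] := hH t; split.
    apply: (@continuous_comp_fun _ _ _ (fun q => H (mirror q) t)); last exact: continuous_mirror.
    exact: (continuous_comp_fun continuous_mirror cHt).
  exists (fun x => mirror (h (mirror x))); split.
  + apply: (@continuous_comp_fun _ _ _ (fun q => h (mirror q))); last exact: continuous_mirror.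
    exact: (continuous_comp_fun continuous_mirror ch).
  + by move=> x; rewrite mirrorK Hh mirrorK.
  + by move=> x; rewrite mirrorK hH' mirrorK.
- by move=> x; rewrite H0 mirrorK.
- rewrite -HAB; apply/seteqP; split => x.
    by move=> [_ [y Ay <-] <-]; exists (H y 1); [exists y | rewrite mirrorK].
  by move=> [_ [y Ay <-] <-]; exists (mirror y); [exists y | rewrite mirrorK].
Qed.

End Coord.

(** * Shadows of edges and their subdivision *)

Section Plane.
Variable R : realType.
Local Notation pt := 'M[R]_(1,3).
Local Notation pl := (R * R)%type.
Implicit Types (a b x y : pl) (e : pl * pl) (T : seq (pl * pl)).

Definition lerp a b (t : R) : pl := (a.1 + t * (b.1 - a.1), a.2 + t * (b.2 - a.2)).
Definition on e x : Prop := exists t : R, 0 <= t < 1 /\ x = lerp e.1 e.2 t.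
Definition onc e x : Prop := exists t : R, 0 <= t <= 1 /\ x = lerp e.1 e.2 t.
Definition cnt T x := count (fun e => `[< on e x >]) T.
Definition vec e : pl := (e.2.1 - e.1.1, e.2.2 - e.1.2).
Definition shadow (S : seq (pt * pt)) : seq (pl * pl) := map (fun e : pt * pt => (proj e.1, proj e.2)) S.

Lemma pl_eqP x y : x.1 = y.1 /\ x.2 = y.2 <-> x = y.
Proof. by case: x y => [a b] [c d] /=; split => [[-> ->]|[-> ->]]. Qed.

Lemma lerp0 a b : lerp a b 0 = a.
Proof. by apply/pl_eqP; rewrite /lerp /=; split; ring. Qed.

Lemma lerp1 a b : lerp a b 1 = b.
Proof. by apply/pl_eqP; rewrite /lerp /=; split; ring. Qed.

Lemma lerp_lerp a b s t u : lerp (lerp a b s) (lerp a b t) u = lerp a b (s + u * (t - s)).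
Proof. by apply/pl_eqP; rewrite /lerp /=; split; ring. Qed.

Lemma lerp_inj a b : a <> b -> injective (lerp a b).
Proof.
move=> ab s t /pl_eqP [] /= h1 h2; apply/eqP/negPn/negP => st; apply: ab; apply/pl_eqP.
have E u : (s - t) * u = 0 -> u = 0 by move=> /eqP; rewrite mulf_eq0 subr_eq0 (negPf st) => /eqP.
have e1 : b.1 - a.1 = 0 by apply: E; lra.
have e2 : b.2 - a.2 = 0 by apply: E; lra.
by split; lra.
Qed.

Lemma on_onc e x : on e x -> onc e x.
Proof. by move=> [t [/andP[t0 t1] ->]]; exists t; rewrite t0 ltW. Qed.

Lemma oncE e x : onc e x <-> on e x \/ x = e.2.
Proof.
split=> [[t [/andP[t0]]]|[/on_onc //|->]]; last by exists 1; rewrite ler01 lexx lerp1.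
rewrite le_eqVlt => /orP[/eqP -> ->|t1 ->]; first by right; rewrite lerp1.
by left; exists t; rewrite t0 t1.
Qed.

Lemma proj_lin (A B : pt) t : proj (A + t *: (B - A)) = lerp (proj A) (proj B) t.
Proof. by apply/pl_eqP; rewrite /proj /lerp /= !mxE. Qed.

Lemma subdiv_range (s s' t : R) : s < s' -> s <= t < s' <-> exists u, 0 <= u < 1 /\ t = s + u * (s' - s).
Proof.
move=> ss; split=> [/andP[st ts]|[u [/andP[u0 u1] ->]]]; last first.
  have h : 0 < s' - s by lra.
  rewrite lerDl mulr_ge0 //=; last lra.
  have : u * (s' - s) < 1 * (s' - s) by rewrite ltr_pM2r.
  lra.
exists ((t - s) / (s' - s)); have h : 0 < s' - s by lra.
rewrite divr_ge0 ?ltr_pdivrMr //=; try lra.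
by split; [lra | field; rewrite gt_eqF].
Qed.

End Plane.
Arguments lerp : simpl never.
Arguments cnt : simpl never.
Arguments vec : simpl never.

Section Subdivision.
Variables (R : realType) (X : eqType) (P : X * X -> X -> Prop) (l : R -> X).
Hypothesis l_inj : injective l.
Hypothesis P_l : forall s s' x, s < s' -> P (l s, l s') x <-> exists t, s <= t < s' /\ x = l t.

(** Stated for an abstract half-open segment [P] along an injective parametrization [l], because it
    serves for edges in space and for their shadows in the plane alike. *)
Lemma count_subdiv x s ss : path <%R s ss ->
  count (fun e => `[< P e x >]) (consec (map l (s :: ss))) =
  `[< exists t, s <= t < last s ss /\ x = l t >].
Proof.
elim: ss s => [|s' ss IH] s /=.
  by move=> _; rewrite (_ : `[< _ >] = false) //; apply/asboolPn => -[t [h _]]; lra.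
move=> /andP[ss' pss]; have := IH _ pss; rewrite /= => ->.
have ls : s' <= last s' ss.
  elim: ss s' pss {IH ss'} => [|s2 ss IH] s' //= /andP[h /IH]; lra.
have [[t [/andP[t0 t1] xt]]|N] := pselect (exists t, s <= t < last s' ss /\ x = l t); last first.
  rewrite (asboolF N) (asboolF (P := P _ _)); last first.
    by move=> /(P_l _ ss') [t [/andP[h1 h2] xt]]; apply: N; exists t; split => //; lra.
  rewrite (asboolF (P := exists _, _)) //.
  by move=> [t [h xt]]; apply: N; exists t; split => //; lra.
rewrite (asboolT (P := exists t, s <= t < last s' ss /\ _)); last by exists t; rewrite t0 t1.
have [ts|st] := ltP t s'.
  rewrite asboolT; last by apply/(P_l _ ss'); exists t; rewrite t0 ts.
  by rewrite asboolF // => -[t' [h xt']]; have := l_inj (etrans (esym xt) xt'); lra.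
rewrite asboolF; last first.
  by move=> /(P_l _ ss') [t' [h xt']]; have := l_inj (etrans (esym xt) xt'); lra.
by rewrite asboolT //; exists t; rewrite st t1.
Qed.

End Subdivision.

Section SubdivisionInstances.
Variable R : realType.
Local Notation pt := 'M[R]_(1,3).
Local Notation pl := (R * R)%type.

Lemma on_lerp (a b : pl) s s' x : s < s' ->
  on (lerp a b s, lerp a b s') x <-> exists t, s <= t < s' /\ x = lerp a b t.
Proof.
move=> ss; split=> [[u [u01 ->]]|[t [/(subdiv_range _ ss) [u [u01 ->]] ->]]].
  by exists (s + u * (s' - s)); rewrite lerp_lerp; split => //; apply/(subdiv_range _ ss); exists u.
by exists u; rewrite lerp_lerp.
Qed.

Lemma cnt_subdiv (a b : pl) x s ss : a <> b -> path <%R s ss ->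
  cnt (consec (map (lerp a b) (s :: ss))) x = `[< exists t, s <= t < last s ss /\ x = lerp a b t >].
Proof.
move=> ab; apply: count_subdiv; first exact: lerp_inj.
by move=> *; apply: on_lerp.
Qed.

Definition lin (A B : pt) (t : R) : pt := A + t *: (B - A).

Lemma lin_lin (A B : pt) s t u : lin (lin A B s) (lin A B t) u = lin A B (s + u * (t - s)).
Proof. by apply/pt_eqP; rewrite /lin !mxE; split; ring. Qed.

Lemma lin0 (A B : pt) : lin A B 0 = A.
Proof. by rewrite /lin scale0r addr0. Qed.

Lemma lin1 (A B : pt) : lin A B 1 = B.
Proof. by rewrite /lin scale1r addrC subrK. Qed.

Lemma lin_inj (A B : pt) : A <> B -> injective (lin A B).
Proof.
move=> AB s t /addrI /eqP; rewrite -subr_eq0 -scalerBl scaler_eq0 !subr_eq0 => /orP[/eqP //|/eqP E].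
by case: AB.
Qed.

Lemma hseg_lin (A B : pt) s s' x : s < s' ->
  hseg (lin A B s, lin A B s') x <-> exists t, s <= t < s' /\ x = lin A B t.
Proof.
move=> ss; split=> [[u [u01 ->]]|[t [/(subdiv_range _ ss) [u [u01 ->]] ->]]].
  by exists (s + u * (s' - s)); rewrite -/(lin _ _ _) lin_lin; split => //; apply/(subdiv_range _ ss); exists u.
by exists u; rewrite -/(lin _ _ _) lin_lin.
Qed.

Lemma hcount_subdiv (A B : pt) x s ss : A <> B -> path <%R s ss ->
  hcount (consec (map (lin A B) (s :: ss))) x = `[< exists t, s <= t < last s ss /\ x = lin A B t >].
Proof.
move=> ab; apply: count_subdiv; first exact: lin_inj.
by move=> *; apply: hseg_lin.
Qed.

Lemma hcount_cat (S S' : seq (pt * pt)) x : hcount (S ++ S') x = (hcount S x + hcount S' x)%N.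
Proof. exact: count_cat. Qed.

Lemma support_hcount (S : seq (pt * pt)) : support S = [set x | (0 < hcount S x)%N].
Proof.
apply/seteqP; split => x.
  by move=> [e eS ex]; rewrite /= -has_count; apply/hasP; exists e => //; apply/asboolP.
by rewrite /= -has_count => /hasP [e eS /asboolP ex]; exists e.
Qed.

Lemma mem_consec_map (X : eqType) (Y : eqType) (f : Y -> X) ss e : e \in consec (map f ss) ->
  exists s s', e = (f s, f s') /\ (s, s') \in consec ss.
Proof.
rewrite /consec (consec_map f) => /mapP [[s s'] h ->]; by exists s, s'.
Qed.

Lemma path_consec (s : R) ss a b : path <%R s ss -> (a, b) \in consec (s :: ss) -> a < b.
Proof.
elim: ss s => [|s' ss IH] s //= /andP[h p]; rewrite consec_cons2 inE => /orP[/eqP[-> ->]//|].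
exact: IH.
Qed.

Lemma good_subdiv (A B : pt) S ss : path <%R 0 (rcons ss 1) -> good ((A, B) :: S) ->
  good (consec (map (lin A B) (0 :: rcons ss 1)) ++ S) /\
  support (consec (map (lin A B) (0 :: rcons ss 1)) ++ S) = support ((A, B) :: S).
Proof.
move=> p [g1 g2]; have AB : A <> B by apply: (g1 (A, B)); rewrite mem_head.
have H x : hcount (consec (map (lin A B) (0 :: rcons ss 1)) ++ S) x = hcount ((A, B) :: S) x.
  rewrite hcount_cat hcount_subdiv // last_rcons.
  have -> : hcount ((A, B) :: S) x = (`[< hseg (A, B) x >] + hcount S x)%N by [].
  by [].
split; last by rewrite !support_hcount; apply/seteqP; split => x /=; rewrite H.
split=> [e|x]; last by rewrite H.
rewrite mem_cat => /orP[|eS]; last by apply: g1; rewrite inE eS orbT.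
move=> /mem_consec_map [s [s' [-> /(path_consec p) ss']]] /= /(lin_inj AB) E.
by move: ss'; rewrite E ltxx.
Qed.

(** [P] lists the edges together with their images. The map has to be affine on these edges only;
    the isotopies below are far from affine elsewhere. *)
Lemma good_image (Phi : pt -> pt) (P : seq ((pt * pt) * (pt * pt))) : injective Phi ->
  (forall p, p \in P -> forall t, 0 <= t <= 1 -> Phi (lin p.1.1 p.1.2 t) = lin p.2.1 p.2.2 t) ->
  good (map fst P) -> good (map snd P) /\ support (map snd P) = Phi @` support (map fst P).
Proof.
move=> Pinj HP [g1 g2].
have H p x : p \in P -> hseg p.2 (Phi x) <-> hseg p.1 x.
  move=> pP; split=> [[t [/andP[t0 t1] E]]|[t [/andP[t0 t1] ->]]]; exists t; rewrite t0 t1; split => //.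
    by apply: Pinj; rewrite E -/(lin _ _ _) -HP // t0 ltW.
  by rewrite -/(lin _ _ _) HP // t0 ltW.
have H2 p y : p \in P -> hseg p.2 y -> exists x, y = Phi x.
  move=> pP [t [/andP[t0 t1] ->]]; exists (lin p.1.1 p.1.2 t); rewrite HP // t0 ltW //.
have HC x : hcount (map snd P) (Phi x) = hcount (map fst P) x.
  rewrite /hcount !count_map; apply: eq_in_count => p pP /=; apply: asbool_equiv_eq; exact: H.
split.
  split=> [e /mapP [p pP ->] E|y].
    have := g1 _ (map_f fst pP); apply; apply: Pinj.
    have := HP _ pP 0; have := HP _ pP 1; by rewrite !lin0 !lin1 lexx ler01 => -> // -> //; rewrite lexx.
  have [[x ->]|N] := pselect (exists x, y = Phi x); first by rewrite HC.
  rewrite leqNgt; apply/negP => h; apply: N.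
  have [e /mapP [p pP ->] /asboolP ey] := count_gt0 (leq_ltn_trans (leq0n _) h).
  exact: H2 ey.
apply/seteqP; split=> y.
  move=> [_ /mapP [p pP ->] py]; have [x E] := H2 _ _ pP py; exists x => //.
  by exists p.1; [apply: map_f | rewrite -H // -E].
by move=> [x [_ /mapP [p pP ->] px] <-]; exists p.2; [apply: map_f | apply/H].
Qed.

End SubdivisionInstances.

(** * Polygonal paths as functions of time *)

Section PiecewiseLinear.
Variable R : realType.
Local Notation pl := (R * R)%type.

Definition clamp (t : R) : R := Num.max 0 (Num.min t 1).

Lemma clamp_range t : 0 <= clamp t <= 1.
Proof. by rewrite /clamp le_max lexx ge_max ler01 ge_min lexx orbT. Qed.

Lemma clamp_id t : 0 <= t <= 1 -> clamp t = t.
Proof. by move=> /andP[t0 t1]; rewrite /clamp min_l // max_r. Qed.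

Lemma clamp_le0 t : t <= 0 -> clamp t = 0.
Proof. by move=> t0; rewrite /clamp max_l // ge_min t0. Qed.

Lemma clamp_ge1 t : 1 <= t -> clamp t = 1.
Proof. by move=> t0; rewrite /clamp min_r // max_r // ler01. Qed.

(** The polygonal path through a and the points of s, one unit of time for each edge, constant
    before time 0 and after the last edge. Written as a sum of clamped increments it is defined by
    one formula for all times, and continuity follows without gluing. *)
Fixpoint plf (a : pl) (s : seq pl) (t : R) : pl :=
  if s is b :: s' then
    ((lerp a b (clamp t)).1 + ((plf b s' (t - 1)).1 - b.1),
     (lerp a b (clamp t)).2 + ((plf b s' (t - 1)).2 - b.2))
  else a.

Lemma plf_cons a b s t : plf a (b :: s) t =
  ((lerp a b (clamp t)).1 + ((plf b s (t - 1)).1 - b.1),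
   (lerp a b (clamp t)).2 + ((plf b s (t - 1)).2 - b.2)).
Proof. by []. Qed.

Lemma plf_le0 a s t : t <= 0 -> plf a s t = a.
Proof.
elim: s a t => [|b s IH] a t t0 //; rewrite plf_cons IH; last lra.
by rewrite clamp_le0 // lerp0 !subrr !addr0 -surjective_pairing.
Qed.

Lemma plf_le1 a b s t : t <= 1 -> plf a (b :: s) t = lerp a b (clamp t).
Proof. by move=> t1; rewrite plf_cons plf_le0 ?subr_le0 // !subrr !addr0. Qed.

Lemma plf_ge1 a b s t : 1 <= t -> plf a (b :: s) t = plf b s (t - 1).
Proof.
move=> t1; rewrite plf_cons clamp_ge1 // lerp1; apply/pl_eqP => /=; split; ring.
Qed.

Lemma plf_onc a s t : s != [::] -> exists2 e, e \in consec (a :: s) & onc e (plf a s t).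
Proof.
elim: s a t => [|b s IH] a t // _.
have [t1|t1] := lerP t 1.
  exists (a, b); first by rewrite consec_cons2 mem_head.
  by rewrite plf_le1 //; exists (clamp t); rewrite clamp_range.
rewrite plf_ge1 ?ltW //; case: s IH => [|c s] IH.
  exists (a, b); first by rewrite mem_head.
  by exists 1; rewrite lexx ler01 lerp1.
have [e es h] := IH b (t - 1) isT; exists e => //.
by rewrite consec_cons2 inE es orbT.
Qed.

Lemma plf_nth a s i t : (i < size s)%N -> 0 <= t <= 1 ->
  plf a s (i%:R + t) = lerp (nth a (a :: s) i) (nth a (a :: s) i.+1) t.
Proof.
elim: s a i => [|b s IH] a [|i] // Hi t01.
  by rewrite add0r plf_le1 ?clamp_id //; case/andP: t01.
have h : 0 <= t by case/andP: t01.
have -> : i.+1%:R + t = 1 + (i%:R + t) by rewrite -natr1; ring.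
rewrite plf_ge1; last by rewrite lerDl addr_ge0.
rewrite [1 + _]addrC addrK IH //; case: i Hi => [|i] /= Hi.
  by case: s IH Hi => //.
by congr lerp; apply: set_nth_default => /=; move: Hi; rewrite ?ltnS //; lia.
Qed.

Lemma continuous_clamp : continuous clamp.
Proof.
by apply: continuous_maxr; [apply: continuous_cst | apply: continuous_minr; [apply: continuous_id | apply: continuous_cst]].
Qed.

Lemma continuous_plf a s : continuous (fun t => (plf a s t).1) /\ continuous (fun t => (plf a s t).2).
Proof.
elim: s a => [|b s IH] a /=; first by split; apply: continuous_cst.
have cc (f : R -> R) : continuous f -> continuous (fun t : R => f (t - 1)).
  move=> cf; apply: (@continuous_comp_fun _ _ _ (fun t : R => t - 1) f) => //.
  by apply: continuous_add; [apply: continuous_id | apply: continuous_cst].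
have [c1 c2] := IH b.
split; (apply: continuous_add;
  first (apply: continuous_add; first exact: continuous_cst);
  first (apply: continuous_mul; [exact: continuous_clamp | exact: continuous_cst]));
  apply: continuous_add; [| exact: continuous_cst | | exact: continuous_cst].
  exact: (cc (fun t => (plf b s t).1)).
exact: (cc (fun t => (plf b s t).2)).
Qed.

End PiecewiseLinear.

(** * Moving one strand *)

Section Slide.
Variable R : realType.
Local Notation pt := 'M[R]_(1,3).
Local Notation pl := (R * R)%type.
Local Notation X v := (v ord0 i0).
Local Notation Y v := (v ord0 i1).
Local Notation Z v := (v ord0 i2).

Lemma consec_iota a n q : q \in consec (iota a n) -> exists i, q = (i, i.+1) /\ (a <= i < a + n.-1)%N.
Proof.
elim: n a => [|[|n] IH] a //; rewrite [iota _ _]/= consec_cons2 inE => /orP[/eqP ->|/IH [i [-> h]]].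
  by exists a; split => //; lia.
by exists i; split => //; move: h => /=; lia.
Qed.

Lemma perm_cons_mid (A : eqType) (x : A) s t : perm_eq (x :: s ++ t) (s ++ x :: t).
Proof. by rewrite -[x :: s ++ t]cat1s perm_catCA. Qed.

Lemma iota_rcons a n : iota a n.+1 = rcons (iota a n) (a + n)%N.
Proof. by rewrite -cats1 -[in LHS]addn1 iotaD. Qed.

(* At height z the plane is moved by the similarity with centre u(z) on the edge U1U2 that
   takes the point of the edge V1V2 at that height to the point of the new path. *)
Lemma slide (U1 U2 V1 V2 : pt) S ws :
  Z V2 < Z V1 -> Z U1 <= Z V2 -> Z V1 <= Z U2 ->
  (forall e, e \in S -> forall v, seg e.1 e.2 v -> Z v <= Z V2 \/ Z V1 <= Z v) ->
  (forall e, e \in consec (proj V1 :: rcons ws (proj V2)) -> forall x, onc e x ->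
     forall s, 0 <= s <= 1 -> x <> lerp (proj U1) (proj U2) s) ->
  (forall x, onc (proj V1, proj V2) x -> forall s, 0 <= s <= 1 -> x <> lerp (proj U1) (proj U2) s) ->
  good ((U1, U2) :: (V1, V2) :: S) ->
  exists xs, [/\ map proj xs = ws, good ((U1, U2) :: consec (V1 :: rcons xs V2) ++ S) &
    ambient_isotopic (support ((U1, U2) :: (V1, V2) :: S))
                     (support ((U1, U2) :: consec (V1 :: rcons xs V2) ++ S))].
Proof.
move=> zV zU1 zU2 zS avW avV gS.
set zr := Z V2; set z0 := Z V1; set m := (size ws).+1.
have dz : 0 < z0 - zr by rewrite subr_gt0.
have dU : 0 < Z U2 - Z U1 by rewrite /zr /z0 in dz; lra.
(* At time 1 this is the parameter of the point of V1V2 at height z, cut off below V2 and above V1.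
   At time 0 it is 1, where the new path is at its end V2 and the similarity is the identity. *)
pose th (z t : R) := clamp (1 - t * ((z - zr) / (z0 - zr))).
pose rho (z : R) := (z - Z U1) / (Z U2 - Z U1).
pose u (z : R) := lerp (proj U1) (proj U2) (rho z).
pose W (tau : R) := plf (proj V1) (rcons ws (proj V2)) (m%:R * tau).
pose ut (tau : R) := u (z0 - tau * (z0 - zr)).
(* With d and e the vectors from the centre to V1V2 and to the new path, [al] + i [be] is the
   complex quotient e / d. Both d and e are nonzero because V1V2 and the path avoid the shadow of
   U1U2, so the similarity exists and is invertible. *)
pose d1 tau := (lerp (proj V1) (proj V2) tau).1 - (ut tau).1.
pose d2 tau := (lerp (proj V1) (proj V2) tau).2 - (ut tau).2.
pose e1 tau := (W tau).1 - (ut tau).1.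
pose e2 tau := (W tau).2 - (ut tau).2.
pose nd tau := d1 tau ^+ 2 + d2 tau ^+ 2.
pose al tau := (e1 tau * d1 tau + e2 tau * d2 tau) / nd tau.
pose be tau := (e2 tau * d1 tau - e1 tau * d2 tau) / nd tau.
pose nc tau := al tau * al tau + be tau * be tau.
have rho01 tau : 0 <= tau <= 1 -> 0 <= rho (z0 - tau * (z0 - zr)) <= 1.
  move=> /andP[t0 t1]; rewrite /rho divr_ge0 ?ler_pdivrMr //=; first last.
  - exact: ltW.
  - have : 0 <= (1 - tau) * (z0 - zr) by rewrite mulr_ge0 //; lra.
    by rewrite /z0 /zr in dz *; lra.
  - have : 0 <= tau * (z0 - zr) by rewrite mulr_ge0 // ltW.
    by rewrite /z0 /zr in dz *; lra.
have sq_neq0 (a b : R) : (a != 0) || (b != 0) -> a ^+ 2 + b ^+ 2 != 0.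
  by apply: contraTneq => /eqP; rewrite paddr_eq0 ?sqr_ge0 // !sqrf_eq0 negb_or !negbK.
have nd0 tau : 0 <= tau <= 1 -> nd tau != 0.
  move=> t01; apply: sq_neq0; rewrite -negb_and; apply/negP; rewrite !subr_eq0 => /andP[/eqP E1 /eqP E2].
  apply: (avV (lerp (proj V1) (proj V2) tau) _ _ (rho01 _ t01)); first by exists tau.
  by apply/pl_eqP; split; [exact: E1 | exact: E2].
have ne0 tau : 0 <= tau <= 1 -> e1 tau ^+ 2 + e2 tau ^+ 2 != 0.
  move=> t01; apply: sq_neq0; rewrite -negb_and; apply/negP; rewrite !subr_eq0 => /andP[/eqP E1 /eqP E2].
  have [|e eW oe] := @plf_onc _ (proj V1) (rcons ws (proj V2)) (m%:R * tau); first by case: (ws).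
  apply: (avW e eW _ oe _ (rho01 _ t01)).
  by apply/pl_eqP; split; [exact: E1 | exact: E2].
have ncE tau : 0 <= tau <= 1 -> nc tau = (e1 tau ^+ 2 + e2 tau ^+ 2) / nd tau.
  move=> t01; have := nd0 _ t01; rewrite /nc /al /be /nd => h; field; exact: h.
have nc0 tau : 0 <= tau <= 1 -> nc tau != 0.
  by move=> t01; rewrite ncE // mulf_neq0 ?invr_eq0 ?nd0 ?ne0.
have thr z t : 0 <= th z t <= 1 by apply: clamp_range.
pose F (t : R) (v : pt) : pt := mk3
  ((u (Z v)).1 + (al (th (Z v) t) * (X v - (u (Z v)).1) - be (th (Z v) t) * (Y v - (u (Z v)).2)))
  ((u (Z v)).2 + (be (th (Z v) t) * (X v - (u (Z v)).1) + al (th (Z v) t) * (Y v - (u (Z v)).2)))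
  (Z v).
pose G (t : R) (v : pt) : pt := mk3
  ((u (Z v)).1 + (al (th (Z v) t) * (X v - (u (Z v)).1) + be (th (Z v) t) * (Y v - (u (Z v)).2)) / nc (th (Z v) t))
  ((u (Z v)).2 + (al (th (Z v) t) * (Y v - (u (Z v)).2) - be (th (Z v) t) * (X v - (u (Z v)).1)) / nc (th (Z v) t))
  (Z v).
have FG t : cancel (F t) (G t).
  move=> v; apply/pt_eqP; rewrite /G /F !mk3E; have := nc0 _ (thr (Z v) t); rewrite /nc.
  move: (al _) (be _) => A B h; split => //; field; exact: h.
have GF t : cancel (G t) (F t).
  move=> v; apply/pt_eqP; rewrite /G /F !mk3E; have := nc0 _ (thr (Z v) t); rewrite /nc.
  move: (al _) (be _) => A B h; split => //; field; exact: h.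
have V1E : lerp (proj V1) (proj V2) 0 = proj V1 by rewrite lerp0.
have V2E : lerp (proj V1) (proj V2) 1 = proj V2 by rewrite lerp1.
have W0 : W 0 = proj V1 by rewrite /W mulr0 plf_le0.
have W1 : W 1 = proj V2.
  rewrite /W mulr1 /m -natr1 plf_nth ?size_rcons ?lexx ?ler01 //.
  by rewrite lerp1 /= -cats1 nth_cat ltnn subnn.
have ab1 tau : 0 <= tau <= 1 -> W tau = lerp (proj V1) (proj V2) tau -> al tau = 1 /\ be tau = 0.
  move=> t01 E; have := nd0 _ t01; rewrite /al /be /nd /e1 /e2 E -/(d1 tau) -/(d2 tau) => h.
  by split; [rewrite -!expr2 divff | rewrite (mulrC (d2 tau)) subrr mul0r].
have Fid t (v : pt) : al (th (Z v) t) = 1 /\ be (th (Z v) t) = 0 -> F t v = v.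
  by move=> [E1 E2]; apply/pt_eqP; rewrite /F !mk3E E1 E2; split => //; ring.
have r01 (c : R) : c = 0 \/ c = 1 -> 0 <= c <= 1 by move=> [->|->]; lra.
have F0 (v : pt) : F 0 v = v.
  apply: Fid; rewrite /th mul0r subr0 clamp_id ?ler01 ?lexx //.
  by apply: ab1; [apply: r01; right | rewrite W1 V2E].
have Flow (v : pt) : Z v <= zr \/ z0 <= Z v -> F 1 v = v.
  move=> [h|h]; apply: Fid; rewrite /th mul1r.
    rewrite clamp_ge1; last by rewrite lerBrDr -lerBrDl subrr ler_pdivrMr // mul0r subr_le0.
    by apply: ab1; [apply: r01; right | rewrite W1 V2E].
  rewrite clamp_le0; last by rewrite subr_le0 ler_pdivlMr // mul1r lerB.
  by apply: ab1; [apply: r01; left | rewrite W0 V1E].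
have FU t s : F t (lin U1 U2 s) = lin U1 U2 s.
  have rs : rho (Z (lin U1 U2 s)) = s.
    by rewrite /rho /lin !mxE; field; rewrite gt_eqF.
  by apply/pt_eqP; rewrite /F !mk3E /u rs -proj_lin -/(lin U1 U2 s) /proj /=; split => //; ring.
have FV tau : 0 <= tau <= 1 -> F 1 (lin V1 V2 tau) = mk3 (W tau).1 (W tau).2 (z0 - tau * (z0 - zr)).
  move=> t01; have zE : Z (lin V1 V2 tau) = z0 - tau * (z0 - zr) by rewrite /lin !mxE /z0 /zr; ring.
  have tE : th (Z (lin V1 V2 tau)) 1 = tau.
    rewrite zE /th mul1r (_ : z0 - tau * (z0 - zr) - zr = (1 - tau) * (z0 - zr)); last by ring.
    by rewrite mulfK ?gt_eqF // subKr clamp_id.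
  have xE : X (lin V1 V2 tau) = (lerp (proj V1) (proj V2) tau).1 by rewrite -proj_lin.
  have yE : Y (lin V1 V2 tau) = (lerp (proj V1) (proj V2) tau).2 by rewrite -proj_lin.
  apply/pt_eqP; rewrite /F !mk3E tE xE yE zE -/(ut tau) -/(d1 tau) -/(d2 tau).
  have h := nd0 _ t01; rewrite /nd in h.
  split => //.
    rewrite (_ : (W tau).1 = (ut tau).1 + e1 tau); last by rewrite /e1; ring.
    congr (_ + _); rewrite /al /be /nd; field; exact: h.
  rewrite (_ : (W tau).2 = (ut tau).2 + e2 tau); last by rewrite /e2; ring.
  congr (_ + _); rewrite /al /be /nd; field; exact: h.
have cpart (f : R -> R) (g : pt * R -> R) : continuous f -> continuous g -> continuous (fun q => f (g q)).
  by move=> cf cg; apply: (@continuous_comp_fun _ _ _ g f).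
have cu : continuous (fun z => (u z).1) /\ continuous (fun z => (u z).2).
  have crho : continuous rho.
    apply: continuous_mul; last exact: continuous_cst.
    by apply: continuous_add; [exact: continuous_id | exact: continuous_cst].
  by split; rewrite /u /lerp /=; (apply: continuous_add; first exact: continuous_cst);
    apply: continuous_mul => //; exact: continuous_cst.
have cut : continuous (fun z => (ut z).1) /\ continuous (fun z => (ut z).2).
  have cl : continuous (fun tau : R => z0 - tau * (z0 - zr)).
    apply: continuous_add; first exact: continuous_cst.
    by apply: continuous_opp; apply: continuous_mul; [exact: continuous_id | exact: continuous_cst].
  by split; [apply: (continuous_comp_fun cl (proj1 cu)) | apply: (continuous_comp_fun cl (proj2 cu))].
have cW : continuous (fun z => (W z).1) /\ continuous (fun z => (W z).2).
  have cl : continuous (fun tau : R => m%:R * tau).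
    by apply: continuous_mul; [apply: continuous_cst | apply: continuous_id].
  have [p1 p2] := continuous_plf (proj V1) (rcons ws (proj V2)).
  by split; [apply: (continuous_comp_fun cl p1) | apply: (continuous_comp_fun cl p2)].
have c01 (f : R -> R) : continuous f -> continuous (fun tau => f (clamp tau)).
  by move=> cf; apply: (continuous_comp_fun (@continuous_clamp R) cf).
have cd1 : continuous (fun tau => d1 (clamp tau)).
  apply: (c01 d1); apply: continuous_add; last exact: continuous_opp (proj1 cut).
  by rewrite /lerp /=; apply: continuous_add; [|apply: continuous_mul];
    first [exact: continuous_cst | exact: continuous_id].
have cd2 : continuous (fun tau => d2 (clamp tau)).
  apply: (c01 d2); apply: continuous_add; last exact: continuous_opp (proj2 cut).
  by rewrite /lerp /=; apply: continuous_add; [|apply: continuous_mul];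
    first [exact: continuous_cst | exact: continuous_id].
have ce1 : continuous (fun tau => e1 (clamp tau)).
  by apply: (c01 e1); apply: continuous_add; [exact: (proj1 cW) | exact: continuous_opp (proj1 cut)].
have ce2 : continuous (fun tau => e2 (clamp tau)).
  by apply: (c01 e2); apply: continuous_add; [exact: (proj2 cW) | exact: continuous_opp (proj2 cut)].
have cnd : continuous (fun tau => (nd (clamp tau))^-1).
  apply: continuous_inv; first by move=> tau; apply: nd0; apply: clamp_range.
  by apply: continuous_add; rewrite /=; (have -> : forall g : R -> R, (fun q => g q ^+ 2) = (fun q => g q * g q)
     by move=> g; apply/funext => q; rewrite expr2); apply: continuous_mul.
have cal : continuous (fun tau => al (clamp tau)).
  by apply: continuous_mul => //; apply: continuous_add; apply: continuous_mul.
have cbe : continuous (fun tau => be (clamp tau)).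
  by apply: continuous_mul => //; apply: continuous_add; [|apply: continuous_opp]; apply: continuous_mul.
have cu1 := proj1 cu; have cu2 := proj2 cu.
have clos (T : topologicalType) (z t : T -> R) : continuous z -> continuous t ->
    continuous (fun q => 1 - t q * ((z q - zr) / (z0 - zr))).
  move=> cz ct; apply: continuous_add; first exact: continuous_cst.
  apply: continuous_opp; apply: continuous_mul; first exact: ct.
  apply: continuous_mul; last exact: continuous_cst.
  by apply: continuous_add; [exact: cz | exact: continuous_cst].
have cF : continuous (fun q : pt * R => F q.2 q.1).
  have cz : continuous (fun q : pt * R => Z q.1) by apply: continuous_coord1.
  have cA : continuous (fun q : pt * R => al (th (Z q.1) q.2)).
    by apply: (continuous_comp_fun (clos _ _ _ cz (@continuous_time R)) cal).
  have cB : continuous (fun q : pt * R => be (th (Z q.1) q.2)).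
    by apply: (continuous_comp_fun (clos _ _ _ cz (@continuous_time R)) cbe).
  have cU1 : continuous (fun q : pt * R => (u (Z q.1)).1) by apply: (continuous_comp_fun cz cu1).
  have cU2 : continuous (fun q : pt * R => (u (Z q.1)).2) by apply: (continuous_comp_fun cz cu2).
  rewrite /F; apply: continuous_mk3; last exact: cz.
    apply: continuous_add => //; apply: continuous_add; [|apply: continuous_opp]; apply: continuous_mul => //;
    by apply: continuous_add; [apply: continuous_coord1 | apply: continuous_opp].
  apply: continuous_add => //; apply: continuous_add; apply: continuous_mul => //;
    by apply: continuous_add; [apply: continuous_coord1 | apply: continuous_opp].
have cG t : continuous (G t).
  have cz : continuous (fun v : pt => Z v) by apply: continuous_coord.
  have ct : continuous (fun v : pt => t) by apply: continuous_cst.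
  have cA : continuous (fun v : pt => al (th (Z v) t)) by apply: (continuous_comp_fun (clos _ _ _ cz ct) cal).
  have cB : continuous (fun v : pt => be (th (Z v) t)) by apply: (continuous_comp_fun (clos _ _ _ cz ct) cbe).
  have cN : continuous (fun v : pt => (nc (th (Z v) t))^-1).
    apply: continuous_inv => [v|]; first exact: nc0.
    by rewrite /nc; apply: continuous_add; apply: continuous_mul.
  have cU1 : continuous (fun v : pt => (u (Z v)).1) by apply: (continuous_comp_fun cz cu1).
  have cU2 : continuous (fun v : pt => (u (Z v)).2) by apply: (continuous_comp_fun cz cu2).
  rewrite /G; apply: continuous_mk3; last exact: cz.
    apply: continuous_add => //; apply: continuous_mul => //; apply: continuous_add; apply: continuous_mul => //;
    by apply: continuous_add; [apply: continuous_coord | apply: continuous_opp].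
  apply: continuous_add => //; apply: continuous_mul => //; apply: continuous_add; [|apply: continuous_opp]; apply: continuous_mul => //;
    by apply: continuous_add; [apply: continuous_coord | apply: continuous_opp].
have iso A := isotopic_by A cF cG FG GF F0.
have m0 : (m%:R : R) != 0 by rewrite pnatr_eq0.
have mp : 0 < (m%:R : R) by rewrite ltr0n.
pose Ws := proj V1 :: rcons ws (proj V2).
(* V1V2 is cut into m equal pieces, one for each edge of the new path; on each piece the final map
   is affine. *)
pose f (j : nat) : pt := mk3 (nth (proj V1) Ws j).1 (nth (proj V1) Ws j).2 (z0 - (j%:R / m%:R) * (z0 - zr)).
pose l (j : nat) : pt := lin V1 V2 (j%:R / m%:R).
pose P := ((U1, U2), (U1, U2)) :: map (fun q => ((l q.1, l q.2), (f q.1, f q.2))) (consec (iota 0 m.+1))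
   ++ map (fun e => (e, e)) S.
have Pfst : map fst P = (U1, U2) :: consec (map l (iota 0 m.+1)) ++ S.
  rewrite /P map_cons map_cat -!map_comp; congr cons; congr cat; last by rewrite map_id_in.
  by rewrite /consec consec_map.
have Psnd : map snd P = (U1, U2) :: consec (map f (iota 0 m.+1)) ++ S.
  rewrite /P map_cons map_cat -!map_comp; congr cons; congr cat; last by rewrite map_id_in.
  by rewrite /consec consec_map.
have iotaS1 n : iota 1 n.+1 = rcons (iota 1 n) n.+1 by rewrite iota_rcons add1n.
have Hio : iota 0 m.+1 = 0%N :: rcons (iota 1 (size ws)) m.
  by rewrite -[iota 0 m.+1]/(0%N :: iota 1 m) /m iotaS1.
pose xs := map f (iota 1 (size ws)).
have fE : map f (iota 0 m.+1) = V1 :: rcons xs V2.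
  rewrite Hio map_cons map_rcons; congr (_ :: rcons _ _).
    rewrite /f /= mul0r mul0r subr0; exact: mk3_eta.
  rewrite /f /= -cats1 nth_cat ltnn subnn /= divff // mul1r subKr; exact: mk3_eta.
have lE : map l (iota 0 m.+1) = map (lin V1 V2) (0 :: rcons (map (fun j => j%:R / m%:R) (iota 1 (size ws))) 1).
  rewrite Hio /l !map_cons !map_rcons -map_comp; congr (_ :: rcons _ _); first by rewrite mul0r.
  by rewrite divff.
have [g1 s1] : good (map fst P) /\ support (map fst P) = support [:: (U1, U2), (V1, V2) & S].
  have pm A B := perm_cons_mid (U1, U2) A B.
  have [] := @good_subdiv R V1 V2 ((U1, U2) :: S) (map (fun j => j%:R / m%:R) (iota 1 (size ws))).
  - have -> : rcons (map (fun j => j%:R / m%:R) (iota 1 (size ws))) (1 : R) = map (fun j => j%:R / m%:R) (iota 1 m).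
      by rewrite [in iota 1 m]/m iotaS1 map_rcons -/m divff.
    have -> : (0 : R) = 0%:R / m%:R by rewrite mul0r.
    rewrite -[path _ _ _]/(sorted <%R (map (fun j : nat => j%:R / m%:R : R) (iota 0 m.+1))).
    apply: (homo_sorted (e := ltn)); last exact: iota_ltn_sorted.
    by move=> i j ij; rewrite ltr_pM2r ?invr_gt0 // ltr_nat.
  - by apply: good_perm gS; apply: (pm [:: (V1, V2)]).
  move=> h1 h2; rewrite Pfst lE; split; first by apply: good_perm h1; rewrite perm_sym pm.
  by rewrite (support_perm (pm _ _)) h2; apply: support_perm; rewrite perm_sym (pm [:: (V1, V2)]).
have [g2 s2] : good (map snd P) /\ support (map snd P) = F 1 @` support (map fst P).
  apply: good_image => //; first exact: can_inj (FG 1).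
  move=> p; rewrite /P inE mem_cat => /orP[/eqP ->|/orP[]].
  - by move=> t _; apply: FU.
  - move=> /mapP [q /consec_iota [i [-> Hi]] ->] t t01.
    rewrite [_.1.1]/(l i) [_.1.2]/(l i.+1) [_.2.1]/(f i) [_.2.2]/(f i.+1).
    have -> : lin (l i) (l i.+1) t = lin V1 V2 ((i%:R + t) / m%:R).
      by rewrite /l lin_lin; congr lin; rewrite -natr1; field.
    rewrite FV; last first.
      have im : i%:R + 1 <= m%:R :> R by rewrite natr1 ler_nat.
      have i0 : 0 <= i%:R :> R by [].
      by rewrite divr_ge0 ?ler_pdivrMr //=; lra.
    have -> : W ((i%:R + t) / m%:R) = lerp (nth (proj V1) Ws i) (nth (proj V1) Ws i.+1) t.
      rewrite /W (_ : m%:R * _ = i%:R + t); last by field.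
      by rewrite plf_nth ?size_rcons.
    by apply/pt_eqP; rewrite /lin /f !mxE /= /lerp /=; split => //; rewrite -natr1; field.
  - move=> /mapP [e eS ->] /= t /andP[t0 t1]; apply: Flow.
    have := zS e eS (lin e.1 e.2 t); apply.
    by rewrite seg_hseg; have := t1; rewrite le_eqVlt => /orP[/eqP ->|t1'];
      [right; rewrite /= lin1 | left; exists t; rewrite t0 t1'].
exists xs; split.
- rewrite /xs -map_comp; apply: (@eq_from_nth _ (proj V1)); first by rewrite size_map size_iota.
  rewrite size_map size_iota => i Hi; rewrite (nth_map 0%N) ?size_iota // nth_iota //.
  by rewrite /= /proj !mk3E -surjective_pairing /Ws /= nth_rcons Hi.
- by rewrite -fE -Psnd.
- by rewrite -fE -Psnd s2 -s1; apply: iso.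
Qed.

End Slide.

(** * Uniform bounds along edges *)

Section Compactness.
Variable R : realType.

Lemma uniform_pos (A : eqType) (s : seq A) (P : A -> R -> Prop) :
  (forall x e e', P x e -> 0 < e' -> e' <= e -> P x e') ->
  (forall x, x \in s -> exists2 e, 0 < e & P x e) -> exists2 e, 0 < e & forall x, x \in s -> P x e.
Proof.
move=> mono; elim: s => [|x s IH] H; first by exists 1.
have [e1 p1 h1] := H x (mem_head _ _).
have [e2 p2 h2] := IH (fun y ys => H y (mem_behead (s := x :: s) ys)).
exists (Num.min e1 e2); first by rewrite lt_min p1.
move=> y; rewrite inE => /orP[/eqP ->|ys].
  by apply: mono h1 _ _; rewrite ?lt_min ?p1 ?p2 // ge_min lexx.
by apply: mono (h2 _ ys) _ _; rewrite ?lt_min ?p1 ?p2 // ge_min lexx orbT.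
Qed.

(** Compactness of the interval: the maximum of finitely many affine functions, positive at every
    point, is bounded away from 0. It turns statements that an edge avoids something into a positive
    distance. *)
Lemma affine_cover (fs : seq (R * R)) :
  (forall u : R, 0 <= u <= 1 -> exists2 f, f \in fs & 0 < f.1 + f.2 * u) ->
  exists2 e, 0 < e & forall u : R, 0 <= u <= 1 -> exists2 f, f \in fs & e <= f.1 + f.2 * u.
Proof.
move=> H.
pose Q a b := exists2 e, 0 < e & forall u, a <= u -> u <= b -> exists2 f, f \in fs & e <= f.1 + f.2 * u.
suff [e e0 He] : Q 0 1 by exists e => // u /andP[u0 u1]; apply: He.
apply: interval_induction => [a b c ab bc [e1 p1 H1] [e2 p2 H2]|x /H [f ff fx]].
  exists (Num.min e1 e2); first by rewrite lt_min p1.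
  move=> u au uc; have [ub|bu] := leP u b.
    by have [f ff fe] := H1 _ au ub; exists f => //; rewrite ge_min fe.
  by have [f ff fe] := H2 _ (ltW bu) uc; exists f => //; rewrite ge_min fe orbT.
set w := f.1 + f.2 * x in fx.
exists (w / 2 / (`|f.2| + 1)); first by rewrite !divr_gt0 // ltr_wpDl.
move=> a b _ ax xb _ ha hb; exists (w / 2); first by rewrite divr_gt0.
move=> u au ub; exists f => //.
have : `|f.2 * (u - x)| <= w / 2.
  rewrite normrM; apply: (le_trans (y := (`|f.2| + 1) * (w / 2 / (`|f.2| + 1)))).
    apply: ler_pM => //; first by rewrite lerDl.
    by rewrite ler_distl; apply/andP; split; lra.
  by rewrite mulrC divfK // gt_eqF // ltr_wpDl.
rewrite ler_norml => /andP[h1 _]; rewrite /w in h1 *; lra.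
Qed.

End Compactness.

Section Lift.
Variable R : realType.
Local Notation pt := 'M[R]_(1,3).
Local Notation pl := (R * R)%type.
Local Notation X v := (v ord0 i0).
Local Notation Y v := (v ord0 i1).
Local Notation Z v := (v ord0 i2).

Definition raise (v : pt) (C : R) : pt := v + C *: mk3 0 0 1.

Lemma raiseX v C : X (raise v C) = X v. Proof. by rewrite !mxE /= mulr0 addr0. Qed.
Lemma raiseY v C : Y (raise v C) = Y v. Proof. by rewrite !mxE /= mulr0 addr0. Qed.
Lemma raiseZ v C : Z (raise v C) = Z v + C. Proof. by rewrite !mxE /= mulr1. Qed.
Lemma proj_raise v C : proj (raise v C) = proj v.
Proof. by rewrite /proj raiseX raiseY. Qed.

Lemma linX (A B : pt) t : X (lin A B t) = X A + t * (X B - X A). Proof. by rewrite !mxE. Qed.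
Lemma linY (A B : pt) t : Y (lin A B t) = Y A + t * (Y B - Y A). Proof. by rewrite !mxE. Qed.
Lemma linZ (A B : pt) t : Z (lin A B t) = Z A + t * (Z B - Z A). Proof. by rewrite !mxE. Qed.

Lemma segP (a b v : pt) : seg a b v <-> exists t : R, 0 <= t <= 1 /\ v = lin a b t.
Proof.
have E (t : R) : (1 - t) *: a + t *: b = lin a b t by rewrite /lin scalerBl scale1r scalerBr addrA addrAC.
by split=> -[t [h ->]]; exists t; rewrite E.
Qed.

(* The part of space above the affine graph sigma is stretched vertically over a thin
   neighbourhood of the shadow of the edge, where only the edge lies above sigma. *)
Lemma lift (A B : pt) S (s1 s2 s5 C : R) :
  0 < s1 -> s1 < s2 -> s2 < s5 -> s5 < 1 -> proj A <> proj B -> 0 <= C ->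
  (forall e, e \in S -> forall v, seg e.1 e.2 v -> forall s, s1 <= s <= s5 ->
     proj v = lerp (proj A) (proj B) s -> Z v < Z (lin A B s)) ->
  good ((A, B) :: S) ->
  let S' := consec [:: A; lin A B s1; raise (lin A B s2) C; lin A B s5; B] ++ S in
  good S' /\ ambient_isotopic (support ((A, B) :: S)) (support S').
Proof.
move=> s10 s12 s25 s51 pAB C0 over gS S'.
pose n := (X B - X A) ^+ 2 + (Y B - Y A) ^+ 2.
have n0 : n != 0.
  apply: contra_not_neq pAB => /eqP; rewrite paddr_eq0 ?sqr_ge0 // !sqrf_eq0 !subr_eq0.
  by move=> /andP[/eqP E1 /eqP E2]; rewrite /proj E1 E2.
(* [sp] is the parameter along the line of the shadow of AB, [tp] a multiple of the signed distance
   from this line, [az] the height of AB continued by the parameter. The function [k] below is the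
   tent that is 0 at s1 and s5, 1 at s2, and negative outside. *)
pose sp (v : pt) := ((X v - X A) * (X B - X A) + (Y v - Y A) * (Y B - Y A)) / n.
pose tp (v : pt) := (X B - X A) * (Y v - Y A) - (Y B - Y A) * (X v - X A).
pose az (v : pt) := Z A + sp v * (Z B - Z A).
pose k1 s := (s - s1) / (s2 - s1); pose k2 s := (s5 - s) / (s5 - s2).
pose k s := Num.min (k1 s) (k2 s).
have d12 : 0 < s2 - s1 by rewrite subr_gt0.
have d25 : 0 < s5 - s2 by rewrite subr_gt0.
have k1E s : k s <= 1.
  rewrite /k ge_min; case: (leP s s2) => h.
    by apply/orP; left; rewrite /k1 ler_pdivrMr // mul1r lerB.
  by apply/orP; right; rewrite /k2 ler_pdivrMr // mul1r lerB // ltW.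
(* At each point of another edge one of five affine functions is positive: it lies below AB, off the
   line on one of the two sides, before s1 or behind s5. The bound [eta] makes this uniform, and in
   each case the stretching leaves the point fixed. *)
have [eta eta0 Heta] : exists2 eta, 0 < eta & forall e, e \in S -> forall v, seg e.1 e.2 v ->
    [\/ eta <= az v - Z v, eta <= `|tp v| | k (sp v) <= - eta].
  apply: (@uniform_pos _ _ S (fun e eta => forall v, seg e.1 e.2 v ->
    [\/ eta <= az v - Z v, eta <= `|tp v| | k (sp v) <= - eta])).
    move=> e u u' H h0 hu v /H [h|h|h]; [apply: Or31 | apply: Or32 | apply: Or33]; lra.
  move=> e eS.
  have aff (f : pt -> R) : (forall u, f (lin e.1 e.2 u) = f e.1 + u * (f e.2 - f e.1)) ->
     forall u, f (lin e.1 e.2 u) = f e.1 + (f e.2 - f e.1) * u by move=> H u; rewrite H mulrC.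
  have spE u : sp (lin e.1 e.2 u) = sp e.1 + u * (sp e.2 - sp e.1) by rewrite /sp linX linY; field.
  have f1 := aff (fun v => az v - Z v); have f2 := aff tp; have f3 := aff (fun v => - tp v).
  have f4 := aff (fun v => - k1 (sp v)); have f5 := aff (fun v => - k2 (sp v)).
  pose fs := [:: (fun v => az v - Z v); tp; (fun v => - tp v); (fun v => - k1 (sp v)); (fun v => - k2 (sp v))].
  have H1 u : (fun v => az v - Z v) (lin e.1 e.2 u) = (az e.1 - Z e.1) + ((az e.2 - Z e.2) - (az e.1 - Z e.1)) * u.
    by rewrite f1 // => t; rewrite /az spE linZ; ring.
  have H2 u : tp (lin e.1 e.2 u) = tp e.1 + (tp e.2 - tp e.1) * u.
    by rewrite f2 // => t; rewrite /tp linX linY; ring.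
  have H3 u : - tp (lin e.1 e.2 u) = - tp e.1 + (- tp e.2 + tp e.1) * u by rewrite H2; ring.
  have H4 u : - k1 (sp (lin e.1 e.2 u)) = - k1 (sp e.1) + (- k1 (sp e.2) + k1 (sp e.1)) * u.
    by rewrite /k1 spE; field; rewrite gt_eqF.
  have H5 u : - k2 (sp (lin e.1 e.2 u)) = - k2 (sp e.1) + (- k2 (sp e.2) + k2 (sp e.1)) * u.
    by rewrite /k2 spE; field; rewrite gt_eqF.
  have [|eta eta0 Heta] := @affine_cover R [:: (az e.1 - Z e.1, (az e.2 - Z e.2) - (az e.1 - Z e.1));
     (tp e.1, tp e.2 - tp e.1); (- tp e.1, - tp e.2 + tp e.1);
     (- k1 (sp e.1), - k1 (sp e.2) + k1 (sp e.1)); (- k2 (sp e.1), - k2 (sp e.2) + k2 (sp e.1))].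
    move=> u u01; set v := lin e.1 e.2 u.
    have sv : seg e.1 e.2 v by apply/segP; exists u.
    case: (ltrgt0P (tp v)) => [h|h|h].
    - by exists (tp e.1, tp e.2 - tp e.1); [rewrite !inE eqxx ?orbT | rewrite /= -H2].
    - by exists (- tp e.1, - tp e.2 + tp e.1); [rewrite !inE eqxx ?orbT | rewrite /= -H3 oppr_gt0].
    case: (ltP (sp v) s1) => h1.
      exists (- k1 (sp e.1), - k1 (sp e.2) + k1 (sp e.1)); first by rewrite !inE eqxx ?orbT.
      by rewrite /= -H4 oppr_gt0 /k1 -/v pmulr_llt0 ?invr_gt0 // subr_lt0.
    case: (ltP s5 (sp v)) => h5.
      exists (- k2 (sp e.1), - k2 (sp e.2) + k2 (sp e.1)); first by rewrite !inE eqxx ?orbT.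
      by rewrite /= -H5 oppr_gt0 /k2 -/v pmulr_llt0 ?invr_gt0 // subr_lt0.
    exists (az e.1 - Z e.1, (az e.2 - Z e.2) - (az e.1 - Z e.1)); first by rewrite !inE eqxx ?orbT.
    rewrite /= -H1 subr_gt0 -/v.
    have := over e eS v sv (sp v); rewrite h1 h5 linZ; apply => //.
    move: h; rewrite /tp => h; apply/pl_eqP; rewrite /proj /lerp /= /sp.
    split; apply/eqP; rewrite -subr_eq0; apply/eqP.
      transitivity (- (Y B - Y A) * ((X B - X A) * (Y v - Y A) - (Y B - Y A) * (X v - X A)) / n).
        by rewrite /n; field; exact: n0.
      by rewrite h mulr0 mul0r.
    transitivity ((X B - X A) * ((X B - X A) * (Y v - Y A) - (Y B - Y A) * (X v - X A)) / n).
      by rewrite /n; field; exact: n0.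
    by rewrite h mulr0 mul0r.
  exists eta => // v /segP [u [u01 ->]]; have [f ff fe] := Heta u u01.
  move: ff fe; rewrite !inE => /or4P[/eqP ->|/eqP ->|/eqP ->|/orP[]/eqP ->] /=.
  - by rewrite -H1 => h; apply: Or31.
  - by rewrite -H2 => h; apply: Or32; apply: le_trans h _; apply: ler_norm.
  - by rewrite -H3 => h; apply: Or32; apply: le_trans h _; rewrite -normrN; apply: ler_norm.
  - by rewrite -H4 => h; apply: Or33; rewrite /k ge_min; apply/orP; left; lra.
  - by rewrite -H5 => h; apply: Or33; rewrite /k ge_min; apply/orP; right; lra.
(* Heights above [sg] are stretched by the factor 1 + [K]. As AB lies [eta] above [sg], the division
   by [eta] makes it rise by exactly C times the tent. *)
pose K (v : pt) := C / eta * Num.max 0 (k (sp v) - `|tp v| / eta).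
pose sg (v : pt) := az v - eta.
have K0 v : 0 <= K v.
  by apply: mulr_ge0; [apply: divr_ge0 => //; exact: ltW | rewrite le_max lexx].
(* An isotopy has to be a homeomorphism at every real time, also a negative one; hence the square of
   t. *)
have K1 t v : 0 < 1 + t ^+ 2 * K v by rewrite ltr_pwDl // mulr_ge0 ?sqr_ge0.
pose F (t : R) (v : pt) : pt := mk3 (X v) (Y v) (Z v + t ^+ 2 * K v * Num.max 0 (Z v - sg v)).
pose G (t : R) (v : pt) : pt := mk3 (X v) (Y v) (Z v - t ^+ 2 * K v / (1 + t ^+ 2 * K v) * Num.max 0 (Z v - sg v)).
have spF (x y z z' : R) : sp (mk3 x y z) = sp (mk3 x y z') by rewrite /sp !mk3E.
have Kxy (v w : pt) : X v = X w -> Y v = Y w -> K v = K w /\ sg v = sg w.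
  by move=> E1 E2; rewrite /K /sg /az /sp /tp E1 E2.
have FG t : cancel (F t) (G t).
  move=> v; have [E1 E2] : K (F t v) = K v /\ sg (F t v) = sg v by apply: Kxy; rewrite !mk3E.
  have XE : X (F t v) = X v by rewrite mk3X.
  have YE : Y (F t v) = Y v by rewrite mk3Y.
  apply/pt_eqP; split; [by rewrite mk3X XE | by rewrite mk3Y YE | rewrite /G mk3Z E1 E2 mk3Z].
  have := K1 t v; move: (t ^+ 2 * K v) => kk k0.
  case: (leP 0 (Z v - sg v)) => h.
    have -> : Num.max 0 (Z v + kk * (Z v - sg v) - sg v) = (1 + kk) * (Z v - sg v).
      by rewrite max_r; [ring | rewrite (_ : _ - sg v = (1 + kk) * (Z v - sg v)); [apply: mulr_ge0 => //; exact: ltW | ring]].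
    by field; rewrite gt_eqF.
  by rewrite mulr0 addr0 max_l ?ltW // mulr0 subr0.
have GF t : cancel (G t) (F t).
  move=> v; have [E1 E2] : K (G t v) = K v /\ sg (G t v) = sg v by apply: Kxy; rewrite !mk3E.
  have XE : X (G t v) = X v by rewrite mk3X.
  have YE : Y (G t v) = Y v by rewrite mk3Y.
  apply/pt_eqP; split; [by rewrite mk3X XE | by rewrite mk3Y YE | rewrite /F mk3Z E1 E2 mk3Z].
  have := K1 t v; move: (t ^+ 2 * K v) => kk k0.
  case: (leP 0 (Z v - sg v)) => h.
    have -> : Num.max 0 (Z v - kk / (1 + kk) * (Z v - sg v) - sg v) = (Z v - sg v) / (1 + kk).
      have E : Z v - kk / (1 + kk) * (Z v - sg v) - sg v = (Z v - sg v) / (1 + kk) by field; rewrite gt_eqF.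
      by rewrite E max_r // divr_ge0 // ltW.
    by field; rewrite gt_eqF.
  by rewrite mulr0 subr0 max_l ?ltW // mulr0 addr0.
have F0 (v : pt) : F 0 v = v.
  by apply/pt_eqP; rewrite /F !mk3E expr0n /= !mul0r addr0.
have Fid (v : pt) : K v = 0 \/ Z v <= sg v -> F 1 v = v.
  move=> h; apply/pt_eqP; rewrite /F !mk3E; split => //.
  by case: h => [->|h]; [rewrite mulr0 mul0r addr0 | rewrite max_l ?subr_le0 // mulr0 addr0].
have csp : continuous sp.
  apply: continuous_mul; last exact: continuous_cst.
  by apply: continuous_add; (apply: continuous_mul; last exact: continuous_cst);
    apply: continuous_add; [exact: continuous_coord | exact: continuous_cst | exact: continuous_coord | exact: continuous_cst].
have ctp : continuous tp.
  by apply: continuous_add; [|apply: continuous_opp]; (apply: continuous_mul; first exact: continuous_cst);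
    apply: continuous_add; [exact: continuous_coord | exact: continuous_cst | exact: continuous_coord | exact: continuous_cst].
have caz : continuous az.
  by apply: continuous_add; [exact: continuous_cst | apply: continuous_mul => //; exact: continuous_cst].
have csg : continuous sg by apply: continuous_add => //; exact: continuous_cst.
have cK : continuous K.
  apply: continuous_mul; first exact: continuous_cst.
  apply: continuous_maxr; first exact: continuous_cst.
  apply: continuous_add; last first.
    by apply: continuous_opp; apply: continuous_mul; [exact: continuous_norm | exact: continuous_cst].
  apply: continuous_minr; (apply: continuous_mul; last exact: continuous_cst); apply: continuous_add => //.
  - exact: continuous_cst.
  - exact: continuous_cst.
  - exact: continuous_opp.
have cmx : continuous (fun v : pt => Num.max 0 (Z v - sg v)).
  apply: continuous_maxr; first exact: continuous_cst.
  by apply: continuous_add; [exact: continuous_coord | exact: continuous_opp].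
have cG t : continuous (G t).
  apply: continuous_mk3; [exact: continuous_coord | exact: continuous_coord | ].
  apply: continuous_add; first exact: continuous_coord.
  apply: continuous_opp; apply: continuous_mul => //; apply: continuous_mul.
    by apply: continuous_mul => //; exact: continuous_cst.
  apply: continuous_inv; first by move=> v; rewrite gt_eqF.
  by apply: continuous_add; [exact: continuous_cst | apply: continuous_mul => //; exact: continuous_cst].
have c1 (f : pt -> R) : continuous f -> continuous (fun q : pt * R => f q.1).
  by move=> cf; apply: (continuous_comp_fun (@continuous_fst _ _) cf).
have cF : continuous (fun q : pt * R => F q.2 q.1).
  apply: continuous_mk3; [exact: continuous_coord1 | exact: continuous_coord1 | ].
  apply: continuous_add; first exact: continuous_coord1.
  apply: continuous_mul; last exact: (c1 _ cmx).
  apply: continuous_mul; last exact: (c1 _ cK).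
  have -> : (fun q : pt * R => q.2 ^+ 2) = (fun q => q.2 * q.2) by apply/funext => q; rewrite expr2.
  by apply: continuous_mul; exact: continuous_time.
have iso D := isotopic_by D cF cG FG GF F0.
have spl s : sp (lin A B s) = s by rewrite /sp linX linY /n; field; exact: n0.
have tpl s : tp (lin A B s) = 0 by rewrite /tp linX linY; ring.
have Fl s : F 1 (lin A B s) = raise (lin A B s) (C * Num.max 0 (k s)).
  apply/pt_eqP; rewrite /F !mk3E raiseX raiseY raiseZ; split => //; congr (_ + _).
  have -> : Z (lin A B s) - sg (lin A B s) = eta by rewrite /sg /az spl linZ; ring.
  rewrite /K spl tpl normr0 mul0r subr0 expr1n mul1r (max_r (ltW eta0)); field; exact: lt0r_neq0.
have FS (v : pt) e : e \in S -> seg e.1 e.2 v -> F 1 v = v.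
  move=> eS sv; apply: Fid; case: (Heta e eS v sv) => h.
  - by right; rewrite /sg; lra.
  - left; rewrite /K max_l ?mulr0 // subr_le0; apply: le_trans (k1E _) _.
    by rewrite ler_pdivlMr // mul1r.
  - left; rewrite /K max_l ?mulr0 // subr_le0; apply: (@le_trans _ _ 0); last by rewrite divr_ge0 // ltW.
    by apply: le_trans h _; rewrite oppr_le0 ltW.
have kle s : s <= s1 \/ s5 <= s -> Num.max 0 (k s) = 0.
  move=> h; rewrite max_l // /k ge_min; apply/orP; case: h => h; [left|right];
    by rewrite pmulr_lle0 ?invr_gt0 // subr_le0.
have k12 t : 0 <= t <= 1 -> Num.max 0 (k (s1 + t * (s2 - s1))) = t.
  move=> /andP[t0 t1]; have e1 : k1 (s1 + t * (s2 - s1)) = t by rewrite /k1; field; exact: lt0r_neq0.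
  have h : t * (s2 - s1) <= s2 - s1 by rewrite ger_pMl.
  by rewrite /k e1 min_l ?max_r // /k2 ler_pdivlMr //; nra.
have k25 t : 0 <= t <= 1 -> Num.max 0 (k (s2 + t * (s5 - s2))) = 1 - t.
  move=> /andP[t0 t1]; have e1 : k2 (s2 + t * (s5 - s2)) = 1 - t by rewrite /k2; field; exact: lt0r_neq0.
  have h : 0 <= t * (s5 - s2) by rewrite mulr_ge0 // ltW.
  by rewrite /k e1 min_r ?max_r // ?subr_ge0 // /k1 ler_pdivlMr //; nra.
have AB : A <> B by move=> E; apply: pAB; rewrite E.
have [|h1 h2] := @good_subdiv R A B S [:: s1; s2; s5] _ gS; first by rewrite /= s10 s12 s25 s51.
rewrite /= lin0 lin1 in h1 h2.
set l1 := lin A B s1 in S' h1 h2 *; set l2 := lin A B s2 in S' h1 h2 *; set l5 := lin A B s5 in S' h1 h2 *.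
pose P := [:: ((A, l1), (A, l1)); ((l1, l2), (l1, raise l2 C)); ((l2, l5), (raise l2 C, l5)); ((l5, B), (l5, B))]
  ++ map (fun e => (e, e)) S.
have Pfst : map fst P = consec [:: A; l1; l2; l5; B] ++ S.
  by rewrite /P map_cat -map_comp map_id_in.
have Psnd : map snd P = S' by rewrite /P map_cat -map_comp map_id_in.
have [g2 e2] : good (map snd P) /\ support (map snd P) = F 1 @` support (map fst P).
  apply: good_image; [exact: can_inj (FG 1) | | by rewrite Pfst].
  have r0 v : raise v (C * 0) = v by apply/pt_eqP; rewrite raiseX raiseY raiseZ mulr0 addr0.
  move=> p; rewrite /P mem_cat => /orP[|/mapP [e eS ->] t t01]; last first.
    by rewrite (FS _ e) //; apply/segP; exists t.
  rewrite !inE => /or4P[]/eqP-> t t01 /=.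
  - have -> : lin A l1 t = lin A B (t * s1).
      by rewrite -[in lin A l1](lin0 A B) /l1 lin_lin; congr lin; ring.
    rewrite Fl kle ?r0 //; left; case/andP: t01 => t0 t1; rewrite ger_pMl //.
  - rewrite /l1 /l2 lin_lin Fl k12 //; apply/pt_eqP.
    by rewrite raiseX raiseY raiseZ !(linX, linY, linZ) raiseX raiseY raiseZ !(linX, linY, linZ); split; ring.
  - rewrite /l5 /l2 lin_lin Fl k25 //; apply/pt_eqP.
    by rewrite raiseX raiseY raiseZ !(linX, linY, linZ) raiseX raiseY raiseZ !(linX, linY, linZ); split; ring.
  - have -> : lin l5 B t = lin A B (s5 + t * (1 - s5)).
      by rewrite -[in lin l5 B](lin1 A B) /l5 lin_lin.
    rewrite Fl kle ?r0 //; right; case/andP: t01 => t0 t1; rewrite lerDl mulr_ge0 // subr_ge0 ltW //.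
by rewrite -Psnd; split => //; rewrite e2 Pfst h2; apply: iso.
Qed.

Lemma upper_bound_list (T : eqType) (f : T -> R) (s : seq T) : exists2 M, 0 <= M & forall x, x \in s -> f x <= M.
Proof.
elim: s => [|x s [M M0 IH]]; first by exists 0.
exists (Num.max M (f x)); first by rewrite le_max M0.
move=> y; rewrite inE => /orP[/eqP ->|/IH h]; rewrite le_max ?lexx ?orbT //.
by rewrite h.
Qed.

(** Heights on the falling side of the tent, from the apex over s2 (r = 0) to the foot over s5 (r =
    1). If C is large, the part between r3 and r4 falls strictly, lies above the level M of all old
    edges and stays below the apex, as [slide] demands of V1V2. *)
Lemma tent_heights (z2 z5 M C r3 r4 : R) :
  0 <= M -> 0 < r3 -> r3 < r4 -> r4 < 1 -> - M <= z2 <= M -> - M <= z5 <= M ->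
  2 * M + 1 <= C * (1 - r4) -> 2 * M + 1 <= C * (r4 - r3) -> 2 * M + 1 <= C * r3 ->
  let h r := (1 - r) * z2 + r * z5 + C * (1 - r) in
  [/\ h r4 < h r3, M <= h r4 & h r3 <= z2 + C].
Proof.
move=> M0 r30 r34 r41 Z2 Z5 C1 C2 C3 h.
have a1 : 0 <= (r4 - r3) * (z2 - z5 + 2 * M) by rewrite mulr_ge0 //; lra.
have a2 : 0 <= M * (1 - (r4 - r3)) by rewrite mulr_ge0 //; lra.
have b1 : 0 <= (1 - r4) * (z2 + M) by rewrite mulr_ge0 //; lra.
have b2 : 0 <= r4 * (z5 + M) by rewrite mulr_ge0 //; lra.
have c1 : 0 <= r3 * (z2 - z5 + 2 * M) by rewrite mulr_ge0 //; lra.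
have c2 : 0 <= M * (1 - r3) by rewrite mulr_ge0 //; lra.
by rewrite /h; split; lra.
Qed.

Lemma perm_eq_rot3 (T : eqType) (x a b : T) s : perm_eq [:: x, a, b & s] [:: a, b, x & s].
Proof. by apply/permP => q /=; lia. Qed.

Lemma perm_eq_shuffle6 (T : eqType) (a b c d e f : T) s :
  perm_eq [:: a, b, c, d, e, f & s] [:: e, b, d, a, c, f & s].
Proof. by apply/permP => q /=; lia. Qed.

Lemma perm_eq_shuffle_cat (T : eqType) (a b c d e : T) s t :
  perm_eq (a :: t ++ [:: b, c, d, e & s]) (([:: b; a; c] ++ t ++ [:: d; e]) ++ s).
Proof. by apply/permP => q; rewrite -catA /= !count_cat /=; lia. Qed.

Lemma seg_le (a b v : pt) c : Z a <= c -> Z b <= c -> seg a b v -> Z v <= c.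
Proof.
move=> ha hb /segP [t [/andP[t0 t1] ->]]; rewrite linZ.
have e1 : 0 <= t * (c - Z b) by rewrite mulr_ge0 //; lra.
have e2 : 0 <= (1 - t) * (c - Z a) by rewrite mulr_ge0 //; lra.
lra.
Qed.

Lemma seg_ge (a b v : pt) c : c <= Z a -> c <= Z b -> seg a b v -> c <= Z v.
Proof.
move=> ha hb /segP [t [/andP[t0 t1] ->]]; rewrite linZ.
have e1 : 0 <= t * (Z b - c) by rewrite mulr_ge0 //; lra.
have e2 : 0 <= (1 - t) * (Z a - c) by rewrite mulr_ge0 //; lra.
lra.
Qed.

(** The edge is lifted to a high tent. Its rising side, over s1 to s2, becomes the axis U1U2 of
    [slide]; the part V1V2 of its falling side, over s3 to s4, is slid to the new path. At these
    heights there is nothing else but the axis, so the path may cross all shadows except that of the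
    axis. *)
Lemma reroute (A B : pt) S (s1 s2 s3 s4 s5 : R) ws :
  let p := lerp (proj A) (proj B) in
  0 < s1 -> s1 < s2 -> s2 < s3 -> s3 < s4 -> s4 < s5 -> s5 < 1 -> proj A <> proj B ->
  (forall e, e \in S -> forall v, seg e.1 e.2 v -> forall s, s1 <= s <= s5 ->
     proj v = p s -> Z v < Z (lin A B s)) ->
  (forall e, e \in consec (p s3 :: rcons ws (p s4)) -> forall x, onc e x ->
     forall s, s1 <= s <= s2 -> x <> p s) ->
  closed_edges ((A, B) :: S) -> good ((A, B) :: S) ->
  exists xs, let S' := consec (A :: rcons xs B) ++ S in
    [/\ map proj xs = [:: p s1; p s2; p s3] ++ ws ++ [:: p s4; p s5],
      closed_edges S', good S' & ambient_isotopic (support ((A, B) :: S)) (support S')].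
Proof.
move=> p s10 s12 s23 s34 s45 s51 pAB over avoid cS gS.
have [M M0 HM] := upper_bound_list (fun e : pt * pt => `|Z e.1| + `|Z e.2|) ((A, B) :: S).
have HMv e v : e \in (A, B) :: S -> seg e.1 e.2 v -> - M <= Z v <= M.
  move=> eS /segP [t [/andP[t0 t1] ->]]; have := HM e eS; rewrite linZ => h.
  have := ler_norm (Z e.1); have := ler_norm (Z e.2); have := ler_norm (- Z e.1); have := ler_norm (- Z e.2).
  rewrite !normrN => *; have a0 := normr_ge0 (Z e.1); have b0 := normr_ge0 (Z e.2).
  have : (1 - t) * (M - Z e.1) >= 0 by rewrite mulr_ge0 //; lra.
  have : t * (M - Z e.2) >= 0 by rewrite mulr_ge0 //; lra.
  have : (1 - t) * (M + Z e.1) >= 0 by rewrite mulr_ge0 //; lra.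
  have : t * (M + Z e.2) >= 0 by rewrite mulr_ge0 //; lra.
  by move=> *; apply/andP; split; lra.
have HMl s : 0 <= s <= 1 -> - M <= Z (lin A B s) <= M.
  by move=> s01; apply: (HMv (A, B)); [rewrite mem_head | apply/segP; exists s].
have s101 : 0 <= s1 <= 1 by lra.
have s501 : 0 <= s5 <= 1 by lra.
have ubl s : 0 <= s <= 1 -> Z (lin A B s) <= M by move=> /HMl /andP[].
have ZA : Z A <= M by have := ubl 0; rewrite lin0; apply; rewrite lexx ler01.
have ZB : Z B <= M by have := ubl 1; rewrite lin1; apply; rewrite lexx ler01.
have between (u a b : R) : 0 <= u <= 1 -> a <= b -> a <= a + u * (b - a) <= b.
  move=> /andP[u0 u1] ab; rewrite lerDl mulr_ge0 ?subr_ge0 //=.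
  by rewrite -lerBrDl ler_piMl // subr_ge0.
have d25 : 0 < s5 - s2 by lra.
pose r3 := (s3 - s2) / (s5 - s2); pose r4 := (s4 - s2) / (s5 - s2).
have r30 : 0 < r3 by rewrite divr_gt0 // subr_gt0.
have r34 : r3 < r4 by rewrite ltr_pM2r ?invr_gt0 // ltrD2r.
have r41 : r4 < 1 by rewrite ltr_pdivrMr // mul1r ltrD2r.
have g1 : 0 < 1 - r4 by lra.
have g2 : 0 < r4 - r3 by lra.
(* One summand for each of the three inequalities of [tent_heights]. *)
pose C := (2 * M + 1) / (1 - r4) + (2 * M + 1) / (r4 - r3) + (2 * M + 1) / r3.
have M1 : 0 < 2 * M + 1 by lra.
have q1 : 0 < (2 * M + 1) / (1 - r4) by rewrite divr_gt0.
have q2 : 0 < (2 * M + 1) / (r4 - r3) by rewrite divr_gt0.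
have q3 : 0 < (2 * M + 1) / r3 by rewrite divr_gt0.
have C1 : 2 * M + 1 <= C * (1 - r4) by rewrite -ler_pdivrMr // /C; lra.
have C2 : 2 * M + 1 <= C * (r4 - r3) by rewrite -ler_pdivrMr // /C; lra.
have C3 : 2 * M + 1 <= C * r3 by rewrite -ler_pdivrMr // /C; lra.
have C0 : 0 <= C by rewrite /C; lra.
have [gT isoT] := lift s10 s12 (lt_trans s23 (lt_trans s34 s45)) s51 pAB C0 over gS.
set l1 := lin A B s1 in gT isoT; set l5 := lin A B s5 in gT isoT.
set T := raise (lin A B s2) C in gT isoT.
have ZT : Z T = Z (lin A B s2) + C by rewrite raiseZ.
set V1 := lin T l5 r3; set V2 := lin T l5 r4.
have HV r : proj (lin T l5 r) = p (s2 + r * (s5 - s2)).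
  by rewrite proj_lin /T proj_raise /l5 !proj_lin lerp_lerp.
have pV1 : proj V1 = p s3 by rewrite HV /r3 divfK ?gt_eqF // addrC subrK.
have pV2 : proj V2 = p s4 by rewrite HV /r4 divfK ?gt_eqF // addrC subrK.
have Z2 : - M <= Z (lin A B s2) <= M by apply: HMl; lra.
have Z5 : - M <= Z l5 <= M by apply: HMl; lra.
have Z1 : - M <= Z l1 <= M by apply: HMl; lra.
have ZV r : Z (lin T l5 r) = (1 - r) * Z (lin A B s2) + r * Z l5 + C * (1 - r) by rewrite linZ ZT; ring.
have ZV1 := ZV r3; have ZV2 := ZV r4; rewrite -/V1 -/V2 in ZV1 ZV2.
have [V12 V2M V1T] : [/\ Z V2 < Z V1, M <= Z V2 & Z V1 <= Z T].
  by rewrite ZT ZV1 ZV2; apply: tent_heights C1 C2 C3.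
have gT2 : good ((T, l5) :: [:: (A, l1); (l1, T); (l5, B)] ++ S).
  by apply: good_perm gT; rewrite perm_sym; apply: perm_eq_rot3.
have suppT : support ((T, l5) :: [:: (A, l1); (l1, T); (l5, B)] ++ S) = support (consec [:: A; l1; T; l5; B] ++ S).
  by apply: support_perm; apply: perm_eq_rot3.
have [|h1 h2] := @good_subdiv R T l5 _ [:: r3; r4] _ gT2; first by rewrite /= r30 r34 r41.
rewrite /= lin0 lin1 -/V1 -/V2 in h1 h2.
pose S2 := [:: (A, l1); (T, V1); (V2, l5); (l5, B)] ++ S.
have pm1 : perm_eq [:: (T, V1), (V1, V2), (V2, l5), (A, l1), (l1, T), (l5, B) & S] ((l1, T) :: (V1, V2) :: S2).
  exact: perm_eq_shuffle6.
have gsl : good ((l1, T) :: (V1, V2) :: S2) by apply: good_perm h1.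
have [| | | | | | |xs [mx gx isox]] := @slide R l1 T V1 V2 S2 ws.
- exact: V12.
- exact: le_trans (ubl _ s101) V2M.
- exact: V1T.
- move=> e; rewrite mem_cat => /orP[|eS v sv]; last first.
    left; apply: le_trans V2M; have := @HMv e v; rewrite inE eS orbT => /(_ isT sv).
    by move=> /andP[].
  rewrite !inE => /or4P[]/eqP-> v sv.
  + by left; apply: seg_le sv; [exact: le_trans ZA V2M | exact: le_trans (ubl _ s101) V2M].
  + by right; apply: seg_ge sv.
  + by left; apply: seg_le sv; [exact: lexx | exact: le_trans (ubl _ s501) V2M].
  + by left; apply: seg_le sv; [exact: le_trans (ubl _ s501) V2M | exact: le_trans ZB V2M].
- rewrite pV1 pV2 => e eW x ex s s01; rewrite /l1 /T proj_raise !proj_lin lerp_lerp.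
  have B1 := between s s1 s2 s01 (ltW s12).
  exact: (avoid e eW x ex _ B1).
- rewrite pV1 pV2 /l1 /T proj_raise !proj_lin => x [t [t01 ->]] s s01 /=; rewrite /p !lerp_lerp.
  move/(lerp_inj pAB) => E.
  have B1 := between s s1 s2 s01 (ltW s12).
  have B2 := between t s3 s4 t01 (ltW s34).
  move: B1 B2 => /andP[_ h1'] /andP[h2' _].
  by have := lt_le_trans s23 h2'; rewrite E ltNge h1'.
- exact: gsl.
have E : perm_eq ((l1, T) :: consec (V1 :: rcons xs V2) ++ S2)
   (consec (A :: rcons ([:: l1; T; V1] ++ xs ++ [:: V2; l5]) B) ++ S).
  have -> : A :: rcons ([:: l1; T; V1] ++ xs ++ [:: V2; l5]) B = [:: A; l1; T] ++ (V1 :: xs ++ [:: V2; l5; B]).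
    by rewrite /= -!cats1 -catA.
  rewrite (consec_cat _ V1) -(cat_cons V1) (consec_cat _ V2) rcons_cons.
  exact: perm_eq_shuffle_cat.
exists ([:: l1; T; V1] ++ xs ++ [:: V2; l5]) => S'; split.
- by rewrite !map_cat mx /= pV1 pV2 /T proj_raise /l1 /l5 !proj_lin.
- exact: closed_edges_insert.
- exact: good_perm E gx.
- rewrite /S' -(support_perm E); apply: isotopic_trans isoT _.
  rewrite -suppT -h2 (support_perm pm1); exact: isox.
Qed.

End Lift.

Section Mirror.
Variable R : realType.
Local Notation pt := 'M[R]_(1,3).
Local Notation pl := (R * R)%type.
Local Notation X v := (v ord0 i0).
Local Notation Y v := (v ord0 i1).
Local Notation Z v := (v ord0 i2).

Lemma closed_edges_map (A B : eqType) (f : A -> B) S :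
  closed_edges S -> closed_edges (map (fun e => (f e.1, f e.2)) S).
Proof.
move=> [L [L0 L3 LS]]; exists (map (map f) L); split; first by rewrite size_map.
  by move=> k; rewrite size_map => kL; rewrite (nth_map [::]) // size_map; apply: L3.
apply: perm_trans (perm_map _ LS); rewrite /link_edges map_flatten -!map_comp.
rewrite (_ : map _ L = map (map (fun e => (f e.1, f e.2)) \o @cyc_edges A) L) //.
apply: eq_map => -[|x s] //=.
by rewrite -map_rcons /consec -consec_map.
Qed.

Definition mirror_edges (S : seq (pt * pt)) := map (fun e : pt * pt => (mirror e.1, mirror e.2)) S.

Lemma mirror_lin (A B : pt) t : mirror (lin A B t) = lin (mirror A) (mirror B) t.
Proof. by apply/pt_eqP; rewrite !(linX, linY, linZ) !mk3E !(linX, linY, linZ); split; ring. Qed.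

Lemma proj_mirror (v : pt) : proj (mirror v) = proj v.
Proof. by rewrite /proj !mk3E. Qed.

Lemma good_mirror S : good S -> good (mirror_edges S) /\ support (mirror_edges S) = @mirror R @` support S.
Proof.
move=> gS; pose P := map (fun e : pt * pt => (e, (mirror e.1, mirror e.2))) S.
have E1 : map fst P = S by rewrite -map_comp map_id_in.
have E2 : map snd P = mirror_edges S by rewrite -map_comp.
have [] := @good_image R (@mirror R) P; last 2 first.
- by rewrite E1.
- by rewrite E1 E2.
- by apply: can_inj; apply: mirrorK.
- by move=> p /mapP [e _ ->] t _; rewrite mirror_lin.
Qed.

Lemma mirror_edgesK S : mirror_edges (mirror_edges S) = S.
Proof.
by rewrite /mirror_edges -map_comp map_id_in // => -[a b] _ /=; rewrite !mirrorK.
Qed.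

(** For a strand below everything, [reroute] is applied to the mirror image and the result is
    reflected back; shadows are not affected. *)
Lemma reroute_side (A B : pt) S (s1 s2 s3 s4 s5 : R) ws :
  let p := lerp (proj A) (proj B) in
  0 < s1 -> s1 < s2 -> s2 < s3 -> s3 < s4 -> s4 < s5 -> s5 < 1 -> proj A <> proj B ->
  (forall e, e \in S -> forall v, seg e.1 e.2 v -> forall s, s1 <= s <= s5 ->
     proj v = p s -> Z v < Z (lin A B s)) \/
  (forall e, e \in S -> forall v, seg e.1 e.2 v -> forall s, s1 <= s <= s5 ->
     proj v = p s -> Z (lin A B s) < Z v) ->
  (forall e, e \in consec (p s3 :: rcons ws (p s4)) -> forall x, onc e x ->
     forall s, s1 <= s <= s2 -> x <> p s) ->
  closed_edges ((A, B) :: S) -> good ((A, B) :: S) ->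
  exists xs, let S' := consec (A :: rcons xs B) ++ S in
    [/\ map proj xs = [:: p s1; p s2; p s3] ++ ws ++ [:: p s4; p s5],
      closed_edges S', good S' & ambient_isotopic (support ((A, B) :: S)) (support S')].
Proof.
move=> p s10 s12 s23 s34 s45 s51 pAB [over|under] avoid cS gS; first exact: reroute.
have [gM eM] := good_mirror gS; have cM := closed_edges_map (@mirror R) cS.
have pm : lerp (proj (mirror A)) (proj (mirror B)) = p by rewrite !proj_mirror.
have [||||||||||| xs [mx cx gx ix]] := @reroute R (mirror A) (mirror B) (mirror_edges S) s1 s2 s3 s4 s5 ws => //.
- by rewrite !proj_mirror.
- move=> _ /mapP [e eS ->] v /segP [t [t01 ->]] s s15 /=.
  rewrite -!mirror_lin proj_mirror pm => E; rewrite !mk3E ltrN2.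
  by apply: (under e eS) => //; apply/segP; exists t.
- by rewrite pm.
exists (map (@mirror R) xs).
have E : consec (A :: rcons (map (@mirror R) xs) B) ++ S = mirror_edges (consec (mirror A :: rcons xs (mirror B)) ++ mirror_edges S).
  rewrite /mirror_edges map_cat -/(mirror_edges _) -/(mirror_edges (mirror_edges S)) mirror_edgesK; congr cat.
  by rewrite /mirror_edges /consec -consec_map /= map_rcons !mirrorK.
move=> S'; have [gx' ex'] := good_mirror gx; rewrite -E -/S' in gx' ex'; split => //.
- rewrite -map_comp; transitivity (map proj xs); last by rewrite mx pm.
  by apply: eq_map => v /=; rewrite proj_mirror.
- by rewrite /S' E; apply: closed_edges_map.
- rewrite ex'; have := isotopic_mirror ix.
  rewrite -[(mirror A, mirror B) :: _]/(mirror_edges ((A, B) :: S)) eM.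
  congr ambient_isotopic; apply/seteqP; split => x.
    by move=> [_ [y Sy <-] <-]; rewrite mirrorK.
  by move=> Sx; exists (mirror x); [exists x | rewrite mirrorK].
Qed.

End Mirror.

(** * Projections with double and quadruple crossings *)

Section Mixed.
Variable R : realType.
Local Notation pt := 'M[R]_(1,3).
Local Notation pl := (R * R)%type.

(** The planar side of a projection with double points X2 and quadruple points X4; both kinds occur
    together between the removal of one crossing and the end. In a closed list every end of an edge
    is a start, so [mixed_start] keeps all vertices off the crossings. *)
Record mixed (T : seq (pl * pl)) (X2 X4 : seq pl) : Prop := Mixed {
  mixed_nondeg : forall e, e \in T -> e.1 <> e.2;
  mixed_off : forall x, x \notin X2 -> x \notin X4 -> (cnt T x <= 1)%N;
  mixed_double : forall x, x \in X2 -> cnt T x = 2%N;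
  mixed_quadruple : forall x, x \in X4 -> cnt T x = 4%N;
  mixed_start : forall e, e \in T -> e.1 \notin X2 ++ X4;
  mixed_transverse : forall x e f, x \in X2 ++ X4 -> e \in T -> f \in T -> on e x -> on f x ->
     e <> f -> det2 (vec e) (vec f) != 0;
  mixed_uniq : uniq (X2 ++ X4) }.

Lemma mixed_perm T T' X2 X4 : perm_eq T T' -> mixed T X2 X4 -> mixed T' X2 X4.
Proof.
move=> TT' [h1 h2 h3 h4 h5 h6 h7]; have m e := perm_mem TT' e.
have c x : cnt T' x = cnt T x by rewrite /cnt (permP TT').
split => //.
- by move=> e; rewrite -m; apply: h1.
- by move=> x; rewrite c; apply: h2.
- by move=> x; rewrite c; apply: h3.
- by move=> x; rewrite c; apply: h4.
- by move=> e; rewrite -m; apply: h5.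
- by move=> x e f; rewrite -!m; apply: h6.
Qed.

Lemma on_start (e : pl * pl) : on e e.1.
Proof. by exists 0; rewrite lexx ltr01 lerp0. Qed.

Lemma shadow_vec (e : pt * pt) : proj (e.2 - e.1) = vec (proj e.1, proj e.2).
Proof. by rewrite /proj /vec /= !mxE. Qed.

Lemma good_uniq (S : seq (pt * pt)) : good S -> uniq S.
Proof.
move=> [_ g]; apply: count_mem_uniq => e; apply/eqP.
case: (boolP (e \in S)) => eS; last by apply/eqP/count_memPn.
apply/eqP/anti_leq; rewrite -has_count has_pred1 eS andbT.
apply: leq_trans (g e.1); apply: sub_count => f /eqP -> /=; apply/asboolP.
by case: e {eS} => a b; apply: hseg0.
Qed.

Lemma mixed_uniq_edges T X2 X4 : mixed T X2 X4 -> uniq T.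
Proof.
move=> m; apply: count_mem_uniq => e; apply/eqP.
case: (boolP (e \in T)) => eT; last by apply/eqP/count_memPn.
apply/eqP/anti_leq; rewrite -has_count has_pred1 eT andbT.
have := mixed_start m eT; rewrite mem_cat negb_or => /andP[n2 n4].
apply: leq_trans (mixed_off m n2 n4); apply: sub_count => f /eqP -> /=.
by apply/asboolP/on_start.
Qed.

Lemma hseg_shadow (e : pt * pt) v : hseg e v -> on (proj e.1, proj e.2) (proj v).
Proof. by move=> [t [t01 ->]]; exists t; rewrite proj_lin. Qed.

(** No edge is vertical, so each has at most one point over x, and different edges of a good list
    have different points. Multiplicities in the plane thus count points of the link. *)
Lemma fiber_list (S : seq (pt * pt)) x : good S -> (forall e, e \in S -> proj e.1 <> proj e.2) ->
  exists s, [/\ uniq s, size s = cnt (shadow S) x &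
    forall v, v \in s <-> exists2 e, e \in S & hseg e v /\ proj v = x].
Proof.
move=> gS nd; pose F := seq.filter (fun e : pt * pt => `[< on (proj e.1, proj e.2) x >]) S.
pose over (e : pt * pt) := xget 0 [set v | hseg e v /\ proj v = x].
have ovP e : e \in F -> hseg e (over e) /\ proj (over e) = x.
  rewrite mem_filter => /andP[/asboolP [t [t01 xE]] eS].
  have : [set v | hseg e v /\ proj v = x] (lin e.1 e.2 t).
    by split; [exists t | rewrite proj_lin -xE].
  by move/(xgetI 0).
exists (map over F); split.
- rewrite map_inj_in_uniq; first by apply: filter_uniq; apply: good_uniq.
  move=> e f eF fF E; have [he _] := ovP e eF; have [hf _] := ovP f fF.
  move: eF fF; rewrite !mem_filter => /andP[_ eS] /andP[_ fS].
  apply: (count_le1_eq (proj2 gS (over e)) eS fS); apply/asboolP => //.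
  by rewrite E.
- by rewrite size_map size_filter /cnt /shadow count_map.
- move=> v; split=> [/mapP [e eF ->]|[e eS [he pv]]].
    by exists e; [move: eF; rewrite mem_filter => /andP[] | exact: ovP].
  apply/mapP; exists e; first by rewrite mem_filter eS andbT; apply/asboolP; rewrite -pv; apply: hseg_shadow.
  have eF : e \in F by rewrite mem_filter eS andbT; apply/asboolP; rewrite -pv; apply: hseg_shadow.
  have [[t [_ E]] p2] := ovP e eF; have [t' [_ E']] := he.
  move: p2 pv; rewrite E E' !proj_lin => <- /(lerp_inj (nd e eS)) -> //.
Qed.

Section Conversions.
Variable L : seq (seq pt).
Hypothesis polyL : polygonal_link L.
Let S := link_edges L.
Let gS : good S := polygonal_good polyL.

Lemma fiberP x v : fiber L x v <-> exists2 e, e \in S & hseg e v /\ proj v = x.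
Proof.
rewrite /fiber linkset_support; last by move=> k kL; case: polyL => _ /(_ _ kL) [].
by split=> [[[e eS he] pv]|[e eS [he pv]]]; [exists e | split => //; exists e].
Qed.

Lemma end_is_vertex a b : (a, b) \in S -> is_vertex L b.
Proof.
move=> /mem_link_edges [k [i [kL iL _ ->]]]; exists k, (i.+1 %% size (Defs.comp L k))%N.
by split; rewrite ?ltn_pmod // /vtx ?modn_mod //; lia.
Qed.

(** The way back from planar conditions to projections, for m = 2 and m = 4 at once. *)
Lemma mixed_singular (X : seq pl) m : (2 <= m)%N -> uniq X ->
  (forall e, e \in shadow S -> e.1 <> e.2) ->
  (forall x, x \notin X -> (cnt (shadow S) x <= 1)%N) ->
  (forall x, x \in X -> cnt (shadow S) x = m) ->
  (forall e, e \in shadow S -> e.1 \notin X) ->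
  (forall x e f, x \in X -> e \in shadow S -> f \in shadow S -> on e x -> on f x ->
     e <> f -> det2 (vec e) (vec f) != 0) ->
  num_singular L (size X) /\ forall x, singular L x -> multi_crossing L m x.
Proof.
move=> m2 uX nd off onX start tr.
have shS e : e \in S -> (proj e.1, proj e.2) \in shadow S by move=> eS; apply: (map_f (fun e : pt * pt => (proj e.1, proj e.2))).
have nd' e : e \in S -> proj e.1 <> proj e.2 by move=> /shS /nd.
have singX x : singular L x <-> x \in X.
  have [s [us ss sP]] := fiber_list x gS nd'; split.
    move=> [v [w [/fiberP /sP vs /fiberP /sP ws vw]]]; apply/negPn/negP => /off.
    rewrite -ss => s1; have := @count_ge2_nth _ predT v s (index v s) (index w s).
    rewrite !index_mem vs ws count_predT => /(_ isT isT) H.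
    have : index v s != index w s.
      by apply: contra_not_neq vw => E; rewrite -(nth_index v vs) E nth_index.
    by move=> /H /(_ isT isT); lia.
  move=> xX; move: ss; rewrite (onX _ xX).
  case: s us sP => [|v [|w s]] /= us sP ss; try lia.
  exists v, w; split; [apply/fiberP/sP; rewrite mem_head | apply/fiberP/sP; rewrite !inE eqxx orbT |] => //.
  by move=> vw; move: us; rewrite vw mem_head.
split; first by exists X; split.
move=> x /singX xX; have [s [us ss sP]] := fiber_list x gS nd'.
have nv v : v \in s -> ~ is_vertex L v.
  move=> /sP [e eS [_ pv]] /vertexP [f fS E].
  by have := start _ (shS f fS); rewrite /= -E pv xX.
exists s; split => //; first by rewrite ss onX.
  by move=> v; split=> [/fiberP/sP|/sP/fiberP].
move=> v w vs ws vw a b c d /on_edgeP [abS sv] /on_edgeP [cdS sw].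
have half a' b' v' : v' \in s -> (a', b') \in S -> seg a' b' v' -> hseg (a', b') v' /\ proj v' = x.
  move=> vs' abS'; rewrite seg_hseg => -[h|E]; first by have [e _ [_ pv]] := proj1 (sP v') vs'.
  by exfalso; apply: (nv _ vs'); rewrite E; apply: end_is_vertex abS'.
have [hv pv] := half _ _ _ vs abS sv; have [hw pw] := half _ _ _ ws cdS sw.
rewrite (shadow_vec (a, b)) (shadow_vec (c, d)); apply: (tr x) => //.
- exact: (shS (a, b)).
- exact: (shS (c, d)).
- by rewrite -pv; apply: hseg_shadow hv.
- by rewrite -pw; apply: hseg_shadow hw.
move=> E; move/eqP: vw; apply.
(* Two edges with the same shadow would give their common start, which is no crossing, the
   multiplicity 2. *)
have abcd : (a, b) = (c, d).
  apply/eqP/negPn/negP => N; have := start _ (shS _ abS) => /off.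
  have c1 := count_ge2_nth (P := fun e : pt * pt => `[< on (proj e.1, proj e.2) (proj a) >]) (d := (a, b))
     (s := S) (i := index (a, b) S) (j := index (c, d) S).
  rewrite !index_mem !nth_index // in c1; move: (c1 abS cdS) => {}c1.
  have ii : index (a, b) S != index (c, d) S.
    by apply: contraNneq N => E'; rewrite -(nth_index (a, b) abS) E' nth_index.
  have := c1 ii (asboolT (on_start _)); rewrite [(proj (c, d).1, _)]/= -E => /(_ (asboolT (on_start _))).
  by rewrite /cnt /shadow count_map => c2 /(leq_trans c2); rewrite ltnn.
move: hv hw pv pw; rewrite -abcd => -[t [_ ->]] [t' [_ ->]]; rewrite !proj_lin => <- /(lerp_inj (nd' _ abS)) -> //.
Qed.

Lemma regular_mixed n : regular_projection L -> num_singular L n ->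
  exists2 X, size X = n & mixed (shadow S) X [::].
Proof.
move=> [_ reg] [X [uX sX XP]]; exists X => //.
(* All points of a vertical edge lie over one point of the plane; three of them already contradict a
   double crossing. *)
have nd' e : e \in S -> proj e.1 <> proj e.2.
  case: e => a b abS pab; have ab : a <> b := proj1 gS _ abS.
  have fl t : 0 <= t < 1 -> fiber L (proj a) (lin a b t).
    move=> t01; apply/fiberP; exists (a, b) => //; split; first by exists t.
    by rewrite proj_lin -pab; apply/pl_eqP; rewrite /lerp /=; split; ring.
  have li := lin_inj ab.
  have [s [us ss sP _ _]] : multi_crossing L 2 (proj a).
    apply: reg; exists (lin a b 0), (lin a b 2^-1); split; [apply: fl; lra | apply: fl; lra | move/li; lra].
  have : (size [:: lin a b 0; lin a b 2^-1; lin a b 4^-1] <= size s)%N.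
    apply: uniq_leq_size.
      rewrite /= !inE negb_or -!andbA andbT; apply/and3P; split; apply/eqP => /li; lra.
    by move=> v; rewrite !inE => /or3P[]/eqP->; apply/sP/fl; lra.
  by rewrite ss.
have pts e x : e \in shadow S -> on e x -> exists2 v, fiber L x v &
    exists2 e', e' \in S & e = (proj e'.1, proj e'.2) /\ hseg e' v.
  move=> /mapP [e' eS ->] [t [t01 ->]]; exists (lin e'.1 e'.2 t).
    apply/fiberP; exists e' => //; split; [by exists t | by rewrite proj_lin].
  by exists e' => //; split => //; exists t.
have distinct e f v w : e \in S -> f \in S -> e <> f -> hseg e v -> hseg f w -> v <> w.
  move=> eS fS ef he hf vw; apply: ef; rewrite -vw in hf.
  by apply: (count_le1_eq (proj2 gS v) eS fS); apply/asboolP.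
split; rewrite ?cats0 //.
- by move=> e /mapP [e' eS ->]; apply: nd'.
- move=> x xX _; rewrite leqNgt; apply/negP; rewrite /cnt /shadow count_map => c2.
  have [e [f [eS fS /eqP ef /asboolP oe /asboolP of_]]] := count_ge2_ex (good_uniq gS) c2.
  move/negP: xX; apply; apply/XP.
  have [t [t01 tE]] := oe; have [u [u01 uE]] := of_.
  exists (lin e.1 e.2 t), (lin f.1 f.2 u); split.
  + by apply/fiberP; exists e => //; split; [exists t | rewrite proj_lin].
  + by apply/fiberP; exists f => //; split; [exists u | rewrite proj_lin].
  + by apply: (distinct e f) => //; [exists t | exists u].
- move=> x /XP /reg [s [us ss sP _ _]].
  have [s' [us' ss' sP']] := fiber_list x gS nd'.
  rewrite -ss'; apply: etrans ss; apply: perm_size; apply: uniq_perm => // v.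
  by apply/idP/idP => [/sP'/fiberP/sP|/sP/fiberP/sP'].
- move=> _ /mapP [e eS ->] /=; apply/negP => /XP /reg [s [_ _ sP nv _]].
  have : e.1 \in s.
    by apply/sP/fiberP; exists e => //; split => //; case: (e) => a b; apply: hseg0.
  by move/nv; apply; apply/vertexP; exists e.
- move=> x e f /XP /reg [s [_ _ sP nv tr]] eT fT oe of_ ef.
  have [v fv [e' eS [eE he]]] := pts _ _ eT oe; have [w fw [f' fS [fE hf]]] := pts _ _ fT of_.
  have := tr v w; rewrite eE fE -!shadow_vec; apply.
  + exact/sP.
  + exact/sP.
  + by apply/eqP; apply: (distinct e' f') => // E; apply: ef; rewrite eE fE E.
  + by apply/on_edgeP; split; [rewrite -surjective_pairing | rewrite seg_hseg; left; rewrite -surjective_pairing].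
  + by apply/on_edgeP; split; [rewrite -surjective_pairing | rewrite seg_hseg; left; rewrite -surjective_pairing].
Qed.

End Conversions.
End Mixed.

(** * Faces and colours *)

Section PlaneTopology.
Variable R : realType.
Local Notation pl := (R * R)%type.
Implicit Types (a b x y z : pl) (e f : pl * pl) (T : seq (pl * pl)).

Definition diagram T : set pl := [set x | exists2 e, e \in T & onc e x].
Definition nbh x (r : R) y : Prop := `|y.1 - x.1| < r /\ `|y.2 - x.2| < r.
Definition free T a b : Prop := forall x, onc (a, b) x -> ~ diagram T x.

(** The classes of this relation play the role of the faces. It is reflexive only off the diagram,
    so that both ends of a connection lie off it. *)
Inductive conn T : pl -> pl -> Prop :=
| conn_refl a : ~ diagram T a -> conn T a a
| conn_step a b c : free T a b -> conn T b c -> conn T a c.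

Lemma onc_start e : onc e e.1.
Proof. by exists 0; rewrite lexx ler01 lerp0. Qed.

Lemma onc_end e : onc e e.2.
Proof. by exists 1; rewrite lexx ler01 lerp1. Qed.

Lemma onc_rev a b x : onc (a, b) x -> onc (b, a) x.
Proof.
move=> [t [t01 ->]]; exists (1 - t); split; first lra.
by apply/pl_eqP; rewrite /lerp /=; split; ring.
Qed.

Lemma conn_trans T a b c : conn T a b -> conn T b c -> conn T a c.
Proof. by elim=> // a' b' c' fr _ IH /IH; apply: conn_step. Qed.

Lemma conn_free T a b : free T a b -> conn T a b.
Proof.
by move=> fr; apply: (conn_step fr); apply: conn_refl; apply: fr; apply: onc_end.
Qed.

Lemma conn_sym T a b : conn T a b -> conn T b a.
Proof.
elim=> [a' ?|a' b' c' fr _ IH]; first exact: conn_refl.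
apply: conn_trans IH _; apply: conn_free => x /onc_rev; exact: fr.
Qed.

Lemma conn_notin T a b : conn T a b -> ~ diagram T a /\ ~ diagram T b.
Proof.
elim=> // a' b' c' fr _ [_ h]; split => //; apply: fr; exact: onc_start.
Qed.

Lemma conn_convex T (P : set pl) : (forall a b t, P a -> P b -> 0 <= t <= 1 -> P (lerp a b t)) ->
  (forall x, P x -> ~ diagram T x) -> forall a b, P a -> P b -> conn T a b.
Proof.
move=> cP PD a b Pa Pb; apply: conn_free => x [t [t01 ->]]; apply: PD; exact: cP.
Qed.

Lemma nbh_le x r r' y : r' <= r -> nbh x r' y -> nbh x r y.
Proof. by move=> rr [h1 h2]; split; apply: lt_le_trans rr. Qed.

Lemma nbh_min x r r' y : nbh x (Num.min r r') y -> nbh x r y /\ nbh x r' y.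
Proof. by move=> h; split; apply: nbh_le h; rewrite ge_min lexx ?orbT. Qed.

Lemma nbh_convex x r a b t : nbh x r a -> nbh x r b -> 0 <= t <= 1 -> nbh x r (lerp a b t).
Proof.
rewrite /nbh !ltr_norml => -[/andP[a1 a2] /andP[a3 a4]] [/andP[b1 b2] /andP[b3 b4]] /andP[t0 t1].
have H (u v : R) : - r < u -> u < r -> - r < v -> v < r -> - r < (1 - t) * u + t * v < r.
  move=> *; apply/andP; split.
    have : 0 <= (1 - t) * (u + r) by rewrite mulr_ge0 //; lra.
    have : 0 <= t * (v + r) by rewrite mulr_ge0 //; lra.
    move: t1; rewrite le_eqVlt => /orP[/eqP ->|t1']; first lra.
    have : 0 < (1 - t) * (u + r) by rewrite mulr_gt0 //; lra.
    lra.
  have : 0 <= (1 - t) * (r - u) by rewrite mulr_ge0 //; lra.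
  have : 0 <= t * (r - v) by rewrite mulr_ge0 //; lra.
  move: t1; rewrite le_eqVlt => /orP[/eqP ->|t1']; first lra.
  have : 0 < (1 - t) * (r - u) by rewrite mulr_gt0 //; lra.
  lra.
have e1 : (lerp a b t).1 - x.1 = (1 - t) * (a.1 - x.1) + t * (b.1 - x.1) by rewrite /lerp /=; ring.
have e2 : (lerp a b t).2 - x.2 = (1 - t) * (a.2 - x.2) + t * (b.2 - x.2) by rewrite /lerp /=; ring.
by rewrite e1 e2; split; apply: H.
Qed.

Lemma onc_far e x : ~ onc e x -> exists2 r, 0 < r & forall y, nbh x r y -> ~ onc e y.
Proof.
case: e => a b nx.
have [|eta eta0 H] := @affine_cover R [:: (a.1 - x.1, b.1 - a.1); (- (a.1 - x.1), - (b.1 - a.1));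
   (a.2 - x.2, b.2 - a.2); (- (a.2 - x.2), - (b.2 - a.2))].
  move=> u u01; have : lerp a b u <> x by move=> E; apply: nx; exists u.
  move=> N; have [h|h|h1] := ltrgt0P (a.1 - x.1 + (b.1 - a.1) * u).
  - by exists (a.1 - x.1, b.1 - a.1); rewrite ?inE ?eqxx.
  - by exists (- (a.1 - x.1), - (b.1 - a.1)); rewrite ?inE ?eqxx ?orbT //=; lra.
  have [h|h|h2] := ltrgt0P (a.2 - x.2 + (b.2 - a.2) * u).
  - by exists (a.2 - x.2, b.2 - a.2); rewrite ?inE ?eqxx ?orbT.
  - by exists (- (a.2 - x.2), - (b.2 - a.2)); rewrite ?inE ?eqxx ?orbT //=; lra.
  by case: N; apply/pl_eqP; rewrite /lerp /=; split; lra.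
exists eta => // y [] /[!ltr_norml] /andP[y1 y2] /andP[y3 y4] [u [u01 E]].
have [f ff fe] := H u u01; move: E y1 y2 y3 y4 => /= -> /=.
by move: ff fe; rewrite !inE => /or4P[]/eqP-> /=; lra.
Qed.

Lemma edges_far T x : exists2 r, 0 < r & forall e, e \in T -> ~ onc e x -> forall y, nbh x r y -> ~ onc e y.
Proof.
apply: (@uniform_pos R _ T (fun e r => ~ onc e x -> forall y, nbh x r y -> ~ onc e y)).
  move=> e r r' H r0 rr ne y h; apply: H => //; exact: nbh_le h.
move=> e eT; have [ho|n] := pselect (onc e x); first by exists 1.
by have [r r0 H] := onc_far n; exists r.
Qed.

Lemma diagram_far T x : ~ diagram T x -> exists2 r, 0 < r & forall y, nbh x r y -> ~ diagram T y.
Proof.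
move=> nD; have [r r0 H] := edges_far T x; exists r => // y xy [e eT ey].
by apply: (H e eT _ y xy ey) => ex; apply: nD; exists e.
Qed.

Lemma affine_sign (c0 c1 c2 : R) x : c0 + c1 * x.1 + c2 * x.2 != 0 ->
  exists2 r, 0 < r & forall y, nbh x r y ->
    (c0 + c1 * y.1 + c2 * y.2 < 0) = (c0 + c1 * x.1 + c2 * x.2 < 0) /\
    (0 < c0 + c1 * y.1 + c2 * y.2) = (0 < c0 + c1 * x.1 + c2 * x.2).
Proof.
set w := c0 + _ + _ => w0; exists (`|w| / (`|c1| + `|c2| + 1)).
  by rewrite divr_gt0 ?normr_gt0 // ltr_wpDl // addr_ge0.
move=> y [h1 h2]; set rr := _ / _ in h1 h2.
have n0 : 0 < `|c1| + `|c2| + 1 by rewrite ltr_wpDl // addr_ge0.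
have rE : rr * (`|c1| + `|c2| + 1) = `|w| by rewrite /rr divfK // gt_eqF.
have r0 : 0 < rr by rewrite /rr divr_gt0 ?normr_gt0.
set v := c0 + _ + _; have vE : v = w + (c1 * (y.1 - x.1) + c2 * (y.2 - x.2)) by rewrite /v /w; ring.
have lt : `|c1 * (y.1 - x.1) + c2 * (y.2 - x.2)| < `|w|.
  apply: le_lt_trans (ler_normD _ _) _; rewrite !normrM -rE.
  have a1 : `|c1| * `|y.1 - x.1| <= `|c1| * rr by rewrite ler_wpM2l // ltW.
  have a2 : `|c2| * `|y.2 - x.2| <= `|c2| * rr by rewrite ler_wpM2l // ltW.
  lra.
move: lt.
rewrite ltr_norml => /andP[l1 l2]; rewrite {}vE.
move: w0; rewrite neq_lt => /orP[wn|wp].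
  rewrite ltr0_norm // in l1 l2.
  have h : w + (c1 * (y.1 - x.1) + c2 * (y.2 - x.2)) < 0 by lra.
  by rewrite h wn !ltNge !ltW.
rewrite gtr0_norm // in l1 l2.
have h : 0 < w + (c1 * (y.1 - x.1) + c2 * (y.2 - x.2)) by lra.
by rewrite h wp !ltNge !ltW.
Qed.

End PlaneTopology.

Section Colour.
Variable R : realType.
Local Notation pl := (R * R)%type.
Implicit Types (a b x y z : pl) (e f : pl * pl) (T : seq (pl * pl)).

Lemma avoid_list (s : seq R) : exists t, t \notin s.
Proof.
have [M M0 H] := upper_bound_list (fun x : R => x) s.
by exists (M + 1); apply/negP => /H; lra.
Qed.

Lemma generic_functional T : (forall e, e \in T -> e.1 <> e.2) ->
  exists s : R, forall e, e \in T -> (vec e).1 + s * (vec e).2 != 0.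
Proof.
move=> nd; have [s sN] := avoid_list (map (fun e => - (vec e).1 / (vec e).2) T).
exists s => e eT; apply: contraNneq sN => E.
have [v0|v0] := eqVneq (vec e).2 0.
  exfalso; apply: (nd e eT); apply/pl_eqP; move: E v0; rewrite /vec /= => E v0.
  rewrite v0 mulr0 addr0 in E; split; lra.
apply/mapP; exists e => //; apply: (mulIf v0); rewrite mulfVK //; lra.
Qed.

(* The colour of a point is the parity of the number of edges above it, where above refers
   to a direction that is not parallel to any edge. *)
Lemma colouring T : perm_eq (map fst T) (map snd T) -> (forall e, e \in T -> e.1 <> e.2) ->
  exists col : pl -> bool, forall x, (forall e, e \in T -> e.1 <> x) ->
  exists2 r, 0 < r & exists K, forall y, nbh x r y ->
    (forall e, e \in T -> onc e x -> det2 (vec e) (vec (x, y)) != 0) ->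
    col y = K (+) \big[addb/false]_(e <- T | `[< onc e x >]) (0 < det2 (vec e) (vec (x, y))).
Proof.
move=> bal nd; have [s sT] := generic_functional nd.
pose xi (p : pl) := p.1 + s * p.2.
pose dd e y := det2 (vec e) (vec (e.1, y)) * xi (vec e).
pose cross e y := ((xi e.1 <= xi y) (+) (xi e.2 <= xi y)) && (dd e y < 0).
exists (fun y => \big[addb/false]_(e <- T) cross e y) => x nx.
have nx2 e : e \in T -> e.2 <> x.
  move=> eT ex; have : e.2 \in map fst T by rewrite (perm_mem bal) map_f.
  by move=> /mapP [f fT E]; apply: (nx f fT); rewrite -E.
have xiv e : xi (vec e) = xi e.2 - xi e.1 by rewrite /xi /vec /=; ring.
(* If the ray upwards from x hits a vertex v, passing from x to y can change the contribution of the
   edges at v. [g y v] is this change for one edge end. Summed over all starts and all ends it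
   cancels, because both form the same multiset. *)
pose g y (v : pl) := ((xi v <= xi x) (+) (xi v <= xi y)) && (x.2 < v.2).
have xi_near v : exists2 r, 0 < r & forall y, nbh x r y -> xi v <> xi x -> (xi v <= xi y) = (xi v <= xi x).
  have [E|N] := eqVneq (xi v) (xi x); first by exists 1.
  have h : - xi v + 1 * x.1 + s * x.2 != 0.
    by apply: contra_neq N; rewrite /xi => ?; lra.
  have [r r0 H] := affine_sign h; exists r => // y /H [H1 _] _.
  rewrite !leNgt; congr negb; transitivity (- xi v + 1 * y.1 + s * y.2 < 0); last rewrite H1;
    by rewrite /xi; apply/idP/idP => ?; lra.
have dd_near e : exists2 r, 0 < r & forall y, nbh x r y -> dd e x != 0 -> (dd e y < 0) = (dd e x < 0).
  have [E|N] := eqVneq (dd e x) 0; first by exists 1.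
  have E y : dd e y = (- (vec e).1 * e.1.2 + (vec e).2 * e.1.1) * xi (vec e) +
      - (vec e).2 * xi (vec e) * y.1 + (vec e).1 * xi (vec e) * y.2.
    by rewrite /dd /det2 /vec /=; ring.
  rewrite E in N; have [r r0 H] := affine_sign N; exists r => // y /H [H1 _] _.
  by rewrite !E H1.
have local e : e \in T -> exists2 r, 0 < r & forall y, nbh x r y ->
    (~ onc e x -> cross e y = cross e x (+) (g y e.1 (+) g y e.2)) /\
    (onc e x -> det2 (vec e) (vec (x, y)) != 0 ->
       cross e y = (0 < xi (vec e)) (+) (0 < det2 (vec e) (vec (x, y))) /\ g y e.1 (+) g y e.2 = false).
  move=> eT; have v0 := sT e eT; rewrite -/(xi (vec e)) in v0.
  have [r1 p1 H1] := xi_near e.1; have [r2 p2 H2] := xi_near e.2; have [r3 p3 H3] := dd_near e.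
  exists (Num.min r1 (Num.min r2 r3)); first by rewrite !lt_min p1 p2.
  move=> y /nbh_min [n1 /nbh_min [n2 n3]].
  have {}H1 := H1 y n1; have {}H2 := H2 y n2; have {}H3 := H3 y n3.
  have sq0 : 0 < xi (vec e) ^+ 2 by rewrite exprn_even_gt0.
  have side v : v = e.1 \/ v = e.2 -> xi v = xi x -> v <> x ->
      dd e x != 0 /\ (x.2 < v.2) = (dd e x < 0).
    move=> vE xv vx.
    have dE : dd e x = (x.2 - v.2) * xi (vec e) ^+ 2.
      move: xv; case: vE => -> xv; rewrite /dd.
        have -> : det2 (vec e) (vec (e.1, x)) = (x.2 - e.1.2) * xi (vec e) + (vec e).2 * (xi e.1 - xi x).
          by rewrite /det2 /vec /xi /=; ring.
        by rewrite xv; ring.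
      have -> : det2 (vec e) (vec (e.1, x)) = (x.2 - e.2.2) * xi (vec e) + (vec e).2 * (xi e.2 - xi x).
        by rewrite /det2 /vec /xi /=; ring.
      by rewrite xv; ring.
    split; last by rewrite dE pmulr_llt0 // subr_lt0.
    rewrite dE; apply: mulf_neq0; last by rewrite gt_eqF.
    rewrite subr_eq0; apply: contra_not_neq vx => h.
    apply/pl_eqP; split => //; move: xv; rewrite /xi h; lra.
  split=> [ne|].
    have [Ea|Na] := eqVneq (xi e.1) (xi x).
      have Nb : xi e.2 <> xi x by move=> Eb; move/eqP: v0; apply; rewrite xiv Ea Eb subrr.
      have [d0 dl] := side e.1 (or_introl erefl) Ea (nx e eT).
      rewrite /cross /g (H2 Nb) (H3 d0) Ea lexx dl addbb /= addbF.
      by case: (xi x <= xi y); case: (xi e.2 <= xi x); case: (dd e x < 0).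
    have [Eb|Nb] := eqVneq (xi e.2) (xi x).
      have [d0 dl] := side e.2 (or_intror erefl) Eb (nx2 e eT).
      rewrite /cross /g (H1 (elimN eqP Na)) (H3 d0) Eb lexx dl addbb /=.
      by case: (xi x <= xi y); case: (xi e.1 <= xi x); case: (dd e x < 0).
    rewrite /cross /g (H1 (elimN eqP Na)) (H2 (elimN eqP Nb)) !addbb /= addbF.
    case str: ((xi e.1 <= xi x) (+) (xi e.2 <= xi x)) => //=.
    apply: H3; apply/negP => /eqP; rewrite /dd => /eqP; rewrite mulf_eq0 (negPf v0) orbF => /eqP dx0.
    apply: ne; pose t := (xi x - xi e.1) / xi (vec e); exists t.
    have tE : t * xi (vec e) = xi x - xi e.1 by rewrite /t divfK.
    split.
      have := tE; rewrite xiv => tE'; move: str v0; rewrite xiv.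
      case: (leP (xi e.1) (xi x)) => ha; case: (leP (xi e.2) (xi x)) => hb //= _ _.
        have h : 0 < xi e.2 - xi e.1 by lra.
        by rewrite /t xiv divr_ge0 ?ler_pdivrMr //=; lra.
      have h : 0 < xi e.1 - xi e.2 by lra.
      have -> : t = (xi e.1 - xi x) / (xi e.1 - xi e.2).
        by rewrite /t xiv -[RHS]mulrNN -invrN !opprB.
      by rewrite divr_ge0 ?ler_pdivrMr //=; lra.
    have k1 : (x.1 - e.1.1 - t * (vec e).1) * xi (vec e) = - s * det2 (vec e) (vec (e.1, x)).
      rewrite !mulrBl -[t * _ * _]mulrAC tE /xi /det2 /vec /=; ring.
    have k2 : (x.2 - e.1.2 - t * (vec e).2) * xi (vec e) = det2 (vec e) (vec (e.1, x)).
      rewrite !mulrBl -[t * _ * _]mulrAC tE /xi /det2 /vec /=; ring.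
    move/eqP: k1; rewrite dx0 mulr0 mulf_eq0 (negPf v0) orbF => /eqP k1.
    move/eqP: k2; rewrite dx0 mulf_eq0 (negPf v0) orbF => /eqP k2.
    by apply/pl_eqP; move: k1 k2; rewrite /lerp /vec /= => k1 k2; split; lra.
  move=> [t [/andP[t0 t1] xE]] dne.
  have {}t0 : 0 < t.
    by rewrite lt0r t0 andbT; apply/eqP => E; apply: (nx e eT); rewrite xE E lerp0.
  have {}t1 : t < 1.
    by rewrite lt_neqAle t1 andbT; apply/eqP => E; apply: (nx2 e eT); rewrite xE E lerp1.
  have xix : xi x = xi e.1 + t * xi (vec e) by rewrite xE /xi /lerp /vec /=; ring.
  have Na : xi e.1 <> xi x.
    move=> E; have : t * xi (vec e) = 0 by rewrite xix in E; lra.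
    by move/eqP; rewrite mulf_eq0 (negPf v0) gt_eqF.
  have Nb : xi e.2 <> xi x.
    move=> E; have : (1 - t) * xi (vec e) = 0 by move: E; rewrite xix xiv; lra.
    by move/eqP; rewrite mulf_eq0 (negPf v0) gt_eqF // subr_gt0.
  rewrite /cross /g (H1 Na) (H2 Nb) !addbb /=; split => //.
  have -> : dd e y = det2 (vec e) (vec (x, y)) * xi (vec e).
    by rewrite /dd xE /det2 /lerp /vec /=; ring.
  have -> : (xi e.1 <= xi x) (+) (xi e.2 <= xi x).
    move: v0; rewrite neq_lt => /orP[vn|vp].
      have : t * xi (vec e) < 0 by rewrite pmulr_rlt0.
      have : (1 - t) * xi (vec e) < 0 by rewrite pmulr_rlt0 // subr_gt0.
      move=> h1 h2; rewrite (leNgt (xi e.1)) [X in ~~ X](_ : _ = true) /=; last by apply/idP; lra.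
      by move: h1; rewrite xix xiv; lra.
    have h1 : 0 < t * xi (vec e) by rewrite mulr_gt0.
    have h2 : 0 < (1 - t) * xi (vec e) by rewrite mulr_gt0 // subr_gt0.
    rewrite [X in X (+) _](_ : _ = true); last by apply/idP; lra.
    rewrite /= -ltNge; move: h2; rewrite xix xiv; lra.
  move: dne v0; rewrite /= !neq_lt => /orP[dn|dp] /orP[vn|vp].
  - by rewrite nmulr_rlt0 // !ltNge !ltW.
  - by rewrite nmulr_rlt0 // vp !ltNge !ltW.
  - by rewrite pmulr_rlt0 // vn dp !ltNge !ltW.
  - by rewrite pmulr_rlt0 // vp dp !ltNge !ltW.
have [r r0 H] : exists2 r, 0 < r & forall e, e \in T -> forall y, nbh x r y ->
    (~ onc e x -> cross e y = cross e x (+) (g y e.1 (+) g y e.2)) /\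
    (onc e x -> det2 (vec e) (vec (x, y)) != 0 ->
       cross e y = (0 < xi (vec e)) (+) (0 < det2 (vec e) (vec (x, y))) /\ g y e.1 (+) g y e.2 = false).
  apply: (@uniform_pos R _ T (fun e r => forall y, nbh x r y -> _)) => // e r r' HH r0 rr y ny.
  by apply: HH; apply: nbh_le ny.
exists r => //.
exists (\big[addb/false]_(e <- T) (if `[< onc e x >] then 0 < xi (vec e) else cross e x)) => y ny dy.
have gz : \big[addb/false]_(e <- T) (g y e.1 (+) g y e.2) = false.
  rewrite big_split /= -(big_map fst xpredT (g y)) -(big_map snd xpredT (g y)).
  by rewrite (perm_big _ bal) addbb.
have bs (F G : pl * pl -> bool) : \big[addb/false]_(e <- T) F e (+) \big[addb/false]_(e <- T) G e =
    \big[addb/false]_(e <- T) (F e (+) G e) by rewrite big_split.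
have -> : \big[addb/false]_(e <- T | `[< onc e x >]) (0 < det2 (vec e) (vec (x, y))) =
    \big[addb/false]_(e <- T) (if `[< onc e x >] then 0 < det2 (vec e) (vec (x, y)) else false).
  by rewrite big_mkcond.
pose A e := if `[< onc e x >] then 0 < xi (vec e) else cross e x.
pose B e := if `[< onc e x >] then 0 < det2 (vec e) (vec (x, y)) else false.
transitivity (\big[addb/false]_(e <- T) (A e (+) B e)); last exact: esym (bs A B).
transitivity (\big[addb/false]_(e <- T) ((A e (+) B e) (+) (g y e.1 (+) g y e.2))); last first.
  by apply: etrans (esym (bs _ _)) _; rewrite gz addbF.
rewrite !big_seq; apply: eq_bigr => e eT; have [h1 h2] := H e eT y ny; rewrite /A /B.
case: asboolP => [ho|n]; last by rewrite addbF h1.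
by have [-> ->] := h2 ho (dy e eT ho); rewrite addbF.
Qed.

End Colour.

(** * The two faces at a point of the diagram that is no crossing *)

Section LocalStructure.
Variable R : realType.
Local Notation pl := (R * R)%type.
Implicit Types (a b x y z : pl) (e f : pl * pl) (T : seq (pl * pl)).

Lemma convex_gt0 (u v t : R) : 0 < u -> 0 < v -> 0 <= t <= 1 -> 0 < (1 - t) * u + t * v.
Proof.
move=> u0 v0 /andP[t0 t1]; have h1 : 0 <= t * v by rewrite mulr_ge0 // ltW.
move: t1; rewrite le_eqVlt => /orP[/eqP ->|t1]; first by rewrite subrr mul0r add0r mul1r.
by rewrite ltr_pwDl // mulr_gt0 // subr_gt0.
Qed.

Definition form (c : R * R * R) y : R := c.1.1 + c.1.2 * y.1 + c.2 * y.2.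

Lemma form_lerp c a b t : form c (lerp a b t) = (1 - t) * form c a + t * form c b.
Proof. by rewrite /form /lerp /=; ring. Qed.

Lemma conn_cone T x r c c' : (forall y, nbh x r y -> 0 < form c y -> 0 < form c' y -> ~ diagram T y) ->
  forall a b, nbh x r a -> 0 < form c a -> 0 < form c' a -> nbh x r b -> 0 < form c b -> 0 < form c' b ->
  conn T a b.
Proof.
move=> H a b na ca ca' nb cb cb'.
apply: (@conn_convex R T [set y | [/\ nbh x r y, 0 < form c y & 0 < form c' y]]) => //=.
  move=> u v t [u1 u2 u3] [v1 v2 v3] t01; rewrite !form_lerp.
  by split; [exact: nbh_convex | exact: convex_gt0 | exact: convex_gt0].
by move=> y [y1 y2 y3]; apply: H.
Qed.

Lemma conn_half T x r c : (forall y, nbh x r y -> 0 < form c y -> ~ diagram T y) ->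
  forall a b, nbh x r a -> 0 < form c a -> nbh x r b -> 0 < form c b -> conn T a b.
Proof. by move=> H a b *; apply: (@conn_cone T x r c c) => // y *; apply: H. Qed.

Definition move_by x (u v : pl) (s t : R) : pl := (x.1 + s * u.1 + t * v.1, x.2 + s * u.2 + t * v.2).

Lemma nbh_move x (u v : pl) r : 0 < r -> exists2 k, 0 < k &
  forall s t, `|s| <= k -> `|t| <= k -> nbh x r (move_by x u v s t).
Proof.
move=> r0; pose m := `|u.1| + `|u.2| + `|v.1| + `|v.2| + 1.
have m0 : 0 < m by rewrite ltr_wpDl // !addr_ge0.
exists (r / 2 / m); first by rewrite !divr_gt0.
have rm : r / 2 / m * m = r / 2 by rewrite divfK // gt_eqF.
set k := r / 2 / m in rm *; have k0 : 0 < k by rewrite !divr_gt0.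
have H (p q s t : R) : `|p| + `|q| <= m -> `|s| <= k -> `|t| <= k -> `|s * p + t * q| < r.
  move=> pq sk tk; apply: le_lt_trans (ler_normD _ _) _; rewrite !normrM.
  have h1 : `|s| * `|p| <= k * `|p| by rewrite ler_wpM2r.
  have h2 : `|t| * `|q| <= k * `|q| by rewrite ler_wpM2r.
  have h3 : k * (`|p| + `|q|) <= k * m by rewrite ler_wpM2l // ltW.
  lra.
have := normr_ge0 u.1; have := normr_ge0 u.2; have := normr_ge0 v.1; have := normr_ge0 v.2.
move=> ? ? ? ? s t sk tk; split; rewrite /move_by /=.
  by rewrite (_ : _ - x.1 = s * u.1 + t * v.1); [apply: H => //; rewrite /m; lra | ring].
by rewrite (_ : _ - x.2 = s * u.2 + t * v.2); [apply: H => //; rewrite /m; lra | ring].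
Qed.

Lemma lerp_near a b (s r : R) : 0 < r -> exists2 k, 0 < k & forall t, s - k < t -> t < s + k -> nbh (lerp a b s) r (lerp a b t).
Proof.
move=> r0; have [k k0 H] := nbh_move (lerp a b s) (vec (a, b)) (0, 0) r0.
exists k => // t h1 h2; have -> : lerp a b t = move_by (lerp a b s) (vec (a, b)) (0, 0) (t - s) 0.
  by apply/pl_eqP; rewrite /lerp /move_by /vec /=; split; ring.
by apply: H; rewrite ?normr0 ?ltW // ltr_norml; apply/andP; split; lra.
Qed.

Lemma ray_near e : e.1 <> e.2 -> exists2 r, 0 < r & forall y, nbh e.1 r y ->
  det2 (vec e) (vec (e.1, y)) = 0 ->
  0 <= (vec e).1 * (vec (e.1, y)).1 + (vec e).2 * (vec (e.1, y)).2 -> onc e y.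
Proof.
move=> e12; pose n := (vec e).1 ^+ 2 + (vec e).2 ^+ 2.
have n0 : 0 < n.
  rewrite lt0r addr_ge0 ?sqr_ge0 // andbT paddr_eq0 ?sqr_ge0 // !sqrf_eq0 /vec /= !subr_eq0.
  by apply/negP => /andP[/eqP E1 /eqP E2]; apply: e12; apply/pl_eqP.
pose g y := ((y.1 - e.1.1) * (vec e).1 + (y.2 - e.1.2) * (vec e).2) / n.
pose c0 := 1 + (e.1.1 * (vec e).1 + e.1.2 * (vec e).2) / n.
have gE y : 1 - g y = c0 + - ((vec e).1 / n) * y.1 + - ((vec e).2 / n) * y.2 by rewrite /g /c0; ring.
have g1 : 1 - g e.1 = 1 by rewrite /g !subrr !mul0r addr0 mul0r subr0.
have [|r r0 H] := @affine_sign R c0 (- ((vec e).1 / n)) (- ((vec e).2 / n)) e.1; first by rewrite -gE g1 oner_neq0.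
exists r => // y ny d0 dot; exists (g y); have [_ h] := H y ny; rewrite -!gE g1 ltr01 in h.
split.
  apply/andP; split; last by rewrite -subr_ge0 ltW.
  apply: divr_ge0; last exact: ltW.
  by move: dot; rewrite /vec /=; lra.
have k1 : y.1 - e.1.1 - g y * (vec e).1 = - (vec e).2 * det2 (vec e) (vec (e.1, y)) / n.
  by rewrite /g /det2 /n /vec /=; field; exact: (lt0r_neq0 n0).
have k2 : y.2 - e.1.2 - g y * (vec e).2 = (vec e).1 * det2 (vec e) (vec (e.1, y)) / n.
  by rewrite /g /det2 /n /vec /=; field; exact: (lt0r_neq0 n0).
rewrite d0 mulr0 mul0r in k1 k2; apply/pl_eqP; rewrite /lerp /=; move: k1 k2; rewrite /vec /= => k1 k2.
by split; lra.
Qed.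

Lemma nbh_open x r m : nbh x r m -> exists2 r', 0 < r' & forall y, nbh m r' y -> nbh x r y.
Proof.
move=> [h1 h2]; exists (Num.min (r - `|m.1 - x.1|) (r - `|m.2 - x.2|)).
  by rewrite lt_min !subr_gt0 h1.
move=> y [ya yb]; rewrite !lt_min in ya yb; case/andP: ya => ya _; case/andP: yb => _ yb; split.
  rewrite (_ : y.1 - x.1 = (y.1 - m.1) + (m.1 - x.1)); last ring.
  by apply: le_lt_trans (ler_normD _ _) _; lra.
rewrite (_ : y.2 - x.2 = (y.2 - m.2) + (m.2 - x.2)); last ring.
by apply: le_lt_trans (ler_normD _ _) _; lra.
Qed.

(** Near x the colour is, up to a constant, the parity of the edges through x that have y on their
    left. One formula covers points off the diagram, points inside an edge and crossings. *)
Definition colours T (col : pl -> bool) := forall x, (forall e, e \in T -> e.1 <> x) ->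
  exists2 r, 0 < r & exists K, forall y, nbh x r y ->
    (forall e, e \in T -> onc e x -> det2 (vec e) (vec (x, y)) != 0) ->
    col y = K (+) \big[addb/false]_(e <- T | `[< onc e x >]) (0 < det2 (vec e) (vec (x, y))).

(** Off the diagram the sum in [colours] is empty, so the colour is locally constant along a
    connection. *)
Lemma conn_colour T col a b : colours T col -> conn T a b -> col a = col b.
Proof.
move=> cT; elim=> // a' b' c' fr _ <-; rewrite -(lerp0 a' b') -[in RHS](lerp1 a' b').
apply: (@interval_induction R (fun s t => col (lerp a' b' s) = col (lerp a' b' t))).
  by move=> s t u _ _ -> ->.
move=> s s01; have nD : ~ diagram T (lerp a' b' s) by apply: fr; exists s.
have [|r r0 [K HK]] := cT (lerp a' b' s).
  by move=> e eT E; apply: nD; exists e => //; rewrite -E; apply: onc_start.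
have [k k0 Hk] := lerp_near a' b' s r0; exists k => // t u _ ts su _ h1 h2.
have H v : nbh (lerp a' b' s) r v -> col v = K.
  move=> nv; rewrite (HK _ nv) => [|e eT oe]; last by case: nD; exists e.
  rewrite big_seq_cond big_pred0 ?addbF // => e; apply/negbTE/negP => /andP[eT /asboolP oe].
  by case: nD; exists e.
by rewrite !H //; apply: Hk; lra.
Qed.

(** Consecutive edges may be collinear but must not form a spike; otherwise they would not divide a
    small square into two pieces. *)
Definition nofold e f := det2 (vec e) (vec f) = 0 -> 0 < (vec e).1 * (vec f).1 + (vec e).2 * (vec f).2.

Definition regular_point T x :=
  (exists e T', [/\ perm_eq T (e :: T'), exists2 t, 0 < t < 1 & x = lerp e.1 e.2 t &
     forall f, f \in T' -> ~ onc f x]) \/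
  (exists e1 e2 T', [/\ perm_eq T (e1 :: e2 :: T'), e1.2 = x /\ e2.1 = x, nofold e1 e2 &
     forall f, f \in T' -> ~ onc f x]).

Definition lineform (v x : pl) : R * R * R := (v.2 * x.1 - v.1 * x.2, - v.2, v.1).

Lemma lineformE v x y : form (lineform v x) y = det2 v (vec (x, y)).
Proof. by rewrite /form /lineform /det2 /vec /=; ring. Qed.

Definition oppform (c : R * R * R) := (- c.1.1, - c.1.2, - c.2).
Lemma oppformE c y : form (oppform c) y = - form c y.
Proof. by rewrite /form /oppform /=; ring. Qed.

Lemma det2_lerp e s t : det2 (vec e) (vec (lerp e.1 e.2 s, lerp e.1 e.2 t)) = 0.
Proof. by rewrite /det2 /vec /lerp /=; ring. Qed.

Lemma line_near e x t : e.1 <> e.2 -> 0 < t < 1 -> x = lerp e.1 e.2 t ->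
  exists2 r, 0 < r & forall y, nbh x r y -> det2 (vec e) (vec (x, y)) = 0 -> onc e y.
Proof.
move=> e12 /andP[t0 t1] xE.
pose n := (vec e).1 ^+ 2 + (vec e).2 ^+ 2.
have n0 : 0 < n.
  rewrite lt0r addr_ge0 ?sqr_ge0 // andbT paddr_eq0 ?sqr_ge0 // !sqrf_eq0 /vec /= !subr_eq0.
  by apply/negP => /andP[/eqP E1 /eqP E2]; apply: e12; apply/pl_eqP.
pose g y := t + ((y.1 - x.1) * (vec e).1 + (y.2 - x.2) * (vec e).2) / n.
have gx : g x = t by rewrite /g !subrr !mul0r addr0 mul0r addr0.
pose c0 := t - (x.1 * (vec e).1 + x.2 * (vec e).2) / n.
have gE y : g y = c0 + (vec e).1 / n * y.1 + (vec e).2 / n * y.2 by rewrite /g /c0; field; rewrite gt_eqF.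
have gE' y : 1 - g y = (1 - c0) + - ((vec e).1 / n) * y.1 + - ((vec e).2 / n) * y.2 by rewrite gE; ring.
have [|ra pa Ha] := @affine_sign R c0 ((vec e).1 / n) ((vec e).2 / n) x; first by rewrite -gE gx gt_eqF.
have [|rb pb Hb] := @affine_sign R (1 - c0) (- ((vec e).1 / n)) (- ((vec e).2 / n)) x.
  by rewrite -gE' gx gt_eqF // subr_gt0.
exists (Num.min ra rb); first by rewrite lt_min pa.
move=> y /nbh_min [ya yb] d0; exists (g y); split.
  have [_ h1] := Ha y ya; have [_ h2] := Hb y yb; rewrite -!gE -!gE' !gx in h1 h2.
  by rewrite ltW ?h1 // -subr_ge0 ltW // h2 subr_gt0.
have k1 : y.1 - e.1.1 - g y * (vec e).1 = - (vec e).2 * det2 (vec e) (vec (x, y)) / n.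
  by rewrite /g xE /lerp /det2 /n /vec /=; field; exact: (lt0r_neq0 n0).
have k2 : y.2 - e.1.2 - g y * (vec e).2 = (vec e).1 * det2 (vec e) (vec (x, y)) / n.
  by rewrite /g xE /lerp /det2 /n /vec /=; field; exact: (lt0r_neq0 n0).
rewrite d0 mulr0 mul0r in k1 k2; apply/pl_eqP; rewrite /lerp /=; move: k1 k2; rewrite /vec /= => k1 k2.
by split; lra.
Qed.

Lemma line_local T col e T' x : (forall f, f \in T -> f.1 <> f.2) -> perm_eq (map fst T) (map snd T) ->
  colours T col -> perm_eq T (e :: T') ->
  (exists2 t, 0 < t < 1 & x = lerp e.1 e.2 t) -> (forall f, f \in T' -> ~ onc f x) ->
  exists2 r, 0 < r &
    [/\ forall y, nbh x r y -> diagram T y <-> det2 (vec e) (vec (x, y)) = 0 &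
     exists K, forall y, nbh x r y -> ~ diagram T y -> col y = K (+) (0 < det2 (vec e) (vec (x, y)))].
Proof.
move=> nd bal cT pT [t /andP[t0 t1] xE] far.
have eT : e \in T by rewrite (perm_mem pT) mem_head.
have mT f : f \in T -> f = e \/ f \in T' by rewrite (perm_mem pT) inE => /orP[/eqP ->|]; [left|right].
have e12 := nd e eT.
have inj := lerp_inj e12.
have nx f : f \in T -> f.1 <> x.
  move=> /mT [->|fT'] E; last by apply: (far f fT'); rewrite -E; apply: onc_start.
  have h0 : lerp e.1 e.2 0 = lerp e.1 e.2 t by rewrite lerp0 -xE.
  by move/inj: h0; lra.
have [r1 p1 [K HK]] := cT x nx; have [r2 p2 H2] := edges_far T x.
have [r3 p3 H3] : exists2 r, 0 < r & forall y, nbh x r y -> det2 (vec e) (vec (x, y)) = 0 -> onc e y.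
  by apply: (@line_near e x t) => //; apply/andP.
exists (Num.min r1 (Num.min r2 r3)); first by rewrite !lt_min p1 p2.
have HD y : nbh x r2 y -> nbh x r3 y -> diagram T y <-> det2 (vec e) (vec (x, y)) = 0.
  move=> y2 y3; split=> [[f fT fy]|d0]; last by exists e => //; apply: H3.
  have [fe|fT'] := mT f fT; last by case: (H2 f fT (far f fT') y y2).
  by move: fy; rewrite fe => -[s [_ ->]]; rewrite xE det2_lerp.
split; first by move=> y /nbh_min [_ /nbh_min [y2 y3]]; apply: HD.
exists K => y /nbh_min [y1 /nbh_min [y2 y3]] nD; rewrite HK //.
  congr (_ (+) _); rewrite (perm_big _ pT) /= big_cons asboolT; last first.
    by exists t; rewrite -xE !ltW.
  rewrite big_seq_cond big_pred0 ?addbF // => f; apply/negbTE/negP => /andP[fT' /asboolP].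
  exact: far.
move=> f fT fx; have [->|fT'] := mT f fT; last by case: (far f fT').
by apply/negP => /eqP d0; apply: nD; apply/HD.
Qed.

Definition dot (u v : pl) : R := u.1 * v.1 + u.2 * v.2.

Lemma sqnorm_gt0 e : e.1 <> e.2 -> 0 < dot (vec e) (vec e).
Proof.
move=> e12; rewrite /dot -!expr2 lt0r addr_ge0 ?sqr_ge0 // andbT paddr_eq0 ?sqr_ge0 //.
rewrite !sqrf_eq0 /vec /= !subr_eq0.
by apply/negP => /andP[/eqP E1 /eqP E2]; apply: e12; apply/pl_eqP.
Qed.

Lemma line_sides T col e T' x rho : (forall f, f \in T -> f.1 <> f.2) -> perm_eq (map fst T) (map snd T) ->
  colours T col -> perm_eq T (e :: T') ->
  (exists2 t, 0 < t < 1 & x = lerp e.1 e.2 t) -> (forall f, f \in T' -> ~ onc f x) -> 0 < rho ->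
  exists p q, [/\ nbh x rho p /\ nbh x rho q, ~ diagram T p /\ ~ diagram T q,
    0 < det2 (vec e) (vec (x, p)) /\ det2 (vec e) (vec (x, q)) < 0 & col p != col q].
Proof.
move=> nd bal cT pT xe far rho0; have [r r0 [HD [K HK]]] := line_local nd bal cT pT xe far.
have e12 : e.1 <> e.2 by apply: nd; rewrite (perm_mem pT) mem_head.
have n0 := sqnorm_gt0 e12; pose u : pl := (- (vec e).2, (vec e).1).
have m0 : 0 < Num.min r rho by rewrite lt_min r0.
have [k k0 Hk] := nbh_move x u u m0.
have dp s : det2 (vec e) (vec (x, move_by x u u s 0)) = s * dot (vec e) (vec e).
  by rewrite /det2 /vec /move_by /dot /u /=; ring.
have kk : `|k| <= k by rewrite gtr0_norm.
have kk' : `|- k| <= k by rewrite normrN.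
have z0 : `|0 : R| <= k by rewrite normr0 ltW.
have [np nr] := nbh_min (Hk _ _ kk z0); have [np' nr'] := nbh_min (Hk _ _ kk' z0).
have d1 : 0 < det2 (vec e) (vec (x, move_by x u u k 0)) by rewrite dp mulr_gt0.
have d2 : det2 (vec e) (vec (x, move_by x u u (- k) 0)) < 0 by rewrite dp mulNr oppr_lt0 mulr_gt0.
have D1 : ~ diagram T (move_by x u u k 0) by move/(HD _ np) => E; rewrite E ltxx in d1.
have D2 : ~ diagram T (move_by x u u (- k) 0) by move/(HD _ np') => E; rewrite E ltxx in d2.
exists (move_by x u u k 0), (move_by x u u (- k) 0); split => //.
by rewrite (HK _ np D1) (HK _ np' D2) d1 (ltNge 0) ltW //; case: K {HK}.
Qed.

(** The two colours at the node x are found at a point m inside e2 close to x, where [line_sides]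
    applies. The last conclusion places both points with respect to the line of e1, which is what
    tells the wedge at x from its complement. *)
Lemma node_sides T col e1 e2 T' x rho : (forall f, f \in T -> f.1 <> f.2) -> perm_eq (map fst T) (map snd T) ->
  colours T col -> perm_eq T (e1 :: e2 :: T') -> e1.2 = x -> e2.1 = x -> nofold e1 e2 ->
  (forall f, f \in T' -> ~ onc f x) -> 0 < rho ->
  exists p q, [/\ nbh x rho p /\ nbh x rho q, ~ diagram T p /\ ~ diagram T q,
    0 < det2 (vec e2) (vec (x, p)) /\ det2 (vec e2) (vec (x, q)) < 0, col p != col q &
    det2 (vec e1) (vec e2) != 0 -> 0 < det2 (vec e1) (vec (x, p)) * det2 (vec e1) (vec e2) /\
      0 < det2 (vec e1) (vec (x, q)) * det2 (vec e1) (vec e2)].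
Proof.
move=> nd bal cT pT x1 x2 nf far rho0.
have e2T : e2 \in T by rewrite (perm_mem pT) !inE eqxx orbT.
have e22 := nd _ e2T; have n0 := sqnorm_gt0 e22.
have [r1 p1 H1] := edges_far T x.
have m0 : 0 < Num.min r1 rho by rewrite lt_min p1.
have [k k0 Hk] := lerp_near e2.1 e2.2 0 m0.
pose t := Num.min (k / 2) (2^-1); have tk : t < k by rewrite gt_min; apply/orP; left; lra.
have t0 : 0 < t by rewrite lt_min; apply/andP; split; [rewrite divr_gt0 | rewrite invr_gt0].
have t1 : t < 1 by rewrite gt_min; apply/orP; right; lra.
set m := lerp e2.1 e2.2 t.
have [m1 m2] : nbh x r1 m /\ nbh x rho m.
  by apply/nbh_min; rewrite -x2 -[e2.1](lerp0 e2.1 e2.2); apply: Hk; lra.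
have e1m : ~ onc e1 m.
  move=> [s [/andP[s0 s1] E]].
  have Ew : vec (x, m) = (t * (vec e2).1, t * (vec e2).2).
    by apply/pl_eqP; rewrite /m -x2 /vec /lerp /=; split; ring.
  have Ew' : vec (x, m) = (- (1 - s) * (vec e1).1, - (1 - s) * (vec e1).2).
    by apply/pl_eqP; rewrite E -x1 /vec /lerp /=; split; ring.
  have EE := etrans (esym Ew) Ew'.
  have k1 : t * (vec e2).1 = - (1 - s) * (vec e1).1 by exact: (congr1 fst EE).
  have k2 : t * (vec e2).2 = - (1 - s) * (vec e1).2 by exact: (congr1 snd EE).
  have d0 : det2 (vec e1) (vec e2) = 0.
    apply/eqP; have : t * det2 (vec e1) (vec e2) = 0.
      transitivity ((vec e1).1 * (t * (vec e2).2) - (vec e1).2 * (t * (vec e2).1)); first by rewrite /det2; ring.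
      by rewrite k1 k2; ring.
    by move/eqP; rewrite mulf_eq0 gt_eqF.
  have dp := nf d0; have : t * dot (vec e2) (vec e2) = - (1 - s) * ((vec e1).1 * (vec e2).1 + (vec e1).2 * (vec e2).2).
    transitivity ((t * (vec e2).1) * (vec e2).1 + (t * (vec e2).2) * (vec e2).2); first by rewrite /dot; ring.
    by rewrite k1 k2; ring.
  have h1 : 0 < t * dot (vec e2) (vec e2) by rewrite mulr_gt0.
  have h2 : 0 <= (1 - s) * ((vec e1).1 * (vec e2).1 + (vec e1).2 * (vec e2).2).
    by rewrite mulr_ge0 ?subr_ge0 // ltW.
  lra.
have pT2 : perm_eq T (e2 :: e1 :: T').
  by apply: perm_trans pT _; apply/permP => z /=; rewrite addnCA.
have farm f : f \in e1 :: T' -> ~ onc f m.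
  rewrite inE => /orP[/eqP -> //|fT']; apply: (H1 f) => //; last exact: far.
  by rewrite (perm_mem pT) !inE fT' !orbT.
have [rr q0 Hr] : exists2 rr, 0 < rr & forall y, nbh m rr y -> nbh x rho y /\
    (det2 (vec e1) (vec e2) != 0 -> 0 < det2 (vec e1) (vec (x, y)) * det2 (vec e1) (vec e2)).
  have [ra qa Ha] : exists2 ra, 0 < ra & forall y, nbh m ra y -> nbh x rho y.
    exact: nbh_open.
  have [d0|dn] := eqVneq (det2 (vec e1) (vec e2)) 0; first by exists ra => // y /Ha.
  pose D := det2 (vec e1) (vec e2).
  have fE y : det2 (vec e1) (vec (x, y)) * D =
     (lineform (vec e1) x).1.1 * D + ((lineform (vec e1) x).1.2 * D) * y.1 + ((lineform (vec e1) x).2 * D) * y.2.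
    by rewrite -lineformE /form; ring.
  have fm : det2 (vec e1) (vec (x, m)) * D = t * D ^+ 2.
    by rewrite /m -x2 /D /det2 /vec /lerp /=; ring.
  have fm0 : 0 < det2 (vec e1) (vec (x, m)) * D.
    by rewrite fm mulr_gt0 // exprn_even_gt0.
  have [|rb qb Hb] := @affine_sign R ((lineform (vec e1) x).1.1 * D) ((lineform (vec e1) x).1.2 * D) ((lineform (vec e1) x).2 * D) m.
    by rewrite -fE gt_eqF.
  exists (Num.min ra rb); first by rewrite lt_min qa.
  move=> y /nbh_min [ya yb]; split; first exact: Ha.
  by move=> _; have [_ h] := Hb y yb; rewrite -/D fE h -fE.
have mI : exists2 t, 0 < t < 1 & m = lerp e2.1 e2.2 t by exists t; rewrite ?t0.
have [p [q [[np nq] [Dp Dq] [dp dq] cpq]]] := line_sides nd bal cT pT2 mI farm q0.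
have dE y : det2 (vec e2) (vec (m, y)) = det2 (vec e2) (vec (x, y)).
  by rewrite /m -x2 /det2 /vec /lerp /=; ring.
rewrite !dE in dp dq; have [xp bp] := Hr p np; have [xq bq] := Hr q nq.
by exists p, q; split => // D0; split; [exact: bp | exact: bq].
Qed.

Lemma two_pieces T col (N P Q : set pl) p q : colours T col ->
  (forall y, N y -> ~ diagram T y -> P y \/ Q y) ->
  (forall y y', P y -> P y' -> conn T y y') -> (forall y y', Q y -> Q y' -> conn T y y') ->
  P p -> Q q -> col p != col q ->
  forall y y', N y -> N y' -> ~ diagram T y -> ~ diagram T y' -> col y = col y' -> conn T y y'.
Proof.
move=> cT cover cP cQ Pp Qq pq y y' Ny Ny' Dy Dy' E.
have [Py|Qy] := cover y Ny Dy; have [Py'|Qy'] := cover y' Ny' Dy'; try by [apply: cP | apply: cQ].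
  have h1 := conn_colour cT (cP _ _ Py Pp); have h2 := conn_colour cT (cQ _ _ Qy' Qq).
  by move: pq; rewrite -h1 -h2 E eqxx.
have h1 := conn_colour cT (cP _ _ Py' Pp); have h2 := conn_colour cT (cQ _ _ Qy Qq).
by move: pq; rewrite -h1 -h2 E eqxx.
Qed.

(* At a node with nonzero turn the inner piece is a wedge and the outer one is a union of two half planes. *)
Lemma node_pieces T e1 e2 T' x : (forall f, f \in T -> f.1 <> f.2) ->
  perm_eq T (e1 :: e2 :: T') -> e1.2 = x -> e2.1 = x -> nofold e1 e2 ->
  (forall f, f \in T' -> ~ onc f x) ->
  exists2 r, 0 < r & exists P Q : set pl,
   [/\ forall y, nbh x r y -> ~ diagram T y -> P y \/ Q y,
     forall y y', P y -> P y' -> conn T y y', forall y y', Q y -> Q y' -> conn T y y' &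
     forall y, nbh x r y -> det2 (vec e2) (vec (x, y)) != 0 ->
      (det2 (vec e1) (vec e2) != 0 -> 0 < det2 (vec e1) (vec (x, y)) * det2 (vec e1) (vec e2)) ->
      if 0 < det2 (vec e2) (vec (x, y)) then P y else Q y].
Proof.
move=> nd pT x1 x2 nf far.
have mT f : f \in T -> [\/ f = e1, f = e2 | f \in T'].
  by rewrite (perm_mem pT) !inE => /or3P[/eqP ->|/eqP ->|]; [constructor 1 | constructor 2 | constructor 3].
have e1T : e1 \in T by rewrite (perm_mem pT) !inE eqxx.
have e2T : e2 \in T by rewrite (perm_mem pT) !inE eqxx orbT.
have [r1 p1 H1] := edges_far T x.
have [ra qa Ha] : exists2 r, 0 < r & forall y, nbh x r y -> det2 (vec e1) (vec (x, y)) = 0 ->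
    dot (vec e1) (vec (x, y)) <= 0 -> onc e1 y.
  have [|r r0 H] := @ray_near (e1.2, e1.1); first by move=> E; apply: (nd _ e1T).
  exists r => //; rewrite -x1 => y ny d0 dd; case: (e1) H ny d0 dd => a b /= H ny d0 dd.
  by apply/onc_rev/H => //; move: d0 dd; rewrite /det2 /dot /vec /=; lra.
have [rb qb Hb] : exists2 r, 0 < r & forall y, nbh x r y -> det2 (vec e2) (vec (x, y)) = 0 ->
    0 <= dot (vec e2) (vec (x, y)) -> onc e2 y.
  by have [|r r0 H] := @ray_near e2; [exact: nd | exists r; rewrite -?x2].
exists (Num.min r1 (Num.min ra rb)); first by rewrite !lt_min p1 qa.
set r := Num.min _ _.
have onD y : nbh x r y -> diagram T y -> onc e1 y \/ onc e2 y.
  move=> /nbh_min [y1 _] [f fT fy]; have [<-|<-|fT'] := mT f fT; [by left | by right|].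
  by case: (H1 f fT (far f fT') y y1 fy).
have on1 y : onc e1 y -> exists2 s, 0 <= s & vec (x, y) = (- s * (vec e1).1, - s * (vec e1).2).
  move=> [s [/andP[s0 s1] ->]]; exists (1 - s); first by rewrite subr_ge0.
  by rewrite -x1; apply/pl_eqP; rewrite /lerp /vec /=; split; ring.
have on2 y : onc e2 y -> exists2 s, 0 <= s & vec (x, y) = (s * (vec e2).1, s * (vec e2).2).
  move=> [s [/andP[s0 s1] ->]]; exists s => //.
  by rewrite -x2; apply/pl_eqP; rewrite /lerp /vec /=; split; ring.
pose D := det2 (vec e1) (vec e2); pose c1 := lineform (vec e1) x; pose c2 := lineform (vec e2) x.
have c1E y : form c1 y = det2 (vec e1) (vec (x, y)) by rewrite lineformE.
have c2E y : form c2 y = det2 (vec e2) (vec (x, y)) by rewrite lineformE.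
have f1 y : onc e1 y -> exists2 s, 0 <= s & form c1 y = 0 /\ form c2 y = s * D.
  move=> /on1 [s s0 E]; exists s => //; rewrite c1E c2E E /D /det2 /=; split; ring.
have f2 y : onc e2 y -> exists2 s, 0 <= s & form c1 y = s * D /\ form c2 y = 0.
  move=> /on2 [s s0 E]; exists s => //; rewrite c1E c2E E /D /det2 /=; split; ring.
have n1 := sqnorm_gt0 (nd _ e1T); have n2 := sqnorm_gt0 (nd _ e2T).
have [D0|Dn] := eqVneq D 0.
  exists [set y | nbh x r y /\ 0 < form c2 y], [set y | nbh x r y /\ 0 < form (oppform c2) y].
  have fr y : nbh x r y -> diagram T y -> form c2 y = 0.
    by move=> ny /(onD _ ny) [/f1|/f2] [s _ [_ ->]]; rewrite ?D0 ?mulr0.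
  have dp := nf D0.
  split.
  - move=> y ny nD; rewrite /= oppformE oppr_gt0.
    case: (ltgtP 0 (form c2 y)) => h; [by left | by right |].
    case: nD; have [ya yb] := nbh_min (proj2 (nbh_min ny)).
    have E1 : det2 (vec e1) (vec (x, y)) = 0.
      apply: (mulIf (lt0r_neq0 n2)); rewrite mul0r.
      transitivity (D * dot (vec e2) (vec (x, y)) + det2 (vec e2) (vec (x, y)) * dot (vec e1) (vec e2)).
        by rewrite /D /det2 /dot; ring.
      by rewrite D0 -c2E -h; ring.
    have [d1|d1] := lerP 0 (dot (vec e2) (vec (x, y))).
      by exists e2 => //; apply: Hb; rewrite // -c2E.
    exists e1 => //; apply: Ha => //; rewrite -(pmulr_lle0 _ n2).
    have -> : dot (vec e1) (vec (x, y)) * dot (vec e2) (vec e2) = dot (vec e2) (vec (x, y)) * dot (vec e1) (vec e2) + det2 (vec e2) (vec (x, y)) * - D.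
      by rewrite /D /det2 /dot; ring.
    by rewrite D0 oppr0 mulr0 addr0 nmulr_rle0 // ltW.
  - move=> y y' [ny py] [ny' py']; apply: (conn_half _ ny py ny' py') => u nu pu /(fr _ nu) E.
    by rewrite E ltxx in pu.
  - move=> y y' [ny py] [ny' py']; apply: (conn_half _ ny py ny' py') => u nu pu /(fr _ nu) E.
    by rewrite oppformE E oppr0 ltxx in pu.
  - move=> y ny; rewrite -c2E /= oppformE oppr_gt0 => nz _.
    by case: ltgtP nz => // E; rewrite -E eqxx.
pose g1 := (c1.1.1 * D, c1.1.2 * D, c1.2 * D); pose g2 := (c2.1.1 * D, c2.1.2 * D, c2.2 * D).
have g1E y : form g1 y = form c1 y * D by rewrite /form /g1 /=; ring.
have g2E y : form g2 y = form c2 y * D by rewrite /form /g2 /=; ring.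
have DD : 0 < D * D by rewrite -expr2 exprn_even_gt0.
pose In : set pl := [set y | [/\ nbh x r y, 0 < form g1 y & 0 < form g2 y]].
pose Out : set pl := [set y | nbh x r y /\ (0 < form (oppform g1) y \/ 0 < form (oppform g2) y)].
have fr y : nbh x r y -> diagram T y -> 0 <= form g1 y /\ 0 <= form g2 y /\ (form g1 y = 0 \/ form g2 y = 0).
  by move=> ny /(onD _ ny) [/f1|/f2] [s s0 [E1 E2]]; rewrite g1E g2E E1 E2 !mul0r -mulrA lexx mulr_ge0 ?(ltW DD) //; split => //; split => //; [left|right].
have cover y : nbh x r y -> ~ diagram T y -> In y \/ Out y.
  move=> ny nD; rewrite /In /Out /= !oppformE !oppr_gt0.
  have [ya yb] := nbh_min (proj2 (nbh_min ny)).
  case: (ltgtP 0 (form g1 y)) => h1; [|by right; split; [|left]|].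
    case: (ltgtP 0 (form g2 y)) => h2; [by left | by right; split; [|right] |].
    case: nD; exists e2 => //.
    have z2 : det2 (vec e2) (vec (x, y)) = 0.
      by apply/eqP; have /eqP := g2E y; rewrite -h2 eq_sym mulf_eq0 (negbTE Dn) orbF c2E.
    apply: Hb => //; rewrite -(pmulr_rge0 _ DD).
    have -> : D * D * dot (vec e2) (vec (x, y)) = dot (vec e2) (vec e2) * form g1 y - D * dot (vec e1) (vec e2) * det2 (vec e2) (vec (x, y)).
      by rewrite g1E c1E /D /det2 /dot; ring.
    by rewrite z2 mulr0 subr0 mulr_ge0 // ltW.
  case: (ltgtP 0 (form g2 y)) => h2; [|by right; split; [|right]|].
    case: nD; exists e1 => //.
    have z1 : det2 (vec e1) (vec (x, y)) = 0.
      by apply/eqP; have /eqP := g1E y; rewrite -h1 eq_sym mulf_eq0 (negbTE Dn) orbF c1E.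
    apply: Ha => //; rewrite -(pmulr_rle0 _ DD).
    have -> : D * D * dot (vec e1) (vec (x, y)) = - (dot (vec e1) (vec e1) * form g2 y) + D * dot (vec e1) (vec e2) * det2 (vec e1) (vec (x, y)).
      by rewrite g2E c2E /D /det2 /dot; ring.
    by rewrite z1 mulr0 addr0 oppr_le0 mulr_ge0 // ltW.
  case: nD; exists e2 => //.
  have z2 : det2 (vec e2) (vec (x, y)) = 0.
    by apply/eqP; have /eqP := g2E y; rewrite -h2 eq_sym mulf_eq0 (negbTE Dn) orbF c2E.
  apply: Hb => //; rewrite -(pmulr_rge0 _ DD).
  have -> : D * D * dot (vec e2) (vec (x, y)) = dot (vec e2) (vec e2) * form g1 y - D * dot (vec e1) (vec e2) * det2 (vec e2) (vec (x, y)).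
    by rewrite g1E c1E /D /det2 /dot; ring.
  by rewrite z2 -h1 !mulr0 subr0.
have cIn y y' : In y -> In y' -> conn T y y'.
  move=> [ny a1 a2] [ny' b1 b2]; apply: (conn_cone _ ny a1 a2 ny' b1 b2) => u nu u1 u2 /(fr _ nu) [_ [_ [E|E]]].
    by rewrite E ltxx in u1.
  by rewrite E ltxx in u2.
have [k k0 Hk] : exists2 k, 0 < k & forall s t, `|s| <= k -> `|t| <= k -> nbh x r (move_by x (vec e1) (vec e2) s t).
  by apply: nbh_move; rewrite /r !lt_min p1 qa.
(* A point opposite to the wedge, in both half planes, which makes their union connected. *)
pose w := move_by x (vec e1) (vec e2) k (- k).
have nw : nbh x r w by apply: Hk; rewrite ?normrN gtr0_norm.
have w1 : 0 < form (oppform g1) w.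
  by rewrite oppformE g1E c1E /w (_ : - _ = k * (D * D)); [rewrite mulr_gt0 | rewrite /D /det2 /vec /move_by /=; ring].
have w2 : 0 < form (oppform g2) w.
  by rewrite oppformE g2E c2E /w (_ : - _ = k * (D * D)); [rewrite mulr_gt0 | rewrite /D /det2 /vec /move_by /=; ring].
have toW y : Out y -> conn T y w.
  move=> [ny [h|h]]; [apply: (conn_half _ ny h nw w1) | apply: (conn_half _ ny h nw w2)] => u nu pu /(fr _ nu) [h1 [h2 _]];
  by move: pu; rewrite oppformE oppr_gt0 ltNge ?h1 ?h2.
have cOut y y' : Out y -> Out y' -> conn T y y'.
  by move=> /toW h /toW h'; apply: conn_trans h (conn_sym h').
have [Dp|Dm] := ltrP 0 D.
  exists In, Out; split => // y ny; rewrite -c2E -c1E -/D => nz /(_ isT) h.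
  case: ltgtP nz => // [hp|hn] _.
    by split => //; rewrite ?g1E ?g2E // pmulr_rgt0.
  by split => //; right; rewrite oppformE oppr_gt0 g2E pmulr_llt0.
have {Dm} Dm : D < 0 by rewrite lt_neqAle Dn.
exists Out, In; split => //.
  by move=> y ny /(cover y ny) [|]; [right | left].
move=> y ny; rewrite -c2E -c1E -/D => nz /(_ isT) h.
case: ltgtP nz => // [hp|hn] _.
  by split => //; right; rewrite oppformE oppr_gt0 g2E nmulr_llt0.
by split => //; rewrite ?g1E ?g2E // nmulr_rgt0.
Qed.

(** At a regular point there are locally two connected pieces, and they differ in colour. Hence a
    face at x can be named by its colour. *)
Lemma twoface T col x : (forall f, f \in T -> f.1 <> f.2) -> perm_eq (map fst T) (map snd T) ->
  colours T col -> regular_point T x ->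
  (exists2 r, 0 < r & forall y y', nbh x r y -> nbh x r y' -> ~ diagram T y -> ~ diagram T y' ->
     col y = col y' -> conn T y y') /\
  (forall rho k, 0 < rho -> exists y, [/\ nbh x rho y, ~ diagram T y & col y = k]).
Proof.
move=> nd bal cT rx.
have both : forall rho, 0 < rho -> exists p q, [/\ nbh x rho p, nbh x rho q, ~ diagram T p, ~ diagram T q & col p != col q].
  move=> rho rho0; case: rx => [[e [T' [pT xe far]]]|[e1 [e2 [T' [pT [x1 x2] nf far]]]]].
    by have [p [q [[? ?] [? ?] _ ?]]] := line_sides nd bal cT pT xe far rho0; exists p, q.
  by have [p [q [[? ?] [? ?] _ ? _]]] := node_sides nd bal cT pT x1 x2 nf far rho0; exists p, q.
split; last first.
  move=> rho k rho0; have [p [q [np nq Dp Dq pq]]] := both rho rho0.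
  have [<-|nk] := eqVneq (col p) k; first by exists p.
  by exists q; split => //; case: (col p) (col q) (k) pq nk => [] [] [].
case: rx => [[e [T' [pT xe far]]]|[e1 [e2 [T' [pT [x1 x2] nf far]]]]].
  have [r r0 [HD _]] := line_local nd bal cT pT xe far; exists r => //.
  have [p [q [[np nq] [Dp Dq] [p0 q0] pq]]] := line_sides nd bal cT pT xe far r0.
  pose c := lineform (vec e) x.
  apply: (two_pieces (P := [set y | nbh x r y /\ 0 < form c y]) (Q := [set y | nbh x r y /\ 0 < form (oppform c) y]) cT _ _ _ _ _ pq).
  - move=> y ny nD; rewrite /= oppformE oppr_gt0 lineformE; case: ltgtP => h; [by left | by right |].
    by case: nD; apply/HD.
  - move=> y y' [ny h] [ny' h']; apply: (conn_half _ ny h ny' h') => u nu pu /(HD _ nu) E.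
    by move: pu; rewrite lineformE E ltxx.
  - move=> y y' [ny h] [ny' h']; apply: (conn_half _ ny h ny' h') => u nu pu /(HD _ nu) E.
    by move: pu; rewrite oppformE lineformE E oppr0 ltxx.
  - by split => //; rewrite lineformE.
  - by split => //; rewrite oppformE oppr_gt0 lineformE.
have [r r0 [P [Q [cov cP cQ side]]]] := node_pieces nd pT x1 x2 nf far; exists r => //.
have [p [q [[np nq] [Dp Dq] [p0 q0] pq s12]]] := node_sides nd bal cT pT x1 x2 nf far r0.
apply: (two_pieces cT cov cP cQ _ _ pq).
  have := side p np (lt0r_neq0 p0); rewrite p0; apply=> h; exact: (s12 h).1.
have := side q nq (ltr0_neq0 q0); have := ltW q0; rewrite leNgt => /negbTE ->; apply=> h; exact: (s12 h).2.
Qed.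

(** The face of colour k at the point x of the diagram is the face of z. Being attached to x instead
    of a point beside it, the relation can be carried along a strand. *)
Definition adj T (col : pl -> bool) x k z := exists2 r, 0 < r & forall y, nbh x r y -> ~ diagram T y -> col y = k -> conn T y z.

Section Walk.
Variables (T : seq (pl * pl)) (col : pl -> bool).
Hypothesis nd : forall f, f \in T -> f.1 <> f.2.
Hypothesis bal : perm_eq (map fst T) (map snd T).
Hypothesis cT : colours T col.

Lemma adj_conn x k z z' : regular_point T x -> adj T col x k z -> adj T col x k z' -> conn T z z'.
Proof.
move=> rx [r r0 H] [r' r0' H']; have [_ both] := twoface nd bal cT rx.
have [|y [/nbh_min [ny ny'] Dy ky]] := both (Num.min r r') k; first by rewrite lt_min r0.
exact: conn_trans (conn_sym (H _ ny Dy ky)) (H' _ ny' Dy ky).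
Qed.

Lemma adj_step x : regular_point T x -> exists2 r, 0 < r & forall x', nbh x r x' -> regular_point T x' ->
  forall k z, adj T col x k z <-> adj T col x' k z.
Proof.
move=> rx; have [[r r0 H] both] := twoface nd bal cT rx.
exists (r / 2); first by rewrite divr_gt0.
move=> x' nx' rx' k z; have [_ both'] := twoface nd bal cT rx'.
have nn y : nbh x' (r / 2) y -> nbh x r y.
  move=> [h1 h2]; case: nx' => k1 k2; split.
    rewrite (_ : y.1 - x.1 = (y.1 - x'.1) + (x'.1 - x.1)); last ring.
    by apply: le_lt_trans (ler_normD _ _) _; lra.
  rewrite (_ : y.2 - x.2 = (y.2 - x'.2) + (x'.2 - x.2)); last ring.
  by apply: le_lt_trans (ler_normD _ _) _; lra.
have r20 : 0 < r / 2 by rewrite divr_gt0.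
split=> -[s s0 Hs].
  have [|y [/nbh_min [ny ny'] Dy ky]] := both (Num.min r s) k; first by rewrite lt_min r0.
  exists (r / 2) => // u /nn nu Du ku; apply: conn_trans (Hs y ny' Dy ky).
  by apply: H; rewrite // ku ky.
have [|y [/nbh_min [ny ny'] Dy ky]] := both' (Num.min (r / 2) s) k; first by rewrite lt_min r20.
exists r => // u nu Du ku; apply: conn_trans (Hs y ny' Dy ky).
by apply: H; rewrite ?ku ?ky //; apply: nn.
Qed.

(** By [twoface] a small square around a regular point has one face of each colour, shared by all
    regular points in its inner half; interval induction does the rest. *)
Lemma adj_walk a b k z : (forall t, 0 <= t <= 1 -> regular_point T (lerp a b t)) ->
  adj T col a k z <-> adj T col b k z.
Proof.
move=> reg; rewrite -{1}(lerp0 a b) -{2}(lerp1 a b).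
apply: (@interval_induction R (fun s t => adj T col (lerp a b s) k z <-> adj T col (lerp a b t) k z)).
  by move=> s t u _ _ -> ->.
move=> s s01; have [r r0 H] := adj_step (reg s s01).
have [d d0 Hd] := lerp_near a b s r0; exists d => // t u t01 ts su u01 h1 h2.
transitivity (adj T col (lerp a b s) k z).
  by apply: iff_sym; apply: H; [apply: Hd; lra | apply: reg; lra].
by apply: H; [apply: Hd; lra | apply: reg; lra].
Qed.

End Walk.

End LocalStructure.

(** * Closed walks through the crossings *)

Section EvenCycle.
Variables (A : eqType) (V : Type) (r : rel V) (X : seq A).
Hypothesis rr : reflexive r.
Hypothesis rs : symmetric r.
Hypothesis rt : transitive r.

(** [F x true] and [F x false] stand for the two opposite faces of one colour at the crossing x, and
    [r] for being in the same face. The pair (x, b) is the passage through x that leaves the face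
    [out] and enters the face [inn]. *)
Definition inn (F : A -> bool -> V) (d : A * bool) := F d.1 (~~ d.2).
Definition out (F : A -> bool -> V) (d : A * bool) := F d.1 d.2.

(** The cycle has k + 1 crossings, so its length is even when k is odd, and k = 0 is a loop. *)
Record good_cycle (F : A -> bool -> V) (k : nat) (c : nat -> A * bool) : Prop := GoodCycle {
  gc_parity : k = 0%N \/ odd k;
  gc_mem : forall j, (j <= k)%N -> (c j).1 \in X;
  gc_uniq : forall j l, (j < l <= k)%N -> (c j).1 != (c l).1;
  gc_step : forall j, (j < k)%N -> r (inn F (c j)) (out F (c j.+1));
  gc_close : r (inn F (c k)) (out F (c 0));
  gc_faces : forall j l, (j < l <= k)%N -> ~~ r (inn F (c j)) (inn F (c l)) }.

Section OneColour.
Variable F : A -> bool -> V.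
Hypothesis noloop : forall x, x \in X -> ~~ r (F x true) (F x false).

Lemma noloop_inn d : d.1 \in X -> ~~ r (out F d) (inn F d).
Proof.
by case: d => x [] xX; rewrite /out /inn /=; [exact: noloop | rewrite rs; exact: noloop].
Qed.

(** The m + 1 faces along m passages: the face before each one, and for j = m the face behind the
    last. *)
Let vert (D : nat -> A * bool) m j := if (j < m)%N then out F (D j) else inn F (D m.-1).

Record simple_chain (m : nat) (D : nat -> A * bool) : Prop := SimpleChain {
  sc_pos : (0 < m)%N;
  sc_mem : forall j, (j < m)%N -> (D j).1 \in X;
  sc_step : forall j, (j < m)%N -> r (inn F (D j)) (vert D m j.+1);
  sc_faces : forall j l, (j < l <= m)%N -> ~~ r (vert D m j) (vert D m l) }.

Lemma same_face d d' : d.1 = d'.1 -> r (out F d) (out F d') \/ r (out F d) (inn F d').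
Proof.
case: d d' => x i [x' i'] /= ->; rewrite /out /inn /=.
by case: i i' => -[]; rewrite /= ?rr; [left|right|right|left].
Qed.

(** A crossing has only two faces of the colour, so using it twice would repeat a face. *)
Lemma chain_uniq m D j l : simple_chain m D -> (j < l < m)%N -> (D j).1 != (D l).1.
Proof.
move=> [m0 mX st fc] /andP[jl lm]; apply/eqP => E.
have jm := ltn_trans jl lm.
have vj : vert D m j = out F (D j) by rewrite /vert jm.
have vl : vert D m l = out F (D l) by rewrite /vert lm.
case: (same_face E) => H.
  by have := fc j l; rewrite jl ltnW // vj vl H => /(_ isT).
have := fc j l.+1; rewrite ltnS ltnW // lm vj => /(_ isT) /negP; apply.
exact: rt H (st _ lm).
Qed.

Lemma chain_size m D : simple_chain m D -> (m <= size X)%N.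
Proof.
move=> sc; have uD : uniq (map (fun j => (D j).1) (iota 0 m)).
  rewrite map_inj_in_uniq ?iota_uniq // => j l; rewrite !mem_iota !add0n /= => jm lm E.
  case: (ltngtP j l) => // h.
    by have := chain_uniq sc (j := j) (l := l); rewrite h lm E eqxx => /(_ isT).
  by have := chain_uniq sc (j := l) (l := j); rewrite h jm E eqxx => /(_ isT).
have := uniq_leq_size uD; rewrite size_map size_iota; apply => x /mapP [j].
by rewrite mem_iota => jm ->; apply: (sc_mem sc).
Qed.

(* In a longest chain every further crossing on the last face leads back to the chain; two of these give three cycles, one of which is even. *)
Lemma even_cycle : (0 < size X)%N ->
  (forall x i, x \in X -> exists y1 y2 i1 i2, [/\ y1 \in X, y2 \in X, [/\ y1 != x, y2 != x & y1 != y2],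
     r (F x i) (F y1 i1) & r (F x i) (F y2 i2)]) ->
  exists k c, good_cycle F k c.
Proof.
move=> X0 deg3.
have [x0 x0X] : exists x, x \in X by case: X X0 => // x s _; exists x; rewrite mem_head.
pose P m := `[< exists D, simple_chain m D >].
have exP : exists m, P m.
  exists 1%N; apply/asboolP; exists (fun=> (x0, true)); split => //.
  by move=> [|j] [|[|l]] //=; rewrite ?andbF // => _; rewrite /vert /= noloop_inn.
have bnd m : P m -> (m <= size X)%N by move=> /asboolP [D /chain_size].
case: (ex_maxnP exP bnd) => m /asboolP [D sc] maxm; have [m0 mX st fc] := sc.
pose u := vert D m.
have u0 : u 0%N = out F (D 0%N) by rewrite /u /vert m0.
(* A crossing y of the chain would make face 0 reappear later in it. As y does not belong to the
   chain and cannot prolong it before face 0, its other face is one of the chain. *)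
have back y i : y \in X -> y != (D 0%N).1 -> r (u 0%N) (F y i) ->
    exists j, [/\ (0 < j <= m)%N, r (F y (~~ i)) (u j) & forall l, (l < m)%N -> (D l).1 != y].
  move=> yX y0 yu.
  have ny l : (l < m)%N -> (D l).1 != y.
    case: l => [_|l lm]; first by rewrite eq_sym.
    apply/eqP => E; have Ey : (D l.+1).1 = (y, i).1 by [].
    have h : r (F y i) (u l.+1) \/ r (F y i) (u l.+2).
      case: (@same_face (y, i) (D l.+1) (esym Ey)) => H.
        by left; rewrite /u /vert lm.
      by right; exact: rt H (st _ lm).
    case: h => h.
      by have := fc 0%N l.+1; rewrite /= ltnW // => /(_ isT) /negP; apply; apply: rt yu h.
    by have := fc 0%N l.+2; rewrite /= lm => /(_ isT) /negP; apply; apply: rt yu h.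
  have [[j jm H]|H] := pselect (exists2 j, (j <= m)%N & r (F y (~~ i)) (u j)).
    exists j; split => //; rewrite jm andbT lt0n; apply/eqP => j0; rewrite j0 in H.
    have := noloop_inn (d := (y, i)) yX; rewrite /out /inn /= => /negP; apply.
    by rewrite rs; apply: rt H yu.
  have : (m.+1 <= m)%N.
    apply: maxm; apply/asboolP; pose D' j := if j is j'.+1 then D j' else (y, ~~ i); exists D'.
    have E j : vert D' m.+1 j.+1 = u j.
      by rewrite /vert /u /vert ltnS; case: ifP => // _; rewrite /= -{1}(prednK m0).
    split => //.
    - by move=> [|j] //= jm; apply: mX.
    - move=> [|j] jm; rewrite E; first by rewrite /inn /= negbK rs.
      exact: st.
    - move=> [|j] [|l] //; rewrite ?E ?ltnS => jl; last exact: fc.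
      by apply/negP => h; apply: H; exists l; first by case/andP: jl.
  by rewrite ltnn.
have inD j : (j < m)%N -> r (inn F (D j)) (u j.+1) by move=> jm; apply: st.
have outD j : (j < m)%N -> out F (D j) = u j by move=> jm; rewrite /u /vert jm.
have nu j l : (j <= m)%N -> (l <= m)%N -> j != l -> ~~ r (u j) (u l).
  by move=> jm lm; case: ltngtP => // h _; [|rewrite rs]; apply: fc; rewrite h.
(* the cycle through [y] and the first [j] steps of the chain *)
have cyc1 y i j : y \in X -> r (u 0%N) (F y i) -> (0 < j <= m)%N -> r (F y (~~ i)) (u j) ->
    (forall l, (l < m)%N -> (D l).1 != y) -> odd j -> exists k c, good_cycle F k c.
  move=> yX yu /andP[j0 jm] yj ny oj.
  pose c l := if l is l'.+1 then D l' else (y, ~~ i).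
  have ic l : (l <= j)%N -> r (inn F (c l)) (u l).
    case: l => [_|l lj]; first by rewrite /inn /= negbK rs.
    by apply: inD; apply: leq_trans lj jm.
  exists j, c; split; first by right.
  - by move=> [|l] //= lj; apply: mX; apply: leq_trans lj jm.
  - move=> [|a] [|b] //=; first by move=> bj; rewrite eq_sym; apply: ny; apply: leq_trans bj jm.
    move=> /andP[ab bj].
    by apply: (chain_uniq sc); apply/andP; split; last exact: leq_trans bj jm.
  - move=> l lj; rewrite (outD l); first by apply: ic; apply: ltnW.
    exact: leq_trans lj jm.
  - by apply: rt (ic _ (leqnn j)) _; rewrite rs.
  - move=> a b /andP[ab bj]; apply/negP => H.
    have am : (a <= m)%N by apply: leq_trans (ltnW ab) (leq_trans bj jm).
    have := nu a b am (leq_trans bj jm); rewrite ltn_eqF // => /(_ isT) /negP; apply.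
    apply: rt (rt _ H) (ic _ bj); rewrite rs; apply: ic; apply: leq_trans (ltnW ab) bj.
(* the cycle through both extra crossings *)
have cyc2 y1 y2 i1 i2 j1 j2 : y1 \in X -> y2 \in X -> y1 != y2 -> r (u 0%N) (F y1 i1) -> r (u 0%N) (F y2 i2) ->
    (0 < j1 <= m)%N -> (0 < j2 <= m)%N -> r (F y1 (~~ i1)) (u j1) -> r (F y2 (~~ i2)) (u j2) ->
    (forall l, (l < m)%N -> (D l).1 != y1) -> (forall l, (l < m)%N -> (D l).1 != y2) ->
    (j1 <= j2)%N -> ~~ odd j1 -> ~~ odd j2 -> exists k c, good_cycle F k c.
  move=> y1X y2X y12 yu1 yu2 /andP[j10 j1m] /andP[j20 j2m] yj1 yj2 ny1 ny2 j12 od1 od2.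
  pose c l := match l with 0%N => (y2, ~~ i2) | 1%N => (y1, i1) | l'.+2 => D (j1 + l')%N end.
  pose k := (j2 - j1).+1.
  pose w l := if l is l'.+1 then u (j1 + l')%N else u 0%N.
  have bnd' l : (l.+2 <= k)%N -> (j1 + l < j2)%N by rewrite /k; clear -j12; lia.
  have ic l : (l <= k)%N -> r (inn F (c l)) (w l).
    case: l => [_|[_|l lk]]; first by rewrite /inn /= negbK rs.
      by rewrite /w addn0.
    rewrite /w addnS; apply: inD; apply: leq_trans (bnd' _ lk) j2m.
  exists k, c; split.
  - by right; rewrite /k /= oddB // (negbTE od1) (negbTE od2).
  - move=> [|[|l]] //= lk; apply: mX; apply: leq_trans (bnd' _ lk) j2m.
  - move=> [|[|a]] [|[|b]] //=; rewrite ?andbF //.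
    + by rewrite eq_sym.
    + by move=> bk; rewrite eq_sym; apply: ny2; apply: leq_trans (bnd' _ bk) j2m.
    + by move=> bk; rewrite eq_sym; apply: ny1; apply: leq_trans (bnd' _ bk) j2m.
    + move=> /andP[ab bk]; apply: (chain_uniq sc); rewrite ltn_add2l; apply/andP; split; first by clear -ab; lia.
      by apply: leq_trans (bnd' _ bk) j2m.
  - move=> [|[|l]] lk; first by apply: rt (ic 0%N isT) _.
      apply: rt (ic 1%N isT) _; rewrite /w /= addn0 outD ?rr //.
      by have := bnd' 0%N lk; rewrite addn0 => /leq_trans; apply.
    rewrite /= outD; last exact: leq_trans (bnd' _ lk) j2m.
    by rewrite addnS; apply: inD; have := bnd' _ lk; lia.
  - apply: rt (ic _ (leqnn k)) _; rewrite /w /k /= subnKC // rs //.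
  - move=> a b /andP[ab bk]; apply/negP => H.
    have ak : (a <= k)%N by apply: leq_trans (ltnW ab) bk.
    have {}H : r (w a) (w b) by apply: rt (rt _ H) (ic _ bk); rewrite rs; apply: ic.
    move: ab bk ak H; case: a => [|a]; case: b => [|b] //= ab bk ak; apply/negP; apply: nu => //; rewrite /k in bk ak; clear -j10 j12 j2m ab bk; lia.
have [y1 [y2 [i1 [i2 [y1X y2X [n1 n2 n12] h1 h2]]]]] := deg3 (D 0%N).1 (D 0%N).2 (mX _ m0).
rewrite -/(out F (D 0%N)) -u0 in h1 h2.
have [j1 [b1 e1 d1]] := back _ _ y1X n1 h1; have [j2 [b2 e2 d2]] := back _ _ y2X n2 h2.
have [od1|od1] := boolP (odd j1); first exact: (cyc1 y1 i1 j1).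
have [od2|od2] := boolP (odd j2); first exact: (cyc1 y2 i2 j2).
have [j12|j21] := leqP j1 j2; first exact: (cyc2 y1 y2 i1 i2 j1 j2).
by apply: (cyc2 y2 y1 i2 i1 j2 j1) => //; [rewrite eq_sym | exact: ltnW].
Qed.

Lemma loop_cycle x : x \in X -> r (F x true) (F x false) -> exists k c, good_cycle F k c.
Proof.
move=> xX H; exists 0%N, (fun=> (x, true)); split => //.
- by left.
- by move=> j l; rewrite leqn0 => /andP[jl /eqP l0]; rewrite l0 in jl.
- by rewrite /inn /out /= rs.
- by move=> j l; rewrite leqn0 => /andP[jl /eqP l0]; rewrite l0 in jl.
Qed.

End OneColour.

(* A face with at most two crossings gives a bigon or a loop in the other colour. *)
Lemma cycle_exists (F : bool -> A -> bool -> V) : (0 < size X)%N ->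
  (forall x i j, x \in X -> exists y i' j', [/\ y \in X, (y, i', j') != (x, i, j),
      r (F false x i) (F false y i') & r (F true x j) (F true y j')]) ->
  exists h k c, good_cycle (F h) k c.
Proof.
move=> X0 darts.
(* In the hypothesis [darts] the triple (x, i, j) stands for the half strand at x between the face i
   of one colour and the face j of the other. Followed to the next crossing y it arrives between the
   same two faces, as the half strand (y, i', j'). *)
have [[h [x xX H]]|nl] := pselect (exists h, exists2 x, x \in X & r (F h x true) (F h x false)).
  by exists h; apply: loop_cycle H.
have nol h x : x \in X -> ~~ r (F h x true) (F h x false).
  by move=> xX; apply/negP => H; apply: nl; exists h, x.
have nolT h x i j : x \in X -> r (F h x i) (F h x j) -> i = j.
  move=> xX; case: i j => -[] // H; first by have := nol h x xX; rewrite H.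
  by have := nol h x xX; rewrite rs H.
have [d3|nd3] := pselect (forall x i, x \in X -> exists y1 y2 i1 i2, [/\ y1 \in X, y2 \in X, [/\ y1 != x, y2 != x & y1 != y2],
     r (F false x i) (F false y1 i1) & r (F false x i) (F false y2 i2)]).
  by exists false; apply: even_cycle => // x; apply: nol.
have [x [i [xX n3]]] : exists x i, x \in X /\ ~ exists y1 y2 i1 i2, [/\ y1 \in X, y2 \in X, [/\ y1 != x, y2 != x & y1 != y2],
     r (F false x i) (F false y1 i1) & r (F false x i) (F false y2 i2)].
  by apply: contrapT => H; apply: nd3 => x i xX; apply: contrapT => H'; apply: H; exists x, i.
have nx y i' j j' : y \in X -> (y, i', j') != (x, i, j) -> r (F false x i) (F false y i') -> r (F true x j) (F true y j') -> y != x.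
  move=> yX ne h1 h2; apply/eqP => E; rewrite E in ne h1 h2.
  by rewrite (nolT _ _ _ _ xX h1) (nolT _ _ _ _ xX h2) eqxx in ne.
(* The two half strands that bound the small face at x lead to the same crossing y, since this face
   has no two further crossings. On their outer sides are the two faces of the other colour at x,
   which are therefore those at y: a cycle of length 2. *)
have [y [i1 [j1 [yX e1 a1 b1]]]] := darts x i true xX.
have [y' [i2 [j2 [yX' e2 a2 b2]]]] := darts x i false xX.
have y1 := nx _ _ _ _ yX e1 a1 b1; have y2 := nx _ _ _ _ yX' e2 a2 b2.
have yy : y' = y.
  apply/eqP; rewrite -[_ == _]negbK; apply/negP => n; apply: n3; exists y', y, i2, i1; split => //.
rewrite yy in b2; have j12 : j2 = ~~ j1.
  have : j1 != j2 by apply/eqP => E; rewrite -E rs in b2; have := nolT _ _ _ _ xX (rt b1 b2).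
  by case: j1 j2 {b1 b2 e1 e2} => -[].
rewrite j12 in b2.
exists true, 1%N, (fun j => if j is 0%N then (x, true) else (y, ~~ j1)); split.
- by right.
- by move=> [|[|]].
- by move=> [|[|j]] [|[|l]] //=; rewrite ?andbF // => _; rewrite eq_sym.
- by move=> [|j] //= _; rewrite /inn /out /=.
- by rewrite /inn /out /= negbK rs.
- move=> [|[|j]] [|[|l]] //=; rewrite ?andbF // => _; rewrite /inn /= negbK; apply/negP => H.
  have K : r (F true x true) (F true x false) by apply: rt b1 _; rewrite rs.
  by have := nolT true x true false xX K.
Qed.

End EvenCycle.

Section CountSplit.
Variable A : eqType.

Lemma count1_split (P : pred A) s : count P s = 1%N ->
  exists x s', [/\ perm_eq s (x :: s'), P x & forall y, y \in s' -> ~~ P y].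
Proof.
move=> c1; have [x xs Px] : exists2 x, x \in s & P x by apply: count_gt0; rewrite c1.
exists x, (rem x s); split => //; first exact: perm_to_rem.
have := permP (perm_to_rem xs) P; rewrite c1 /= Px add1n => -[c0] y yr; apply/negP => Py.
by have : (0 < count P (rem x s))%N; [rewrite -has_count; apply/hasP; exists y | rewrite -c0].
Qed.

Lemma count2_split (P : pred A) s : count P s = 2%N ->
  exists x y s', [/\ perm_eq s (x :: y :: s'), P x, P y & forall z, z \in s' -> ~~ P z].
Proof.
move=> c2; have [x xs Px] : exists2 x, x \in s & P x by apply: count_gt0; rewrite c2.
have p1 := perm_to_rem xs; have := permP p1 P; rewrite c2 /= Px => -[] /esym /count1_split [y [s' [p2 Py H]]].
by exists x, y, s'; split => //; apply: perm_trans p1 _; rewrite perm_cons.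
Qed.

Lemma perm_cons2 (x y : A) s : perm_eq [:: x, y & s] [:: y, x & s].
Proof. by apply/permP => P /=; rewrite addnCA. Qed.

Lemma uniq_map_inj (B : eqType) (h : A -> B) s x y : uniq (map h s) -> x \in s -> y \in s -> h x = h y -> x = y.
Proof.
move=> us xs ys E; apply: (@count_le1_eq _ (fun z => h z == h x) s) => //; last by rewrite E.
have := count_uniq_mem (h x) us; rewrite count_map /= => ->; exact: leq_b1.
Qed.

End CountSplit.

(** * The faces at a crossing and along a strand *)

Section Crossings.
Variable R : realType.
Local Notation pl := (R * R)%type.
Implicit Types (a b x y z q : pl) (e f : pl * pl).

Lemma avoid_interval (s : seq R) (a b : R) : a < b -> exists t, a < t < b /\ t \notin s.
Proof.
move=> ab; suff [a' [b' [h1 h2 h3 H]]] : exists a' b' : R, [/\ a <= a', a' < b', b' <= b & forall t, a' < t < b' -> t \notin s].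
  exists ((a' + b') / 2); have m : a' < (a' + b') / 2 < b' by apply/andP; split; lra.
  by split; [case/andP: m => *; apply/andP; split; lra | exact: H].
elim: s => [|x s [a' [b' [h1 h2 h3 H]]]]; first by exists a, b; rewrite !lexx ab.
have [/andP[x1 x2]|nx] := boolP (a' < x < b').
  exists a', x; split => //; first lra.
  move=> t /andP[t1 t2]; rewrite inE lt_eqF //=; apply: H; rewrite t1 /=; lra.
exists a', b'; split => // t t12; rewrite inE negb_or H // andbT.
by apply: contraNneq nx => <-.
Qed.

Lemma avoid_points (p : R -> pl) (X : seq pl) (a b : R) : injective p -> a < b -> exists t, a < t < b /\ p t \notin X.
Proof.
move=> ip ab; have [t [tab nt]] := avoid_interval (map (fun x => xget 0 [set s | x = p s]) X) ab.
exists t; split => //; apply: contra nt => tX; apply/mapP; exists (p t) => //.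
by apply: esym; case: xgetP => [s _ /ip ->|/(_ t)] //= h; case: h.
Qed.

Lemma lt0_neg (b : R) : b != 0 -> (b < 0) = ~~ (0 < b).
Proof. by case: ltgtP. Qed.

Lemma convex_01 (u v t : R) : 0 <= u <= 1 -> 0 <= v <= 1 -> 0 <= t <= 1 -> 0 <= (1 - t) * u + t * v <= 1.
Proof.
move=> /andP[u0 u1] /andP[v0 v1] /andP[t0 t1].
have h1 : 0 <= (1 - t) * u by rewrite mulr_ge0 // subr_ge0.
have h2 : 0 <= t * v by rewrite mulr_ge0.
have h3 : 0 <= (1 - t) * (1 - u) by rewrite mulr_ge0 // subr_ge0.
have h4 : 0 <= t * (1 - v) by rewrite mulr_ge0 // subr_ge0.
by apply/andP; split; lra.
Qed.

Variables (T : seq (pl * pl)) (X : seq pl).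
Hypothesis mT : mixed T X [::].
Hypothesis bal : perm_eq (map fst T) (map snd T).

Lemma mixed_nd e : e \in T -> e.1 <> e.2.
Proof. exact: mixed_nondeg mT e. Qed.

Lemma start_notin e : e \in T -> e.1 \notin X.
Proof. by move=> eT; have := mixed_start mT eT; rewrite cats0. Qed.

Lemma end_start e : e \in T -> exists2 f, f \in T & f.1 = e.2.
Proof.
move=> eT; have : e.2 \in map fst T by rewrite (perm_mem bal) map_f.
by case/mapP => f fT E; exists f.
Qed.

Lemma start_end e : e \in T -> exists2 f, f \in T & f.2 = e.1.
Proof.
move=> eT; have : e.1 \in map snd T by rewrite -(perm_mem bal) map_f.
by case/mapP => f fT E; exists f.
Qed.

Lemma end_notin e : e \in T -> e.2 \notin X.
Proof. by move=> /end_start [f /start_notin h <-]. Qed.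

Lemma cnt_off x : x \notin X -> (cnt T x <= 1)%N.
Proof. by move=> xX; apply: (mixed_off mT). Qed.

Lemma on_unique e f x : x \notin X -> e \in T -> f \in T -> on e x -> on f x -> e = f.
Proof.
move=> xX eT fT ex fx; apply: (count_le1_eq (cnt_off xX)) => //; exact/asboolP.
Qed.

Lemma inj_start e f : e \in T -> f \in T -> e.1 = f.1 -> e = f.
Proof.
move=> eT fT E; apply: (on_unique (start_notin eT)) => //; first exact: on_start.
by rewrite E; apply: on_start.
Qed.

Lemma inj_end e f : e \in T -> f \in T -> e.2 = f.2 -> e = f.
Proof.
have us : uniq (map snd T).
  rewrite -(perm_uniq bal) map_inj_in_uniq ?(mixed_uniq_edges mT) //.
  by move=> u v uT vT; apply: inj_start.
exact: uniq_map_inj us.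
Qed.

Lemma onc_interior e q : e \in T -> q \in X -> onc e q -> exists2 t, 0 < t < 1 & q = lerp e.1 e.2 t.
Proof.
move=> eT qX [t [/andP[t0 t1] E]]; exists t => //; rewrite !lt_neqAle t0 t1 !andbT.
apply/andP; split; apply/eqP => E'.
  by have := start_notin eT; rewrite -(lerp0 e.1 e.2) E' -E qX.
by have := end_notin eT; rewrite -(lerp1 e.1 e.2) -E' -E qX.
Qed.

(** If e2 turned back along e1, all points of e2 near the node would lie on both edges. All but
    finitely many of them are no crossings, where the multiplicity is at most 1. *)
Lemma nofold_consec e1 e2 : e1 \in T -> e2 \in T -> e1.2 = e2.1 -> nofold e1 e2.
Proof.
move=> e1T e2T E D0; rewrite -/(dot (vec e1) (vec e2)) ltNge; apply/negP => dp.
have n1 := sqnorm_gt0 (mixed_nd e1T); have n2 := sqnorm_gt0 (mixed_nd e2T).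
pose c := - dot (vec e1) (vec e2) / dot (vec e1) (vec e1).
have [v1 v2] : (vec e2).1 = - c * (vec e1).1 /\ (vec e2).2 = - c * (vec e1).2.
  rewrite /c; split; apply: (mulIf (lt0r_neq0 n1)).
    transitivity (dot (vec e1) (vec e2) * (vec e1).1 - det2 (vec e1) (vec e2) * (vec e1).2).
      by rewrite /dot /det2; ring.
    by rewrite D0; field; exact: (lt0r_neq0 n1).
  transitivity (dot (vec e1) (vec e2) * (vec e1).2 + det2 (vec e1) (vec e2) * (vec e1).1).
    by rewrite /dot /det2; ring.
  by rewrite D0; field; exact: (lt0r_neq0 n1).
have c0 : 0 < c.
  rewrite lt0r; apply/andP; split; last by rewrite /c divr_ge0 ?oppr_ge0 // ltW.
  by apply/eqP => c0; move: n2; rewrite /dot v1 v2 c0 oppr0 !mul0r addr0 ltxx.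
have m0 : 0 < Num.min 1 c^-1 by rewrite lt_min ltr01 invr_gt0.
have [s [/andP[s0 sm] sX]] := avoid_points X (lerp_inj (mixed_nd e2T)) m0.
move: sm; rewrite lt_min => /andP[s1 sc].
have sc1 : s * c < 1 by rewrite -ltr_pdivlMr // div1r.
have [] : e1 <> e2 by move=> E'; apply: (mixed_nd e2T); rewrite -E -E'.
apply: (on_unique sX) => //; last by exists s; rewrite ltW.
exists (1 - s * c); split.
  have h : 0 < s * c by rewrite mulr_gt0.
  by apply/andP; split; lra.
transitivity (e2.1.1 + s * (vec e2).1, e2.1.2 + s * (vec e2).2); first by [].
by rewrite v1 v2 -E; apply/pl_eqP; rewrite /lerp /vec /=; split; ring.
Qed.

Lemma regularP x : diagram T x -> x \notin X -> regular_point T x.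
Proof.
move=> [e eT ex] xX; have uT := mixed_uniq_edges mT.
have [/mapP [e2 e2T x2]|ns] := boolP (x \in map fst T).
  have [e1 e1T x1] := start_end e2T; right; exists e1, e2, (rem e2 (rem e1 T)).
  have n12 : e2 != e1 by apply/eqP => E; apply: (mixed_nd e2T); rewrite -x1 E.
  have e2r : e2 \in rem e1 T by rewrite mem_rem_uniq // !inE n12.
  split.
  - by apply: perm_trans (perm_to_rem e1T) _; rewrite perm_cons; apply: perm_to_rem.
  - by rewrite x1 x2.
  - exact: nofold_consec.
  move=> f; rewrite mem_rem_uniq ?rem_uniq // !inE mem_rem_uniq // !inE => /and3P[f2 f1 fT].
  case/oncE => [fx|xf].
    move/eqP: f2; apply; apply: (on_unique xX) => //; rewrite x2; exact: on_start.
  by move/eqP: f1; apply; apply: inj_end => //; rewrite -xf x1.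
have nend f : f \in T -> x <> f.2.
  by move=> fT E; have [g gT g1] := end_start fT; move/negP: ns; apply; rewrite E -g1 map_f.
left; exists e, (rem e T); split; first exact: perm_to_rem.
  case/oncE: ex => [[t [/andP[t0 t1] E]]|/nend //]; exists t => //; rewrite t1 andbT lt_neqAle t0 andbT.
  by apply/eqP => E0; move/negP: ns; apply; rewrite E -E0 lerp0 map_f.
move=> f; rewrite mem_rem_uniq // !inE => /andP[fe fT] /oncE [fx|]; last exact: nend.
move/eqP: fe; apply; apply: (on_unique xX) => //.
by case/oncE: ex => // /nend.
Qed.

Definition crossing_edges q e f := exists T', [/\ perm_eq T (e :: f :: T'),
  exists2 t, 0 < t < 1 & q = lerp e.1 e.2 t, exists2 t, 0 < t < 1 & q = lerp f.1 f.2 t,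
  det2 (vec e) (vec f) != 0 & forall g, g \in T' -> ~ onc g q].

Lemma crossing_edgesC q e f : crossing_edges q e f -> crossing_edges q f e.
Proof.
move=> [T' [p h1 h2 D far]]; exists T'; split => //.
  by apply: perm_trans p (perm_cons2 _ _ _).
apply: contraNneq D => E; rewrite (_ : det2 _ _ = - det2 (vec f) (vec e)); last by rewrite /det2; ring.
by rewrite E oppr0.
Qed.

Lemma crossing_edgesP q : q \in X -> exists e f, crossing_edges q e f.
Proof.
move=> qX; have [e [f [T' [p /asboolP eq /asboolP fq H]]]] := count2_split (mixed_double mT qX).
have eT : e \in T by rewrite (perm_mem p) mem_head.
have fT : f \in T by rewrite (perm_mem p) !inE eqxx orbT.
exists e, f, T'; split => //; try by apply: onc_interior => //; apply: on_onc.
  apply: (mixed_transverse mT) (eq) (fq) _ => //; first by rewrite cats0.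
  by move=> ef; have := mixed_uniq_edges mT; rewrite (perm_uniq p) /= ef inE eqxx.
move=> g gT' /oncE [/asboolP gq|E]; first by have := H g gT'; rewrite gq.
have gT : g \in T by rewrite (perm_mem p) !inE gT' !orbT.
by have := end_notin gT; rewrite -E qX.
Qed.

Variable col : pl -> bool.
Hypothesis cT : colours T col.

(** In a small square around a crossing the diagram consists of two lines. The quadrants are convex,
    hence connected, and the colour changes at either line. *)
Lemma quadrants q e f : crossing_edges q e f -> exists2 r, 0 < r & exists K, forall y, nbh q r y ->
  let al := det2 (vec e) (vec (q, y)) in let be := det2 (vec f) (vec (q, y)) in
  [/\ diagram T y <-> al = 0 \/ be = 0, ~ diagram T y -> col y = K (+) (0 < al) (+) (0 < be) &
   forall y', nbh q r y' -> ~ diagram T y -> ~ diagram T y' ->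
     (0 < al) = (0 < det2 (vec e) (vec (q, y'))) -> (0 < be) = (0 < det2 (vec f) (vec (q, y'))) -> conn T y y'].
Proof.
move=> [T' [p [t t01 qe] [s s01 qf] D far]].
have eT : e \in T by rewrite (perm_mem p) mem_head.
have fT : f \in T by rewrite (perm_mem p) !inE eqxx orbT.
have mem g : g \in T -> [\/ g = e, g = f | g \in T'].
  by rewrite (perm_mem p) !inE => /or3P[/eqP ->|/eqP ->|]; [constructor 1 | constructor 2 | constructor 3].
have oe : onc e q by exists t; rewrite !ltW //; case/andP: t01.
have of_ : onc f q by exists s; rewrite !ltW //; case/andP: s01.
have nq g : g \in T -> g.1 <> q.
  move=> /mem [->|->|gT'] E.
  - have h : lerp e.1 e.2 0 = lerp e.1 e.2 t by rewrite lerp0 -qe.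
    by move/(lerp_inj (mixed_nd eT)): h t01 => <-; rewrite ltxx.
  - have h : lerp f.1 f.2 0 = lerp f.1 f.2 s by rewrite lerp0 -qf.
    by move/(lerp_inj (mixed_nd fT)): h s01 => <-; rewrite ltxx.
  - by apply: (far g gT'); rewrite -E; apply: onc_start.
have [r1 p1 H1] := edges_far T q; have [r2 p2 [K HK]] := cT nq.
have [r3 p3 H3] := line_near (mixed_nd eT) t01 qe; have [r4 p4 H4] := line_near (mixed_nd fT) s01 qf.
exists (Num.min (Num.min r1 r2) (Num.min r3 r4)); first by rewrite !lt_min p1 p2 p3.
set r := Num.min _ _.
have HD y : nbh q r y -> diagram T y <-> det2 (vec e) (vec (q, y)) = 0 \/ det2 (vec f) (vec (q, y)) = 0.
  move=> /nbh_min [/nbh_min [y1 y2] /nbh_min [y3 y4]]; split=> [[g gT gy]|[d0|d0]]; last 2 first.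
  - by exists e => //; apply: H3.
  - by exists f => //; apply: H4.
  have [ge|gf|gT'] := mem g gT; last by case: (H1 g gT (far g gT') y y1 gy).
    by left; move: gy; rewrite ge => -[u [_ ->]]; rewrite qe det2_lerp.
  by right; move: gy; rewrite gf => -[u [_ ->]]; rewrite qf det2_lerp.
exists K => y ny al be; split; first exact: HD.
  move=> nD; have [/nbh_min [y1 y2] _] := nbh_min ny.
  have al0 : al != 0 by apply/eqP => E; apply: nD; apply/HD => //; left.
  have be0 : be != 0 by apply/eqP => E; apply: nD; apply/HD => //; right.
  rewrite HK // => [|g gT gq]; last first.
    by have [->|->|gT'] := mem g gT => //; case: (far g gT').
  rewrite (perm_big _ p) /= !big_cons asboolT // asboolT // big_seq_cond big_pred0 ?addbF ?addbA // => g.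
  by apply/negbTE/negP => /andP[gT' /asboolP]; apply: far.
move=> y' ny' nD nD'.
pose sg (b : bool) c := if b then c else @oppform R c.
have sgE (b : bool) c z : (0 < form (sg b c) z) = (if b then 0 < form c z else form c z < 0).
  by case: b => //=; rewrite oppformE oppr_gt0.
pose c1 := lineform (vec e) q; pose c2 := lineform (vec f) q.
have pos c z : form c z != 0 -> 0 < form (sg (0 < form c z) c) z.
  by move=> nz; rewrite sgE; case: ltgtP nz => //.
have nz z : nbh q r z -> ~ diagram T z -> form c1 z != 0 /\ form c2 z != 0.
  move=> nz dz; split; apply/eqP; rewrite lineformE => E; apply: dz; apply/HD => //; by [left|right].
have [y1 y2] := nz y ny nD; have [z1 z2] := nz y' ny' nD'.
rewrite /al /be -!lineformE => E1 E2.
apply: (@conn_cone R T q r (sg (0 < form c1 y) c1) (sg (0 < form c2 y) c2)) => //; try exact: pos.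
- move=> z nz'; rewrite !sgE => h1 h2 /HD - /(_ nz'); rewrite -!lineformE -/c1 -/c2 => -[E|E].
    by move: h1; rewrite E ltxx; case: ifP.
  by move: h2; rewrite E ltxx; case: ifP.
- by rewrite E1; apply: pos.
- by rewrite E2; apply: pos.
Qed.

(** This is arranged by [one_per_edge]. It allows one to walk from a crossing to either end of its
    edge without meeting another one. *)
Hypothesis one : forall e x y, e \in T -> x \in X -> y \in X -> onc e x -> onc e y -> x = y.

Definition side e (i : bool) : pl := if i then e.2 else e.1.

Lemma regular_side e i : e \in T -> regular_point T (side e i).
Proof.
move=> eT; apply: regularP; first by exists e => //; case: i; [apply: onc_end | apply: onc_start].
by case: i; [apply: end_notin | apply: start_notin].
Qed.

(** The face in a quadrant is adjacent to the point of e with the same first coordinate. From there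
    it is carried to the end of e on that side, away from q. *)
Lemma adj_side q e f : q \in X -> crossing_edges q e f -> exists2 k, 0 < k & forall a b : R, a != 0 -> b != 0 -> `|a| <= k -> `|b| <= k ->
  let p := move_by q (vec e) (vec f) a b in adj T col (side e (0 < a)) (col p) p.
Proof.
move=> qX ce; have [r r0 [K HK]] := quadrants ce.
have [T' [p [t /andP[t0 t1] qe] _ D far]] := ce.
have eT : e \in T by rewrite (perm_mem p) mem_head.
have [k1 k10 Hk] := nbh_move q (vec e) (vec f) r0.
pose k := Num.min k1 (Num.min (t / 2) ((1 - t) / 2)).
have k0 : 0 < k by rewrite !lt_min k10 !divr_gt0 ?subr_gt0.
exists k => // a b a0 b0; rewrite !le_min => /and3P[a1 a2 a3] /and3P[b1 b2 b3] P.
pose x := move_by q (vec e) (vec f) a 0.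
have nx : nbh q r x by apply: Hk => //; rewrite normr0 ltW.
have nP : nbh q r P by apply: Hk.
have xE : x = lerp e.1 e.2 (t + a) by apply/pl_eqP; rewrite /x qe /move_by /lerp /vec /=; split; ring.
have ta : 0 <= t + a <= 1 by move: a2 a3; rewrite !ler_norml => /andP[? ?] /andP[? ?]; apply/andP; split; lra.
have reg (u : R) : 0 <= u <= 1 -> u != t -> regular_point T (lerp e.1 e.2 u).
  move=> u01 ut; apply: regularP; first by exists e => //; exists u.
  apply/negP => uX; move/eqP: ut; apply; apply: (lerp_inj (mixed_nd eT)); rewrite -qe.
  apply: (one eT) => //; first by exists u.
  by exists t; rewrite !ltW.
have adjx : adj T col x (col P) P.
  have [r2 r20 H2] := nbh_open nx.
  have bx : det2 (vec f) (vec (q, x)) = - a * det2 (vec e) (vec f) by rewrite /x /det2 /vec /move_by /=; ring.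
  have bP : det2 (vec f) (vec (q, P)) = - a * det2 (vec e) (vec f) by rewrite /P /det2 /vec /move_by /=; ring.
  have aP : det2 (vec e) (vec (q, P)) = b * det2 (vec e) (vec f) by rewrite /P /det2 /vec /move_by /=; ring.
  have fE y : (lineform (vec f) q).1.1 + (lineform (vec f) q).1.2 * y.1 + (lineform (vec f) q).2 * y.2 = det2 (vec f) (vec (q, y)).
    by rewrite -lineformE.
  have bn : - a * det2 (vec e) (vec f) != 0 by rewrite mulf_neq0 // oppr_eq0.
  have an : b * det2 (vec e) (vec f) != 0 by rewrite mulf_neq0.
  have [|r3 r30 H3] := @affine_sign R (lineform (vec f) q).1.1 (lineform (vec f) q).1.2 (lineform (vec f) q).2 x.
    by rewrite fE bx.
  exists (Num.min r2 r3); first by rewrite lt_min r20.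
  move=> y /nbh_min [/H2 ny y3] Dy; have [_ h3] := H3 y y3; rewrite !fE bx in h3.
  have [hD hc hconn] := HK y ny; have [hDP hcP _] := HK P nP.
  have DP : ~ diagram T P by move/hDP; rewrite aP bP => -[] /eqP; [move/negP: an | move/negP: bn].
  rewrite (hc Dy) (hcP DP) => cE; apply: hconn => //; last by rewrite h3 bP.
  by move: cE; rewrite h3 bP => /addIb /addbI.
have wx (u : R) k' z : 0 <= u <= 1 -> (forall s : R, 0 <= s <= 1 -> t + a + s * (u - (t + a)) != t) ->
    adj T col x k' z -> adj T col (lerp e.1 e.2 u) k' z.
  move=> u01 hs; rewrite xE => /(adj_walk mixed_nd bal cT (b := lerp e.1 e.2 u)); apply=> s s01.
  rewrite lerp_lerp; apply: reg; last exact: hs.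
  have -> : t + a + s * (u - (t + a)) = (1 - s) * (t + a) + s * u by ring.
  exact: convex_01.
rewrite /side; case: (ltgtP 0 a) a0 => // ha _.
  rewrite -[e.2](lerp1 e.1); apply: wx => // [|s /andP[s0 s1]]; first by rewrite ler01 lexx.
  have h1 : 0 <= s * (1 - (t + a)) by rewrite mulr_ge0 // subr_ge0; case/andP: ta.
  by rewrite gt_eqF //; lra.
rewrite -[e.1](lerp0 e.1 e.2); apply: wx => // [|s /andP[s0 s1]]; first by rewrite ler01 lexx.
have h1 : 0 <= s * (t + a) by rewrite mulr_ge0 //; case/andP: ta.
by rewrite lt_eqF //; lra.
Qed.

Lemma crossing_faces q e f : q \in X -> crossing_edges q e f -> exists (k : R) (K : bool), [/\ 0 < k,
  forall a b : R, a != 0 -> b != 0 -> `|a| <= k -> `|b| <= k -> let p := move_by q (vec e) (vec f) a b in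
   [/\ ~ diagram T p, col p = K (+) (0 < a) (+) (0 < b),
       adj T col (side e (0 < a)) (col p) p & adj T col (side f (0 < b)) (col p) p] &
  forall a b a' b' : R, a != 0 -> b != 0 -> a' != 0 -> b' != 0 ->
   `|a| <= k -> `|b| <= k -> `|a'| <= k -> `|b'| <= k -> (0 < a) = (0 < a') -> (0 < b) = (0 < b') ->
   conn T (move_by q (vec e) (vec f) a b) (move_by q (vec e) (vec f) a' b')].
Proof.
move=> qX ce; have [k1 k10 H1] := adj_side qX ce; have [k2 k20 H2] := adj_side qX (crossing_edgesC ce).
have [r r0 [K HK]] := quadrants ce; have [T' [_ _ _ D _]] := ce.
have [k3 k30 H3] := nbh_move q (vec e) (vec f) r0.
have aE (a b : R) : det2 (vec e) (vec (q, move_by q (vec e) (vec f) a b)) = b * det2 (vec e) (vec f).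
  by rewrite /det2 /vec /move_by /=; ring.
have bE (a b : R) : det2 (vec f) (vec (q, move_by q (vec e) (vec f) a b)) = - a * det2 (vec e) (vec f).
  by rewrite /det2 /vec /move_by /=; ring.
have sgn (a b : R) : a != 0 -> b != 0 -> (0 < b * det2 (vec e) (vec f)) (+) (0 < - a * det2 (vec e) (vec f)) = true (+) (0 < a) (+) (0 < b).
  move=> a0 b0; have [Dp|Dn|D0] := ltgtP 0 (det2 (vec e) (vec f)); last by rewrite -D0 eqxx in D.
    by rewrite !pmulr_lgt0 // oppr_gt0 lt0_neg //; case: (0 < a) (0 < b) => -[].
  by rewrite !nmulr_lgt0 // oppr_lt0 lt0_neg //; case: (0 < a) (0 < b) => -[].
have nD (a b : R) : a != 0 -> b != 0 -> `|a| <= k3 -> `|b| <= k3 -> ~ diagram T (move_by q (vec e) (vec f) a b).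
  move=> a0 b0 ak bk; have [h _ _] := HK _ (H3 _ _ ak bk).
  by move/h; rewrite aE bE => -[] /eqP; rewrite mulf_eq0 ?oppr_eq0 (negbTE D) orbF; apply/negP.
exists (Num.min k3 (Num.min k1 k2)), (K (+) true); split; first by rewrite !lt_min k30 k10.
  move=> a b a0 b0; rewrite !le_min => /and3P[a3 a1 a2] /and3P[b3 b1 b2] p.
  have [_ hc _] := HK _ (H3 _ _ a3 b3); split.
  - exact: nD.
  - by rewrite /p hc; [rewrite aE bE -addbA sgn // !addbA | exact: nD].
  - exact: H1.
  - have := H2 b a b0 a0 b2 a2; rewrite (_ : move_by q _ _ b a = p) //.
    by apply/pl_eqP; rewrite /p /move_by /=; split; ring.
move=> a b a' b' a0 b0 a0' b0'; rewrite !le_min => /and3P[a3 _ _] /and3P[b3 _ _] /and3P[a3' _ _] /and3P[b3' _ _] ea eb.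
have [_ _ hc] := HK _ (H3 _ _ a3 b3); apply: hc; [exact: H3 | exact: nD | exact: nD | |]; rewrite !(aE, bE).
  have [Dp|Dn|D0] := ltgtP 0 (det2 (vec e) (vec f)); last by rewrite -D0 eqxx in D.
    by rewrite !pmulr_lgt0.
  by rewrite !nmulr_lgt0 // !lt0_neg // eb.
have [Dp|Dn|D0] := ltgtP 0 (det2 (vec e) (vec f)); last by rewrite -D0 eqxx in D.
  by rewrite !pmulr_lgt0 // !oppr_gt0 !lt0_neg // ea.
by rewrite !nmulr_lgt0 // !oppr_lt0.
Qed.

Definition crosses e := exists2 q, q \in X & onc e q.

Lemma walk_plain e k z : e \in T -> ~ crosses e -> adj T col e.1 k z <-> adj T col e.2 k z.
Proof.
move=> eT nc; apply: (adj_walk mixed_nd bal cT) => t t01; apply: regularP; first by exists e => //; exists t.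
by apply/negP => tX; apply: nc; exists (lerp e.1 e.2 t) => //; exists t.
Qed.

(** The successor is a permutation of the finite set of edges, so the walk from e returns to e at
    the latest and meets an edge with a crossing. On the edges without one in between the two faces
    do not change. *)
Lemma next_side e i : e \in T -> crosses e -> exists e', [/\ e' \in T, crosses e' &
  forall k z, adj T col (side e i) k z <-> adj T col (side e' (~~ i)) k z].
Proof.
move=> eT ce; pose A : finType := seq_sub T.
have [g gP] : {g : A -> A & forall x : A, side (val (g x)) (~~ i) = side (val x) i}.
  apply: (@boolp.choice A A (fun x y : A => side (val y) (~~ i) = side (val x) i)) => x.
  case: i => /=.
    by have [f fT fE] := end_start (valP x); exists (SeqSub fT).
  by have [f fT fE] := start_end (valP x); exists (SeqSub fT).
have ginj : injective g.
  move=> x y E; apply: val_inj; have := gP x; rewrite E gP.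
  case: i {gP} => /= h; [apply: inj_end | apply: inj_start] => //; exact: valP.
pose x0 : A := SeqSub eT.
pose P m := (0 < m)%N && `[< crosses (val (iter m g x0)) >].
have exP : exists m, P m.
  by exists (fingraph.order g x0); rewrite /P fingraph.order_gt0 /=; apply/asboolP; rewrite fingraph.iter_order.
case: (ex_minnP exP) => m /andP[m0 /asboolP cm] minm.
exists (val (iter m g x0)); split => //; first exact: valP.
have plain f k z : f \in T -> ~ crosses f -> adj T col (side f i) k z <-> adj T col (side f (~~ i)) k z.
  by move=> fT nc; have := walk_plain k z fT nc; case: i {gP} => /= -[h1 h2]; split.
have walk j : (j < m)%N -> forall k z, adj T col (side e i) k z <-> adj T col (side (val (iter j g x0)) i) k z.
  elim: j => // j IH jm k z; rewrite IH ?(ltnW jm) // -gP; apply: iff_sym; apply: plain; first exact: valP.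
  by move=> cj; have := minm j.+1; rewrite /P /= asboolT // leqNgt jm => /(_ isT).
move=> k z; case: m m0 cm minm walk => // m _ _ _ walk.
by rewrite (walk m (ltnSn m)) -gP.
Qed.

End Crossings.

Section Circuit.
Variable R : realType.
Local Notation pl := (R * R)%type.
Implicit Types (a b x y z q : pl) (e f : pl * pl).
Variables (T : seq (pl * pl)) (X : seq pl).
Hypothesis mT : mixed T X [::].
Hypothesis bal : perm_eq (map fst T) (map snd T).
Hypothesis one : forall e x y, e \in T -> x \in X -> y \in X -> onc e x -> onc e y -> x = y.

(** Orients the strands so that the walk leaves a crossing through the quadrant of positive
    coordinates and enters it through the negative one. *)
Definition signed (i : bool) (v : pl) : pl := if i then v else (- v.1, - v.2).

(* A closed walk through the faces, crossing the diagram straight through crossings only. *)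
Record circuit (k : nat) (q : nat -> pl) (e f : nat -> pl * pl) (s t : nat -> bool) (w : nat -> pl) (eps : R) : Prop := Circuit {
  ci_parity : k = 0%N \/ odd k;
  ci_eps : 0 < eps;
  ci_mem : forall j, (j <= k)%N -> q j \in X;
  ci_uniq : forall j l, (j < l <= k)%N -> q j != q l;
  ci_edges : forall j, (j <= k)%N -> crossing_edges T (q j) (e j) (f j);
  ci_out : forall j (a b : R), (j <= k)%N -> 0 < a <= eps -> 0 < b <= eps ->
    conn T (move_by (q j) (signed (s j) (vec (e j))) (signed (t j) (vec (f j))) a b) (w j);
  ci_in : forall j (a b : R), (j <= k)%N -> 0 < a <= eps -> 0 < b <= eps ->
    conn T (move_by (q j) (signed (s j) (vec (e j))) (signed (t j) (vec (f j))) (- a) (- b)) (w (if j is j'.+1 then j' else k));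
  ci_faces : forall j l, (j < l <= k)%N -> ~ conn T (w j) (w l) }.

Definition sv (i : bool) (k : R) : R := if i then k else - k.

Lemma sv_gt0 i (k : R) : 0 < k -> (0 < sv i k) = i.
Proof. by case: i => //= k0; rewrite oppr_gt0 ltNge ltW. Qed.

Lemma sv_neq0 i (k : R) : 0 < k -> sv i k != 0.
Proof. by move=> k0; case: i; rewrite /= ?oppr_eq0 gt_eqF. Qed.

Lemma sv_norm i (k : R) : 0 < k -> `|sv i k| = k.
Proof. by move=> k0; case: i; rewrite /= ?normrN gtr0_norm. Qed.

Lemma move_signed q (u v : pl) (i j : bool) (a b : R) :
  move_by q (signed i u) (signed j v) a b = move_by q u v (sv i a) (sv j b).
Proof. by apply/pl_eqP; case: i j => -[]; rewrite /move_by /signed /sv /=; split; ring. Qed.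

Lemma circuit_exists : (0 < size X)%N -> exists k (q : nat -> pl) (e f : nat -> pl * pl) (s t : nat -> bool) (w : nat -> pl) (eps : R), circuit k q e f s t w eps.
Proof.
move=> X0; have [col cT] := colouring bal (mixed_nondeg mT).
pose good x (D : (pl * pl) * (pl * pl) * bool) (k : R) := let: (e, f, K) := D in [/\
  forall a b : R, a != 0 -> b != 0 -> `|a| <= k -> `|b| <= k -> let p := move_by x (vec e) (vec f) a b in
   [/\ ~ diagram T p, col p = K (+) (0 < a) (+) (0 < b),
       adj T col (side e (0 < a)) (col p) p & adj T col (side f (0 < b)) (col p) p] &
  forall a b a' b' : R, a != 0 -> b != 0 -> a' != 0 -> b' != 0 ->
   `|a| <= k -> `|b| <= k -> `|a'| <= k -> `|b'| <= k -> (0 < a) = (0 < a') -> (0 < b) = (0 < b') ->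
   conn T (move_by x (vec e) (vec f) a b) (move_by x (vec e) (vec f) a' b')].
have goodW x D (k k' : R) : k' <= k -> good x D k -> good x D k'.
  case: D => [[e f] K] kk [h1 h2]; split.
    by move=> a b a0 b0 ak bk; apply: h1 => //; apply: le_trans kk.
  by move=> a b a' b' a0 b0 a0' b0' ak bk ak' bk'; apply: h2 => //; apply: le_trans kk.
have [D DP] : {D : pl -> (pl * pl) * (pl * pl) * bool & forall x, x \in X ->
    crossing_edges T x (D x).1.1 (D x).1.2 /\ exists2 k, 0 < k & good x (D x) k}.
  apply: (@boolp.choice pl _ (fun x D => x \in X -> crossing_edges T x D.1.1 D.1.2 /\ exists2 k, 0 < k & good x D k)) => x.
  have [xX|nX] := boolP (x \in X); last by exists ((x, x), (x, x), true).
  have [e [f ef]] := crossing_edgesP mT bal xX.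
  have [k [K [k0 h1 h2]]] := crossing_faces mT bal cT one xX ef.
  by exists (e, f, K) => _; split => //; exists k.
have [eps eps0 He] : exists2 eps, 0 < eps & forall x, x \in X -> good x (D x) eps.
  apply: (@uniform_pos R _ X (fun x k => good x (D x) k)).
    by move=> x k k' gk _ kk; apply: goodW gk.
  by move=> x xX; have [_] := DP x xX.
pose E x := (D x).1.1; pose F x := (D x).1.2; pose K x := (D x).2.
(* A point in the quadrant of colour h with the sign i along the first strand. The sign along the
   second strand is forced, because the colour is [K x] plus both signs. *)
pose pt h x (i : bool) := move_by x (vec (E x)) (vec (F x)) (sv i eps) (sv (i (+) h (+) K x) eps).
have ptP h x i : x \in X -> [/\ ~ diagram T (pt h x i), col (pt h x i) = h,
    adj T col (side (E x) i) h (pt h x i) & adj T col (side (F x) (i (+) h (+) K x)) h (pt h x i)].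
  move=> xX; have := He x xX; rewrite /good /pt /E /F /K; case: (D x) => [[e f] c] [h1 _].
  have [||||n ce ae af] := h1 (sv i eps) (sv (i (+) h (+) c) eps); rewrite ?sv_neq0 ?sv_norm ?lexx //.
  have chE : col (move_by x (vec e) (vec f) (sv i eps) (sv (i (+) h (+) c) eps)) = h.
    by rewrite ce !sv_gt0 //; case: (c) (i) (h) => [] [] [].
  by rewrite chE !sv_gt0 // in ae af.
(* Equality is added because [conn] is not reflexive on the diagram, whereas the combinatorial part
   wants an equivalence on all points. *)
pose r z z' := (z == z') || `[<conn T z z'>].
have rP z z' : ~ diagram T z -> r z z' -> conn T z z'.
  by move=> nz /orP[/eqP <-|/asboolP //]; apply: conn_refl.
have rr : reflexive r by move=> z; rewrite /r eqxx.
have rs : symmetric r.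
  by move=> z z'; rewrite /r eq_sym; congr (_ || _); apply: asbool_equiv_eq; split; apply: conn_sym.
have rt : transitive r.
  move=> y x z /orP[/eqP -> //|/asboolP h1] /orP[/eqP <-|/asboolP h2]; first by rewrite /r (asboolT h1) orbT.
  by rewrite /r (asboolT (conn_trans h1 h2)) orbT.
have mem x : x \in X -> E x \in T /\ F x \in T.
  by move=> /DP [[T' [p _ _ _ _]] _]; rewrite !(perm_mem p) !inE !eqxx orbT.
have [|h [k [c gc]]] := @cycle_exists pl pl r X rr rs rt pt X0.
  move=> x i j xX; have [_ cf aef aff] := ptP false x i xX; have [_ ct aet aft] := ptP true x j xX.
  have [Ex Fx] := mem x xX.
  (* Two quadrants of different colours share a half strand. With signs i and j along the first
     strand this is a half of the first strand if i = j, and of the second one otherwise. *)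
  have [g [sg [gT cg a0 a1 gE]]] : exists g sg, [/\ g \in T, crosses X g,
      adj T col (side g sg) false (pt false x i), adj T col (side g sg) true (pt true x j) &
      (i = j /\ g = E x /\ sg = i) \/ (j = ~~ i /\ g = F x /\ sg = i (+) K x)].
    have [[T' [p [t t01 te] [s s01 sf] _ _]] _] := DP x xX.
    have [ij|ij] := eqVneq i j.
      exists (E x), i; split => //; last by left.
      - by exists x => //; exists t; rewrite // !ltW //; case/andP: t01.
      - by rewrite ij.
    have {}ij : j = ~~ i by case: i j ij {cf aef aff ct aet aft} => -[].
    exists (F x), (i (+) K x); split => //; last by right.
    - by exists x => //; exists s; rewrite // !ltW //; case/andP: s01.
    - by move: aff; rewrite addbF.
    - by move: aft; rewrite ij addbT negbK.
  have [g' [g'T [y yX g'y] tr]] := next_side mT bal cT sg gT cg.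
  have rg := regular_side mT bal (~~ sg) g'T.
  have link h x1 i1 y1 i2 : adj T col (side g sg) h (pt h x1 i1) -> adj T col (side g' (~~ sg)) h (pt h y1 i2) -> r (pt h x1 i1) (pt h y1 i2).
    by move=> /tr a a'; rewrite /r (asboolT (adj_conn (mixed_nondeg mT) bal cT rg a a')) orbT.
  have [[T' [p _ _ _ far]] _] := DP y yX.
  have gEF : g' = E y \/ g' = F y.
    move: g'T; rewrite (perm_mem p) !inE => /or3P[/eqP|/eqP|g'T']; [by left | by right |].
    by case: (far _ g'T').
  case: gEF => g'E.
    exists y, (~~ sg), (~~ sg); split => //.
    - apply/negP => /eqP [yx i1 j1]; case: gE => [[ij [_ si]]|[ij _]]; last by move: ij; rewrite -j1 -i1; case: (sg).
      by move: i1; rewrite si; case: (i).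
    - by apply: link => //; rewrite g'E; have [] := ptP false y (~~ sg) yX.
    - by apply: link => //; rewrite g'E; have [] := ptP true y (~~ sg) yX.
  exists y, (~~ sg (+) K y), (sg (+) K y); split => //.
  - apply/negP => /eqP [yx i1 j1]; case: gE => [[ij _]|[_ [_ si]]].
      by move: ij; rewrite -i1 -j1; case: (sg) (K y) => [] [].
    by move: i1; rewrite yx si; case: (i) (K x) => [] [].
  - apply: link => //; rewrite g'E; have [_ _ _] := ptP false y (~~ sg (+) K y) yX.
    by rewrite addbF -addbA addbb addbF.
  - apply: link => //; rewrite g'E; have [_ _ _] := ptP true y (sg (+) K y) yX.
    by rewrite addbT addNb -addbA addbb addbF.
have [par cm cu cs cl cf] := gc.
pose q j := (c j).1; pose s j := ~~ (c j).2; pose t j := (s j) (+) h (+) K (q j).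
exists k, q, (E \o q), (F \o q), s, t, (fun j => pt h (q j) (s j)), eps; split => //.
- by move=> j jk; have [] := DP _ (cm j jk).
- move=> j a b jk /andP[a0 ae] /andP[b0 be]; rewrite move_signed /=.
  have := He _ (cm j jk); rewrite /good /pt /= /t /s /q /E /F /K; case: (D _) => [[e f] cc] [_ h2].
  by apply: h2; rewrite ?sv_neq0 ?sv_norm ?sv_gt0.
- move=> j a b jk /andP[a0 ae] /andP[b0 be]; rewrite move_signed /=.
  apply: (@conn_trans R T _ (pt h (q j) (~~ s j))).
    have E1 i (u : R) : sv i (- u) = sv (~~ i) u by case: i; rewrite /= ?opprK.
    rewrite !E1.
    have := He _ (cm j jk); rewrite /good /pt /= /t /q /E /F /K; case: (D _) => [[e f] cc] [_ h2].
    have -> : ~~ s j (+) h (+) cc = ~~ (s j (+) h (+) cc) by rewrite !addNb.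
    by apply: h2; rewrite ?sv_neq0 ?sv_norm ?sv_gt0.
  have [nd _ _ _] := ptP h (q j) (~~ s j) (cm j jk); apply: rP => //.
  rewrite /s negbK rs; case: j jk {nd} => [|j] jk; [exact: cl | exact: cs].
- move=> j l jl cn; have := cf j l jl; rewrite /inn /r -/(q j) -/(q l) -/(s j) -/(s l) asboolT ?orbT //.
Qed.

End Circuit.

Ltac nlia :=
  repeat match goal with
  | H : ?P |- _ =>
    lazymatch P with
    | is_true (leq _ _) => fail
    | is_true (andb (leq _ _) (leq _ _)) => fail
    | @eq ?T _ _ => tryif unify T nat then fail else clear H
    | nat => fail
    | _ => clear H
    end
  end; lia.

(** * Arcs inside the faces *)

Section Arcs.
Variable R : realType.
Local Notation pl := (R * R)%type.
Implicit Types (a b x y z s t d : pl) (e f : pl * pl).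

Definition ray s d (a : R) : pl := (s.1 + a * d.1, s.2 + a * d.2).

(** Only the two ends may leave V; they will lie on the diagram and the rest in a face. The germs d
    and d' are prescribed since they decide in which direction a crossing is passed and on which
    side of another path. *)
Record polyline (V : set pl) s d t d' (n : nat) (p : nat -> pl) : Prop := Polyline {
  pl_pos : (0 < n)%N;
  pl_start : p 0%N = s;
  pl_end : p n.+1 = t;
  pl_head : exists2 a, 0 < a & p 1%N = ray s d a;
  pl_last : exists2 a, 0 < a & p n = ray t d' a;
  pl_in : forall i (u : R), (i <= n)%N -> 0 <= u <= 1 -> (i = 0%N -> u != 0) -> (i = n -> u != 1) ->
    V (lerp (p i) (p i.+1) u) }.

Record arc (V : set pl) s d t d' (n : nat) (p : nat -> pl) : Prop := Arc {
  arc_polyline :> polyline V s d t d' n p;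
  arc_nondeg : forall i, (i <= n)%N -> p i <> p i.+1;
  arc_simple : forall i j (u v : R), (i < j <= n)%N -> 0 <= u < 1 -> 0 <= v < 1 ->
    lerp (p i) (p i.+1) u <> lerp (p j) (p j.+1) v }.

Lemma pl_vertex V s d t d' n p i : polyline V s d t d' n p -> (0 < i <= n)%N -> V (p i).
Proof.
move=> [n0 _ _ _ _ H] /andP[i0 iN]; rewrite -(lerp0 (p i) (p i.+1)); apply: H => //.
- by rewrite lexx ler01.
- by move=> E; rewrite E in i0.
- by move=> _; rewrite eq_sym oner_neq0.
Qed.

Lemma lerp_comp a b (u v : R) : lerp a (lerp a b u) v = lerp a b (v * u).
Proof. by apply/pl_eqP; rewrite /lerp /=; split; ring. Qed.

Lemma lerp_comp_end a b (u v : R) : lerp (lerp a b u) b v = lerp a b (u + v * (1 - u)).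
Proof. by apply/pl_eqP; rewrite /lerp /=; split; ring. Qed.

Lemma lerp_rev a b (u : R) : lerp a b u = lerp b a (1 - u).
Proof. by apply/pl_eqP; rewrite /lerp /=; split; ring. Qed.

Lemma lerp_ray s d (a u : R) : lerp s (ray s d a) u = ray s d (u * a).
Proof. by apply/pl_eqP; rewrite /lerp /ray /=; split; ring. Qed.

Lemma lerp_ray_end s d (a u : R) : lerp (ray s d a) s u = ray s d ((1 - u) * a).
Proof. by apply/pl_eqP; rewrite /lerp /ray /=; split; ring. Qed.

Section Surgery.
Variables (V : set pl) (s d t d' : pl).
Hypothesis Vs : ~ V s.
Hypothesis Vt : ~ V t.

(** The loop is cut out: the vertices from i + 1 to j, at least two, give way to the point of
    intersection. *)
Lemma shortcut n p i j (u v : R) : polyline V s d t d' n p -> (i.+1 < j <= n)%N -> 0 <= u < 1 -> 0 <= v < 1 ->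
  lerp (p i) (p i.+1) u = lerp (p j) (p j.+1) v -> exists m p', polyline V s d t d' m p' /\ (m < n)%N.
Proof.
move=> P /andP[ij jn] /andP[u0 u1] /andP[v0 v1] E; have [n0 ps pt [a a0 pa] [b b0 pb] H] := P.
set x := lerp (p i) (p i.+1) u in E.
have Vx : V x.
  rewrite E; apply: H => //; first by rewrite v0 ltW.
    by move=> j0; rewrite j0 in ij.
  by move=> _; rewrite lt_eqF.
have ui : i = 0%N -> u != 0.
  move=> i0; apply/eqP => uz; apply: Vs; rewrite -ps -[p 0%N](lerp0 _ (p 1%N)).
  by move: Vx; rewrite /x i0 uz.
have i1n : (i.+1 <= n)%N by apply: leq_trans (ltnW ij) jn.
pose c := (j - i.+1)%N; have jE : j = (i.+1 + c)%N by rewrite /c subnKC // ltnW.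
have c0 : (0 < c)%N by rewrite /c subn_gt0.
pose p' l := if (l <= i)%N then p l else if l == i.+1 then x else p (l + c)%N.
exists (n - c)%N, p'; split; last by rewrite ltn_subrL c0.
have cn : (i.+1 + c <= n)%N by rewrite -jE.
have pi1 : p' i.+1 = x by rewrite /p' ltnn eqxx.
have ple l : (l <= i)%N -> p' l = p l by rewrite /p' => ->.
have pgt l : (i.+1 < l)%N -> p' l = p (l + c)%N.
  by move=> h; rewrite /p' leqNgt (ltnW h) /= gtn_eqF.
split.
- by nlia.
- by rewrite ple.
- by rewrite -subSn ?pgt ?subnK; rewrite ?pt //; nlia.
- have [i0|i0] := posnP i; last by rewrite ple //; exists a.
  exists (u * a); first by rewrite mulr_gt0 // lt_neqAle u0 eq_sym ui.
  by rewrite -{1}i0 pi1 /x i0 ps pa lerp_ray.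
- have [jn'|jn'] := eqVneq j n.
    have -> : (n - c)%N = i.+1 by nlia.
    exists ((1 - v) * b); first by rewrite mulr_gt0 // subr_gt0.
    by rewrite pi1 E jn' pt pb lerp_ray_end.
  exists b => //; rewrite pgt; last by move/eqP: jn'; nlia.
  by rewrite subnK //; nlia.
- move=> l w ln /andP[w0 w1] l0 lnc.
  have [li|li|li] := ltngtP l i.
  + rewrite (ple l) ?(ltnW li) // (ple l.+1) //; apply: H => //; [nlia | by rewrite w0 | nlia].
  + have [l2|l2] := eqVneq l i.+1.
      rewrite l2 pi1 pgt // addSn -jE E lerp_comp_end; apply: H => //.
      * have h1 : 0 <= w * (1 - v) by rewrite mulr_ge0 // subr_ge0 ltW.
        have h2 : 0 <= (1 - w) * (1 - v) by rewrite mulr_ge0 // subr_ge0 // ltW.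
        by apply/andP; split; lra.
      * by move=> j0; rewrite j0 in ij.
      * move=> jn'; have w1' : w != 1 by apply: lnc; nlia.
        have h2 : 0 < (1 - w) * (1 - v) by rewrite mulr_gt0 // subr_gt0 // lt_neqAle w1' w1.
        by rewrite lt_eqF //; lra.
    rewrite !pgt; last 2 first.
    * by move/eqP: l2; nlia.
    * by rewrite ltn_neqAle eq_sym l2.
    by rewrite addSn; apply: H; rewrite ?w0 //; [nlia | nlia | move=> ?; apply: lnc; nlia].
  + rewrite li ple // pi1 /x lerp_comp; apply: H => //; first exact: ltnW.
    * by rewrite mulr_ge0 //= mulr_ile1 // ltW.
    * move=> i0; rewrite mulf_neq0 //; [by apply: l0; rewrite li | exact: ui].
    * by move=> iN; move: i1n; rewrite -iN ltnn.
Qed.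

Lemma drop_vertex n p i : polyline V s d t d' n p -> (i < n)%N -> (1 < n)%N ->
  (forall u : R, 0 <= u <= 1 -> (i = 0%N -> u != 0) -> (i = n.-1 -> u != 1) -> V (lerp (p i) (p i.+2) u)) ->
  (i = 0%N -> exists2 a, 0 < a & p 2%N = ray s d a) -> (i = n.-1 -> exists2 a, 0 < a & p n.-1 = ray t d' a) ->
  exists m p', polyline V s d t d' m p' /\ (m < n)%N.
Proof.
move=> [n0 ps pt hd la H] iN n1 He h0 hn.
pose p' l := if (l <= i)%N then p l else p l.+1; exists n.-1, p'; split; last by rewrite ltn_predL.
have ple l : (l <= i)%N -> p' l = p l by rewrite /p' => ->.
have pgt l : (i < l)%N -> p' l = p l.+1 by rewrite /p' [(l <= i)%N]leqNgt => ->.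
split.
- by nlia.
- by rewrite ple.
- by rewrite (prednK n0) pgt.
- have [i0|i0] := posnP i; last by rewrite ple.
  by rewrite pgt ?i0 //; apply: h0.
- have [iE|iE] := eqVneq i n.-1; first by rewrite ple ?iE // -?iE; rewrite iE; apply: hn.
  by rewrite pgt ?(prednK n0) //; move/eqP: iE; nlia.
- move=> l w ln w01 l0 lnc; have [li|li|li] := ltngtP l i.
  + by rewrite !ple ?(ltnW li) //; apply: H => //; nlia.
  + rewrite (pgt l) // (pgt l.+1) ?(leqW li) //; apply: H => //; [nlia | move=> ?; apply: lnc; nlia].
  + by rewrite ple ?li // pgt //; apply: He => //; rewrite -li.
Qed.

Lemma minimal_arc : (s = t -> forall a b : R, 0 < a -> 0 < b -> ray s d a <> ray t d' b) ->
  (exists n p, polyline V s d t d' n p) -> exists n p, arc V s d t d' n p.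
Proof.
move=> st [n0 [p0 P0]].
pose Q n := `[< exists p, polyline V s d t d' n p >].
have exQ : exists n, Q n by exists n0; apply/asboolP; exists p0.
case: (ex_minnP exQ) => n /asboolP [p P] minn; exists n, p.
have nomin m p' : polyline V s d t d' m p' -> (n <= m)%N by move=> P'; apply: minn; apply/asboolP; exists p'.
have no : ~ exists m p', polyline V s d t d' m p' /\ (m < n)%N.
  by move=> [m [p' [P' mn]]]; have := nomin _ _ P'; rewrite leqNgt mn.
have [n_0 ps pt [a a0 pa] [b b0 pb] H] := P.
have Vp i : (0 < i <= n)%N -> V (p i) by apply: pl_vertex P.
have nd i : (i <= n)%N -> p i <> p i.+1.
  move=> iN E; have [i0|i0] := posnP i.
    by apply: Vs; rewrite -ps -i0 E i0; apply: Vp; rewrite n_0.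
  have [iE|iE] := eqVneq i n; first by apply: Vt; rewrite -pt -iE -E; apply: Vp; rewrite i0.
  have {iE} ilt : (i < n)%N by rewrite ltn_neqAle iE.
  apply: no; apply: (drop_vertex (i := i) P) => //; first by nlia.
  - by move=> u u01 _ un; rewrite E; apply: H => // h; apply: un; nlia.
  - by move=> i00; rewrite i00 in i0.
  - by move=> iE; exists b => //; rewrite -pb -{1}iE E iE prednK.
split => // i j u v /andP[ij jn] u01 v01 E.
have [ij1|ij1] := leqP j i.+1; last first.
  by apply: no; apply: (shortcut (i := i) (j := j) P _ u01 v01 E); rewrite ij1.
have {ij ij1} jE : j = i.+1 by apply/eqP; rewrite eqn_leq ij1.
rewrite {}jE in jn E; have {jn} iN : (i < n)%N by [].
case/andP: u01 => u0 u1; case/andP: v01 => v0 v1.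
have v0' : 0 < v.
  rewrite lt_neqAle v0 andbT; apply/eqP => vz; move: E; rewrite -vz lerp0 -{2}(lerp1 (p i) (p i.+1)).
  by move/(lerp_inj (nd i (ltnW iN))) => uE; rewrite uE ltxx in u1.
(* The ratio of the lengths of the second edge and the first one, which it retraces. Up to 1 the
   second edge ends on the first; beyond 1 it runs over the start of the first. *)
pose mu := (1 - u) / v; have mu0 : 0 < mu by rewrite divr_gt0 // subr_gt0.
have p2E : p i.+2 = lerp (p i) (p i.+1) (1 - mu).
  have [E1 E2] := proj2 (pl_eqP _ _) E; rewrite /lerp /= in E1 E2.
  have muv : mu * v = 1 - u by rewrite /mu divfK // gt_eqF.
  apply/pl_eqP; rewrite /lerp /=; split; apply: (mulIf (lt0r_neq0 v0')).
    have : (p i.+2).1 * v = (p i.+1).1 * v + ((p i).1 - (p i.+1).1) * (1 - u) by lra.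
    by rewrite -muv => ->; ring.
  have : (p i.+2).2 * v = (p i.+1).2 * v + ((p i).2 - (p i.+1).2) * (1 - u) by lra.
  by rewrite -muv => ->; ring.
have seg_le (w : R) : mu <= 1 -> 0 <= w <= 1 -> (i = 0%N -> w != 0 /\ mu != 1) -> V (lerp (p i) (p i.+2) w).
  move=> m1 /andP[w0 w1] i0; rewrite p2E lerp_comp; apply: H; first exact: ltnW.
  - have h1 : 0 <= (1 - w) * (1 - mu) by rewrite mulr_ge0 ?subr_ge0.
    rewrite mulr_ge0 ?subr_ge0 //=; lra.
  - by move=> /i0 [wn mn]; rewrite mulf_neq0 // subr_eq0 eq_sym.
  - by move=> E'; move: iN; rewrite E' ltnn.
have rev (w : R) : 1 < mu -> lerp (p i) (p i.+2) w = lerp (p i.+1) (p i.+2) (mu^-1 + w * (1 - mu^-1)).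
  move=> m1; have mn : mu != 0 by rewrite gt_eqF.
  rewrite p2E; apply/pl_eqP; rewrite /lerp /=; split; field; exact: mn.
have pirev : 1 < mu -> p i = lerp (p i.+1) (p i.+2) mu^-1.
  by move=> m1; rewrite -[LHS](lerp0 _ (p i.+2)) rev // mul0r addr0.
have inv1 : 1 < mu -> 0 < mu^-1 < 1 by move=> m1; rewrite invr_gt0 mu0 invf_lt1.
have Vrev (w : R) : 1 < mu -> 0 <= w <= 1 -> (i.+1 = n -> w != 1) -> V (lerp (p i) (p i.+2) w).
  move=> m1 /andP[w0 w1] wn; rewrite rev //; have /andP[k0 k1] := inv1 m1.
  have h1 : 0 <= w * (1 - mu^-1) by rewrite mulr_ge0 // subr_ge0 ltW.
  have h2 : 0 <= (1 - w) * (1 - mu^-1) by rewrite mulr_ge0 // subr_ge0 // ltW.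
  apply: H => //; first by apply/andP; split; lra.
  move=> /wn w1'; have h3 : 0 < (1 - w) * (1 - mu^-1) by rewrite mulr_gt0 // subr_gt0 // lt_neqAle w1' w1.
  by rewrite lt_eqF //; lra.
have Vmu : mu <= 1 -> (i = 0%N -> mu != 1) -> V (p i.+2).
  by move=> m1 i0; rewrite -(lerp1 (p i) (p i.+2)); apply: seg_le => //; rewrite ?ler01 ?lexx // => /i0; rewrite oner_neq0.
have Vpi : 1 < mu -> V (p i).
  by move=> m1; rewrite -(lerp0 (p i) (p i.+2)); apply: Vrev => //; rewrite ?ler01 ?lexx // eq_sym oner_neq0.
have [n1|n1] := leqP n 1.
  have n1' : n = 1%N by apply/eqP; rewrite eqn_leq n1.
  have i0 : i = 0%N by move: iN; rewrite n1'; nlia.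
  have p2t : p i.+2 = t by rewrite i0 -pt n1'.
  have [m1|m1] := lerP mu 1; last by apply: Vs; rewrite -ps -i0; apply: Vpi.
  have [mE|mn] := eqVneq mu 1; last by apply: Vt; rewrite -p2t; apply: Vmu.
  apply: (st _ a b) => //.
    by rewrite -p2t p2E mE subrr lerp0 i0.
  by rewrite -pa -pb n1'.
have mi : mu <= 1 -> i = 0%N -> mu != 1.
  move=> m1 i0; apply/eqP => mE; apply: Vs; rewrite -ps.
  have <- : p 2%N = p 0%N by have := p2E; rewrite mE subrr lerp0 i0.
  exact: Vp.
apply: no; apply: (drop_vertex (i := i) P) => //.
- move=> w w01 wi wn; have [m1|m1] := lerP mu 1.
    by apply: seg_le => // i0; split; [apply: wi | apply: mi].
  by apply: Vrev => // iE; apply: wn; nlia.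
- move=> i0; have [m1|m1] := lerP mu 1; last by case: Vs; rewrite -ps -i0; apply: Vpi.
  exists ((1 - mu) * a); first by rewrite mulr_gt0 // subr_gt0 lt_neqAle mi.
  by have := p2E; rewrite i0 ps pa lerp_ray.
- move=> iE; have iE1 : i.+1 = n by nlia.
  have [m1|m1] := lerP mu 1.
    by case: Vt; rewrite -pt -iE1; apply: Vmu => //; apply: mi.
  have /andP[k0 k1] := inv1 m1; exists ((1 - mu^-1) * b); first by rewrite mulr_gt0 // subr_gt0.
  by rewrite -iE pirev // iE1 pt pb lerp_ray_end.
Qed.

End Surgery.

Lemma conn_polyline T a b : conn T a b -> exists m (p : nat -> pl), [/\ p 0%N = a, p m = b &
  forall i (u : R), (i < m)%N -> 0 <= u <= 1 -> conn T (lerp (p i) (p i.+1) u) b].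
Proof.
elim=> [x nx|x y z fr cyz [m [p [p0 pm H]]]].
  by exists 0%N, (fun=> x).
exists m.+1, (fun i => if i is i'.+1 then p i' else x); split => // -[|i] u im u01; last exact: H.
rewrite /= p0; apply: conn_step cyz => v [w [w01 ->]]; apply: fr.
rewrite /= lerp_comp_end; exists (u + w * (1 - u)); split => //.
case/andP: u01 => u0 u1; case/andP: w01 => w0 w1.
have h1 : 0 <= w * (1 - u) by rewrite mulr_ge0 // subr_ge0.
have h2 : 0 <= (1 - w) * (1 - u) by rewrite mulr_ge0 ?subr_ge0.
by apply/andP; split; lra.
Qed.

(* Among the polygonal arcs with these germs one with the fewest vertices is simple. *)
Lemma arc_exists T z s d t d' (eps : R) : 0 < eps -> diagram T s -> diagram T t ->
  (s = t -> forall a b : R, 0 < a -> 0 < b -> ray s d a <> ray t d' b) ->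
  (forall a : R, 0 < a <= eps -> conn T (ray s d a) z) -> (forall a : R, 0 < a <= eps -> conn T (ray t d' a) z) ->
  exists n p, arc (fun x => conn T x z) s d t d' n p.
Proof.
move=> e0 Ds Dt st gs gt.
have nV x : diagram T x -> ~ conn T x z by move=> Dx /conn_notin [].
apply: minimal_arc => //; [exact: nV | exact: nV |].
have ee : 0 < eps <= eps by rewrite e0 lexx.
have [m [p [p0 pm H]]] := conn_polyline (conn_trans (gs _ ee) (conn_sym (gt _ ee))).
exists m.+1, (fun i => if i is i'.+1 then (if (i' <= m)%N then p i' else t) else s); split => //.
- by rewrite ltnn.
- by exists eps; rewrite ?p0.
- by exists eps; rewrite ?leqnn ?pm.
- move=> [|i] u im /andP[u0 u1] i0 iN /=.
    have u0' : 0 < u by rewrite lt_neqAle u0 eq_sym i0.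
    by rewrite p0 lerp_ray; apply: gs; rewrite mulr_gt0 //= ler_piMl // ltW.
  rewrite ltnS in im; rewrite im; have [im'|im'] := ltnP i m.
    by apply: conn_trans (H i u im' _) (gt _ ee); rewrite u0.
  have iE : i = m by apply/eqP; rewrite eqn_leq im' im.
  rewrite iE pm lerp_ray_end; apply: gt.
  have u1' : u < 1 by rewrite lt_neqAle u1 iN ?iE.
  rewrite mulr_gt0 ?subr_gt0 //=; have h : 0 <= u * eps by rewrite mulr_ge0 // ltW.
  lra.
Qed.

End Arcs.

(** * Pushing an arc off itself *)

Section Offset.
Variable R : realType.
Local Notation pl := (R * R)%type.
Implicit Types (a b x y z s t d m : pl) (e f g : pl * pl) (T G : seq (pl * pl)).

Lemma nbh_ray x v (r : R) : 0 < r -> exists2 k, 0 < k & forall a : R, `|a| <= k -> nbh x r (ray x v a).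
Proof.
move=> r0; have [k k0 H] := nbh_move x v (0, 0) r0; exists k => // a ak.
have -> : ray x v a = move_by x v (0, 0) a 0 by apply/pl_eqP; rewrite /ray /move_by /=; split; ring.
by apply: H; rewrite // normr0 ltW.
Qed.

Lemma nbh_lerp a b a' b' (r u : R) : nbh a r a' -> nbh b r b' -> 0 <= u <= 1 -> nbh (lerp a b u) r (lerp a' b' u).
Proof.
rewrite /nbh !ltr_norml => -[/andP[a1 a2] /andP[a3 a4]] [/andP[b1 b2] /andP[b3 b4]] u01.
have H (p q : R) : - r < p -> p < r -> - r < q -> q < r -> - r < (1 - u) * p + u * q < r.
  move=> p1 p2 q1 q2.
  have h1 := @convex_gt0 R (p + r) (q + r) u; have h2 := @convex_gt0 R (r - p) (r - q) u.
  have {}h1 : 0 < (1 - u) * (p + r) + u * (q + r) by apply: h1 => //; lra.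
  have {}h2 : 0 < (1 - u) * (r - p) + u * (r - q) by apply: h2 => //; lra.
  by apply/andP; split; lra.
have e1 : (lerp a' b' u).1 - (lerp a b u).1 = (1 - u) * (a'.1 - a.1) + u * (b'.1 - b.1) by rewrite /lerp /=; ring.
have e2 : (lerp a' b' u).2 - (lerp a b u).2 = (1 - u) * (a'.2 - a.2) + u * (b'.2 - b.2) by rewrite /lerp /=; ring.
by rewrite e1 e2; split; apply: H.
Qed.

Lemma tube T a b : free T a b -> exists2 r, 0 < r & forall a' b', nbh a r a' -> nbh b r b' -> free T a' b'.
Proof.
move=> fr; suff [r r0 H] : exists2 r, 0 < r & forall u : R, 0 <= u <= 1 -> forall y, nbh (lerp a b u) r y -> ~ diagram T y.
  exists r => // a' b' na nb x [u [u01 ->]]; apply: (H u u01); exact: nbh_lerp.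
apply: (@interval_induction R (fun s t : R => exists2 r, 0 < r & forall u : R, s <= u <= t -> forall y, nbh (lerp a b u) r y -> ~ diagram T y)).
  move=> s t v _ _ [r r0 H] [r' r0' H']; exists (Num.min r r'); first by rewrite lt_min r0.
  move=> u /andP[u1 u2] y /nbh_min [n1 n2]; have [ut|ut] := lerP u t.
    by apply: (H u) => //; rewrite u1.
  by apply: (H' u) => //; rewrite u2 ltW.
move=> s s01; have [|r r0 H] := @diagram_far R T (lerp a b s); first by apply: fr; exists s.
have r20 : 0 < r / 2 by rewrite divr_gt0.
have [k k0 Hk] := lerp_near a b s r20; exists k => // s1 s2 _ _ _ _ h1 h2; exists (r / 2) => //.
move=> u /andP[u1 u2] y ny; apply: H; have [n1 n2] : nbh (lerp a b s) (r / 2) (lerp a b u) by apply: Hk; lra.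
case: ny => m1 m2; split.
  rewrite (_ : y.1 - _ = (y.1 - (lerp a b u).1) + ((lerp a b u).1 - (lerp a b s).1)); last ring.
  by apply: le_lt_trans (ler_normD _ _) _; lra.
rewrite (_ : y.2 - _ = (y.2 - (lerp a b u).2) + ((lerp a b u).2 - (lerp a b s).2)); last ring.
by apply: le_lt_trans (ler_normD _ _) _; lra.
Qed.

Definition arc_edges (n : nat) (p : nat -> pl) : seq (pl * pl) := map (fun i => (p i, p i.+1)) (iota 0 n.+1).

Lemma mem_arc_edges n p e : e \in arc_edges n p -> exists2 i, (i <= n)%N & e = (p i, p i.+1).
Proof. by move=> /mapP [i]; rewrite mem_iota /= add0n ltnS => iN ->; exists i. Qed.

Lemma diagram_cat T G x : diagram (T ++ G) x <-> diagram T x \/ diagram G x.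
Proof.
split=> [[e]|[[e eT ex]|[e eG ex]]]; last 2 first.
- by exists e; rewrite // mem_cat eT.
- by exists e; rewrite // mem_cat eG orbT.
by rewrite mem_cat => /orP[eT|eG] ex; [left|right]; exists e.
Qed.

Lemma free_sub T G a b : {subset G <= T} -> free T a b -> free G a b.
Proof. by move=> sub fr x /fr nx [e eG ex]; apply: nx; exists e => //; apply: sub. Qed.

Lemma conn_sub T G a b : {subset G <= T} -> conn T a b -> conn G a b.
Proof.
move=> sub; elim=> [x nx|x y z fr _ IH]; last by apply: conn_step IH; apply: free_sub fr.
by apply: conn_refl => -[e eG ex]; apply: nx; exists e => //; apply: sub.
Qed.

(** In the wedge spanned by the germ d and a direction m to its side, T is absent, and the edges of
    G at s run along the line of d, which b > 0 avoids. The remaining edges of G keep a distance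
    from s. *)
Lemma cone_conn T G s d m (eps : R) : 0 < eps -> det2 d m != 0 ->
  (forall a b : R, 0 <= a <= eps -> 0 < b <= eps -> ~ diagram T (move_by s d m a b)) ->
  (forall e, e \in G -> onc e s -> forall x, onc e x -> det2 d (vec (s, x)) = 0) ->
  exists2 k, 0 < k & forall a b a' b' : R, 0 <= a <= k -> 0 < b <= k -> 0 <= a' <= k -> 0 < b' <= k ->
    conn (T ++ G) (move_by s d m a b) (move_by s d m a' b').
Proof.
move=> e0 dm HT HG; have [r r0 Hr] := edges_far G s; have [k k0 Hk] := nbh_move s d m r0.
exists (Num.min eps k); first by rewrite lt_min e0.
move=> a b a' b'; rewrite !le_min => /and3P[a0 ae ak] /and3P[b0 be bk] /and3P[a0' ae' ak'] /and3P[b0' be' bk'].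
apply: conn_free => x [u [u01 ->]].
have -> : lerp (move_by s d m a b) (move_by s d m a' b') u = move_by s d m ((1 - u) * a + u * a') ((1 - u) * b + u * b').
  by apply/pl_eqP; rewrite /lerp /move_by /=; split; ring.
have B0 := convex_gt0 b0 b0' u01; case/andP: u01 => u0 u1.
have A0 : 0 <= (1 - u) * a + u * a' by rewrite addr_ge0 // mulr_ge0 // subr_ge0.
have le (p q w : R) : p <= w -> q <= w -> (1 - u) * p + u * q <= w.
  move=> pw qw; have h1 : 0 <= (1 - u) * (w - p) by rewrite mulr_ge0 // subr_ge0.
  have h2 : 0 <= u * (w - q) by rewrite mulr_ge0 // subr_ge0.
  lra.
move: A0 B0 (le _ _ _ ae ae') (le _ _ _ ak ak') (le _ _ _ be be') (le _ _ _ bk bk').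
move: (_ * a + _) (_ * b + _) => A B A0 B0 Ae Ak Be Bk.
case/diagram_cat => [|[e eG ex]]; first by apply: HT; rewrite ?A0 ?B0.
have [os|ns] := pselect (onc e s).
  have := HG e eG os _ ex; rewrite (_ : det2 _ _ = B * det2 d m); last by rewrite /det2 /vec /move_by /=; ring.
  by move/eqP; rewrite mulf_eq0 (negbTE dm) orbF gt_eqF.
apply: (Hr e eG ns _ _ ex); apply: Hk; first by rewrite ger0_norm.
by rewrite gtr0_norm.
Qed.

Section OffsetEdge.
Variables (sg : R) (y y' c nu nu' : pl).
Hypothesis cnu : 0 < sg * det2 c nu.
Hypothesis cnu' : 0 < sg * det2 c nu'.
Hypothesis cy : det2 c (vec (y, y')) = 0.

(** Four reasons why g stays clear of yy' moved slightly to the side [sg]: it is disjoint from yy';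
    it lies behind the line of yy'; or it lies behind the line of the next or the previous edge of
    the arc, before which the moved edge stays. *)
Inductive clear_of g : Prop :=
| clear_far of (forall x, onc g x -> ~ onc (y, y') x)
| clear_line of (forall x, onc g x -> sg * det2 c (vec (y, x)) <= 0)
| clear_next c' of 0 < sg * det2 c' nu' & 0 < sg * det2 c' (vec (y', y)) &
    (forall x, onc g x -> sg * det2 c' (vec (y', x)) <= 0)
| clear_prev c' of 0 < sg * det2 c' nu & 0 < sg * det2 c' (vec (y, y')) &
    (forall x, onc g x -> sg * det2 c' (vec (y, x)) <= 0).

Lemma det2_near (c' w x : pl) : 0 < sg * det2 c' (vec (w, x)) -> exists2 r, 0 < r & forall x', nbh x r x' -> 0 < sg * det2 c' (vec (w, x')).
Proof.
move=> h; pose l := lineform c' w.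
have lE z : sg * l.1.1 + sg * l.1.2 * z.1 + sg * l.2 * z.2 = sg * det2 c' (vec (w, z)).
  by rewrite -lineformE /form -/l; ring.
have [|r r0 H] := @affine_sign R (sg * l.1.1) (sg * l.1.2) (sg * l.2) x; first by rewrite lE gt_eqF.
by exists r => // x' nx; have [_] := H x' nx; rewrite !lE h.
Qed.

Lemma ray_det (c' w v x : pl) (a : R) : det2 c' (vec (w, ray x v a)) = det2 c' (vec (w, x)) + a * det2 c' v.
Proof. by rewrite /det2 /vec /ray /=; ring. Qed.

Lemma lerp_det (c' w a b : pl) (u : R) : det2 c' (vec (w, lerp a b u)) = (1 - u) * det2 c' (vec (w, a)) + u * det2 c' (vec (w, b)).
Proof. by rewrite /det2 /vec /lerp /=; ring. Qed.

Lemma vec_self (c' w : pl) : det2 c' (vec (w, w)) = 0.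
Proof. by rewrite /det2 /vec /=; ring. Qed.

Lemma offset_edge g : clear_of g -> exists2 k, 0 < k & forall e : R, 0 < e <= k -> free [:: g] (ray y nu e) (ray y' nu' e).
Proof.
have sep c' w a b : 0 < sg * det2 c' (vec (w, a)) -> 0 < sg * det2 c' (vec (w, b)) ->
    (forall x, onc g x -> sg * det2 c' (vec (w, x)) <= 0) -> free [:: g] a b.
  move=> ha hb hg x [u [u01 ->]] [g']; rewrite inE => /eqP -> /hg; rewrite lerp_det mulrDr !(mulrCA sg).
  by apply/negP; rewrite -ltNge convex_gt0.
case=> [far|line|c' h1 h2 h3|c' h1 h2 h3].
- have [|r r0 H] := @tube [:: g] y y'; first by move=> x xy [g']; rewrite inE => /eqP -> /far.
  have [k k0 Hk] := nbh_ray y nu r0; have [k' k0' Hk'] := nbh_ray y' nu' r0.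
  exists (Num.min k k'); first by rewrite lt_min k0.
  move=> e /andP[e0]; rewrite le_min => /andP[ek ek']; apply: H; [apply: Hk | apply: Hk']; rewrite gtr0_norm //.
- exists 1 => // e /andP[e0 _]; apply: (sep c y) => //; rewrite ray_det ?vec_self ?cy add0r mulrCA mulr_gt0 //.
- have [|r r0 H] := @det2_near c' y' y; first exact: h2.
  have [k k0 Hk] := nbh_ray y nu r0; exists k => // e /andP[e0 ek]; apply: (sep c' y') => //.
    by apply: H; apply: Hk; rewrite gtr0_norm.
  by rewrite ray_det vec_self add0r mulrCA mulr_gt0.
- have [|r r0 H] := @det2_near c' y y'; first exact: h2.
  have [k k0 Hk] := nbh_ray y' nu' r0; exists k => // e /andP[e0 ek]; apply: (sep c' y) => //.
    by rewrite ray_det vec_self add0r mulrCA mulr_gt0.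
  by apply: H; apply: Hk; rewrite gtr0_norm.
Qed.

Lemma offset_edges G : (forall g, g \in G -> clear_of g) ->
  exists2 k, 0 < k & forall e : R, 0 < e <= k -> free G (ray y nu e) (ray y' nu' e).
Proof.
move=> H; have [k k0 Hk] : exists2 k, 0 < k & forall g, g \in G -> forall e : R, 0 < e <= k -> free [:: g] (ray y nu e) (ray y' nu' e).
  apply: (@uniform_pos R _ G (fun g k => forall e : R, 0 < e <= k -> free [:: g] (ray y nu e) (ray y' nu' e))).
    by move=> g k k' Hk _ kk e /andP[e0 ek]; apply: Hk; rewrite e0 (le_trans ek).
  by move=> g /H /offset_edge.
exists k => // e ek x xy [g gG gx]; apply: (Hk g gG e ek x xy); exists g => //; exact: mem_head.
Qed.

End OffsetEdge.

(** The direction in which a vertex is moved must point to the same side of both its edges: the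
    normal if they are collinear, a multiple of v - u if the arc turns. *)
Lemma offset_dir (sg : R) (u v : pl) : sg != 0 -> 0 < dot u u -> (det2 u v = 0 -> 0 < dot u v) ->
  exists nu, 0 < sg * det2 u nu /\ 0 < sg * det2 v nu.
Proof.
move=> s0 u0 nf; have ss : 0 < sg * sg by rewrite -expr2 exprn_even_gt0.
have [D0|Dn] := eqVneq (det2 u v) 0.
  exists (- sg * u.2, sg * u.1); split.
    by rewrite (_ : _ * _ = sg * sg * dot u u); [rewrite mulr_gt0 | rewrite /det2 /dot /=; ring].
  by rewrite (_ : _ * _ = sg * sg * dot u v); [rewrite mulr_gt0 // nf | rewrite /det2 /dot /=; ring].
have DD : 0 < det2 u v * det2 u v by rewrite -expr2 exprn_even_gt0.
pose k := sg * det2 u v; exists (k * (v.1 - u.1), k * (v.2 - u.2)); split.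
  by rewrite (_ : _ * _ = sg * sg * (det2 u v * det2 u v)); [rewrite mulr_gt0 | rewrite /k /det2 /=; ring].
by rewrite (_ : _ * _ = sg * sg * (det2 u v * det2 u v)); [rewrite mulr_gt0 | rewrite /k /det2 /=; ring].
Qed.

Lemma antiparallel (u v : pl) : 0 < dot u u -> 0 < dot v v -> det2 u v = 0 -> dot u v <= 0 ->
  exists2 c : R, 0 < c & v = (- c * u.1, - c * u.2).
Proof.
move=> n1 n2 D0 dp; pose c := - dot u v / dot u u.
have un := lt0r_neq0 n1.
have v1 : v.1 = - c * u.1.
  apply: (mulIf un); transitivity (dot u v * u.1 - det2 u v * u.2); first by rewrite /dot /det2; ring.
  by rewrite D0 /c; field.
have v2 : v.2 = - c * u.2.
  apply: (mulIf un); transitivity (dot u v * u.2 + det2 u v * u.1); first by rewrite /dot /det2; ring.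
  by rewrite D0 /c; field.
exists c; last by apply/pl_eqP.
rewrite lt0r /c divr_ge0 ?oppr_ge0 ?(ltW n1) // andbT; apply/eqP => c0.
by move: n2; rewrite /dot v1 v2 /c c0 oppr0 !mul0r addr0 ltxx.
Qed.

Lemma arc_nofold V s d t d' n p i : arc V s d t d' n p -> (i < n)%N ->
  nofold (p i, p i.+1) (p i.+1, p i.+2).
Proof.
move=> A iN D0; rewrite ltNge; apply/negP => dp.
have nd := arc_nondeg A; have n1 := @sqnorm_gt0 R (p i, p i.+1) (nd i (ltnW iN)).
have n2 := @sqnorm_gt0 R (p i.+1, p i.+2) (nd i.+1 iN).
have [c c0 vE] := antiparallel n1 n2 D0 dp.
have m0 : 0 < Num.min 2^-1 (2 * c)^-1 by rewrite lt_min !invr_gt0 ltr0n mulr_gt0 ?ltr0n.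
pose w := Num.min 2^-1 (2 * c)^-1.
have w1 : w <= 2^-1 by rewrite ge_min lexx.
have w2 : w * c <= 2^-1.
  have : w <= (2 * c)^-1 by rewrite ge_min lexx orbT.
  by rewrite invfM -ler_pdivlMr // mulrC.
have wc : 0 < w * c by rewrite mulr_gt0.
apply: (arc_simple A (i := i) (j := i.+1) (u := 1 - w * c) (v := w)).
- by rewrite ltnSn.
- by apply/andP; split; lra.
- by rewrite ltW //=; lra.
- have v1 : (p i.+2).1 - (p i.+1).1 = - c * ((p i.+1).1 - (p i).1) by exact: (congr1 fst vE).
  have v2 : (p i.+2).2 - (p i.+1).2 = - c * ((p i.+1).2 - (p i).2) by exact: (congr1 snd vE).
  by apply/pl_eqP; rewrite /lerp /= v1 v2; split; ring.
Qed.

Lemma arc_inj V s d t d' n p i j (u v : R) : arc V s d t d' n p -> (i <= n)%N -> (j <= n)%N -> i != j ->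
  0 <= u < 1 -> 0 <= v < 1 -> lerp (p i) (p i.+1) u <> lerp (p j) (p j.+1) v.
Proof.
move=> A iN jn; rewrite neq_ltn => /orP[ij|ij] u01 v01 E.
  by apply: (arc_simple A (i := i) (j := j)) u01 v01 E; rewrite ij.
by apply: (arc_simple A (i := j) (j := i)) v01 u01 (esym E); rewrite ij.
Qed.

Lemma arc_norm V s d t d' n p i (u : R) x : polyline V s d t d' n p -> (i <= n)%N -> 0 <= u <= 1 ->
  x = lerp (p i) (p i.+1) u -> x <> t ->
  exists i' u', [/\ i' = i \/ i' = i.+1, (i' <= n)%N, 0 <= u' < 1 & x = lerp (p i') (p i'.+1) u'].
Proof.
move=> P iN /andP[u0]; rewrite le_eqVlt => /orP[/eqP -> ->|u1 xE _]; last first.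
  by exists i, u; rewrite u0; split => //; left.
rewrite lerp1 => xt; exists i.+1, 0; rewrite lerp0 lexx ltr01; split => //; first by right.
by rewrite ltn_neqAle iN andbT; apply/eqP => iE; apply: xt; rewrite iE (pl_end P).
Qed.

(* The connection is the arc, pushed off itself to one side. *)
Lemma arc_side T z s d t d' n p (sg : R) m m' (eps : R) :
  arc (fun x => conn T x z) s d t d' n p -> s <> t -> diagram T s -> diagram T t -> 0 < eps -> sg != 0 ->
  0 < sg * det2 d m -> sg * det2 d' m' < 0 ->
  (forall a b : R, 0 <= a <= eps -> 0 < b <= eps -> ~ diagram T (move_by s d m a b)) ->
  (forall a b : R, 0 <= a <= eps -> 0 < b <= eps -> ~ diagram T (move_by t d' m' a b)) ->
  exists2 k, 0 < k & forall b b' : R, 0 < b <= k -> 0 < b' <= k ->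
    conn (T ++ arc_edges n p) (ray s m b) (ray t m' b').
Proof.
move=> A st Ds Dt e0 s0 dm dm' Hs Ht; set G := arc_edges n p.
have P : polyline _ s d t d' n p := A; have [n0 ps pt [a a0 pa] [b b0 pb] H] := P.
have nface x : diagram T x -> ~ conn T x z by move=> Dx /conn_notin [].
have onp i x : (i <= n)%N -> onc (p i, p i.+1) x -> [\/ x = s /\ i = 0%N, x = t /\ i = n | conn T x z].
  move=> iN [u [u01 ->]] /=; have [[i0 uz]|h0] := pselect (i = 0%N /\ u = 0).
    by constructor 1; rewrite i0 uz lerp0 ps.
  have [[iE uo]|h1] := pselect (i = n /\ u = 1); first by constructor 2; rewrite iE uo lerp1 pt.
  constructor 3; apply: H => //; move=> iE; apply/eqP => uE; [exact: h0 | exact: h1].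
have ds : det2 d m != 0 by apply: contraTneq dm => ->; rewrite mulr0 ltxx.
have dt : det2 d' m' != 0 by apply: contraTneq dm' => ->; rewrite mulr0 ltxx.
have [k1 k10 H1] : exists2 k, 0 < k & forall a b a' b' : R, 0 <= a <= k -> 0 < b <= k -> 0 <= a' <= k -> 0 < b' <= k ->
    conn (T ++ G) (move_by s d m a b) (move_by s d m a' b').
  apply: (cone_conn e0 ds Hs) => g /mem_arc_edges [i iN ->] /(onp i s iN) [[_ i0]|[/st //]|/(nface _ Ds) //] x [u [_ ->]].
  by rewrite i0 /= ps pa lerp_ray /det2 /vec /ray /=; ring.
have [k2 k20 H2] : exists2 k, 0 < k & forall a b a' b' : R, 0 <= a <= k -> 0 < b <= k -> 0 <= a' <= k -> 0 < b' <= k ->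
    conn (T ++ G) (move_by t d' m' a b) (move_by t d' m' a' b').
  apply: (cone_conn e0 dt Ht) => g /mem_arc_edges [i iN ->] /(onp i t iN) [[/esym /st //]|[_ iE]|/(nface _ Dt) //] x [u [_ ->]].
  by rewrite iE /= pt pb lerp_ray_end /det2 /vec /ray /=; ring.
pose al := Num.min k1 (a / 2); pose al' := Num.min k2 (b / 2).
have al0 : 0 < al by rewrite lt_min k10 divr_gt0.
have al0' : 0 < al' by rewrite lt_min k20 divr_gt0.
have alk : al <= k1 by rewrite ge_min lexx.
have alk' : al' <= k2 by rewrite ge_min lexx.
have ala : al / a <= 2^-1 by rewrite ler_pdivrMr // mulrC ge_min lexx orbT.
have alb : al' / b <= 2^-1 by rewrite ler_pdivrMr // mulrC ge_min lexx orbT.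
have h20 : (2^-1 : R) < 1 by rewrite invf_lt1 ?ltr1n.
have h21 : 0 < (2^-1 : R) by rewrite invr_gt0.
(* The arc without short pieces at its ends, so that it keeps a distance from the diagram. The
   pieces left out are bridged by the two wedges above. *)
pose y i := if i == 0%N then ray s d al else if i == n.+1 then ray t d' al' else p i.
pose c i := vec (p i, p i.+1).
have c0 i : (i <= n)%N -> 0 < dot (c i) (c i) by move=> iN; apply: sqnorm_gt0; apply: (arc_nondeg A).
have [nu nuP] : {nu : nat -> pl & forall i, (i < n)%N -> 0 < sg * det2 (c i) (nu i) /\ 0 < sg * det2 (c i.+1) (nu i)}.
  apply: (@boolp.choice nat pl (fun i v => (i < n)%N -> 0 < sg * det2 (c i) v /\ 0 < sg * det2 (c i.+1) v)) => i.
  have [iN|_] := ltnP i n; last by exists s.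
  by have [v hv] := offset_dir s0 (c0 i (ltnW iN)) (arc_nofold A iN); exists v.
pose nu' i := if i == 0%N then m else if i == n.+1 then m' else nu i.-1.
have cs : c 0%N = (a * d.1, a * d.2).
  by apply/pl_eqP; rewrite /c ps pa /vec /ray /=; split; ring.
have ct : c n = (- b * d'.1, - b * d'.2).
  by apply/pl_eqP; rewrite /c pt pb /vec /ray /=; split; ring.
have nu1 i : (i <= n)%N -> 0 < sg * det2 (c i) (nu' i).
  case: i => [_|i iN]; rewrite /nu' /=.
    have -> : sg * det2 (c 0%N) m = a * (sg * det2 d m) by rewrite cs /det2 /=; ring.
    by rewrite mulr_gt0.
  by rewrite eqSS (ltn_eqF iN); have [] := nuP i iN.
have nu2 i : (i <= n)%N -> 0 < sg * det2 (c i) (nu' i.+1).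
  move=> iN; rewrite /nu' /= eqSS; have [iE|iE] := eqVneq i n.
    have -> : sg * det2 (c i) m' = b * - (sg * det2 d' m') by rewrite iE ct /det2 /=; ring.
    by rewrite mulr_gt0 // oppr_gt0.
  by have [] := nuP i; rewrite // ltn_neqAle iE.
have ylr i : (i <= n)%N -> exists l r : R, [/\ 0 <= l < 1, 0 < r <= 1 & l < r] /\
    [/\ y i = lerp (p i) (p i.+1) l, y i.+1 = lerp (p i) (p i.+1) r, i = 0%N -> 0 < l & i = n -> r < 1].
  move=> iN; rewrite /y /= eqSS (ltn_eqF (_ : (i < n.+1)%N)) //; have [i0|i0] := eqVneq i 0%N.
    have nz : (0%N == n) = false by rewrite eq_sym gtn_eqF.
    have la : 0 < al / a by rewrite divr_gt0.
    exists (al / a), 1; rewrite i0 nz; split; first by split; [clear -la ala h20; apply/andP; split; lra | rewrite ltr01 lexx | clear -ala h20; lra].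
    split; rewrite ?lerp1 //; last by move=> E; rewrite -E in n0.
    by rewrite ps pa lerp_ray divfK // gt_eqF.
  have [iE|iE] := eqVneq i n.
    have lb : 0 < al' / b by rewrite divr_gt0.
    exists 0, (1 - al' / b); rewrite lerp0 iE; split; first by split; [rewrite lexx ltr01 | clear -lb alb h20; apply/andP; split; lra | clear -lb alb h20; lra].
    split => //; last by move=> _; clear -lb; lra.
      by rewrite pt pb lerp_ray_end opprB addrC subrK divfK // gt_eqF.
    by move=> nE; move: n0; rewrite nE.
  exists 0, 1; rewrite lerp0 lerp1; split; first by rewrite !lexx ltr01.
  by split => //; move=> E; [rewrite E eqxx in i0 | rewrite E eqxx in iE].
have yface i x : (i <= n)%N -> onc (y i, y i.+1) x -> conn T x z /\ exists2 u : R, 0 <= u <= 1 & x = lerp (p i) (p i.+1) u.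
  move=> iN [w [/andP[w0 w1] ->]]; have [l [r [[/andP[l0 l1] /andP[r0 r1] lr] [-> -> h0 hn]]]] := ylr i iN.
  rewrite /= lerp_lerp; set u := l + _.
  have k1' : 0 <= w * (r - l) by rewrite mulr_ge0 // subr_ge0 ltW.
  have k2' : 0 <= (1 - w) * (r - l) by rewrite mulr_ge0 // subr_ge0 // ltW.
  have u01 : 0 <= u <= 1 by rewrite /u; clear -k1' k2' l0 r1; apply/andP; split; lra.
  split; last by exists u.
  apply: H => //; first by move=> /h0 l00; rewrite gt_eqF // /u; clear -k1' l00; lra.
  by move=> /hn r11; rewrite lt_eqF // /u; clear -k2' r11; lra.
have step i : (i <= n)%N -> exists2 k, 0 < k & forall e : R, 0 < e <= k ->
    free (T ++ G) (ray (y i) (nu' i) e) (ray (y i.+1) (nu' i.+1) e).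
  move=> iN; have [l [r [[/andP[l0 l1] /andP[r0 r1] lr] [yi yi1 h0 hn]]]] := ylr i iN.
  apply: (@offset_edges sg (y i) (y i.+1) (c i)) => [|||g]; [exact: nu1 | exact: nu2 | |].
    by rewrite yi yi1 /c (det2_lerp (p i, p i.+1)).
  rewrite mem_cat => /orP[gT|/mem_arc_edges [j jn ->]].
    apply: clear_far => x gx /(yface i x iN) [cx _]; apply: (nface x _ cx); by exists g.
  have [ji|ji] := eqVneq j i.
    apply: clear_line => x [u [_ ->]]; rewrite ji yi /c /= (det2_lerp (p i, p i.+1)) mulr0 //.
  have [ji1|ji1] := eqVneq j i.+1.
    have iN' : (i < n)%N by rewrite -ji1.
    have y1 : y i.+1 = p i.+1 by rewrite /y /= eqSS (ltn_eqF iN').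
    (* If the arc turns away from the side [sg], the next edge lies behind the line of this one. If
       it turns towards it, this edge lies before the line of the next one. *)
    have [dl|dl] := lerP (sg * det2 (c i) (c i.+1)) 0.
      apply: clear_line => x [u [/andP[u0 _] ->]]; rewrite ji1 yi.
      rewrite (_ : det2 _ _ = u * det2 (c i) (c i.+1)); last by rewrite /c /det2 /vec /lerp /=; ring.
      by rewrite mulrCA mulr_ge0_le0.
    apply: (@clear_next _ _ _ _ _ _ _ (c i.+1)).
    - by have := nu1 i.+1 iN'.
    - rewrite y1 yi (_ : _ * _ = (1 - l) * (sg * det2 (c i) (c i.+1))); first by rewrite mulr_gt0 // subr_gt0.
      by rewrite /c /det2 /vec /lerp /=; ring.
    - by move=> x [u [_ ->]]; rewrite ji1 y1 /c /det2 /vec /lerp /=; rewrite le_eqVlt; apply/orP; left; apply/eqP; ring.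
  have [ij1|ij1] := eqVneq j.+1 i.
    have y1 : y i = p i by rewrite /y -ij1 /= eqSS ltn_eqF // ij1.
    have [dl|dl] := lerP (sg * det2 (c j) (c i)) 0.
      apply: clear_line => x [u [/andP[_ u1] ->]]; rewrite y1 -ij1 /=.
      rewrite (_ : det2 _ _ = (1 - u) * det2 (c j) (c j.+1)); last by rewrite /c /det2 /vec /lerp /=; ring.
      by rewrite mulrCA mulr_ge0_le0 ?subr_ge0 // ij1.
    apply: (@clear_prev _ _ _ _ _ _ _ (c j)).
    - by rewrite -ij1; apply: nu2.
    - rewrite y1 yi1 -ij1 (_ : _ * _ = r * (sg * det2 (c j) (c j.+1))); first by rewrite mulr_gt0 // ij1.
      by rewrite /c /det2 /vec /lerp /=; ring.
    - by move=> x [u [_ ->]]; rewrite y1 -ij1 /c /det2 /vec /lerp /=; rewrite le_eqVlt; apply/orP; left; apply/eqP; ring.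
  apply: clear_far => x [v [v01 xj]] /(yface i x iN) [cx [u u01 xi]].
  have xt : x <> t by move=> E; apply: (nface t Dt); rewrite -E.
  have [i' [u' [hi i'n u'01 E1]]] := arc_norm P iN u01 xi xt.
  have [j' [v' [hj j'n v'01 E2]]] := arc_norm P jn v01 xj xt.
  apply: (arc_inj A i'n j'n _ u'01 v'01); last by rewrite -E1 -E2.
  by apply/eqP; move/eqP: ji; move/eqP: ji1; move/eqP: ij1; case: hi hj => [] -> [] ->; clear; lia.
have [k3 k30 H3] : exists2 k, 0 < k & forall i, i \in iota 0 n.+1 -> forall e : R, 0 < e <= k ->
    free (T ++ G) (ray (y i) (nu' i) e) (ray (y i.+1) (nu' i.+1) e).
  apply: (@uniform_pos R _ (iota 0 n.+1) (fun i k => forall e : R, 0 < e <= k -> free (T ++ G) (ray (y i) (nu' i) e) (ray (y i.+1) (nu' i.+1) e))).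
    by move=> i k k' Hk _ kk e /andP[e0' ek]; apply: Hk; rewrite e0' (le_trans ek).
  by move=> i; rewrite mem_iota add0n ltnS => /step.
pose e := Num.min k3 (Num.min k1 k2).
have e00 : 0 < e by rewrite !lt_min k30 k10.
have ek3 : 0 < e <= k3 by rewrite e00 ge_min lexx.
have ek1 : 0 < e <= k1 by rewrite e00 !ge_min lexx orbT.
have ek2 : 0 < e <= k2 by rewrite e00 !ge_min lexx !orbT.
have chain j : (j <= n)%N -> conn (T ++ G) (ray (y 0%N) (nu' 0%N) e) (ray (y j.+1) (nu' j.+1) e).
  elim: j => [_|j IH jn]; first by apply: conn_free; apply: H3 => //; rewrite mem_iota.
  apply: conn_trans (IH (ltnW jn)) _; apply: conn_free; apply: H3 => //; by rewrite mem_iota add0n ltnS.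
have yE0 : ray (y 0%N) (nu' 0%N) e = move_by s d m al e by apply/pl_eqP; rewrite /ray /move_by /y /nu' /=.
have yEn : ray (y n.+1) (nu' n.+1) e = move_by t d' m' al' e by apply/pl_eqP; rewrite /ray /move_by /y /nu' /= eqxx.
have rE x (u v : pl) (w : R) : ray x v w = move_by x u v 0 w by apply/pl_eqP; rewrite /ray /move_by /=; split; ring.
exists (Num.min k1 k2); first by rewrite lt_min k10.
move=> w w'; rewrite !le_min => /and3P[w0 wk1 _] /and3P[w0' _ wk2'].
have cz := chain n (leqnn n); rewrite yE0 yEn in cz.
rewrite (rE s d) (rE t d'); apply: conn_trans (conn_trans _ cz) _.
  by apply: H1; rewrite ?lexx ?(ltW k10) ?(ltW al0) ?w0.
by apply: H2; rewrite ?lexx ?(ltW k20) ?(ltW al0') ?w0'.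
Qed.

End Offset.

(** * Joining the arcs of consecutive faces *)

Section Chains.
Variable R : realType.
Local Notation pl := (R * R)%type.
Implicit Types (a b c x y z : pl) (e f g : pl * pl).

Lemma cnt_cat (T G : seq (pl * pl)) x : cnt (T ++ G) x = (cnt T x + cnt G x)%N.
Proof. exact: count_cat. Qed.

Lemma cnt_cons e (T : seq (pl * pl)) x : cnt (e :: T) x = (`[< on e x >] + cnt T x)%N.
Proof. by []. Qed.

Lemma cnt_gt0P (T : seq (pl * pl)) x : (0 < cnt T x)%N <-> exists2 e, e \in T & on e x.
Proof.
rewrite /cnt -has_count; split=> [/hasP [e eT /asboolP oe]|[e eT oe]]; first by exists e.
by apply/hasP; exists e => //; apply/asboolP.
Qed.

Lemma on_split a b (v : R) x : a <> b -> 0 < v < 1 ->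
  (`[< on (a, b) x >] : nat) = (`[< on (a, lerp a b v) x >] + `[< on (lerp a b v, b) x >])%N.
Proof.
move=> ab /andP[v0 v1]; have h2 : path <%R (0 : R) [:: v; 1] by rewrite /= v0 v1.
have h1 : path <%R (0 : R) [:: 1] by rewrite /= ltr01.
have := cnt_subdiv x ab h2; have := cnt_subdiv x ab h1.
by rewrite /= /consec /= !lerp0 !lerp1 /cnt /= !addn0 => -> ->.
Qed.

Lemma consec_mapI (p : nat -> pl) i m : consec (map p (iota i m.+1)) = map (fun j => (p j, p j.+1)) (iota i m).
Proof.
elim: m i => // m IH i; rewrite [iota i m.+2]/= [map p _]/= [iota i m.+1]/= [RHS]/= -IH.
by rewrite [iota i.+1 m.+1]/= [map p (_ :: _)]/= consec_cons2.
Qed.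

Definition inner_vertices (n : nat) (p : nat -> pl) := map p (iota 1 n).

Lemma arc_edgesE n p : arc_edges n p = consec (p 0%N :: rcons (inner_vertices n p) (p n.+1)).
Proof.
rewrite /arc_edges -consec_mapI /inner_vertices; congr consec.
by rewrite -[iota 0 n.+2]/(0%N :: iota 1 n.+1) iota_rcons map_cons map_rcons add1n.
Qed.

Section OneArc.
Variables (V : set pl) (s d t d' : pl) (n : nat) (p : nat -> pl).
Hypothesis A : arc V s d t d' n p.

Lemma arc_cnt x : (cnt (arc_edges n p) x <= 1)%N.
Proof.
apply: (@count_le1_nth _ _ (p 0%N, p 1%N)) => i j ij; rewrite size_map size_iota => jn.
have iN := ltn_trans ij jn.
rewrite !(nth_map 0%N) ?size_iota // !nth_iota // !add0n => /asboolP [u [u01 xu]] /asboolP [v [v01 xv]].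
by apply: (arc_simple A (i := i) (j := j)) u01 v01 _; rewrite ?ij // -xu -xv.
Qed.

Lemma arc_points x : (0 < cnt (arc_edges n p) x)%N -> x = s \/ V x.
Proof.
move=> /cnt_gt0P [e /mem_arc_edges [i iN ->] [u [/andP[u0 u1] ->]]] /=.
have P : polyline V s d t d' n p := A; have [n0 ps pt _ _ H] := P.
have [[i0 uz]|h0] := pselect (i = 0%N /\ u = 0); first by left; rewrite i0 uz lerp0 ps.
right; apply: H => //; first by rewrite u0 ltW.
  by move=> iz; apply/eqP => uz; apply: h0.
by move=> _; rewrite lt_eqF.
Qed.

Lemma arc_cnt_start : cnt (arc_edges n p) s = 1%N.
Proof.
apply/eqP; rewrite eqn_leq arc_cnt; apply/cnt_gt0P; exists (p 0%N, p 1%N).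
  by rewrite /arc_edges /= mem_head.
by have <- := pl_start A; apply: on_start.
Qed.

End OneArc.

Section Chain.
Variables (k : nat) (V : nat -> set pl) (s d t d' : nat -> pl) (n : nat -> nat) (p : nat -> nat -> pl).
Hypothesis A : forall j, (j <= k)%N -> arc (V j) (s j) (d j) (t j) (d' j) (n j) (p j).
Hypothesis join : forall j, (j < k)%N -> t j = s j.+1 /\ d' j = (- (d j.+1).1, - (d j.+1).2).

(** The joints are left out of the list of vertices: they are crossings, and no vertex may lie on a
    crossing. *)
Fixpoint chain_vertices j := if j is j'.+1 then chain_vertices j' ++ inner_vertices (n j) (p j) else inner_vertices (n 0%N) (p 0%N).
Definition chain_edges j := consec (s 0%N :: rcons (chain_vertices j) (t j)).

Lemma inner_head j : (j <= k)%N -> exists u U, inner_vertices (n j) (p j) = u :: U /\ exists2 a, 0 < a & u = ray (s j) (d j) a.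
Proof.
move=> jk; have P := A jk; have hd := pl_head P; have := pl_pos P.
by rewrite /inner_vertices; case: (n j) => // m _; exists (p j 1%N), (map (p j) (iota 2 m)).
Qed.

Lemma inner_last j : (j <= k)%N -> exists u U, inner_vertices (n j) (p j) = rcons U u /\ exists2 a, 0 < a & u = ray (t j) (d' j) a.
Proof.
move=> jk; have P := A jk; have la := pl_last P; have := pl_pos P.
rewrite /inner_vertices; case: (n j) la => // m la _; exists (p j m.+1), (map (p j) (iota 1 m)); split => //.
by rewrite iota_rcons map_rcons add1n.
Qed.

Lemma chain_last j : (j <= k)%N -> exists u U, chain_vertices j = rcons U u /\ exists2 a, 0 < a & u = ray (t j) (d' j) a.
Proof.
move=> jk; have [u [U [E ua]]] := inner_last jk; case: j jk E ua => [|j] jk E ua; first by exists u, U.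
by exists u, (chain_vertices j ++ U); rewrite /= E rcons_cat.
Qed.

(* Passing from one arc to the next replaces two collinear edges meeting at [s j.+1] by their union. *)
Lemma chain_step j : (j < k)%N -> exists E1 a b E2 v, [/\ chain_edges j = rcons E1 (a, s j.+1),
    arc_edges (n j.+1) (p j.+1) = (s j.+1, b) :: E2, chain_edges j.+1 = E1 ++ (a, b) :: E2 &
    [/\ a <> b, 0 < v < 1, s j.+1 = lerp a b v & exists2 c, c != 0 & vec (a, b) = (c * (d j.+1).1, c * (d j.+1).2)]].
Proof.
move=> jk; have [tE dE] := join jk.
have [a [U [aU [al al0 aE]]]] := chain_last (ltnW jk); have [b [U' [bU [be be0 bE]]]] := inner_head jk.
rewrite tE dE in aE.
exists (consec (s 0%N :: rcons U a)), a, b, (consec (b :: rcons U' (t j.+1))), (al / (al + be)).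
have sn : al + be != 0 by rewrite gt_eqF // addr_gt0.
split.
- by rewrite /chain_edges aU tE -!rcons_cons consec_rcons2.
- rewrite arc_edgesE bU rcons_cons consec_cons2 (pl_start (A jk)) (pl_end (A jk)) //.
- rewrite /chain_edges /= aU bU rcons_cat cat_rcons rcons_cons.
  have -> : s 0%N :: U ++ a :: b :: rcons U' (t j.+1) = (s 0%N :: U) ++ a :: (b :: rcons U' (t j.+1)) by [].
  by rewrite consec_cat consec_cons2.
split.
- move=> E; have := arc_nondeg (A jk) (leq0n _); rewrite (pl_start (A jk)).
  have [n0 _ _ _ _ _] := arc_polyline (A jk); move=> nd; apply: nd.
  have b1 : p j.+1 1%N = b by move: bU; rewrite /inner_vertices; case: (n j.+1) n0 => // m _ [].
  have [E1 E2] := proj2 (pl_eqP _ _) (etrans (esym aE) (etrans E bE)).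
  rewrite /ray /= in E1 E2.
  have d1 : (al + be) * (d j.+1).1 = 0 by lra.
  have d2 : (al + be) * (d j.+1).2 = 0 by lra.
  move/eqP: d1; rewrite mulf_eq0 (negbTE sn) => /eqP d1; move/eqP: d2; rewrite mulf_eq0 (negbTE sn) => /eqP d2.
  by rewrite b1 bE; apply/pl_eqP; rewrite /ray /= d1 d2 !mulr0 !addr0.
- by rewrite divr_gt0 ?addr_gt0 //= ltr_pdivrMr ?addr_gt0 // mul1r ltrDl.
- by rewrite aE bE; apply/pl_eqP; rewrite /lerp /ray /=; split; field.
- by exists (al + be) => //; rewrite aE bE; apply/pl_eqP; rewrite /vec /ray /=; split; ring.
Qed.

Lemma chain_cnt j x : (j <= k)%N -> cnt (chain_edges j) x = (\sum_(i < j.+1) cnt (arc_edges (n i) (p i)) x)%N.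
Proof.
elim: j => [_|j IH jk].
  by rewrite big_ord_recr big_ord0 /= add0n /chain_edges arc_edgesE (pl_start (A (leq0n k))) (pl_end (A (leq0n k))).
rewrite big_ord_recr /= -IH ?(ltnW jk) //; have [E1 [a [b [E2 [v [-> -> -> [ab v01 sE _]]]]]]] := chain_step jk.
by rewrite cnt_cat -cats1 cnt_cat !cnt_cons (on_split x ab v01) -sE /= !addnA addn0.
Qed.

Lemma chain_nondeg j e : (j <= k)%N -> e \in chain_edges j -> e.1 <> e.2.
Proof.
have arcnd i : (i <= k)%N -> forall f, f \in arc_edges (n i) (p i) -> f.1 <> f.2.
  by move=> ik f /mem_arc_edges [l ln ->]; apply: (arc_nondeg (A ik)).
elim: j e => [|j IH] e jk.
  rewrite /chain_edges -(pl_start (A jk)) -(pl_end (A jk)) -arc_edgesE; exact: arcnd.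
have [E1 [a [b [E2 [v [c1 c2 -> [ab _ _ _]]]]]]] := chain_step jk.
rewrite mem_cat inE => /or3P[eE|/eqP -> //|eE].
  by apply: IH; [exact: ltnW | rewrite c1 mem_rcons inE eE orbT].
by apply: (arcnd _ jk); rewrite c2 inE eE orbT.
Qed.

Lemma consec_next (l : seq pl) x0 e : e \in consec l -> e.2 = last x0 l \/ exists2 f, f \in consec l & f.1 = e.2.
Proof.
elim: l => [|x [|y l] IH] //; rewrite consec_cons2 inE => /orP[/eqP ->|/IH [h|[f fl fe]]].
- case: l {IH} => [|z l]; first by left.
  by right; exists (y, z) => //; rewrite consec_cons2 !inE eqxx orbT.
- by left.
- by right; exists f; rewrite // inE fl orbT.
Qed.

Hypothesis Vdisj : forall i j x, (i < j <= k)%N -> V i x -> ~ V j x.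
Hypothesis Vs : forall i j, (i <= k)%N -> (j <= k)%N -> ~ V i (s j).
Hypothesis sdisj : forall i j, (i < j <= k)%N -> s i <> s j.

Lemma chain_arc_unique i j x : (i <= k)%N -> (j <= k)%N -> (0 < cnt (arc_edges (n i) (p i)) x)%N ->
  (0 < cnt (arc_edges (n j) (p j)) x)%N -> i = j.
Proof.
wlog ij : i j / (i <= j)%N.
  move=> H ik jk hi hj; have [ij|/ltnW ji] := leqP i j; first exact: H.
  by apply: esym; apply: H.
move=> ik jk /(arc_points (A ik)) hi /(arc_points (A jk)) hj; apply/eqP; rewrite eqn_leq ij leqNgt; apply/negP => lt.
have ltk : (i < j <= k)%N by rewrite lt.
case: hi hj => [xi|Vi] [xj|Vj].
- by apply: (sdisj ltk); rewrite -xi -xj.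
- by apply: (Vs jk ik); rewrite -xi.
- by apply: (Vs ik jk); rewrite -xj.
- exact: (Vdisj ltk Vi Vj).
Qed.

Lemma chain_cnt1 i x : (i <= k)%N -> (0 < cnt (arc_edges (n i) (p i)) x)%N -> cnt (chain_edges k) x = 1%N.
Proof.
move=> ik ci; rewrite chain_cnt // (bigD1 (Ordinal (ik : (i < k.+1)%N))) //= big1 => [|j ji].
  by rewrite addn0; apply/eqP; rewrite eqn_leq (arc_cnt (A ik)).
apply/eqP; rewrite -leqn0 leqNgt; apply/negP => cj; move/negP: ji; apply; apply/eqP/val_inj => /=.
by apply: esym; apply: chain_arc_unique ci cj => //; rewrite -ltnS.
Qed.

Lemma chain_on x : (0 < cnt (chain_edges k) x)%N -> exists2 i, (i <= k)%N & (0 < cnt (arc_edges (n i) (p i)) x)%N.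
Proof.
rewrite chain_cnt // lt0n => h; have [[i H]|no] := pselect (exists i : 'I_k.+1, (0 < cnt (arc_edges (n i) (p i)) x)%N).
  by exists i => //; rewrite -ltnS.
case/eqP: h; apply: big1 => i _; apply/eqP; rewrite -leqn0 leqNgt; apply/negP => ci; apply: no; by exists i.
Qed.

Lemma chain_le1 x : (cnt (chain_edges k) x <= 1)%N.
Proof. by case: (posnP (cnt (chain_edges k) x)) => [->|/chain_on [i ik] /(chain_cnt1 ik) ->]. Qed.

Lemma chain_pass j : (j < k)%N -> forall e, e \in chain_edges k -> on e (s j.+1) ->
  exists2 c, c != 0 & vec e = (c * (d j.+1).1, c * (d j.+1).2).
Proof.
move=> jk; have ex m : (j < m <= k)%N -> exists e, [/\ e \in chain_edges m, on e (s j.+1) &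
    exists2 c, c != 0 & vec e = (c * (d j.+1).1, c * (d j.+1).2)].
  elim: m => // m IH /andP[]; rewrite ltnS leq_eqVlt => /orP[/eqP <- _|jm mk].
    have [E1 [a [b [E2 [v [_ _ -> [ab /andP[v0 v1] sE h]]]]]]] := chain_step jk.
    by exists (a, b); split => //; [rewrite mem_cat mem_head orbT | exists v; rewrite sE (ltW v0) v1].
  have [|e [eC oe h]] := IH; first by rewrite jm ltnW.
  have [E1 [a [b [E2 [v [c1 c2 cE [ab /andP[v0 v1] sE [c c0 vE]]]]]]]] := chain_step mk.
  (* If an arc has few vertices, the edge through the joint can be the last one of the chain and is
     prolonged by the next step; its direction changes only by a factor. *)
  move: eC; rewrite c1 mem_rcons inE => /orP[/eqP eE|eE]; last first.
    by exists e; split; rewrite // cE mem_cat eE.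
  exists (a, b); split; first by rewrite cE mem_cat mem_head orbT.
    move: oe; rewrite eE => -[u [/andP[u0 u1] ->]]; exists (u * v); rewrite /= sE lerp_comp; split => //.
    rewrite mulr_ge0 ?(ltW v0) //=; apply: lt_trans v1; by rewrite -[ltRHS]mul1r ltr_pM2r.
  case: h => c' c'0; rewrite eE => vE'; exists (c' / v); first by rewrite mulf_neq0 ?invr_eq0 // gt_eqF.
  have [E3 E4] := proj2 (pl_eqP _ _) vE'; have vn : v != 0 by rewrite gt_eqF.
  rewrite sE /vec /lerp /= in E3 E4.
  have E5 : v * (b.1 - a.1) = c' * (d j.+1).1 by lra.
  have E6 : v * (b.2 - a.2) = c' * (d j.+1).2 by lra.
  apply/pl_eqP; rewrite /vec /=; split; apply: (mulfI vn); [rewrite E5 | rewrite E6]; field; exact: vn.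
move=> e eC oe; have [|f [fC of_ h]] := ex k; first by rewrite jk leqnn.
suff -> : e = f by [].
by apply: (count_le1_eq (chain_le1 (s j.+1))) => //; apply/asboolP.
Qed.

End Chain.
End Chains.

Section Detours.
Variable R : realType.
Local Notation pl := (R * R)%type.
Implicit Types (a b c x y z : pl) (e f g : pl * pl).

Definition detour_edges a b (ws : seq pl) := consec (a :: rcons ws b).

(* A polygonal path that leaves the diagram at [a], comes back at [b] and in between meets it only at
   the crossings [q 1], ..., [q k], in the given directions. *)
Record detour (T : seq (pl * pl)) a b (k : nat) (q D : nat -> pl) (ws : seq pl) : Prop := Detour {
  dt_nondeg : forall e, e \in detour_edges a b ws -> e.1 <> e.2;
  dt_le1 : forall x, (cnt (detour_edges a b ws) x <= 1)%N;
  dt_points : forall e x, e \in detour_edges a b ws -> onc e x ->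
    [\/ x = a, x = b, exists2 i, (0 < i <= k)%N & x = q i | ~ diagram T x];
  dt_start : cnt (detour_edges a b ws) a = 1%N;
  dt_end : cnt (detour_edges a b ws) b = 0%N;
  dt_pass : forall i, (0 < i <= k)%N -> cnt (detour_edges a b ws) (q i) = 1%N;
  dt_starts : forall e, e \in detour_edges a b ws -> e.1 = a \/ ~ diagram T e.1;
  dt_ends : forall e, e \in detour_edges a b ws -> e.2 = b \/ ~ diagram T e.2;
  dt_dir : forall i e, (0 < i <= k)%N -> e \in detour_edges a b ws -> on e (q i) ->
    exists2 c, c != 0 & vec e = (c * (D i).1, c * (D i).2) }.

Lemma mem_consec_pair (A : eqType) (l : seq A) (a x y : A) : (x, y) \in consec (a :: l) ->
  x \in belast a l /\ y \in l.
Proof.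
elim: l a => [|b l IH] a; first by rewrite in_nil.
rewrite consec_cons2 in_cons => /orP[/eqP[-> ->]|/IH [h1 h2]].
  by split; [exact: mem_head | rewrite eqxx].
by rewrite /= !in_cons h1 h2 !orbT.
Qed.

Lemma consec_rev (A : eqType) (l : seq A) : consec (rev l) = rev (map (fun e : A * A => (e.2, e.1)) (consec l)).
Proof.
elim: l => [|x [|y l] IH] //; rewrite consec_cons2 map_cons [RHS]rev_cons -IH [rev (x :: _)]rev_cons.
by rewrite [rev (y :: l)]rev_cons consec_rcons2.
Qed.

Lemma on_swap a b x : a <> b -> (`[< on (a, b) x >] + (x == b) = `[< on (b, a) x >] + (x == a))%N.
Proof.
move=> ab; have inj := lerp_inj ab.
have oa : on (a, b) a by apply: on_start. have ob : on (b, a) b by apply: on_start.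
have nb : ~ on (a, b) b.
  by move=> [u [/andP[_ u1] E]]; move: u1; rewrite -(inj 1 u) ?ltxx // lerp1.
have na : ~ on (b, a) a.
  by move=> [u [/andP[_ u1] E]]; move: u1; rewrite -(lerp_inj (not_eq_sym ab) (x1 := 1) (x2 := u)) ?ltxx // lerp1.
have [->|xb] := eqVneq x b.
  by rewrite (asboolF nb) (asboolT ob) eq_sym; move/eqP/negbTE: ab => ->.
have [->|xa] := eqVneq x a; first by rewrite (asboolF na) (asboolT oa).
congr (_ + _)%N; congr nat_of_bool; apply: asbool_equiv_eq.
have H c d : x != c -> on (c, d) x -> on (d, c) x.
  move=> xc [u [/andP[u0 u1] xE]]; exists (1 - u); split; last by rewrite xE /= lerp_rev.
  have u0' : 0 < u by rewrite lt_neqAle u0 andbT; apply: contraNneq xc => u00; rewrite xE -u00 lerp0.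
  by apply/andP; split; lra.
by split; apply: H.
Qed.

(** Half-open edges miss the last point of a path; reversal exchanges the end that is missed. *)
Lemma cnt_rev (l : seq pl) x0 x : (forall e, e \in consec l -> e.1 <> e.2) -> l <> [::] ->
  (cnt (consec (rev l)) x + (x == head x0 l) = cnt (consec l) x + (x == last x0 l))%N.
Proof.
rewrite consec_rev /cnt count_rev count_map.
elim: l => [|a [|b l] IH] // nd _; rewrite consec_cons2 [LHS]/= [in RHS]/=.
have {}IH := IH (fun e he => nd e (mem_behead (s := (a, b) :: consec (b :: l)) he)) (fun h => ltac:(discriminate h)).
have ab : a <> b by apply: (nd (a, b)); rewrite consec_cons2 mem_head.
have := on_swap x ab; rewrite [head _ _]/= [last _ _]/= in IH *; move: IH.
rewrite /preim /=; set c1 := count _ _; set c2 := count _ _; lia.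
Qed.

Lemma detour_rev T a b k q D ws : a <> b -> diagram T a -> diagram T b -> (forall i, (0 < i <= k)%N -> diagram T (q i)) ->
  (forall i, (0 < i <= k)%N -> a <> q i /\ b <> q i) ->
  detour T a b k q D ws -> detour T b a k q D (rev ws).
Proof.
move=> ab Da Db Dq nq [h1 h2 h3 h4 h5 h6 h7 h8 h9].
have E : detour_edges b a (rev ws) = rev (map (fun e : pl * pl => (e.2, e.1)) (detour_edges a b ws)).
  by rewrite /detour_edges -consec_rev rev_cons rev_rcons.
have mE e : e \in detour_edges b a (rev ws) -> (e.2, e.1) \in detour_edges a b ws.
  by rewrite E mem_rev => /mapP [[x y] xy ->].
have cE x : (cnt (detour_edges b a (rev ws)) x + (x == a) = cnt (detour_edges a b ws) x + (x == b))%N.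
  have := @cnt_rev (a :: rcons ws b) a x h1 (fun h => ltac:(discriminate h)).
  by rewrite /= last_rcons rev_cons rev_rcons.
have ba : (b == a) = false by apply/eqP => ba; apply: ab.
have ca : cnt (detour_edges b a (rev ws)) a = 0%N.
  by have := cE a; rewrite eqxx h4 eq_sym ba addn1 addn0 => -[].
have cb : cnt (detour_edges b a (rev ws)) b = 1%N by have := cE b; rewrite eqxx h5 ba addn0.
have cq x : x <> a -> x <> b -> cnt (detour_edges b a (rev ws)) x = cnt (detour_edges a b ws) x.
  by move=> /eqP/negbTE xa /eqP/negbTE xb; have := cE x; rewrite xa xb !addn0.
have rv e x : onc e x -> onc (e.2, e.1) x by case: e => u v; apply: onc_rev.
split => //.
- by move=> e /mE /h1 /= n1 n2; apply: n1.
- move=> x; have [->|/eqP xa] := eqVneq x a; first by rewrite ca.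
  by have [->|/eqP xb] := eqVneq x b; [rewrite cb | rewrite cq].
- move=> e x /mE eE /rv /(h3 _ _ eE) [|||]; by [constructor 2 | constructor 1 | constructor 3 | constructor 4].
- by move=> i ik; have [na nb] := nq i ik; rewrite cq ?h6 // => E'; [apply: na | apply: nb].
- by move=> e /mE /h8.
- by move=> e /mE /h7.
- move=> i e ik /mE eE [u [/andP[u0 u1] xE]].
  have u0' : 0 < u.
    rewrite lt_neqAle u0 andbT; apply/eqP => u00; rewrite -u00 lerp0 in xE.
    have := h8 _ eE; rewrite /= -xE => -[E'|]; last by move=> nD; apply: nD; apply: Dq.
    by have [_] := nq i ik; rewrite E'.
  have [|c c0 vE] := h9 i _ ik eE.
    exists (1 - u); split; last by rewrite xE /= lerp_rev.
    by apply/andP; split; lra.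
  exists (- c); first by rewrite oppr_eq0.
  have v1 : e.1.1 - e.2.1 = c * (D i).1 by exact: (congr1 fst vE).
  have v2 : e.1.2 - e.2.2 = c * (D i).2 by exact: (congr1 snd vE).
  by apply/pl_eqP; rewrite /vec /=; split; lra.
Qed.

Section FromArcs.
Variables (T : seq (pl * pl)) (k : nat) (q w : nat -> pl).
Variables (V : nat -> set pl) (s d t d' : nat -> pl) (n : nat -> nat) (p : nat -> nat -> pl).
Hypothesis A : forall j, (j <= k)%N -> arc (V j) (s j) (d j) (t j) (d' j) (n j) (p j).
Hypothesis join : forall j, (j < k)%N -> t j = s j.+1 /\ d' j = (- (d j.+1).1, - (d j.+1).2).
Hypothesis sq : forall j, (0 < j <= k)%N -> s j = q j.
Hypothesis VT : forall j x, (j <= k)%N -> V j x -> conn T x (w j).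
Hypothesis wdisj : forall i j, (i < j <= k)%N -> ~ conn T (w i) (w j).
Hypothesis Ds : forall j, (j <= k)%N -> diagram T (s j).
Hypothesis Dt : diagram T (t k).
Hypothesis sdisj : forall i j, (i < j <= k)%N -> s i <> s j.
Hypothesis tdisj : forall j, (j <= k)%N -> t k <> s j.

Let Vdisj i j x : (i < j <= k)%N -> V i x -> ~ V j x.
Proof.
move=> /andP[ij jk] /(VT (leq_trans (ltnW ij) jk)) h1 /(VT jk) h2.
by apply: (wdisj (i := i) (j := j)); [rewrite ij | apply: conn_trans (conn_sym h1) h2].
Qed.

Let Vn i x : (i <= k)%N -> V i x -> ~ diagram T x.
Proof. by move=> ik /(VT ik) /conn_notin []. Qed.

Let Vs i j : (i <= k)%N -> (j <= k)%N -> ~ V i (s j).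
Proof. by move=> ik jk /(Vn ik); apply; apply: Ds. Qed.

(** The arcs lie in different faces, so the chain is simple, and it meets the diagram only where the
    arcs start and at its end. *)
Lemma chain_detour : detour T (s 0%N) (t k) k q d (chain_vertices n p k).
Proof.
have kk := leqnn k.
have on_pts x : (0 < cnt (chain_edges s t n p k) x)%N -> (exists2 i, (i <= k)%N & x = s i) \/ ~ diagram T x.
  by move=> /(chain_on A join) [i ik] /(arc_points (A ik)) [->|/(Vn ik)]; [left; exists i | right].
have ends e : e \in chain_edges s t n p k -> e.2 = t k \/ exists2 f, f \in chain_edges s t n p k & f.1 = e.2.
  by move=> /(consec_next (s 0%N)) [|h]; [rewrite /= last_rcons; left | right].
have verts x : x \in chain_vertices n p k -> ~ diagram T x.
  have inner j : (j <= k)%N -> x \in inner_vertices (n j) (p j) -> ~ diagram T x.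
    move=> jk /mapP [l]; rewrite mem_iota add1n ltnS => ln ->.
    by apply: (Vn jk); apply: (pl_vertex (A jk)).
  elim: {1 3}k (kk) => [|j IH] jk /=; first exact: inner.
  by rewrite mem_cat => /orP[/IH|/inner]; apply; rewrite // ltnW.
have starts e : e \in chain_edges s t n p k -> e.1 = s 0%N \/ ~ diagram T e.1.
  case: e => x y /mem_consec_pair [+ _]; rewrite belast_rcons in_cons => /orP[/eqP ->|/verts]; by [left|right].
split.
- by move=> e; apply: (chain_nondeg A join kk).
- exact: (chain_le1 A join Vdisj Vs sdisj).
- move=> e x eE; rewrite oncE => -[oe|->].
    have /on_pts [[i ik ->]|nD] : (0 < cnt (chain_edges s t n p k) x)%N by apply/cnt_gt0P; exists e.
      by case: i ik => [|i] ik; [constructor 1 | constructor 3; exists i.+1; rewrite ?ik // sq ?ik].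
    by constructor 4.
  case: (ends e eE) => [->|[f fE <-]]; first by constructor 2.
  by case: (starts f fE) => [->|]; [constructor 1 | constructor 4].
- by apply: (chain_cnt1 A join Vdisj Vs sdisj (leq0n k)); rewrite (arc_cnt_start (A (leq0n k))).
- apply/eqP; rewrite -leqn0 leqNgt; apply/negP => /on_pts [[i ik]|]; first exact: tdisj.
  by apply.
- move=> i /andP[i0 ik]; rewrite -sq ?i0 //.
  by apply: (chain_cnt1 A join Vdisj Vs sdisj ik); rewrite (arc_cnt_start (A ik)).
- exact: starts.
- by case=> x y /mem_consec_pair [_]; rewrite mem_rcons in_cons => /orP[/eqP ->|/verts h]; [left|right].
- case=> // i e /andP[_ ik] eE; rewrite -sq ?ik // => oe.
  exact: (chain_pass A join Vdisj Vs sdisj ik eE oe).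
Qed.

End FromArcs.
End Detours.

(** * Removing one crossing *)

Section CircuitDetours.
Variable R : realType.
Local Notation pl := (R * R)%type.
Implicit Types (a b c x y z : pl).

Lemma det2C (x y : pl) : det2 x y = - det2 y x.
Proof. by rewrite /det2; ring. Qed.

Lemma arc_touch T z s d t d' n p g x : arc (fun x => conn T x z) s d t d' n p -> g \in arc_edges n p -> onc g x ->
  [\/ x = s, x = t | conn T x z].
Proof.
move=> A /mem_arc_edges [i iN ->] [u [u01 ->]] /=.
have P : polyline _ s d t d' n p := A; have [n0 ps pt _ _ H] := P.
have [[i0 uz]|h0] := pselect (i = 0%N /\ u = 0); first by constructor 1; rewrite i0 uz lerp0 ps.
have [[iE uo]|h1] := pselect (i = n /\ u = 1); first by constructor 2; rewrite iE uo lerp1 pt.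
by constructor 3; apply: H => // iE; apply/eqP => uE; [exact: h0 | exact: h1].
Qed.

Lemma arc_touch_start T z s d t d' n p g x : arc (fun x => conn T x z) s d t d' n p -> diagram T s -> s <> t ->
  g \in arc_edges n p -> onc g s -> onc g x -> det2 d (vec (s, x)) = 0.
Proof.
move=> A Ds st /mem_arc_edges [i iN ->] [u [u01 sE]] [v [_ ->]]; move: sE => /= sE.
have P : polyline _ s d t d' n p := A; have [n0 ps pt [a a0 pa] _ H] := P.
have i0 : i = 0%N.
  have [[iE uo]|h1] := pselect (i = n /\ u = 1); first by case: st; rewrite sE iE uo lerp1 pt.
  apply/eqP; apply: contraT => i0; have : conn T s z.
    by rewrite sE; apply: H => // E; [rewrite E in i0 | apply/eqP => uo; apply: h1].
  by case/conn_notin.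
by rewrite i0 ps pa lerp_ray /det2 /vec /ray /=; ring.
Qed.

Lemma arc_touch_end T z s d t d' n p g x : arc (fun x => conn T x z) s d t d' n p -> diagram T t -> s <> t ->
  g \in arc_edges n p -> onc g t -> onc g x -> det2 d' (vec (t, x)) = 0.
Proof.
move=> A Dt st /mem_arc_edges [i iN ->] [u [u01 tE]] [v [_ ->]]; move: tE => /= tE.
have P : polyline _ s d t d' n p := A; have [n0 ps pt _ [b b0 pb] H] := P.
have iE : i = n.
  have [[i0 uz]|h1] := pselect (i = 0%N /\ u = 0); first by case: st; rewrite tE i0 uz lerp0 ps.
  apply/eqP; apply: contraT => i0; have : conn T t z.
    by rewrite tE; apply: H => // E; [apply/eqP => uo; apply: h1 | rewrite E eqxx in i0].
  by case/conn_notin.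
by rewrite iE pt pb lerp_ray_end /det2 /vec /ray /=; ring.
Qed.

(* The corner at [q], cut off from the rest of the quadrant by an edge through the point at distance [h] on the first axis. *)
Lemma corner_link (T G : seq (pl * pl)) q u v (h eps : R) : det2 u v != 0 -> 0 < h -> 0 < eps ->
  (forall a b : R, 0 < a <= h -> 0 < b <= eps -> ~ diagram T (move_by q u v a b)) ->
  (forall g (a : R), g \in G -> 0 <= a < h -> ~ onc g (move_by q u v a 0)) ->
  (forall g x, g \in G -> onc g (move_by q u v h 0) -> onc g x -> det2 v (vec (move_by q u v h 0, x)) = 0) ->
  exists2 k, 0 < k & forall a b b' : R, 0 < a <= k -> 0 < b <= k -> 0 < b' <= k ->
    conn (T ++ G) (move_by q u v a b) (move_by q u v (h - b') b').
Proof.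
move=> D h0 e0 offT offG line; set s := move_by q u v h 0 in line.
have lerpP (a b a' b' w : R) : lerp (move_by q u v a b) (move_by q u v a' b') w = move_by q u v ((1 - w) * a + w * a') ((1 - w) * b + w * b').
  by apply/pl_eqP; rewrite /lerp /move_by /=; split; ring.
have h20 : 0 < h / 2 by rewrite divr_gt0.
have [k k0 Hk] : exists2 k, 0 < k & forall g, g \in G -> forall a b b' : R, 0 < a <= Num.min k (h / 2) -> 0 < b <= Num.min k (h / 2) -> 0 < b' <= Num.min k (h / 2) ->
    free [:: g] (move_by q u v a b) (move_by q u v (h - b') b').
  apply: (@uniform_pos R _ G (fun g k => forall a b b' : R, 0 < a <= Num.min k (h / 2) -> 0 < b <= Num.min k (h / 2) -> 0 < b' <= Num.min k (h / 2) ->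
    free [:: g] (move_by q u v a b) (move_by q u v (h - b') b'))).
    move=> g k k' H _ kk a b b' /andP[a0 ak] /andP[b0 bk] /andP[b0' bk'].
    have mn (y : R) : y <= Num.min k' (h / 2) -> y <= Num.min k (h / 2).
      by rewrite !le_min => /andP[h1 ->]; rewrite (le_trans h1 kk).
    by apply: H; rewrite ?a0 ?b0 ?b0' /= mn.
  move=> g gG; have [os|ns] := pselect (onc g s).
    exists 1 => // a b b' /andP[a0]; rewrite le_min => /andP[_ ah] _ /andP[b0'] _.
    move=> x [w [w01 ->]] [g']; rewrite inE => /eqP -> /(line g _ gG os); rewrite /= lerpP.
    rewrite (_ : det2 _ _ = - ((1 - w) * (h - a) + w * b') * det2 v u); last by rewrite /s /det2 /vec /move_by /=; ring.
    move/eqP; rewrite mulf_eq0 oppr_eq0 gt_eqF /=; last by apply: convex_gt0 => //; lra.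
    by rewrite (_ : det2 v u = - det2 u v); [rewrite oppr_eq0 (negbTE D) | rewrite /det2; ring].
  have [|r r0 Hr] := @tube R [:: g] (move_by q u v 0 0) s.
    move=> x [w [/andP[w0 w1] ->]] [g']; rewrite inE => /eqP ->; rewrite /= lerpP !mulr0 !addr0 add0r.
    have [->|w1'] := eqVneq w 1; first by rewrite mul1r.
    by apply: offG => //; rewrite mulr_ge0 ?(ltW h0) //= -[ltRHS]mul1r ltr_pM2r // lt_neqAle w1'.
  have [k1 k10 H1] := nbh_move (move_by q u v 0 0) u v r0; have [k2 k20 H2] := nbh_move s u v r0.
  exists (Num.min k1 k2); first by rewrite lt_min k10.
  move=> a b b'; rewrite !le_min -!andbA => /and4P[a0 ak1 _ _] /and4P[b0 bk1 _ _] /and4P[b0' _ bk2 _].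
  rewrite (_ : move_by q u v a b = move_by (move_by q u v 0 0) u v a b); last by apply/pl_eqP; rewrite /move_by /=; split; ring.
  rewrite (_ : move_by q u v (h - b') b' = move_by s u v (- b') b'); last by apply/pl_eqP; rewrite /s /move_by /=; split; ring.
  by apply: Hr; [apply: H1 | apply: H2]; rewrite ?normrN gtr0_norm.
exists (Num.min eps (Num.min k (h / 2))); first by rewrite !lt_min e0 k0.
move=> a b b' /andP[a0 am] /andP[b0 bm] /andP[b0' bm'].
move: (am) (bm) (bm'); rewrite ![_ <= Num.min eps _]le_min => /andP[ae ak] /andP[be bk] /andP[be' bk'].
have [ah bh'] : a <= h / 2 /\ b' <= h / 2 by split; [move: ak | move: bk']; rewrite le_min => /andP[].
apply: conn_free => x xs; case/diagram_cat => [|[g gG gx]]; last first.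
  by apply: (Hk g gG a b b' _ _ _ x xs); rewrite ?a0 ?b0 ?b0' //; exists g => //; exact: mem_head.
case: xs => w [w01 ->]; rewrite /= lerpP; apply: offT.
  rewrite convex_gt0 //=; last lra.
  have h1 : 0 < (1 - w) * (h - a) + w * b' by apply: convex_gt0 => //; lra.
  lra.
rewrite convex_gt0 //=; case/andP: w01 => w0 w1.
have h1 : 0 <= (1 - w) * (eps - b) by rewrite mulr_ge0 // subr_ge0.
have h2 : 0 <= w * (eps - b') by rewrite mulr_ge0 // subr_ge0.
lra.
Qed.

Section FromCircuit.
Variables (T : seq (pl * pl)) (X : seq pl).
Hypothesis mT : mixed T X [::].
Hypothesis bal : perm_eq (map fst T) (map snd T).
Hypothesis one : forall e x y, e \in T -> x \in X -> y \in X -> onc e x -> onc e y -> x = y.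
Variables (k : nat) (q : nat -> pl) (e f : nat -> pl * pl) (s t : nat -> bool) (w : nat -> pl) (eps : R).
Hypothesis ci : circuit T X k q e f s t w eps.

Definition neg (v : pl) : pl := (- v.1, - v.2).
Definition comb (a b : R) (u v : pl) : pl := (a * u.1 + b * v.1, a * u.2 + b * v.2).

Let u j := signed (s j) (vec (e j)).
Let v j := signed (t j) (vec (f j)).
(** Oblique coordinates at the crossing j along its two strands; the face w j is at the positive
    quadrant, the face before it at the negative one. *)
Let P j (a b : R) := move_by (q j) (u j) (v j) a b.

Lemma signed_det (i j : bool) (x y : pl) : det2 (signed i x) (signed j y) != 0 <-> det2 x y != 0.
Proof.
have E : det2 (signed i x) (signed j y) = det2 x y \/ det2 (signed i x) (signed j y) = - det2 x y.
  by case: i j => -[]; rewrite /det2 /signed /=; [left|right|right|left]; ring.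
by case: E => ->; rewrite ?oppr_eq0.
Qed.

Lemma uv_det j : (j <= k)%N -> det2 (u j) (v j) != 0.
Proof. by move=> jk; apply/signed_det; have [T' [_ _ _ D _]] := ci_edges ci jk. Qed.

Lemma comb_det j (a b : R) : (j <= k)%N -> a != 0 -> b != 0 ->
  det2 (comb a b (u j) (v j)) (vec (e j)) != 0 /\ det2 (comb a b (u j) (v j)) (vec (f j)) != 0.
Proof.
move=> jk a0 b0; have [T' [_ _ _ D _]] := ci_edges ci jk.
have D' : det2 (vec (f j)) (vec (e j)) != 0.
  by rewrite det2C oppr_eq0.
have E1 : det2 (comb a b (u j) (v j)) (vec (e j)) = b * det2 (v j) (vec (e j)).
  by rewrite /u /comb /signed /det2; case: (s j) => /=; ring.
have E2 : det2 (comb a b (u j) (v j)) (vec (f j)) = a * det2 (u j) (vec (f j)).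
  by rewrite /v /comb /signed /det2; case: (t j) => /=; ring.
by rewrite E1 E2 !mulf_neq0 //; [apply/(signed_det (s j) true) | apply/(signed_det (t j) true)].
Qed.

Lemma crossing_diagram j : (j <= k)%N -> diagram T (q j).
Proof.
move=> jk; have [T' [p [x /andP[x0 x1] qe] _ _ _]] := ci_edges ci jk.
by exists (e j); [rewrite (perm_mem p) mem_head | exists x; rewrite !ltW].
Qed.

Lemma crossing_neq i j : (i <= k)%N -> (j <= k)%N -> i != j -> q i != q j.
Proof. by move=> ik jk; rewrite neq_ltn => /orP[h|h]; [|rewrite eq_sym]; apply: (ci_uniq ci); rewrite h. Qed.

Lemma strand_points j g (i : bool) (x0 : R) : (j <= k)%N -> g \in T -> 0 < x0 < 1 -> q j = lerp g.1 g.2 x0 ->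
  forall a : R, `|a| < Num.min x0 (1 - x0) -> let y := ray (q j) (signed i (vec g)) a in
  [/\ y = lerp g.1 g.2 (x0 + sv i a), 0 < x0 + sv i a < 1, diagram T y & a != 0 -> y \notin X].
Proof.
move=> jk gT /andP[x00 x01] qE a; rewrite lt_min => /andP[a1 a2] y.
have yE : y = lerp g.1 g.2 (x0 + sv i a).
  by apply/pl_eqP; rewrite /y qE; case: (i); rewrite /ray /signed /sv /lerp /vec /=; split; ring.
have r01 : 0 < x0 + sv i a < 1.
  by move: a1 a2; rewrite !ltr_norml => /andP[? ?] /andP[? ?]; case: i {y yE} => /=; apply/andP; split; lra.
have oy : onc g y by exists (x0 + sv i a); rewrite yE; case/andP: r01 => r0 r1; rewrite !ltW.
split => //; first by exists g.
move=> a0; apply/negP => yX; have oq : onc g (q j) by exists x0; rewrite qE !ltW.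
have := one gT yX (ci_mem ci jk) oy oq; rewrite yE qE => /(lerp_inj (mixed_nondeg mT gT)) E.
by case: i {y yE r01 oy yX} E => /= E; move/eqP: a0; apply; lra.
Qed.

Lemma P_ray j (a b c d h : R) : ray (P j a b) (comb c d (u j) (v j)) h = P j (a + h * c) (b + h * d).
Proof. by apply/pl_eqP; rewrite /ray /P /move_by /comb /=; split; ring. Qed.

Let nx j := if j == k then 0%N else j.+1.

Let nxk j : (j <= k)%N -> (nx j <= k)%N.
Proof. by rewrite /nx; have [//|jk] := eqVneq j k; rewrite leq_eqVlt (negbTE jk). Qed.

(** Arc j runs through the face w j from the crossing j to the next one. At the crossing 0 the paths
    start and end on one of the strands, at (h, 0) and (- h, 0) for the first path, at (0, h) and
    (0, - h) for the second; [at0] is this offset, which is 0 at the other crossings. [Dir] and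
    [Dir'] are the germs in the same coordinates. *)
Let S (xs ys : nat -> R) j := P j (xs j) (ys j).
Let E (xs ys : nat -> R) j := P (nx j) (- xs (nx j)) (- ys (nx j)).
Let Dir (al be : nat -> R) j := comb (al j) (be j) (u j) (v j).
Let Dir' (al be : nat -> R) j := comb (- al (nx j)) (- be (nx j)) (u (nx j)) (v (nx j)).
Let at0 (h : R) j : R := if j is 0%N then h else 0.

Let P00 j : P j 0 0 = q j.
Proof. by apply/pl_eqP; rewrite /P /move_by /=; split; ring. Qed.

Let out_conn j (a b : R) : (j <= k)%N -> 0 < a <= eps -> 0 < b <= eps -> conn T (P j a b) (w j).
Proof. exact: (ci_out ci). Qed.

Let in_conn j (a b : R) : (j <= k)%N -> 0 < a <= eps -> 0 < b <= eps -> conn T (P (nx j) (- a) (- b)) (w j).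
Proof.
move=> jk ha hb; have := ci_in ci (nxk jk) ha hb; rewrite -/(u _) -/(v _) -/(P _ _ _).
by rewrite /nx; have [->|//] := eqVneq j k.
Qed.

Let inj_P j (a b a' b' : R) : (j <= k)%N -> P j a b = P j a' b' -> a = a' /\ b = b'.
Proof.
move=> jk /pl_eqP [/= E1 E2]; have D := uv_det jk.
have F1 : (a - a') * (u j).1 = (b' - b) * (v j).1 by lra.
have F2 : (a - a') * (u j).2 = (b' - b) * (v j).2 by lra.
have H1 : (a - a') * det2 (u j) (v j) = 0.
  transitivity (((a - a') * (u j).1) * (v j).2 - ((a - a') * (u j).2) * (v j).1); first by rewrite /det2; ring.
  by rewrite F1 F2; ring.
have H2 : (b - b') * det2 (u j) (v j) = 0.
  transitivity (- ((u j).1 * ((b' - b) * (v j).2) - (u j).2 * ((b' - b) * (v j).1))); first by rewrite /det2; ring.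
  by rewrite -F1 -F2; ring.
move/eqP: H1; rewrite mulf_eq0 (negbTE D) orbF subr_eq0 => /eqP ->.
by move/eqP: H2; rewrite mulf_eq0 (negbTE D) orbF subr_eq0 => /eqP ->.
Qed.

Record endpoints (x0 y0 : R) : Prop := Endpoints {
  ep_neq : x0 != 0 \/ y0 != 0;
  ep_diagram : diagram T (P 0%N x0 y0) /\ diagram T (P 0%N (- x0) (- y0));
  ep_notin : P 0%N x0 y0 \notin X /\ P 0%N (- x0) (- y0) \notin X }.

Section Ends.
Variables (x0 y0 : R).
Hypothesis ep : endpoints x0 y0.
Let xs := at0 x0.
Let ys := at0 y0.

Let SE j : (0 < j)%N -> S xs ys j = q j.
Proof. by case: j => // j _; rewrite /S /xs /ys /at0 P00. Qed.

Let EE j : (j < k)%N -> E xs ys j = q j.+1.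
Proof. by move=> jk; rewrite /E /nx (ltn_eqF jk) /xs /ys /at0 /= oppr0 P00. Qed.

Let EEk : E xs ys k = P 0%N (- x0) (- y0).
Proof. by rewrite /E /nx eqxx. Qed.

Let AB : P 0%N x0 y0 <> P 0%N (- x0) (- y0).
Proof. by move=> /(inj_P (leq0n k)) [h1 h2]; case: (ep_neq ep) => /eqP; apply; lra. Qed.

Let qX j : (j <= k)%N -> q j \in X.
Proof. exact: (ci_mem ci). Qed.

Lemma ends_diagram j : (j <= k)%N -> diagram T (S xs ys j) /\ diagram T (E xs ys j).
Proof.
move=> jk; have [D1 D2] := ep_diagram ep; split.
  by case: j jk => [|j] jk; [exact: D1 | rewrite SE //; apply: crossing_diagram].
have [->|jn] := eqVneq j k; first by rewrite EEk.
have lt : (j < k)%N by rewrite ltn_neqAle jn.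
by rewrite EE //; apply: crossing_diagram.
Qed.

Lemma starts_neq i j : (i < j <= k)%N -> S xs ys i <> S xs ys j.
Proof.
case/andP=> ij jk; rewrite (SE (leq_ltn_trans (leq0n _) ij)); case: i ij => [|i] ij.
  by move=> E'; have [+ _] := ep_notin ep; rewrite -[P _ _ _]/(S xs ys 0%N) E' qX.
by rewrite SE // => /eqP; apply/negP; apply: (ci_uniq ci); rewrite ij.
Qed.

Lemma last_neq j : (j <= k)%N -> E xs ys k <> S xs ys j.
Proof.
rewrite EEk; case: j => [_|j jk]; first by move=> E'; apply: AB.
by rewrite SE // => E'; have [_] := ep_notin ep; rewrite E' qX.
Qed.

Lemma start_end_neq j : (j <= k)%N -> S xs ys j <> E xs ys j.
Proof.
move=> jk; have [->|jn] := eqVneq j k; first by move=> E'; apply: (last_neq (leqnn k)).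
have lt : (j < k)%N by rewrite ltn_neqAle jn.
rewrite EE // -(SE (ltn0Sn j)); apply: starts_neq; by rewrite ltnSn.
Qed.

(** [TT j] is what arc j has to avoid: the diagram for the first path, the diagram and arc j of the
    first path for the second one. *)
Lemma arcs_exist (TT : nat -> seq (pl * pl)) (z : nat -> pl) (al be : nat -> R) (eps' : R) :
  (forall j, {subset T <= TT j}) -> 0 < eps' ->
  (forall j (a : R), (j <= k)%N -> 0 < a <= eps' -> conn (TT j) (ray (S xs ys j) (Dir al be j) a) (z j)) ->
  (forall j (a : R), (j <= k)%N -> 0 < a <= eps' -> conn (TT j) (ray (E xs ys j) (Dir' al be j) a) (z j)) ->
  exists (n : nat -> nat) (p : nat -> nat -> pl), forall j, (j <= k)%N ->
    arc (fun x => conn (TT j) x (z j)) (S xs ys j) (Dir al be j) (E xs ys j) (Dir' al be j) (n j) (p j).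
Proof.
move=> sub e0 hS hE.
have [np H] : {np : nat -> nat * (nat -> pl) & forall j, (j <= k)%N ->
    arc (fun x => conn (TT j) x (z j)) (S xs ys j) (Dir al be j) (E xs ys j) (Dir' al be j) (np j).1 (np j).2}.
  apply: (@boolp.choice nat _ (fun j np => (j <= k)%N -> arc (fun x => conn (TT j) x (z j)) (S xs ys j) (Dir al be j) (E xs ys j) (Dir' al be j) np.1 np.2)) => j.
  have [jk|_] := leqP j k; last by exists (0%N, fun=> q 0%N).
  have [D1 D2] := ends_diagram jk.
  have DD x : diagram T x -> diagram (TT j) x by move=> [g gT gx]; exists g => //; apply: sub.
  have [|||n [p A]] := @arc_exists R (TT j) (z j) (S xs ys j) (Dir al be j) (E xs ys j) (Dir' al be j) eps' e0 (DD _ D1) (DD _ D2).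
    by move=> E'; case: (start_end_neq jk).
  - by move=> a ha; apply: hS.
  - by move=> a ha; apply: hE.
  by exists (n, p).
by exists (fun j => (np j).1), (fun j => (np j).2).
Qed.

Lemma arcs_detour (TT : nat -> seq (pl * pl)) (z : nat -> pl) (al be : nat -> R) n p :
  (forall j, {subset T <= TT j}) -> (forall j, (j <= k)%N -> conn T (z j) (w j)) ->
  (forall j, (j <= k)%N -> arc (fun x => conn (TT j) x (z j)) (S xs ys j) (Dir al be j) (E xs ys j) (Dir' al be j) (n j) (p j)) ->
  detour T (P 0%N x0 y0) (P 0%N (- x0) (- y0)) k q (Dir al be) (chain_vertices n p k) /\
  forall x, (0 < cnt (detour_edges (P 0%N x0 y0) (P 0%N (- x0) (- y0)) (chain_vertices n p k)) x)%N ->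
    exists2 j, (j <= k)%N & (0 < cnt (arc_edges (n j) (p j)) x)%N.
Proof.
move=> sub zw A.
have jn j : (j < k)%N -> E xs ys j = S xs ys j.+1 /\ Dir' al be j = (- (Dir al be j.+1).1, - (Dir al be j.+1).2).
  move=> jk; rewrite EE // SE //; split => //.
  by rewrite /Dir' /Dir /nx (ltn_eqF jk) /comb /=; apply/pl_eqP; split => /=; ring.
rewrite -EEk; split; last by move=> x; apply: (chain_on A jn).
apply: (@chain_detour R T k q w (fun j x => conn (TT j) x (z j)) (S xs ys) (Dir al be) (E xs ys) (Dir' al be) n p A jn).
- by move=> j /andP[j0 jk]; rewrite SE.
- by move=> j x jk /(conn_sub (sub j)) h; apply: conn_trans h (zw j jk).
- exact: (ci_faces ci).
- by move=> j /ends_diagram [].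
- by have [] := ends_diagram (leqnn k).
- exact: starts_neq.
- exact: last_neq.
Qed.

End Ends.

Lemma endpoints_e : exists2 h0, 0 < h0 & forall h : R, 0 < h <= h0 -> endpoints h 0 /\ forall a : R, `|a| <= h -> onc (e 0%N) (P 0%N a 0).
Proof.
have [T' [p [x0 x01 qE] _ _ _]] := ci_edges ci (leq0n k).
have gT : e 0%N \in T by rewrite (perm_mem p) mem_head.
exists (Num.min x0 (1 - x0) / 2).
  by rewrite divr_gt0 // lt_min subr_gt0.
set m := Num.min _ _ => h /andP[h0 hm]; have m0 : 0 < m by rewrite lt_min subr_gt0.
have H (a : R) : `|a| < m -> a != 0 -> diagram T (P 0%N a 0) /\ P 0%N a 0 \notin X.
  move=> am an; have [_ _ D nX] := strand_points (s 0%N) (leq0n k) gT x01 qE am.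
  have -> : P 0%N a 0 = ray (q 0%N) (signed (s 0%N) (vec (e 0%N))) a.
    by apply/pl_eqP; rewrite /P /move_by /ray /u /=; split; ring.
  by split => //; apply: nX.
have hn : h != 0 by rewrite gt_eqF.
have [||D1 X1] := H h => //; first by rewrite gtr0_norm //; lra.
have [||D2 X2] := H (- h); rewrite ?oppr_eq0 // ?normrN ?gtr0_norm //; first lra.
split; first by split; rewrite ?oppr0 //; left.
move=> a ah; have am : `|a| < m by lra.
have [yE /andP[r0 r1] _ _] := strand_points (s 0%N) (leq0n k) gT x01 qE am.
exists (x0 + sv (s 0%N) a); rewrite !ltW //; split => //; rewrite -yE.
by apply/pl_eqP; rewrite /P /move_by /ray /u /=; split; ring.
Qed.

Lemma endpoints_f : exists2 h0, 0 < h0 & forall h : R, 0 < h <= h0 -> endpoints 0 h.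
Proof.
have [T' [p _ [x0 x01 qE] _ _]] := ci_edges ci (leq0n k).
have gT : f 0%N \in T by rewrite (perm_mem p) !inE eqxx orbT.
exists (Num.min x0 (1 - x0) / 2).
  by rewrite divr_gt0 // lt_min subr_gt0.
set m := Num.min _ _ => h /andP[h0 hm]; have m0 : 0 < m by rewrite lt_min subr_gt0.
have H (a : R) : `|a| < m -> a != 0 -> diagram T (P 0%N 0 a) /\ P 0%N 0 a \notin X.
  move=> am an; have [_ _ D nX] := strand_points (t 0%N) (leq0n k) gT x01 qE am.
  have -> : P 0%N 0 a = ray (q 0%N) (signed (t 0%N) (vec (f 0%N))) a.
    by apply/pl_eqP; rewrite /P /move_by /ray /v /=; split; ring.
  by split => //; apply: nX.
have hn : h != 0 by rewrite gt_eqF.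
have [||D1 X1] := H h => //; first by rewrite gtr0_norm //; lra.
have [||D2 X2] := H (- h); rewrite ?oppr_eq0 // ?normrN ?gtr0_norm //; first lra.
by split; rewrite ?oppr0 //; right.
Qed.

Let out_free j (a b : R) : (j <= k)%N -> 0 < a <= eps -> 0 < b <= eps -> ~ diagram T (P j a b).
Proof. by move=> jk ha hb; have [] := conn_notin (out_conn jk ha hb). Qed.

Let in_free j (a b : R) : (j <= k)%N -> 0 < a <= eps -> 0 < b <= eps -> ~ diagram T (P (nx j) (- a) (- b)).
Proof. by move=> jk ha hb; have [] := conn_notin (in_conn jk ha hb). Qed.

(** First coordinate of the germs of the first path, the second one being 1: it leaves its strand at
    the crossing 0 parallel to the other strand, along (0, 1), and passes the other crossings along
    the diagonal (1, 1). *)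
Definition one_after0 (j : nat) : R := if j is 0%N then 0 else 1.
Let aE := one_after0.
Let bE (j : nat) : R := 1.

Lemma first_arcs (h : R) : 0 < h <= eps -> endpoints h 0 -> exists (n : nat -> nat) (p : nat -> nat -> pl), forall j, (j <= k)%N ->
  arc (fun x => conn T x (w j)) (S (at0 h) (at0 0) j) (Dir aE bE j) (E (at0 h) (at0 0) j) (Dir' aE bE j) (n j) (p j).
Proof.
move=> /andP[h0 he] ep; have e0 := ci_eps ci.
apply: (arcs_exist ep (TT := fun=> T) (eps' := eps)) => [j g //|//||] j a jk /andP[a0 ae].
  by rewrite /S /Dir P_ray; apply: out_conn => //; case: j jk => [|j] jk; rewrite /at0 /aE /bE /= ?mulr0 ?mulr1 ?addr0 ?add0r ?h0 ?a0.
rewrite /E /Dir' P_ray.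
have -> : - at0 h (nx j) + a * - aE (nx j) = - (at0 h (nx j) + a * aE (nx j)) by ring.
have -> : - at0 0 (nx j) + a * - bE (nx j) = - (at0 0 (nx j) + a * bE (nx j)) by ring.
apply: in_conn => //; case: (nx j) => [|i]; by rewrite /at0 /aE /bE /= ?mulr0 ?mulr1 ?addr0 ?add0r ?h0 ?a0.
Qed.

Lemma single_detour (hb : R) : 0 < hb -> exists h ws, [/\ 0 < h <= hb, endpoints h 0 &
  detour T (P 0%N h 0) (P 0%N (- h) 0) k q (Dir aE bE) ws].
Proof.
move=> hb0; have [h0 h00 H] := endpoints_e; have e0 := ci_eps ci.
pose h := Num.min hb (Num.min h0 eps).
have hp : 0 < h by rewrite !lt_min hb0 h00.
have hh0 : h <= h0 by rewrite !ge_min lexx orbT.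
have hhb : h <= hb by rewrite ge_min lexx.
have hhe : h <= eps by rewrite !ge_min lexx !orbT.
have [|ep _] := H h; first by rewrite hp.
have [|n [p A]] := first_arcs _ ep; first by rewrite hp.
have wconn j : (j <= k)%N -> conn T (w j) (w j).
  move=> jk; have ee : 0 < eps <= eps by rewrite e0 lexx.
  by have [_ h'] := conn_notin (out_conn jk ee ee); apply: conn_refl.
have [d _] := arcs_detour ep (TT := fun=> T) (z := w) (fun _ _ => id)
  wconn A.
exists h, (chain_vertices n p k); rewrite hp hhb; split => //.
by rewrite oppr0 in d.
Qed.

Let delta j := det2 (u j) (v j).
(** The side of the first path on which the second one runs through the face j. It changes at each q
    i, and the ends on the two strands at q 0 ask for one more change. With k odd these k + 1
    changes cancel around the walk. *)
Let sg j := if odd j then - delta 0 else delta 0.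

(* Directions for the second path: it has to change sides of the first one at every crossing. *)
Let aF (j : nat) : R := if j is 0%N then 1 else if 0 < sg j * delta j then 1 else 2.
Let bF (j : nat) : R := if j is 0%N then 0 else if 0 < sg j * delta j then 2 else 1.
(** Direction from the first path to the second one. At the q i it is the germ of the second path.
    At the crossing 0 the paths start on different strands, and (-1, 1) points from the start of the
    first into the corner at q 0 where the second one starts. *)
Let am (j : nat) : R := if j is 0%N then -1 else aF j.
Let bm (j : nat) : R := if j is 0%N then 1 else bF j.

Lemma comb_comb_det j (a b c d : R) : det2 (comb a b (u j) (v j)) (comb c d (u j) (v j)) = (a * d - b * c) * delta j.
Proof. by rewrite /delta /det2 /comb /=; ring. Qed.

Let sg0 j : sg j != 0.
Proof. by rewrite /sg; case: (odd j); rewrite ?oppr_eq0 uv_det. Qed.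

Let cross_gt0 j : (j <= k)%N -> 0 < sg j * ((aE j * bm j - bE j * am j) * delta j).
Proof.
move=> jk; have D := uv_det jk; case: j jk D => [|j] jk D.
  have D0 : 0 < delta 0 * delta 0 by rewrite -expr2 exprn_even_gt0.
  have -> : sg 0 * ((aE 0 * bm 0 - bE 0 * am 0) * delta 0) = delta 0 * delta 0; last by [].
  by rewrite /sg /am /bm /aE /bE /one_after0 /=; ring.
rewrite /am /bm /aF /bF /aE /bE /=; case: ifP => [h|/negbT h].
  have -> : sg j.+1 * ((1 * 2 - 1 * 1) * delta j.+1) = sg j.+1 * delta j.+1 by ring.
  exact: h.
have -> : sg j.+1 * ((1 * 1 - 1 * 2) * delta j.+1) = - (sg j.+1 * delta j.+1) by ring.
by rewrite oppr_gt0 lt_neqAle mulf_neq0 //= leNgt.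
Qed.

Let sg_next j : odd k -> (j <= k)%N -> sg (nx j) = - sg j.
Proof.
move=> ok jk; rewrite /nx /sg; have [->|_] := eqVneq j k; first by rewrite ok opprK.
by rewrite /=; case: (odd j); rewrite ?opprK.
Qed.

Let m12 j : (0 < j)%N -> (am j = 1 /\ bm j = 2) \/ (am j = 2 /\ bm j = 1).
Proof. by case: j => // j _; rewrite /am /bm /aF /bF; case: ifP => _; [left | right]. Qed.

(** In the coordinates of the strands the four directions at the future quadruple crossing are (1,
    0), (0, 1), (1, 1) and one of (1, 2) and (2, 1). *)
Lemma pass_det j : (0 < j <= k)%N -> det2 (Dir aE bE j) (Dir aF bF j) != 0 /\
  [/\ det2 (Dir aE bE j) (vec (e j)) != 0, det2 (Dir aE bE j) (vec (f j)) != 0,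
      det2 (Dir aF bF j) (vec (e j)) != 0 & det2 (Dir aF bF j) (vec (f j)) != 0].
Proof.
move=> /andP[j0 jk]; have m : (aF j = 1 /\ bF j = 2) \/ (aF j = 2 /\ bF j = 1).
  by have := m12 j0; rewrite /am /bm; case: (j) j0.
have aE1 : aE j = 1 by case: (j) j0.
have n2 : (2 : R) != 0 by rewrite pnatr_eq0.
have [d1 d2] : det2 (Dir aF bF j) (vec (e j)) != 0 /\ det2 (Dir aF bF j) (vec (f j)) != 0.
  by case: m => -[E1 E2]; rewrite /Dir E1 E2; apply: comb_det; rewrite ?oner_neq0.
have [d3 d4] : det2 (Dir aE bE j) (vec (e j)) != 0 /\ det2 (Dir aE bE j) (vec (f j)) != 0.
  by apply: comb_det => //; rewrite ?aE1 oner_neq0.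
split => //; rewrite comb_comb_det mulf_neq0 ?uv_det // aE1 /bE.
by case: m => -[-> ->]; apply/eqP; lra.
Qed.

Section SecondPath.
Hypothesis ok : odd k.
Variables (h : R) (n : nat -> nat) (p : nat -> nat -> pl).
Hypothesis h0 : 0 < h <= eps / 3.
Hypothesis ep : endpoints h 0.
Hypothesis A : forall j, (j <= k)%N -> arc (fun x => conn T x (w j)) (S (at0 h) (at0 0) j) (Dir aE bE j) (E (at0 h) (at0 0) j) (Dir' aE bE j) (n j) (p j).

Hypothesis hax : forall a : R, `|a| <= h -> onc (e 0%N) (P 0%N a 0).

Let TT j := T ++ arc_edges (n j) (p j).
Let SE j := S (at0 h) (at0 0) j.
Let EE j := E (at0 h) (at0 0) j.
Let m j := comb (am j) (bm j) (u j) (v j).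
Let m' j := comb (- am (nx j)) (- bm (nx j)) (u (nx j)) (v (nx j)).

Let SE_m j (a : R) : ray (SE j) (m j) a = P j (at0 h j + a * am j) (a * bm j).
Proof. by rewrite /SE /S /m P_ray; congr P; case: (j) => [|i] /=; ring. Qed.

Let EE_m j (a : R) : ray (EE j) (m' j) a = P (nx j) (- (at0 h (nx j) + a * am (nx j))) (- (a * bm (nx j))).
Proof. by rewrite /EE /E /m' P_ray; congr P; case: (nx j) => [|i] /=; ring. Qed.

Let cone_bound i (a b : R) : 0 <= a <= h / 2 -> 0 < b <= h / 2 ->
  0 < at0 h i + a * aE i + b * am i <= eps /\ 0 < a * bE i + b * bm i <= eps.
Proof.
move: h0 => /andP[h00 he] /andP[a0 ah] /andP[b0 bh]; have e0 := ci_eps ci.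
case: (posnP i) => [->|i0].
  by rewrite /at0 /aE /am /bE /bm /=; split; apply/andP; split; lra.
have -> : at0 h i = 0 by case: (i) i0. have -> : aE i = 1 by case: (i) i0.
by rewrite /bE; case: (m12 i0) => -[-> ->]; split; apply/andP; split; lra.
Qed.

(** [arc_side] applied to the first path: its two sign conditions are [cross_gt0] at both ends of
    the arc, and they fit together by [sg_next]. *)
Lemma second_side j : (j <= k)%N -> exists2 c, 0 < c & forall b b' : R, 0 < b <= c -> 0 < b' <= c ->
  conn (TT j) (ray (SE j) (m j) b) (ray (EE j) (m' j) b').
Proof.
move=> jk; have [D1 D2] := ends_diagram ep jk.
have h20 : 0 < h / 2 by case/andP: h0 => ? _; rewrite divr_gt0.
apply: (arc_side (A jk) (start_end_neq ep jk) D1 D2 h20 (sg0 j)).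
- by rewrite comb_comb_det; apply: cross_gt0.
- rewrite comb_comb_det !mulrNN; have := cross_gt0 (nxk jk); rewrite (sg_next ok jk) mulNr oppr_gt0.
  exact.
- move=> a b ha hb; rewrite (_ : move_by _ _ _ a b = P j (at0 h j + a * aE j + b * am j) (a * bE j + b * bm j)).
    by have [? ?] := cone_bound j ha hb; apply: out_free.
  by rewrite /S /Dir /m /P /comb /move_by; apply/pl_eqP; case: (j) => [|i] /=; split; ring.
- move=> a b ha hb; rewrite (_ : move_by _ _ _ a b = P (nx j) (- (at0 h (nx j) + a * aE (nx j) + b * am (nx j))) (- (a * bE (nx j) + b * bm (nx j)))).
    by have [? ?] := cone_bound (nx j) ha hb; apply: in_free.
  by rewrite /E /Dir' /m' /P /comb /move_by; apply/pl_eqP; case: (nx j) => [|i] /=; split; ring.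
Qed.

Let axis_diagram (a : R) : `|a| <= h -> diagram T (P 0%N a 0) /\ forall j, (0 < j <= k)%N -> P 0%N a 0 <> q j.
Proof.
move=> ah; have oa := hax ah; have k0 := leq0n k.
have [T' [pT [x0 /andP[x00 x01] qE] _ _ _]] := ci_edges ci k0.
have gT : e 0%N \in T by rewrite (perm_mem pT) mem_head.
have oq : onc (e 0%N) (q 0%N) by exists x0; rewrite qE !ltW.
split; first by exists (e 0%N).
move=> j /andP[j0 jk] E'; rewrite E' in oa.
have := one gT (ci_mem ci jk) (ci_mem ci k0) oa oq => qq.
by have := crossing_neq jk k0 (lt0n_neq0 j0); rewrite qq eqxx.
Qed.

Let kpos : (0 < k)%N.
Proof. by case: (k) ok. Qed.

(** In the positive quadrant at q 0 the first path leaves the axis at distance h and does not touch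
    it before. So the corner, where the second path starts, is linked with the side of the first
    path that faces q 0. *)
Lemma first_corner : exists2 c, 0 < c & forall a b b' : R, 0 < a <= c -> 0 < b <= c -> 0 < b' <= c ->
  conn (TT 0) (P 0%N a b) (P 0%N (h - b') b').
Proof.
have /andP[h00 he] := h0; have e0 := ci_eps ci; have A0 := A (leq0n k).
have [D1 D2] := ends_diagram ep (leq0n k); have ne := start_end_neq ep (leq0n k).
have E0 : EE 0 = q 1%N by rewrite /EE /E /nx (ltn_eqF kpos) /at0 oppr0 P00.
apply: (corner_link (uv_det (leq0n k)) h00 e0).
- move=> a b /andP[a0 ah] hb; apply: out_free => //; rewrite a0 /=; lra.
- move=> g a gG /andP[a0 ah] /(arc_touch A0 gG) [E'|E'|/conn_notin [nD _]].
  + by have [] := inj_P (leq0n k) E'; rewrite /at0; lra.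
  + have [|_ /(_ 1%N)] := @axis_diagram a; first by rewrite ger0_norm // ltW.
    by rewrite kpos; apply => //; rewrite -E0.
  + by apply: nD; have [] := @axis_diagram a; first by rewrite ger0_norm // ltW.
- move=> g x gG gs gx; have := arc_touch_start A0 D1 ne gG gs gx.
  rewrite (_ : det2 (Dir aE bE 0) _ = det2 (v 0) (vec (move_by (q 0%N) (u 0) (v 0) h 0, x))) //.
  by rewrite /Dir /comb /S /P /at0 /aE /bE /one_after0 /det2 /=; ring.
Qed.

(** The same in the opposite quadrant, through which the walk comes back to q 0. *)
Lemma last_corner : exists2 c, 0 < c & forall a b b' : R, 0 < a <= c -> 0 < b <= c -> 0 < b' <= c ->
  conn (TT k) (P 0%N (- a) (- b)) (P 0%N (- (h - b')) (- b')).
Proof.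
have /andP[h00 he] := h0; have e0 := ci_eps ci; have Ak := A (leqnn k).
have [D1 D2] := ends_diagram ep (leqnn k); have ne := start_end_neq ep (leqnn k).
have nk : nx k = 0%N by rewrite /nx eqxx.
have D : det2 (neg (u 0)) (neg (v 0)) != 0.
  by rewrite (_ : det2 _ _ = det2 (u 0) (v 0)); [exact: uv_det | rewrite /det2 /neg /=; ring].
have PE (a b : R) : move_by (q 0%N) (neg (u 0)) (neg (v 0)) a b = P 0%N (- a) (- b).
  by apply/pl_eqP; rewrite /P /move_by /neg /=; split; ring.
have Sk : SE k = q k by rewrite /SE /S /at0; case: (k) kpos => // i _; rewrite P00.
have [|||c c0 Hc] := corner_link (T := T) (G := arc_edges (n k) (p k)) (q := q 0%N) D h00 e0; last first.
  by exists c => // a b b' ha hb hb'; have := Hc a b b' ha hb hb'; rewrite !PE.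
- move=> g x gG; rewrite PE => gs gx; have := arc_touch_end Ak D2 ne gG; rewrite /E nk /at0.
  move=> /(_ x); have -> : P 0%N (- h) (- 0) = P 0%N (- h) (- 0) by []. move=> /(_ gs gx).
  rewrite (_ : det2 (Dir' aE bE k) _ = det2 (neg (v 0)) (vec (P 0%N (- h) (- 0), x))) //.
  by rewrite /Dir' nk /comb /neg /aE /bE /one_after0 /det2 /=; ring.
- move=> g a gG /andP[a0 ah]; rewrite PE => /(arc_touch Ak gG) [E'|E'|/conn_notin [nD _]].
  + have [|_ /(_ k)] := @axis_diagram (- a); first by rewrite normrN ger0_norm // ltW.
    by rewrite kpos leqnn; apply => //; rewrite -Sk -[SE k]E' oppr0.
  + by move: E'; rewrite /E nk => /(inj_P (leq0n k)) []; rewrite /at0; lra.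
  + by apply: nD; rewrite oppr0; have [] := @axis_diagram (- a); first by rewrite normrN ger0_norm // ltW.
- move=> a b /andP[a0 ah] hb; rewrite PE -nk; apply: in_free => //; rewrite a0 /=; lra.
Qed.

Lemma second_detour : exists2 c, 0 < c & forall h' : R, 0 < h' <= c -> endpoints 0 h' -> exists ws,
  detour T (P 0%N 0 h') (P 0%N 0 (- h')) k q (Dir aF bF) ws /\
  forall x, (0 < cnt (detour_edges (P 0%N h 0) (P 0%N (- h) 0) (chain_vertices n p k)) x)%N ->
    (0 < cnt (detour_edges (P 0%N 0 h') (P 0%N 0 (- h')) ws) x)%N -> exists2 i, (0 < i <= k)%N & x = q i.
Proof.
have [c1 c10 H1] := first_corner; have [c2 c20 H2] := last_corner.
have [c3 c30 H3] : exists2 c, 0 < c & forall j, j \in iota 0 k.+1 -> forall b b' : R, 0 < b <= c -> 0 < b' <= c ->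
    conn (TT j) (ray (SE j) (m j) b) (ray (EE j) (m' j) b').
  apply: (@uniform_pos R _ (iota 0 k.+1) (fun j (c : R) => forall b b' : R, 0 < b <= c -> 0 < b' <= c ->
    conn (TT j) (ray (SE j) (m j) b) (ray (EE j) (m' j) b'))).
    by move=> j c5 c' H _ cc b b' /andP[b0 bc] /andP[b0' bc']; apply: H; rewrite ?b0 ?b0' /= (le_trans _ cc).
  by move=> j; rewrite mem_iota add0n ltnS => /second_side.
have h20 : 0 < h / 2 by case/andP: h0 => ? _; rewrite divr_gt0.
pose c := Num.min (h / 2) (Num.min c1 (Num.min c2 c3)).
have c0 : 0 < c by rewrite !lt_min h20 c10 c20.
have [ch [cc1 [cc2 cc3]]] : c <= h / 2 /\ c <= c1 /\ c <= c2 /\ c <= c3 by rewrite !ge_min !lexx !orbT.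
have side j (b b' : R) : (j <= k)%N -> 0 < b <= c -> 0 < b' <= c -> conn (TT j) (ray (SE j) (m j) b) (ray (EE j) (m' j) b').
  move=> jk /andP[b0 bc] /andP[b0' bc']; apply: H3; rewrite ?mem_iota ?b0 ?b0' //= ?ltnS //; exact: le_trans cc3.
have cc : 0 < c <= c by rewrite c0 lexx.
exists c => // h' /andP[h'0 hc'] ep'.
pose z j := ray (SE j) (m j) c.
have sub j : {subset T <= TT j} by move=> g gT; rewrite mem_cat gT.
have zw j : (j <= k)%N -> conn T (z j) (w j).
  move=> jk; rewrite /z SE_m; have hc : 0 <= (0 : R) <= h / 2 by rewrite lexx ltW.
  have [|b1 b2] := @cone_bound j 0 c hc; first by rewrite c0.
  by move: b1 b2; rewrite !mul0r addr0 add0r => b1 b2; apply: out_conn.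
have m1 (b : R) : 0 < b <= c -> 0 < b <= c1 by move=> /andP[-> /= bc]; apply: le_trans cc1.
have m2 (b : R) : 0 < b <= c -> 0 < b <= c2 by move=> /andP[-> /= bc]; apply: le_trans cc2.
have hh : 0 < h' <= c by rewrite h'0.
have [||n' [p' A']] := arcs_exist ep' (TT := TT) (z := z) (al := aF) (be := bF) sub c0.
- move=> j a jk ha; have [j0|j0] := posnP j.
    rewrite /S /Dir P_ray j0 /at0 /aF /bF /= !(mulr0, mulr1) add0r addr0 /z SE_m /am /bm /at0 mulrN1 mulr1.
    by apply: H1; apply: m1.
  have := conn_trans (side j a c jk ha cc) (conn_sym (side j c c jk cc cc)).
  suff -> : ray (S (at0 0) (at0 h') j) (Dir aF bF j) a = ray (SE j) (m j) a by [].
  by rewrite SE_m /S /Dir P_ray; case: (j) j0 => // i _; rewrite /at0 /am /bm !add0r.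
- move=> j a jk ha; have [j0|j0] := posnP (nx j).
    have jE : j = k by move: j0; rewrite /nx; case: eqP.
    rewrite /E /Dir' P_ray j0 /at0 /aF /bF /= (_ : - 0 + a * -1 = - a); last ring.
    rewrite (_ : - h' + a * - 0 = - h'); last ring.
    have := H2 a h' c (m2 _ ha) (m2 _ hh) (m2 _ cc); rewrite -jE => hl; apply: conn_trans hl _.
    have := conn_sym (side j c c jk cc cc); rewrite EE_m j0 /at0 /am /bm.
    by rewrite (_ : h + c * -1 = h - c) ?mulr1 //; ring.
  suff -> : ray (E (at0 0) (at0 h') j) (Dir' aF bF j) a = ray (EE j) (m' j) a by apply: conn_sym (side j c a jk cc ha).
  rewrite EE_m /E /Dir' P_ray; case: (nx j) j0 => // i _; rewrite /at0 /am /bm.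
  by congr P; ring.
have [d onF] := arcs_detour ep' sub zw A'; rewrite oppr0 in d onF.
exists (chain_vertices n' p' k); split => //.
have wconn j : (j <= k)%N -> conn T (w j) (w j).
  by move=> jk; apply: conn_refl; have [] := conn_notin (zw j jk).
have [_ onE] := arcs_detour ep (TT := fun=> T) (z := w) (fun _ _ => id) wconn A; rewrite oppr0 in onE.
move=> x /onE [i ik ci'] /onF [j jk cj].
have Di : diagram (arc_edges (n i) (p i)) x by have /cnt_gt0P [g gG og] := ci'; exists g => //; apply: on_onc.
have [D1 _] := ends_diagram ep ik; have [D2 _] := ends_diagram ep' jk.
have [xi|Vi] := arc_points (A ik) ci'; have [xj|Vj] := arc_points (A' j jk) cj.
- case: i ik xi {ci' Di D1} => [|i] ik xi; last by exists i.+1 => //; rewrite xi /S /at0 P00.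
  have [nX _] := ep_notin ep; case: j jk xj {cj D2} => [|j] jk xj.
    by move: xi; rewrite xj /S /at0 => /(inj_P (leq0n k)) [_ hz]; move: h'0; rewrite hz ltxx.
  by move: nX; rewrite -[P _ _ _]/(S (at0 h) (at0 0) 0%N) -xi xj /S /at0 P00 (ci_mem ci jk).
- by case/(conn_sub (sub j))/conn_notin: Vj; rewrite xi.
- by case/conn_notin: Vi; rewrite xj.
(* Here x lies inside a face for both paths: arcs of different index are in different faces, and
   arcs of the same index are disjoint by the choice of the obstacles. *)
- have Vj' : conn T x (w j) := conn_trans (conn_sub (sub j) Vj) (zw j jk).
  have [ij|ij] := eqVneq i j; last first.
    have wij : conn T (w i) (w j) := conn_trans (conn_sym Vi) Vj'.
    move: ij; rewrite neq_ltn => /orP[ij|ij].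
      by case: (ci_faces ci (j := i) (l := j)); rewrite ?ij.
    by case: (ci_faces ci (j := j) (l := i)); [rewrite ij | apply: conn_sym].
  by have [nD _] := conn_notin Vj; case: nD; apply/diagram_cat; right; rewrite -ij.
Qed.

End SecondPath.

Lemma double_detour (hb hb' : R) : odd k -> 0 < hb -> 0 < hb' -> exists h h' ws ws',
  [/\ 0 < h <= hb /\ 0 < h' <= hb', endpoints h 0 /\ endpoints 0 h',
    detour T (P 0%N h 0) (P 0%N (- h) 0) k q (Dir aE bE) ws,
    detour T (P 0%N 0 h') (P 0%N 0 (- h')) k q (Dir aF bF) ws' &
    forall x, (0 < cnt (detour_edges (P 0%N h 0) (P 0%N (- h) 0) ws) x)%N ->
      (0 < cnt (detour_edges (P 0%N 0 h') (P 0%N 0 (- h')) ws') x)%N -> exists2 i, (0 < i <= k)%N & x = q i].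
Proof.
move=> ok hb0 hb0'; have [h0 h00 H] := endpoints_e; have [h1 h10 H'] := endpoints_f; have e0 := ci_eps ci.
have e30 : 0 < eps / 3 by rewrite divr_gt0.
pose h := Num.min hb (Num.min h0 (eps / 3)).
have hp : 0 < h by rewrite !lt_min hb0 h00.
have [hhb [hh0 hhe]] : h <= hb /\ h <= h0 /\ h <= eps / 3 by rewrite !ge_min !lexx !orbT.
have [|ep hax] := H h; first by rewrite hp.
have [|n [p A]] := first_arcs _ ep; first by rewrite hp /=; lra.
have wconn j : (j <= k)%N -> conn T (w j) (w j).
  move=> jk; have ee : 0 < eps <= eps by rewrite e0 lexx.
  by have [_ h'] := conn_notin (out_conn jk ee ee); apply: conn_refl.
have [d _] := arcs_detour ep (TT := fun=> T) (z := w) (fun _ _ => id) wconn A; rewrite oppr0 in d.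
have [|c c0 H2] := second_detour ok _ ep A hax; first by rewrite hp.
pose h' := Num.min hb' (Num.min h1 c).
have hp' : 0 < h' by rewrite !lt_min hb0' h10.
have [hhb' [hh1 hc]] : h' <= hb' /\ h' <= h1 /\ h' <= c by rewrite !ge_min !lexx !orbT.
have ep' : endpoints 0 h' by apply: H'; rewrite hp'.
have [|ws' [d' dis]] := H2 h' _ ep'; first by rewrite hp'.
by exists h, h', (chain_vertices n p k), ws'; rewrite hp hp' hhb hhb'; split.
Qed.

End FromCircuit.
End CircuitDetours.

(** * Multiplicities after the strands are replaced *)

Section Surgery.
Variable R : realType.
Local Notation pt := 'M[R]_(1,3).
Local Notation pl := (R * R)%type.
Implicit Types (x y z : pl) (e f g h : pl * pl) (T N : seq (pl * pl)).

Lemma closed_balanced (A : eqType) (S : seq (A * A)) : closed_edges S -> perm_eq (map fst S) (map snd S).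
Proof.
move=> [L [_ _ p]]; apply: perm_trans (perm_trans _ (perm_map snd p)); first by rewrite perm_sym; apply: perm_map p.
rewrite /link_edges; elim: L {p} => //= c L IH; rewrite !map_cat; apply: perm_cat IH.
case: c => // x s; rewrite /cyc_edges /consec.
have -> : map fst (zip (rcons (x :: s) x) (behead (rcons (x :: s) x))) = x :: s.
  have u1 (b : A) l a : unzip1 (zip (a :: rcons l b) (rcons l b)) = a :: l.
    by elim: l a => //= y l IHl a; rewrite IHl.
  exact: u1.
have -> : map snd (zip (rcons (x :: s) x) (behead (rcons (x :: s) x))) = rcons s x.
  by rewrite -/(unzip2 _) unzip2_zip //= size_rcons.
by rewrite perm_sym perm_rcons.
Qed.

Lemma shadow_balanced (S : seq (pt * pt)) : closed_edges S -> perm_eq (map fst (shadow S)) (map snd (shadow S)).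
Proof.
move=> /closed_balanced p; rewrite /shadow -!map_comp (map_comp (@Defs.proj R) fst) (map_comp (@Defs.proj R) snd).
exact: perm_map.
Qed.

Lemma diagram_cnt T x : ~ diagram T x -> cnt T x = 0%N.
Proof.
by move=> nD; apply: count_eq0 => e eT /asboolP oe; apply: nD; exists e => //; apply: on_onc.
Qed.

(** The case of a point that is no crossing: c and c' are its old and new multiplicities, d1 and d2
    those in the new paths, i1 and i2 tell whether it lies on a removed part. A new path meets the
    old diagram here only at its start, and this is removed. *)
Lemma surgery_count (c c' d1 d2 : nat) (i1 i2 : bool) : (c' + i1 + i2 = c + d1 + d2)%N -> (c <= 1)%N ->
  (d1 <= 1)%N -> (d2 <= 1)%N -> ((0 < d1)%N -> i1 \/ c = 0%N) -> ((0 < d2)%N -> i2 \/ c = 0%N) ->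
  ((0 < d1)%N -> (0 < d2)%N -> False) -> (c' <= 1)%N.
Proof.
case: d1 d2 => [|[|d1]] [|[|d2]] //= E c1 _ _ h1 h2 h12; first by move: E; lia.
- by case: (h2 isT) => [i|c0]; move: E; rewrite ?i ?c0; lia.
- by case: (h1 isT) => [i|c0]; move: E; rewrite ?i ?c0; lia.
- by case: h12.
Qed.

Section MixedSurgery.
Variables (T T0 : seq (pl * pl)) (X Q : seq pl) (e f : pl * pl) (p : pl).
Variables (Ne Nf De Df : seq (pl * pl)) (Ie If : set pl).
Hypothesis mT : mixed T X [::].
Hypothesis pT : perm_eq T (e :: f :: T0).
Hypothesis pX : p \in X.
Hypothesis uQ : uniq Q.
Hypothesis QX : {subset Q <= X}.
Hypothesis pQ : p \notin Q.

(** The edge g gives way to the list N: the half-open part J of g is taken away and the path D is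
    added. With J and D empty the edge stays as it is, which is what happens to the second strand
    when k = 0. *)
Record restrand g N D (J : set pl) : Prop := Restrand {
  rs_cnt : forall x, (cnt N x + `[< J x >] = (`[< on g x >] : nat) + cnt D x)%N;
  rs_crossing : forall x, x \in X -> J x -> x = p;
  rs_le1 : forall x, (cnt D x <= 1)%N;
  rs_points : forall x, (0 < cnt D x)%N -> [\/ x \notin X /\ J x, x \in Q | ~ diagram T x];
  rs_nondeg : forall h, h \in N -> h.1 <> h.2;
  rs_start : forall h, h \in N -> h.1 \notin X;
  rs_edges : forall h, h \in N -> [\/ h \in D, h \in T | forall x, x \in X -> ~ on h x];
  rs_dir : forall x h h', x \in Q -> h \in D -> on h x -> h' \in T -> on h' x -> det2 (vec h) (vec h') != 0 }.

Hypothesis re : restrand e Ne De Ie.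
Hypothesis rf : restrand f Nf Df If.
Hypothesis Ip : Ie p.
Hypothesis onQ : forall x, x \in Q -> (0 < cnt De x)%N /\ (0 < cnt Df x)%N.
Hypothesis disj : forall x, (0 < cnt De x)%N -> (0 < cnt Df x)%N -> x \in Q.
Hypothesis dir2 : forall x h h', x \in Q -> h \in De -> h' \in Df -> on h x -> on h' x -> det2 (vec h) (vec h') != 0.

Let T' := Ne ++ Nf ++ T0.
Let X2 := seq.filter (fun x => (x != p) && (x \notin Q)) X.

Let cntT' x : (cnt T' x + `[< Ie x >] + `[< If x >] = cnt T x + cnt De x + cnt Df x)%N.
Proof.
have E : cnt T x = (`[< on e x >] + (`[< on f x >] + cnt T0 x))%N by rewrite /cnt (permP pT).
have h1 := rs_cnt re x; have h2 := rs_cnt rf x.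
rewrite /T' !cnt_cat E; nlia.
Qed.

Let XD x : x \in X -> diagram T x.
Proof.
move=> xX; have : (0 < cnt T x)%N by rewrite (mixed_double mT xX).
by move=> /cnt_gt0P [g gT og]; exists g => //; apply: on_onc.
Qed.

Let DX g N D J x : restrand g N D J -> x \in X -> (0 < cnt D x)%N -> x \in Q.
Proof. by move=> r xX /(rs_points r) [[/negP nX]|//|]; [case: nX | move/(_ (XD xX))]. Qed.

Let notI g N D J x : restrand g N D J -> x \in X -> x != p -> `[< J x >] = false.
Proof. by move=> r xX xp; apply/asboolP => Jx; move/eqP: xp; apply; apply: (rs_crossing r). Qed.

(** Counts are additive: p loses at least one of its two strands, a point of Q gains one from each
    new path and gets 2 + 1 + 1, and the other crossings keep their multiplicity. *)
Lemma mixed_surgery : mixed T' X2 Q.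
Proof.
have mX2 x : x \in X2 -> [/\ x \in X, x != p & x \notin Q] by rewrite mem_filter => /andP[/andP[? ?] ?].
have T0T g : g \in T0 -> g \in T by move=> gT; rewrite (perm_mem pT) !inE gT !orbT.
have XQ x : x \in X2 ++ Q -> x \in X /\ x != p.
  rewrite mem_cat => /orP[/mX2 [] //|xQ]; split; first exact: QX.
  by apply: contraNneq pQ => <-.
have uX : uniq X by have := mixed_uniq mT; rewrite cats0.
have c0 D x : (0 < cnt D x)%N = false -> cnt D x = 0%N by case: (cnt D x).
have zero g N D J x : restrand g N D J -> x \in X -> x \notin Q -> cnt D x = 0%N.
  by move=> r xX xQ; apply: c0; apply/negbTE/negP => /(DX r xX); apply/negP.
split.
- move=> g; rewrite /T' !mem_cat => /or3P[/(rs_nondeg re)|/(rs_nondeg rf)|/T0T gT] //.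
  exact: (mixed_nondeg mT).
- move=> x x2 xQ; have := cntT' x; have [xX|xX] := boolP (x \in X).
    have xp : x = p by apply/eqP; apply: contraNT x2 => xp; rewrite mem_filter xp xQ.
    rewrite (zero _ _ _ _ _ re xX xQ) (zero _ _ _ _ _ rf xX xQ) (mixed_double mT xX) asboolT ?xp //.
    by case: (`[< If p >]) => /=; nlia.
  have cT : (cnt T x <= 1)%N by apply: (mixed_off mT).
  have cas D g N J : restrand g N D J -> (0 < cnt D x)%N -> `[< J x >] \/ cnt T x = 0%N.
    move=> r /(rs_points r) [[_ Jx]|xQ'|nD]; [by left; apply/asboolP | by rewrite xQ' in xQ | by right; apply: diagram_cnt].
  move=> E; apply: (surgery_count E cT (rs_le1 re x) (rs_le1 rf x)); [exact: cas re | exact: cas rf |].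
  by move=> de df; have := disj de df; rewrite (negbTE xQ).
- move=> x /mX2 [xX xp xQ]; have := cntT' x.
  by rewrite (zero _ _ _ _ _ re xX xQ) (zero _ _ _ _ _ rf xX xQ) (mixed_double mT xX) (notI re xX xp) (notI rf xX xp) !addn0.
- move=> x xQ; have xX := QX xQ; have xp : x != p by apply: contraNneq pQ => <-.
  have [de df] := onQ xQ; have := cntT' x; rewrite (mixed_double mT xX) (notI re xX xp) (notI rf xX xp).
  by have := rs_le1 re x; have := rs_le1 rf x; nlia.
- move=> g gT'; apply/negP => /XQ [gX _]; move: gT' gX; rewrite /T' !mem_cat => /or3P[/(rs_start re)/negP //|/(rs_start rf)/negP //|/T0T gT].
  by apply/negP; have := mixed_start mT gT; rewrite cats0.
- move=> x g h /XQ [xX xp] gT' hT' og oh gh.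
  have cas g' : g' \in T' -> on g' x -> [\/ g' \in De /\ x \in Q, g' \in Df /\ x \in Q | g' \in T].
    rewrite /T' !mem_cat => /or3P[gN|gN|/T0T gT] og'; last by constructor 3.
      case: (rs_edges re gN) => [gD|gT|/(_ x xX)//]; [constructor 1; split => // | by constructor 3].
      by apply: (DX re xX); apply/cnt_gt0P; exists g'.
    case: (rs_edges rf gN) => [gD|gT|/(_ x xX)//]; [constructor 2; split => // | by constructor 3].
    by apply: (DX rf xX); apply/cnt_gt0P; exists g'.
  have same g' N' D' J g1 g2 : restrand g' N' D' J -> g1 \in D' -> g2 \in D' -> on g1 x -> on g2 x -> g1 = g2.
    by move=> r d1 d2 o1 o2; apply: (count_le1_eq (rs_le1 r x)) => //; apply/asboolP.
  have [[gD xQ]|[gD xQ]|gT] := cas g gT' og; have [[hD xQ']|[hD xQ']|hT] := cas h hT' oh.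
  + by case: gh; apply: same re gD hD og oh.
  + exact: (dir2 xQ).
  + exact: (rs_dir re xQ).
  + by rewrite det2C oppr_eq0; apply: (dir2 xQ).
  + by case: gh; apply: same rf gD hD og oh.
  + exact: (rs_dir rf xQ).
  + by rewrite det2C oppr_eq0; apply: (rs_dir re xQ').
  + by rewrite det2C oppr_eq0; apply: (rs_dir rf xQ').
  + by apply: (mixed_transverse mT) og oh gh => //; rewrite cats0.
- rewrite cat_uniq uQ andbT filter_uniq //=; apply/hasPn => x xQ.
  by rewrite mem_filter xQ andbF.
Qed.

Lemma size_surgery : (size X2 + size Q).+1 = size X.
Proof.
have uX : uniq X by have := mixed_uniq mT; rewrite cats0.
have pE : perm_eq X (p :: X2 ++ Q).
  apply: uniq_perm => //.
    rewrite /= mem_cat mem_filter eqxx /= pQ cat_uniq uQ andbT filter_uniq //=; apply/hasPn => x xQ.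
    by rewrite mem_filter xQ andbF.
  move=> x; rewrite inE mem_cat mem_filter; have [->|xp] := eqVneq x p; first by rewrite pX.
  by case: (boolP (x \in Q)) => [/QX ->|]; rewrite ?orbT ?orbF.
by rewrite (perm_size pE) /= size_cat.
Qed.

End MixedSurgery.
End Surgery.

(** * At most one crossing on each edge *)

Section Splitting.
Variable R : realType.
Local Notation pt := 'M[R]_(1,3).
Local Notation pl := (R * R)%type.
Implicit Types (x y z : pl) (e f g h : pl * pl) (T N : seq (pl * pl)).

Lemma vec_lerp (a b : pl) (s s' : R) : vec (lerp a b s, lerp a b s') = ((s' - s) * (vec (a, b)).1, (s' - s) * (vec (a, b)).2).
Proof. by apply/pl_eqP; rewrite /vec /lerp /=; split; ring. Qed.

Lemma det2Zl (u v : pl) (c : R) : det2 (c * u.1, c * u.2) v = c * det2 u v.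
Proof. by rewrite /det2 /=; ring. Qed.

Lemma det2Zr (u v : pl) (c : R) : det2 u (c * v.1, c * v.2) = c * det2 u v.
Proof. by rewrite /det2 /=; ring. Qed.

Lemma mixed_split (a b : pl) T0 X (t : R) : mixed ((a, b) :: T0) X [::] -> 0 < t < 1 -> lerp a b t \notin X ->
  mixed [:: (a, lerp a b t), (lerp a b t, b) & T0] X [::].
Proof.
move=> mT t01 mX; set m := lerp a b t; case/andP: (t01) => t0 t1.
have ab : a <> b by apply: (mixed_nondeg mT (e := (a, b))); rewrite mem_head.
have inj := lerp_inj ab.
have v1 : vec (a, m) = (t * (vec (a, b)).1, t * (vec (a, b)).2).
  by rewrite /m -{1}(lerp0 a b) vec_lerp subr0.
have v2 : vec (m, b) = ((1 - t) * (vec (a, b)).1, (1 - t) * (vec (a, b)).2).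
  by rewrite /m -{2}(lerp1 a b) vec_lerp.
have cE x : cnt [:: (a, m), (m, b) & T0] x = cnt ((a, b) :: T0) x.
  by rewrite !cnt_cons addnA -on_split.
have T0T g : g \in T0 -> g \in (a, b) :: T0 by move=> gT; rewrite inE gT orbT.
have old g x : g \in [:: (a, m), (m, b) & T0] -> on g x -> g \in T0 \/ (on (a, b) x /\ exists2 c, c != 0 & vec g = (c * (vec (a, b)).1, c * (vec (a, b)).2)).
  have sp := on_split x ab t01; rewrite -/m in sp.
  rewrite !inE => /or3P[/eqP ->|/eqP ->|gT _]; [| |by left]; move=> /asboolP og; right.
  - split; last by exists t; rewrite // gt_eqF.
    by apply/asboolP; move: sp; rewrite og; case: (`[< on (a, b) x >]).
  - split; last by exists (1 - t); rewrite // gt_eqF // subr_gt0.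
    by apply/asboolP; move: sp; rewrite og; case: (`[< on (a, b) x >]) => //; rewrite addnC.
split; rewrite ?cats0.
- move=> g; rewrite !inE => /or3P[/eqP ->|/eqP ->|/T0T /(mixed_nondeg mT) //] /= E.
    by move: t0; rewrite (inj t 0) ?ltxx // lerp0 -/m -E.
  by move: t1; rewrite (inj t 1) ?ltxx // lerp1 -/m E.
- by move=> x h1 h2; rewrite cE; apply: (mixed_off mT).
- by move=> x h1; rewrite cE; apply: (mixed_double mT).
- by [].
- have st g : g \in (a, b) :: T0 -> g.1 \notin X by move/(mixed_start mT); rewrite cats0.
  move=> g; rewrite !inE => /or3P[/eqP ->|/eqP ->|/T0T /st //] //=.
  by apply: (st (a, b)); rewrite mem_head.
- move=> x g h xX gT hT og oh gh.
  have ut := mixed_uniq_edges mT.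
  have tr g' h' : g' \in (a, b) :: T0 -> h' \in (a, b) :: T0 -> on g' x -> on h' x -> g' <> h' -> det2 (vec g') (vec h') != 0.
    by apply: (mixed_transverse mT); rewrite cats0.
  have nin g' : g' \in T0 -> g' <> (a, b) by move=> gT' E; move: ut; rewrite /= -E gT'.
  have [gT0|[oab [c c0 cE']]] := old g x gT og; have [hT0|[oab' [c' c0' cE'']]] := old h x hT oh.
  + by apply: tr => //; apply: T0T.
  + have := tr g (a, b) (T0T _ gT0) (mem_head _ _) og oab' (nin _ gT0).
    rewrite cE'' det2Zr.
    by move=> D; rewrite mulf_neq0.
  + have := tr (a, b) h (mem_head _ _) (T0T _ hT0) oab oh (not_eq_sym (nin _ hT0)).
    rewrite cE' det2Zl.
    by move=> D; rewrite mulf_neq0.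
  + have [gT0|gn] := boolP (g \in T0).
      by have := tr g (a, b) (T0T _ gT0) (mem_head _ _) og oab' (nin _ gT0); rewrite cE' /det2 /= => /eqP []; ring.
    have [hT0|hn] := boolP (h \in T0).
      by have := tr h (a, b) (T0T _ hT0) (mem_head _ _) oh oab (nin _ hT0); rewrite cE'' /det2 /= => /eqP []; ring.
    have sp := on_split x ab t01; rewrite -/m in sp.
    have ge : g = (a, m) \/ g = (m, b) by move: gT; rewrite !inE (negbTE gn) orbF => /orP[/eqP|/eqP]; [left|right].
    have he : h = (a, m) \/ h = (m, b) by move: hT; rewrite !inE (negbTE hn) orbF => /orP[/eqP|/eqP]; [left|right].
    have both : on (a, m) x /\ on (m, b) x by case: ge og gh => -> og; case: he oh => -> oh //.
    by move: sp; case: both => /asboolP -> /asboolP ->; case: (`[< on (a, b) x >]).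
- by have := mixed_uniq mT; rewrite cats0.
Qed.

(** Induction on the sum of the squares of the numbers of crossings on the edges: a cut between two
    crossings of an edge replaces (u + v)^2 by u^2 + v^2 with u and v positive. *)
Lemma one_per_edge (S : seq (pt * pt)) X : closed_edges S -> good S -> mixed (shadow S) X [::] ->
  exists S', [/\ closed_edges S', good S', support S' = support S, mixed (shadow S') X [::] &
    forall e x y, e \in shadow S' -> x \in X -> y \in X -> onc e x -> onc e y -> x = y].
Proof.
pose c e := count (fun x => `[< on e x >]) X.
have [N] := ubnP (\sum_(e <- shadow S) c e ^ 2)%N.
elim: N S => // N IH S muS cS gS mS.
have [H|H] := pselect (forall e x y, e \in shadow S -> x \in X -> y \in X -> onc e x -> onc e y -> x = y).
  by exists S.
have [e [x [y [eT xX yX [ex ey xy]]]]] : exists e x y, [/\ e \in shadow S, x \in X, y \in X & [/\ onc e x, onc e y & x <> y]].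
  apply: contrapT => H'; apply: H => e x y eT xX yX ex ey; apply: contrapT => xy; apply: H'.
  by exists e, x, y.
have bal := shadow_balanced cS.
have [tx tx01 xE] := onc_interior mS bal eT xX ex; have [ty ty01 yE] := onc_interior mS bal eT yX ey.
wlog txy : x y tx ty xX yX ex ey xy tx01 ty01 xE yE / tx < ty.
  move=> W; have [lt|gt|E] := ltgtP tx ty.
  - exact: (W x y tx ty).
  - by apply: (W y x ty tx) => // E; apply: xy.
  - by case: xy; rewrite xE yE E.
have e12 := mixed_nondeg mS eT; have inj := lerp_inj e12.
have [t [/andP[tt1 tt2] tX]] := avoid_points X inj txy.
have t01 : 0 < t < 1 by case/andP: tx01 => ? _; case/andP: ty01 => _ ?; apply/andP; split; lra.
case/mapP: eT => -[A B] AS eE; have pS := perm_to_rem AS; set S0 := rem (A, B) S in pS.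
pose M := lin A B t; pose S1 := [:: (A, M), (M, B) & S0].
have pth : path <%R (0 : R) (rcons [:: t] 1) by rewrite /=; case/andP: t01 => -> ->.
have SE : S1 = consec (map (lin A B) (0 :: rcons [:: t] 1)) ++ S0 by rewrite /S1 /= lin0 lin1.
have gS' := good_perm pS gS.
have [g1 s1] := good_subdiv pth gS'; rewrite -SE in g1 s1.
have cS' : closed_edges ((A, B) :: S0) := closed_edges_perm pS cS.
have c1 : closed_edges S1 := closed_edges_insert [:: M] cS'.
have pT : perm_eq (shadow S) (e :: shadow S0) by rewrite eE; apply: (perm_map _ pS).
have mE : proj M = lerp e.1 e.2 t by rewrite /M proj_lin eE.
have shE : shadow S1 = [:: (e.1, lerp e.1 e.2 t), (lerp e.1 e.2 t, e.2) & shadow S0] by rewrite /S1 /= mE eE.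
have m1 : mixed (shadow S1) X [::].
  by rewrite shE; apply: mixed_split => //; rewrite -surjective_pairing; apply: mixed_perm pT mS.
have cE : c e = (c (e.1, lerp e.1 e.2 t) + c (lerp e.1 e.2 t, e.2))%N.
  rewrite /c; elim: (X) => //= z l ->; have := on_split z e12 t01; rewrite -surjective_pairing => ->; exact: addnACA.
have pos g z : z \in X -> on g z -> (0 < c g)%N by move=> zX gz; rewrite -has_count; apply/hasP; exists z => //; apply/asboolP.
have p1 : (0 < c (e.1, lerp e.1 e.2 t))%N.
  apply: (pos _ x xX); rewrite xE -[X in (X, _)](lerp0 e.1 e.2) on_lerp; last by case/andP: t01.
  by exists tx; split => //; case/andP: tx01 => /ltW -> _.
have p2 : (0 < c (lerp e.1 e.2 t, e.2))%N.
  apply: (pos _ y yX); rewrite yE -[X in (_, X)](lerp1 e.1 e.2) on_lerp; last by case/andP: t01.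
  by exists ty; split => //; case/andP: ty01 => _ ->; rewrite ltW.
have [|S' [h1 h2 h3 h4 h5]] := IH S1 _ c1 g1 m1; last first.
  by exists S'; split => //; rewrite h3 s1; apply: esym; apply: support_perm.
move: muS; rewrite (perm_big _ pT) big_cons shE !big_cons /= cE.
move: (c _) (c _) p1 p2 (\sum_(_ <- _) _)%N => u v u0 v0 w; rewrite ltnS; apply: leq_trans.
by rewrite addnA ltn_add2r sqrnD -[X in (X < _)%N]addn0 ltn_add2l !muln_gt0 u0 v0.
Qed.

End Splitting.

Section Strand.
Variable R : realType.
Local Notation pl := (R * R)%type.
Implicit Types (x y z : pl) (e f g : pl * pl) (T N : seq (pl * pl)).

Lemma mem_detour_cnt T a b k q D ws x : detour T a b k q D ws -> (0 < cnt (detour_edges a b ws) x)%N ->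
  [\/ x = a, exists2 i, (0 < i <= k)%N & x = q i | ~ diagram T x].
Proof.
move=> d c0; have [g gD og] := (cnt_gt0P _ _).1 c0.
case: (dt_points d gD (on_onc og)) => [|E|[i ik ->]|]; [by constructor 1| |by constructor 2; exists i|by constructor 3].
by move: c0; rewrite E (dt_end d).
Qed.

Section Rerouted.
Variables (g : pl * pl) (s1 s2 s3 s4 s5 : R) (ws : seq pl).
Hypothesis gn : g.1 <> g.2.
Hypothesis order5 : [/\ 0 < s1, s1 < s2, s2 < s3 & [/\ s3 < s4, s4 < s5 & s5 < 1]].
Let l := lerp g.1 g.2.
Let De := detour_edges (l s3) (l s4) ws.

Definition rerouted := consec (g.1 :: rcons ([:: l s1; l s2; l s3] ++ ws ++ [:: l s4; l s5]) g.2).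

Lemma reroutedE : rerouted = consec (map l [:: 0; s1; s2; s3]) ++ De ++ consec (map l [:: s4; s5; 1]).
Proof.
rewrite /= /l lerp0 lerp1 -/l /rerouted; transitivity (consec ([:: g.1; l s1; l s2] ++ l s3 :: (ws ++ [:: l s4; l s5; g.2]))).
  by rewrite /= rcons_cat.
by rewrite consec_cat -cat_cons (consec_cat (_ :: _)).
Qed.

Definition pieces := consec (map l [:: 0; s1; s2; s3]) ++ consec (map l [:: s4; s5; 1]).

Lemma mem_rerouted e : e \in rerouted -> e \in De \/ exists s s', [/\ e \in pieces, e = (l s, l s'), s < s' &
  (s \in [:: 0; s1; s2] /\ 0 <= s /\ s' <= s3) \/ (s \in [:: s4; s5] /\ s4 <= s /\ s' <= 1)].
Proof.
have [r1 r2 r3 [r34 r4 r5]] := order5.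
rewrite reroutedE /pieces !mem_cat => /or3P[|eD|]; [|by left|] => pe; right; rewrite pe ?orbT;
  have [s [s' [-> ss]]] := mem_consec_map pe; exists s, s'.
  have lt : s < s' by apply: path_consec ss; rewrite /= r1 r2 r3.
  have [m1 m2] := mem_consec_pair ss; split => //; left; split; first exact: m1.
  by split; [move: m1; rewrite /= !inE => /or3P[]/eqP ->; lra | move: m2; rewrite !inE => /or3P[]/eqP ->; lra].
have lt : s < s' by apply: path_consec ss; rewrite /= r4 r5.
have [m1 m2] := mem_consec_pair ss; split => //; right; split; first exact: m1.
by split; [move: m1; rewrite /= !inE => /orP[]/eqP ->; lra | move: m2; rewrite !inE => /orP[]/eqP ->; lra].
Qed.

Lemma pieces_cnt x : (cnt pieces x + `[< exists s : R, (s3 <= s < s4)%R /\ x = l s >] = (`[< on g x >] : nat))%N.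
Proof.
have [r1 r2 r3 [r34 r4 r5]] := order5; have inj : injective l := lerp_inj gn.
rewrite cnt_cat !cnt_subdiv //= ?r1 ?r2 ?r3 ?r4 ?r5 //.
have [[t [/andP[t0 t1] xE]]|no] := pselect (on g x); last first.
  by rewrite !asboolF // => -[t [/andP[t0 t1] xE]]; apply: no; exists t; split => //; apply/andP; split; lra.
have E (a b : R) : `[< exists t, a <= t < b /\ x = l t >] = (a <= t < b).
  apply/asboolP/idP => [[u [uab E]]|tab]; last by exists t.
  by have -> : t = u by apply: inj; rewrite -[l t]xE.
rewrite !E t0 t1 andbT; have [c1|c1] := ltP t s3; have [c2|c2] := leP s4 t => //=; exfalso; lra.
Qed.

Lemma rerouted_cnt x : (cnt rerouted x + `[< exists s : R, (s3 <= s < s4)%R /\ x = l s >] = (`[< on g x >] : nat) + cnt De x)%N.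
Proof.
have := pieces_cnt x; rewrite reroutedE /pieces !cnt_cat => <-.
by rewrite (addnC (cnt De x)) addnA addnAC.
Qed.

End Rerouted.

Variables (T : seq (pl * pl)) (X : seq pl).
Hypothesis mT : mixed T X [::].
Hypothesis bal : perm_eq (map fst T) (map snd T).
Hypothesis one : forall e x y, e \in T -> x \in X -> y \in X -> onc e x -> onc e y -> x = y.

Lemma crossing_on_diagram x : x \in X -> diagram T x.
Proof.
move=> xX; have : (0 < cnt T x)%N by rewrite (mixed_double mT xX).
by move=> /cnt_gt0P [g gT og]; exists g => //; apply: on_onc.
Qed.

(** Off the crossings only one half-open edge passes through a point, and an end of g is the start
    of some edge, hence no interior point of e. *)
Lemma interior_shared e g s : e \in T -> g \in T -> e <> g -> 0 < s < 1 -> onc g (lerp e.1 e.2 s) -> lerp e.1 e.2 s \in X.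
Proof.
move=> eT gT eg /andP[s0 s1] og; apply/negPn/negP => nX; have inj := lerp_inj (mixed_nondeg mT eT).
have oe : on e (lerp e.1 e.2 s) by exists s; rewrite ltW.
case/oncE: og => [og|E]; first by apply: eg; apply: (on_unique mT nX).
have [h hT hE] := end_start bal gT.
have eh : e = h by apply: (on_unique mT nX) => //; rewrite E -hE; apply: on_start.
by move: s0; rewrite (inj s 0) ?ltxx // E -hE lerp0 eh.
Qed.

Variables (p : pl) (k : nat) (q D : nat -> pl).
Hypothesis pX : p \in X.
Hypothesis qX : forall i, (0 < i <= k)%N -> q i \in X.
Hypothesis qp : forall i, (0 < i <= k)%N -> q i != p.
Hypothesis dirs : forall i h, (0 < i <= k)%N -> h \in T -> on h (q i) -> det2 (D i) (vec h) != 0.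

Section OneEdge.
Variables (g : pl * pl) (tau h : R) (ws : seq pl).
Hypothesis gT : g \in T.
Hypothesis pE : p = lerp g.1 g.2 tau.
Hypothesis tauh : [/\ 0 < h, 0 < tau - h & tau + h < 1].
Let l := lerp g.1 g.2.
(** Any parameters with 0 < s1 < s2 < tau - h and tau + h < s5 < 1 serve; they mark the tent of
    [reroute], while the part from tau - h to tau + h is replaced. *)
Let s1 := (tau - h) / 3.
Let s2 := (tau - h) / 2.
Let s5 := (tau + h + 1) / 2.
Hypothesis dt : detour T (l (tau - h)) (l (tau + h)) k q D ws.
Let De := detour_edges (l (tau - h)) (l (tau + h)) ws.

Let J : set pl := [set x | exists s, tau - h <= s < tau + h /\ x = l s].

Let order : [/\ 0 < s1, s1 < s2, s2 < tau - h & [/\ tau - h < tau + h, tau + h < s5 & s5 < 1]].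
Proof. by case: tauh => h0 h1 h2; rewrite /s1 /s2 /s5; split; [lra|lra|lra|split; lra]. Qed.

Let inj : injective l.
Proof. exact: lerp_inj (mixed_nondeg mT gT). Qed.

Lemma strand_crossing s : 0 <= s <= 1 -> l s \in X -> s = tau.
Proof.
move=> s01 sX; apply: inj; rewrite -[l tau]pE; apply: (one gT sX pX); first by exists s.
by exists tau; split => //; case: tauh => h0 h1 h2; apply/andP; split; lra.
Qed.

Lemma detour_ends_notin : l (tau - h) \notin X /\ l (tau + h) \notin X.
Proof. by case: tauh => h0 h1 h2; split; apply/negP => /strand_crossing E; move: h0; rewrite -(subr0 h); lra. Qed.

Let N := rerouted g s1 s2 (tau - h) (tau + h) s5 ws.

Let memN e : e \in N -> e \in De \/ exists s s', [/\ e = (l s, l s'), 0 <= s, s < s', s' <= 1 & s' <= tau - h \/ tau + h <= s].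
Proof.
move=> /(mem_rerouted order) [|[s [s' [_ -> ss H]]]]; [by left|right; exists s, s']; have [h0 h1 h2] := tauh.
by case: H => -[_ [a b]]; split => //; [lra|left|lra|right].
Qed.

Lemma rerouted_restrand (Q : seq pl) : (forall x, x \in Q <-> exists2 i, (0 < i <= k)%N & x = q i) ->
  restrand T X Q p g N De J.
Proof.
move=> QP; have [h0 h1 h2] := tauh; have [nA nB] := detour_ends_notin.
split.
- exact: (rerouted_cnt _ (mixed_nondeg mT gT) order).
- by move=> x xX [s [/andP[s1' s2'] xE]]; rewrite pE xE; congr (lerp _ _ _); apply: strand_crossing; rewrite -?xE //; apply/andP; split; lra.
- exact: dt_le1 dt.
- move=> x /(mem_detour_cnt dt) [->|[i ik ->]|nD]; last by constructor 3.
    by constructor 1; split => //; exists (tau - h); rewrite lexx; split => //; rewrite /= ; lra.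
  by constructor 2; apply/QP; exists i.
- move=> e /memN [eD|[s [s' [-> _ ss _ _]]]]; first exact: (dt_nondeg dt).
  by move=> /inj E; move: ss; rewrite E ltxx.
- move=> e /memN [eD|[s [s' [-> s0 ss s1' ts]]]].
    by case: (dt_starts dt eD) => [->//|nD]; apply/negP => /crossing_on_diagram.
  apply/negP => /= sX; have E : s = tau by apply: strand_crossing sX; apply/andP; split; lra.
  by case: ts; lra.
- move=> e /memN [eD|[s [s' [-> s0 ss s1' ts]]]]; first by constructor 1.
  constructor 3 => x xX /(on_lerp _ _ _ ss) [t [/andP[t1 t2] xE]].
  have : t = tau by apply: strand_crossing; rewrite -?[l t]xE //; apply/andP; split; lra.
  by move=> E; case: ts => ts; lra.
- move=> x e f /QP [i ik ->] eD oe fT of_.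
  have [c c0 ->] := dt_dir dt ik eD oe.
  by rewrite det2Zl mulf_neq0 //; apply: (dirs ik fT of_).
Qed.

(** Once the first strand has left p, it no longer meets the interior of the edge f of the other
    strand; this frees f for its own move. *)
Lemma rerouted_other e f s : e \in N -> f \in T -> f <> g -> onc f p -> 0 < s < 1 -> ~ onc e (lerp f.1 f.2 s).
Proof.
move=> eN fT fg fp s01 oe; have onf : onc f (lerp f.1 f.2 s).
  by exists s; split => //; case/andP: s01 => /ltW -> /ltW ->.
have [h0 h1 h2] := tauh.
have share t : 0 <= t <= 1 -> lerp f.1 f.2 s = l t -> t = tau.
  move=> t01 E; have fX : lerp f.1 f.2 s \in X by apply: (interior_shared fT gT fg s01); rewrite E; exists t.
  by apply: strand_crossing => //; rewrite -[l t]E.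
case: (memN eN) => [eD|[a [b [eE a0 ab b1 abt]]]].
  case: (dt_points dt eD oe) => [/share E|/share E|[i ik E]|[]].
  - by have := E ltac:(apply/andP; split; lra); lra.
  - by have := E ltac:(apply/andP; split; lra); lra.
  - have sX := qX ik; rewrite -E in sX; move/eqP: (qp ik); apply; rewrite -E; exact: (one fT sX pX onf fp).
  - by exists f.
move: oe; rewrite eE => -[u [/andP[u0 u1]]]; rewrite [RHS]lerp_lerp.
have w1 : 0 <= u * (b - a) by apply: mulr_ge0 => //; lra.
have w2 : 0 <= (1 - u) * (b - a) by apply: mulr_ge0; lra.
move=> /share E; have := E ltac:(apply/andP; split; lra); case: abt; [|lra].
by move=> ba; lra.
Qed.

Lemma detour_self e s : e \in De -> s1 <= s <= s2 -> ~ onc e (l s).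
Proof.
have [r1 r2 r3 [r34 r4 r5]] := order; have [h0 h1 h2] := tauh; move=> eD /andP[ss1 ss2] oe.
case: (dt_points dt eD oe) => [/inj|/inj|[i ik E]|[]]; [lra|lra| |].
  have sX : l s \in X by rewrite E qX.
  by have := strand_crossing _ sX; rewrite -/s; move=> /(_ ltac:(apply/andP; split; lra)); lra.
by exists g => //; exists s; split => //; apply/andP; split; lra.
Qed.

End OneEdge.
End Strand.

Section PlaneDetours.
Variable R : realType.
Local Notation pl := (R * R)%type.
Implicit Types (x y z : pl) (e f g : pl * pl) (T N : seq (pl * pl)).

Variables (T : seq (pl * pl)) (X : seq pl).
Hypothesis mT : mixed T X [::].
Hypothesis bal : perm_eq (map fst T) (map snd T).
Hypothesis one : forall e x y, e \in T -> x \in X -> y \in X -> onc e x -> onc e y -> x = y.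

(** The walk may leave p in the direction of the strand, whereas the replaced part needs a path from
    tau - h to tau + h; in that case the path is reversed. *)
Lemma oriented_detour p k (q D : nat -> pl) g (tau h : R) ws (i : bool) : p \in X -> (forall j, (0 < j <= k)%N -> q j \in X) ->
  g \in T -> p = lerp g.1 g.2 tau -> [/\ 0 < h, 0 < tau - h & tau + h < 1] ->
  detour T (lerp g.1 g.2 (tau + sv i h)) (lerp g.1 g.2 (tau - sv i h)) k q D ws ->
  exists2 ws', detour T (lerp g.1 g.2 (tau - h)) (lerp g.1 g.2 (tau + h)) k q D ws' &
    forall x, (0 < cnt (detour_edges (lerp g.1 g.2 (tau - h)) (lerp g.1 g.2 (tau + h)) ws') x)%N ->
      [\/ x = lerp g.1 g.2 (tau - h), x = lerp g.1 g.2 (tau + h) |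
       (0 < cnt (detour_edges (lerp g.1 g.2 (tau + sv i h)) (lerp g.1 g.2 (tau - sv i h)) ws) x)%N].
Proof.
move=> pX qX gT pE th; have [h0 h1 h2] := th; have [nA nB] := detour_ends_notin mT one pX gT pE th.
case: i; rewrite /sv; last by rewrite opprK => d; exists ws => // x; constructor 3.
set b := lerp _ _ (tau + h) in nB *; set a := lerp _ _ (tau - h) in nA * => d; exists (rev ws).
  have inj := lerp_inj (mixed_nondeg mT gT).
  have dg t : 0 <= t <= 1 -> diagram T (lerp g.1 g.2 t) by move=> t01; exists g => //; exists t.
  apply: detour_rev d.
  - by move/inj; lra.
  - by apply: dg; apply/andP; split; lra.
  - by apply: dg; apply/andP; split; lra.
  - by move=> j jk; apply: (crossing_on_diagram mT); apply: qX.
  - by move=> j jk; split=> E; [move: nB|move: nA]; rewrite E qX.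
move=> x c0; have := @cnt_rev R (b :: rcons ws a) b x (fun e eD => dt_nondeg d eD) (fun H => ltac:(discriminate H)).
rewrite rev_cons rev_rcons /= last_rcons -/(detour_edges b a ws) -[consec (a :: _)]/(detour_edges a b (rev ws)).
have [->|xa] := eqVneq x a; first by constructor 1.
by rewrite addn0 => E; constructor 3; rewrite -E addn_gt0 c0.
Qed.

Record strand_detour k (q D : nat -> pl) g (tau h : R) ws : Prop := StrandDetour {
  sd_room : [/\ 0 < h, 0 < tau - h & tau + h < 1];
  sd_detour : detour T (lerp g.1 g.2 (tau - h)) (lerp g.1 g.2 (tau + h)) k q D ws;
  sd_dirs : forall i g', (0 < i <= k)%N -> g' \in T -> on g' (q i) -> det2 (D i) (vec g') != 0 }.

Lemma strand_detours_exist : (0 < size X)%N -> exists p e f T0 (tau sig : R) k (q D : nat -> pl) (h : R) ws, [/\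
  [/\ p \in X, perm_eq T (e :: f :: T0), p = lerp e.1 e.2 tau, p = lerp f.1 f.2 sig & 0 < sig < 1],
  [/\ forall i, (0 < i <= k)%N -> q i \in X, forall i, (0 < i <= k)%N -> q i != p, uniq (map q (iota 1 k)) & forall g, g \in T0 -> ~ onc g p],
  strand_detour k q D e tau h ws &
  k = 0%N \/ exists (D' : nat -> pl) (h' : R) ws', [/\ strand_detour k q D' f sig h' ws',
    forall i, (0 < i <= k)%N -> det2 (D i) (D' i) != 0 &
    forall x, (0 < cnt (detour_edges (lerp e.1 e.2 (tau - h)) (lerp e.1 e.2 (tau + h)) ws) x)%N ->
      (0 < cnt (detour_edges (lerp f.1 f.2 (sig - h')) (lerp f.1 f.2 (sig + h')) ws') x)%N ->
      exists2 i, (0 < i <= k)%N & x = q i]].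
Proof.
move=> X0; have [k [q [e [f [s [t [w [eps ci]]]]]]]] := circuit_exists mT bal one X0.
have [T0 [pT [tau tau01 pe] [sig sig01 pf] D0 far]] := ci_edges ci (leq0n k).
have eT : e 0%N \in T by rewrite (perm_mem pT) mem_head.
have fT : f 0%N \in T by rewrite (perm_mem pT) !inE eqxx orbT.
have ef : e 0%N <> f 0%N by have := mixed_uniq_edges mT; rewrite (perm_uniq pT) /= inE negb_or => /andP[/andP[/eqP]].
have pX : q 0%N \in X := ci_mem ci (leq0n k).
have qX i : (0 < i <= k)%N -> q i \in X by case/andP => _; apply: (ci_mem ci).
have qp i : (0 < i <= k)%N -> q i != q 0%N by move=> ik; rewrite eq_sym; apply: (ci_uniq ci).
have uq : uniq (map q (iota 1 k)).
  rewrite map_inj_in_uniq ?iota_uniq // => i j; rewrite !mem_iota => ik jk E; apply/eqP/negPn/negP.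
  move=> /(crossing_neq ci (i := i) (j := j)); rewrite E eqxx; case/andP: ik jk; rewrite add1n ltnS => _ ik /andP[_ jk].
  by rewrite ltnS in jk; move=> /(_ ik jk).
have room (tau0 h : R) : 0 < tau0 < 1 -> 0 < h <= Num.min tau0 (1 - tau0) / 2 -> [/\ 0 < h, 0 < tau0 - h & tau0 + h < 1].
  move=> /andP[t0 t1] /andP[h0 hb].
  have m1 : Num.min tau0 (1 - tau0) <= tau0 by rewrite ge_min lexx.
  have m2 : Num.min tau0 (1 - tau0) <= 1 - tau0 by rewrite ge_min lexx orbT.
  by split; lra.
have mpos (tau0 : R) : 0 < tau0 < 1 -> 0 < Num.min tau0 (1 - tau0) / 2.
  by move=> /andP[t0 t1]; rewrite divr_gt0 // lt_min t0 subr_gt0.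
have pointE (h : R) : move_by (q 0%N) (signed (s 0%N) (vec (e 0%N))) (signed (t 0%N) (vec (f 0%N))) h 0 = lerp (e 0%N).1 (e 0%N).2 (tau + sv (s 0%N) h) /\
   move_by (q 0%N) (signed (s 0%N) (vec (e 0%N))) (signed (t 0%N) (vec (f 0%N))) (- h) 0 = lerp (e 0%N).1 (e 0%N).2 (tau - sv (s 0%N) h).
  by split; apply/pl_eqP; rewrite {1 2}pe; case: (s 0%N); rewrite /move_by /signed /lerp /vec /=; split; ring.
have pointF (h : R) : move_by (q 0%N) (signed (s 0%N) (vec (e 0%N))) (signed (t 0%N) (vec (f 0%N))) 0 h = lerp (f 0%N).1 (f 0%N).2 (sig + sv (t 0%N) h) /\
   move_by (q 0%N) (signed (s 0%N) (vec (e 0%N))) (signed (t 0%N) (vec (f 0%N))) 0 (- h) = lerp (f 0%N).1 (f 0%N).2 (sig - sv (t 0%N) h).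
  by split; apply/pl_eqP; rewrite {1 2}pf; case: (t 0%N); rewrite /move_by /signed /lerp /vec /=; split; ring.
have through i g : (0 < i <= k)%N -> g \in T -> on g (q i) -> g = e i \/ g = f i.
  move=> /andP[_ ik] gT og; have [T' [p' _ _ _ far']] := ci_edges ci ik.
  move: gT; rewrite (perm_mem p') !inE => /or3P[/eqP|/eqP|gT]; [by left|by right|].
  by case: (far' g gT); apply: on_onc.
have [k0|ok] := ci_parity ci.
  have [h [ws [hb _ d]]] := single_detour mT one ci (mpos _ tau01).
  have [p1 p2] := pointE h; rewrite /= p1 p2 in d.
  have th := room _ _ tau01 hb; have [ws' d' _] := oriented_detour pX qX eT pe th d.
  exists (q 0%N), (e 0%N), (f 0%N), T0, tau, sig, k, q; eexists; exists h, ws'; split; [by split|by split| |by left].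
  split; [exact: th|exact: d'|].
  by move=> i g' /andP[i0]; rewrite k0 leqNgt i0.
have [h [h' [ws [ws' [[hb hb'] _ d d' dj]]]]] := double_detour mT one ci ok (mpos _ tau01) (mpos _ sig01).
have [p1 p2] := pointE h; have [p3 p4] := pointF h'; rewrite /= p1 p2 p3 p4 in d d' dj.
have th := room _ _ tau01 hb; have th' := room _ _ sig01 hb'.
have [vs e1 E1] := oriented_detour pX qX eT pe th d; have [vs' f1 F1] := oriented_detour pX qX fT pf th' d'.
have [a1 a2] := detour_ends_notin mT one pX eT pe th; have [b1 b2] := detour_ends_notin mT one pX fT pf th'.
exists (q 0%N), (e 0%N), (f 0%N), T0, tau, sig, k, q; eexists; exists h, vs; split; [by split|by split| |right].
  split; [exact: th|exact: e1|] => i g' ik gT' /(through _ _ ik gT') [] ->; have [_ []] := pass_det ci ik; by [].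
eexists; exists h', vs'; split.
- split; [exact: th'|exact: f1|] => i g' ik gT' /(through _ _ ik gT') [] ->; have [_ []] := pass_det ci ik; by [].
- by move=> i ik; have [] := pass_det ci ik.
have mid (tau0 u : R) : [/\ 0 < u, 0 < tau0 - u & tau0 + u < 1] -> 0 < tau0 - u < 1 /\ 0 < tau0 + u < 1.
  by move=> [u0 u1 u2]; clear -u0 u1 u2; split; apply/andP; split; lra.
(* Reversal changes which end of a path is counted, so the ends are checked anew: they lie inside an
   edge at p and off the crossings, hence not on the other path. *)
have touch g g' a tau0 (D : nat -> pl) c c' us : g \in T -> g' \in T -> g <> g' -> a = lerp g.1 g.2 tau0 -> 0 < tau0 < 1 -> a \notin X ->
    detour T c c' k q D us -> (exists2 u, 0 <= u <= 1 & c = lerp g'.1 g'.2 u) -> (0 < cnt (detour_edges c c' us) a)%N -> False.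
  move=> gT gT' gg aE t01 nX du [u u01 cE] /(mem_detour_cnt du) [E|[i ik E]|nD].
  - move/negP: nX; apply; rewrite aE; apply: (interior_shared mT bal gT gT' gg t01).
    by exists u; rewrite -aE E.
  - by move: nX; rewrite E qX.
  - by apply: nD; exists g => //; exists tau0; split => //; case/andP: t01 => /ltW -> /ltW ->.
have [[m1 m2] [m3 m4]] := (mid _ _ th, mid _ _ th').
have sub01 (u : R) : 0 < u < 1 -> 0 <= u <= 1 by case/andP => /ltW -> /ltW ->.
move=> x cE cF; case: (E1 x cE) => [xE|xE|cE'].
- case: (touch _ _ x _ _ _ _ _ eT fT ef xE m1 _ f1 _ cF); first by rewrite xE.
  by exists (sig - h') => //; apply: sub01.
- case: (touch _ _ x _ _ _ _ _ eT fT ef xE m2 _ f1 _ cF); first by rewrite xE.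
  by exists (sig - h') => //; apply: sub01.
case: (F1 x cF) => [xE|xE|cF']; last exact: dj.
- case: (touch _ _ x _ _ _ _ _ fT eT (not_eq_sym ef) xE m3 _ e1 _ cE); first by rewrite xE.
  by exists (tau - h) => //; apply: sub01.
- case: (touch _ _ x _ _ _ _ _ fT eT (not_eq_sym ef) xE m4 _ e1 _ cE); first by rewrite xE.
  by exists (tau - h) => //; apply: sub01.
Qed.

End PlaneDetours.

(** * Rerouting the strands at p in space *)

Section Reduction.
Variable R : realType.
Local Notation pt := 'M[R]_(1,3).
Local Notation pl := (R * R)%type.
Local Notation Z v := (v ord0 i2).

Lemma shadow_consec (xs : seq pt) (A B : pt) :
  shadow (consec (A :: rcons xs B)) = consec (proj A :: rcons (map proj xs) (proj B)).
Proof. by rewrite /shadow /consec -consec_map /= map_rcons. Qed.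

Lemma seg_onc (e : pt * pt) v : seg e.1 e.2 v -> onc (proj e.1, proj e.2) (proj v).
Proof. by move=> /segP [t [t01 ->]]; exists t; split => //; rewrite /lin proj_lin. Qed.

(* At a crossing one of the two strands is on top, so it can be lifted freely there. *)
Lemma crossing_height S (A B C D : pt) S0 X (p : pl) (tau sig : R) : let T := shadow S in
  closed_edges S -> good S -> mixed T X [::] ->
  (forall e x y, e \in T -> x \in X -> y \in X -> onc e x -> onc e y -> x = y) ->
  perm_eq S ((A, B) :: (C, D) :: S0) ->
  p \in X -> p = lerp (proj A) (proj B) tau -> 0 < tau < 1 -> p = lerp (proj C) (proj D) sig -> 0 < sig < 1 ->
  (forall g, g \in shadow S0 -> ~ onc g p) ->
  (forall e, e \in (C, D) :: S0 -> forall v, seg e.1 e.2 v -> forall s, 0 < s < 1 ->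
     proj v = lerp (proj A) (proj B) s -> Z v < Z (lin A B s)) \/
  (forall e, e \in (C, D) :: S0 -> forall v, seg e.1 e.2 v -> forall s, 0 < s < 1 ->
     proj v = lerp (proj A) (proj B) s -> Z (lin A B s) < Z v).
Proof.
move=> T cS gS mT one pS pX pA t01 pC s01 far; have bal := shadow_balanced cS.
have pT : perm_eq T (shadow ((A, B) :: (C, D) :: S0)) := perm_map _ pS.
have aT : (proj A, proj B) \in T by rewrite (perm_mem pT) mem_head.
have cT : (proj C, proj D) \in T by rewrite (perm_mem pT) !inE eqxx orbT.
have nAB : proj A <> proj B := mixed_nondeg mT aT; have nCD : proj C <> proj D := mixed_nondeg mT cT.
have le01 (u : R) : 0 < u < 1 -> 0 <= u <= 1 by case/andP => /ltW -> /ltW ->.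
have key e v s : e \in (C, D) :: S0 -> seg e.1 e.2 v -> 0 < s < 1 -> proj v = lerp (proj A) (proj B) s -> s = tau /\ v = lin C D sig.
  move=> eS sv s01' vE; have eT : (proj e.1, proj e.2) \in shadow ((C, D) :: S0) by apply: (map_f (fun e : pt * pt => (proj e.1, proj e.2))).
  have ne : (proj A, proj B) <> (proj e.1, proj e.2).
    by move=> E; have := mixed_uniq_edges mT; rewrite (perm_uniq pT) /= -/(shadow ((C, D) :: S0)) E eT.
  have ov := seg_onc sv; rewrite vE in ov.
  have eT' : (proj e.1, proj e.2) \in T by rewrite (perm_mem pT) inE eT orbT.
  have sX := interior_shared mT bal aT eT' ne s01' ov.
  have sp : lerp (proj A) (proj B) s = p.
    by apply: (one _ _ _ aT sX pX); [exists s; split => //; apply: le01 | exists tau; split => //; apply: le01].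
  split; first by apply: (lerp_inj nAB); rewrite sp.
  move: eS; rewrite inE => /orP[/eqP E|eS]; last first.
    by case: (far (proj e.1, proj e.2)); [apply: (map_f (fun e : pt * pt => (proj e.1, proj e.2))) | rewrite -sp].
  move: sv; rewrite E => /segP [t [_ vt]]; rewrite vt; congr lin.
  by apply: (lerp_inj nCD); rewrite -pC -sp -vE vt /lin proj_lin.
have nz : Z (lin C D sig) != Z (lin A B tau).
  apply/eqP => E; have E' : lin C D sig = lin A B tau.
    have : proj (lin C D sig) = proj (lin A B tau) by rewrite /lin !proj_lin -pA -pC.
    by rewrite /proj => -[E1 E2]; apply/pt_eqP.
  have CA : (C, D) = (A, B).
    have inC : (C, D) \in S by rewrite (perm_mem pS) !inE eqxx orbT.
    have inA : (A, B) \in S by rewrite (perm_mem pS) mem_head.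
    apply: (count_le1_eq (P := fun e => `[< hseg e (lin A B tau) >]) (proj2 gS (lin A B tau)) inC inA); apply/asboolP.
      by rewrite -E'; exists sig; split => //; case/andP: s01 => /ltW -> ->.
    by exists tau; split => //; case/andP: t01 => /ltW -> ->.
  by have := good_uniq gS; rewrite (perm_uniq pS) /= CA mem_head.
have [lt|gt|E] := ltgtP (Z (lin C D sig)) (Z (lin A B tau)); last by rewrite E eqxx in nz.
- by left=> e eS v sv s s01' vE; have [-> ->] := key e v s eS sv s01' vE.
- by right=> e eS v sv s s01' vE; have [-> ->] := key e v s eS sv s01' vE.
Qed.

Lemma perm_cons_mem (A : eqType) (x : A) s s' : perm_eq s (x :: s') -> x \in s.
Proof. by move=> /perm_mem ->; apply: mem_head. Qed.

Lemma lift_shadow (S : seq (pt * pt)) e T0 : perm_eq (shadow S) (e :: T0) ->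
  exists g S0, [/\ perm_eq S (g :: S0), e = (proj g.1, proj g.2) & perm_eq (shadow S0) T0].
Proof.
move=> pS; have /mapP [g gS eE] := perm_cons_mem pS; exists g, (rem g S).
have pr := perm_to_rem gS; split => //.
by rewrite -(perm_cons e); apply: perm_trans pS; rewrite perm_sym {1}eE; apply: (perm_map _ pr).
Qed.

Lemma restrand_id T X p k (q : nat -> pl) g : k = 0%N -> mixed T X [::] -> g \in T ->
  restrand T X (map q (iota 1 k)) p g [:: g] [::] set0.
Proof.
move=> -> mT gT; split => //.
- by move=> x; rewrite (asboolF (P := set0 x)) // /cnt /= !addn0.
- by move=> h; rewrite inE => /eqP ->; apply: (mixed_nondeg mT).
- by move=> h; rewrite inE => /eqP ->; have := mixed_start mT gT; rewrite cats0.
- by move=> h; rewrite inE => /eqP ->; constructor 2.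
Qed.

Lemma reduction (S : seq (pt * pt)) X : closed_edges S -> good S -> mixed (shadow S) X [::] -> (0 < size X)%N ->
  exists S' X2 X4, [/\ closed_edges S', good S', ambient_isotopic (support S) (support S'),
    mixed (shadow S') X2 X4 & (size X2 + size X4).+1 = size X].
Proof.
move=> cS0 gS0 mS0 X0; have [S1 [cS gS <- mT one]] := one_per_edge cS0 gS0 mS0.
move: {S cS0 gS0 mS0} S1 cS gS mT one => S cS gS mT one; have bal := shadow_balanced cS.
have [p [e [f [T0 [tau [sig [k [q [D [h [ws]]]]]]]]]]] := strand_detours_exist mT bal one X0.
move=> [[pX pT pe pf sig01] [qX qp uq far] [th d dirs] second].
have [[A B] [S1 [pS eE pT1]]] := lift_shadow pT.
have [[C C'] [S0 [pS1 fE pT0]]] := lift_shadow pT1.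
have {pS pS1}pS : perm_eq S ((A, B) :: (C, C') :: S0) by apply: (perm_trans pS); rewrite perm_cons.
have cS' := closed_edges_perm pS cS; have gS' := good_perm pS gS.
have pT' : perm_eq (shadow S) ((proj A, proj B) :: (proj C, proj C') :: shadow S0) := perm_map _ pS.
have eT : e \in shadow S by rewrite (perm_mem pT') -eE mem_head.
have fT : f \in shadow S by rewrite (perm_mem pT') -fE !inE eqxx orbT.
have ef : e <> f by move=> E; have := mixed_uniq_edges mT; rewrite (perm_uniq pT') -eE -fE /= E mem_head.
have far' g : g \in shadow S0 -> ~ onc g p by rewrite (perm_mem pT0); apply: far.
have [h0 h1 h2] := th; have tau01 : 0 < tau < 1 by clear -h0 h1 h2; apply/andP; split; lra.
rewrite eE in pe; rewrite fE in pf.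
have ht := crossing_height cS gS mT one pS pX pe tau01 pf sig01 far'.
have inner s : (tau - h) / 3 <= s <= (tau + h + 1) / 2 -> 0 < s < 1 by case/andP => h3 h4; clear -h0 h1 h2 h3 h4; apply/andP; split; lra.
have nAB : proj A <> proj B by have := mixed_nondeg mT eT; rewrite eE.
have over : (forall e, e \in (C, C') :: S0 -> forall v, seg e.1 e.2 v -> forall s, (tau - h) / 3 <= s <= (tau + h + 1) / 2 ->
     proj v = lerp (proj A) (proj B) s -> Z v < Z (lin A B s)) \/
  (forall e, e \in (C, C') :: S0 -> forall v, seg e.1 e.2 v -> forall s, (tau - h) / 3 <= s <= (tau + h + 1) / 2 ->
     proj v = lerp (proj A) (proj B) s -> Z (lin A B s) < Z v).
  by case: ht => H; [left|right] => g gS1 v sv s /inner s01 vE; apply: (H g).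
have avoid g : g \in consec (lerp (proj A) (proj B) (tau - h) :: rcons ws (lerp (proj A) (proj B) (tau + h))) -> forall x, onc g x ->
    forall s, (tau - h) / 3 <= s <= (tau - h) / 2 -> x <> lerp (proj A) (proj B) s.
  move=> gD x og s s12 xE; rewrite eE in d eT.
  by apply: (detour_self mT one pX qX eT pe th d gD s12); rewrite -xE.
have [||||||xs [mx cx gx ix]] := reroute_side _ _ _ _ _ _ nAB over avoid cS' gS'; try by clear -h0 h1 h2; lra.
set N := consec (A :: rcons xs B) in cx gx ix.
have NE : shadow N = rerouted e ((tau - h) / 3) ((tau - h) / 2) (tau - h) (tau + h) ((tau + h + 1) / 2) ws by rewrite /N shadow_consec mx eE.
pose Q := map q (iota 1 k).
have QP x : x \in Q <-> exists2 i, (0 < i <= k)%N & x = q i.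
  split=> [/mapP [i] ik ->|[i ik ->]]; first by exists i => //; move: ik; rewrite mem_iota add1n ltnS.
  by apply: map_f; rewrite mem_iota add1n ltnS.
have QX : {subset Q <= X} by move=> x /QP [i ik ->]; apply: qX.
have pQ : p \notin Q by apply/negP => /QP [i /qp + E]; rewrite -E eqxx.
have pe' : p = lerp e.1 e.2 tau by rewrite eE.
have pf' : p = lerp f.1 f.2 sig by rewrite fE.
have re := rerouted_restrand mT one pX dirs eT pe' th d QP.
have iso S' : ambient_isotopic (support (N ++ (C, C') :: S0)) S' -> ambient_isotopic (support S) S'.
  by rewrite (support_perm pS); apply: isotopic_trans ix.
have Ie : exists s : R, tau - h <= s < tau + h /\ p = lerp e.1 e.2 s by exists tau; split => //; clear -h0; apply/andP; split; lra.
suff [S' [Nf [Df [If [cS1 gS1 iS1 pS1 [rf onQ disj dir2]]]]]] : exists S' Nf Df If, [/\ closed_edges S', good S',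
    ambient_isotopic (support (N ++ (C, C') :: S0)) (support S'), perm_eq (shadow S') (shadow N ++ Nf ++ shadow S0) &
     [/\ restrand (shadow S) X Q p f Nf Df If,
    forall x, x \in Q -> (0 < cnt (detour_edges (lerp e.1 e.2 (tau - h)) (lerp e.1 e.2 (tau + h)) ws) x)%N /\ (0 < cnt Df x)%N,
    forall x, (0 < cnt (detour_edges (lerp e.1 e.2 (tau - h)) (lerp e.1 e.2 (tau + h)) ws) x)%N -> (0 < cnt Df x)%N -> x \in Q &
    forall x g g', x \in Q -> g \in detour_edges (lerp e.1 e.2 (tau - h)) (lerp e.1 e.2 (tau + h)) ws -> g' \in Df -> on g x -> on g' x -> det2 (vec g) (vec g') != 0]].
  exists S', (seq.filter (fun x => (x != p) && (x \notin Q)) X), Q; split => //.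
  - exact: iso.
  - rewrite perm_sym in pS1; apply: mixed_perm pS1 _; rewrite NE.
    have pT2 : perm_eq (shadow S) (e :: f :: shadow S0) by rewrite eE fE.
    exact: (mixed_surgery mT pT2 uq QX pQ re rf Ie onQ disj dir2).
  - exact: (size_surgery mT pX uq QX pQ).
case: second => [k0|[D' [h' [ws' [[th' d' dirs'] DD' dj]]]]].
  exists (N ++ (C, C') :: S0), [:: f], [::], set0; split => //.
  - exact: isotopic_refl.
  - by rewrite fE /shadow map_cat.
  - split => //; first exact: restrand_id.
    by move=> x; rewrite /Q k0.
have [h0' h1' h2'] := th'.
have inner' s : (sig - h') / 3 <= s <= (sig + h' + 1) / 2 -> 0 < s < 1 by case/andP => h3 h4; clear -h0' h1' h2' h3 h4; apply/andP; split; lra.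
have pC : perm_eq (N ++ (C, C') :: S0) ((C, C') :: N ++ S0) by rewrite -cat1s perm_catCA.
have onf : onc f p by exists sig => //; split => //; case/andP: sig01 => /ltW -> /ltW ->.
have other g v s : g \in N ++ S0 -> seg g.1 g.2 v -> 0 < s < 1 -> proj v <> lerp (proj C) (proj C') s.
  move=> gS1 /seg_onc og s01 vE; have gsh : (proj g.1, proj g.2) \in shadow (N ++ S0) by apply: (map_f (fun e : pt * pt => (proj e.1, proj e.2))).
  rewrite vE in og; move: gsh; rewrite /shadow map_cat -/(shadow N) -/(shadow S0) mem_cat => /orP[|gT0].
    by rewrite NE => gN; apply: (rerouted_other mT bal one pX qX qp eT pe' th d gN fT (not_eq_sym ef) onf s01); rewrite fE.
  have gT : (proj g.1, proj g.2) \in shadow S by rewrite (perm_mem pT') !inE gT0 !orbT.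
  have gf : f <> (proj g.1, proj g.2).
    by move=> E; have := mixed_uniq_edges mT; rewrite (perm_uniq pT') -fE E /= gT0 /= andbF.
  have og' : onc (proj g.1, proj g.2) (lerp f.1 f.2 s) by rewrite fE.
  have sX := interior_shared mT bal fT gT gf s01 og'.
  have sp : lerp f.1 f.2 s = p.
    by apply: (one _ _ _ fT sX pX _ onf); exists s; split => //; case/andP: s01 => /ltW -> /ltW ->.
  by apply: (far' _ gT0); rewrite -sp.
have nCD : proj C <> proj C' by have := mixed_nondeg mT fT; rewrite fE.
(* The other strand has left p, so nothing lies over or under this edge any more and the condition
   holds vacuously. *)
have over' : (forall g, g \in N ++ S0 -> forall v, seg g.1 g.2 v -> forall s, (sig - h') / 3 <= s <= (sig + h' + 1) / 2 ->
     proj v = lerp (proj C) (proj C') s -> Z v < Z (lin C C' s)) \/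
  (forall g, g \in N ++ S0 -> forall v, seg g.1 g.2 v -> forall s, (sig - h') / 3 <= s <= (sig + h' + 1) / 2 ->
     proj v = lerp (proj C) (proj C') s -> Z (lin C C' s) < Z v).
  by left=> g gS1 v sv s /inner' s01 vE; case: (other g v s gS1 sv s01).
have avoid' g : g \in consec (lerp (proj C) (proj C') (sig - h') :: rcons ws' (lerp (proj C) (proj C') (sig + h'))) -> forall x, onc g x ->
    forall s, (sig - h') / 3 <= s <= (sig - h') / 2 -> x <> lerp (proj C) (proj C') s.
  move=> gD x og s s12 xE; rewrite fE in d' fT.
  by apply: (detour_self mT one pX qX fT pf th' d' gD s12); rewrite -xE.
have [||||||ys [my cy gy iy]] := reroute_side _ _ _ _ _ _ nCD over' avoid' (closed_edges_perm pC cx) (good_perm pC gx); try by clear -h0' h1' h2'; lra.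
exists (consec (C :: rcons ys C') ++ N ++ S0), (rerouted f ((sig - h') / 3) ((sig - h') / 2) (sig - h') (sig + h') ((sig + h' + 1) / 2) ws'); do 2 eexists; split; [done|done|by rewrite (support_perm pC)| |].
- by rewrite /shadow !map_cat -/(shadow _) shadow_consec my perm_catCA fE.
split.
- exact: (rerouted_restrand mT one pX dirs' fT pf' th' d' QP).
- by move=> x /QP [i ik ->]; rewrite (dt_pass d ik) (dt_pass d' ik).
- by move=> x c1 c2; apply/QP; apply: dj.
- move=> x g g' /QP [i ik ->] gD gD' og og'.
  have [c c0 ->] := dt_dir d ik gD og; have [c' c0' ->] := dt_dir d' ik gD' og'.
  by rewrite det2Zl det2Zr !mulf_neq0 // DD'.
Qed.

End Reduction.

(** * From double to quadruple crossings *)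

Section Finger.
Variable R : realType.
Local Notation pt := 'M[R]_(1,3).
Local Notation pl := (R * R)%type.
Local Notation Z v := (v ord0 i2).
Implicit Types (x y z : pl) (e f g : pl * pl) (T N : seq (pl * pl)).

(* A strand along the first axis follows this path, crossing the second axis only at the origin, and
   goes on along the first axis: it passes three times through the origin. *)
Definition finger : seq pl := [:: (-4, 0); (-2, 2); (2, -2); (2, -1); (-2, 1); (-1, 0)].

Lemma finger_edges g : g \in consec finger -> [\/ g = ((-4, 0), (-2, 2)), g = ((-2, 2), (2, -2)), g = ((2, -2), (2, -1)) |
  g = ((2, -1), (-2, 1)) \/ g = ((-2, 1), (-1, 0))].
Proof.
rewrite /finger /consec /= !inE => /or4P[/eqP ->|/eqP ->|/eqP ->|/orP[/eqP ->|/eqP ->]];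
  [by constructor 1|by constructor 2|by constructor 3|by constructor 4; left|by constructor 4; right].
Qed.

Lemma finger_box g z : g \in consec finger -> onc g z -> -4 <= z.1 <= 2 /\ -2 <= z.2 <= 2.
Proof. by move=> /finger_edges [->|->|->|[->|->]] [t [/andP[t0 t1] ->]]; rewrite /lerp /=; split; apply/andP; split; lra. Qed.

Lemma finger_axes g z : g \in consec finger -> on g z -> (z.1 = 0 -> z = (0, 0)) /\ (z.2 = 0 -> z = (0, 0) \/ z = (-4, 0)).
Proof.
move=> H [t [/andP[t0 t1] zE]]; split.
  move=> z0; apply/pl_eqP; rewrite z0; split => //; move: z0.
  by move: H zE => /finger_edges [->|->|->|[->|->]] ->; rewrite /lerp /=; lra.
move=> z0; have [z10|/eqP z10] := eqVneq z.1 0; first by left; apply/pl_eqP.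
right; apply/pl_eqP; rewrite z0; split => //; move: z0 z10.
by move: H zE => /finger_edges [->|->|->|[->|->]] ->; rewrite /lerp /= => E N; first [lra | by case: N; lra].
Qed.

Lemma finger_starts g : g \in consec finger -> g.1 <> g.2 /\ g.1 <> (0, 0).
Proof. by move=> /finger_edges [->|->|->|[->|->]] /=; split=> /pl_eqP /= [E1 E2]; lra. Qed.

Lemma finger_center g : g \in consec finger -> on g (0, 0) -> g = ((-2, 2), (2, -2)) \/ g = ((2, -1), (-2, 1)).
Proof.
move=> /finger_edges [->|->|->|[->|->]] [t [/andP[t0 t1] /pl_eqP]]; rewrite /lerp /vec /= => -[E1 E2]; try by exfalso; lra.
  by left.
by right.
Qed.

Lemma finger_cnt0 : cnt (consec finger) (0, 0) = 2%N.
Proof.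
rewrite /cnt /finger /consec /=.
rewrite asboolF; last by move=> [t [/andP[t0 t1] /pl_eqP]]; rewrite /lerp /= => -[E1 E2]; lra.
rewrite asboolT; last by exists (2^-1); split; [lra | apply/pl_eqP; rewrite /lerp /=; split; field].
rewrite asboolF; last by move=> [t [/andP[t0 t1] /pl_eqP]]; rewrite /lerp /= => -[E1 E2]; lra.
rewrite asboolT; last by exists (2^-1); split; [lra | apply/pl_eqP; rewrite /lerp /=; split; field].
by rewrite asboolF //; move=> [t [/andP[t0 t1] /pl_eqP]]; rewrite /lerp /= => -[E1 E2]; lra.
Qed.

Lemma finger_cnt1 z : z <> (0, 0) -> (cnt (consec finger) z <= 1)%N.
Proof.
move=> z0; rewrite leqNgt; apply/negP => c2.
have u : uniq (consec finger).
  (* The function 10 x + y takes different values at the five starting points. *)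
  apply: (@map_uniq _ _ (fun g : pl * pl => 10 * g.1.1 + g.1.2)); rewrite /= !inE !negb_or.
  by do !(apply/andP; split); rewrite ?andbT //; apply/eqP; lra.
have [g [h [gF hF /eqP gh /asboolP [t [/andP[t0 t1] zt]] /asboolP [v [/andP[v0 v1] zv]]]]] := count_ge2_ex u c2.
suff [z1 z2] : z.1 = 0 /\ z.2 = 0 by apply: z0; apply/pl_eqP.
move: zv; rewrite {1}zt => /pl_eqP [/=]; rewrite {1 2}zt {z0 c2 u zt}.
move: (finger_edges gF) (finger_edges hF) gh => [->|->|->|[->|->]] [->|->|->|[->|->]] gh; try (by case: gh);
  rewrite /lerp /= {gF hF gh} => E1 E2; split; lra.
Qed.

Lemma det2_comb (u v : pl) (a b a' b' m m' : R) :
  det2 (m * (a * u.1 + b * v.1), m * (a * u.2 + b * v.2)) (m' * (a' * u.1 + b' * v.1), m' * (a' * u.2 + b' * v.2)) =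
  m * m' * (a * b' - b * a') * det2 u v.
Proof. by rewrite /det2 /=; ring. Qed.

Lemma move_by_inj x (u v : pl) (a b a' b' : R) : det2 u v != 0 -> move_by x u v a b = move_by x u v a' b' -> a = a' /\ b = b'.
Proof.
rewrite /det2 => D /pl_eqP; rewrite /move_by /=; move: u.1 u.2 v.1 v.2 D => u1 u2 v1 v2 D [E1 E2].
have E3 : (a - a') * (u1 * v2 - u2 * v1) = 0.
  transitivity ((x.1 + a * u1 + b * v1 - (x.1 + a' * u1 + b' * v1)) * v2 - (x.2 + a * u2 + b * v2 - (x.2 + a' * u2 + b' * v2)) * v1); first by ring.
  by rewrite E1 E2; ring.
have E4 : (b - b') * (u1 * v2 - u2 * v1) = 0.
  transitivity (u1 * (x.2 + a * u2 + b * v2 - (x.2 + a' * u2 + b' * v2)) - u2 * (x.1 + a * u1 + b * v1 - (x.1 + a' * u1 + b' * v1))); first by ring.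
  by rewrite E1 E2; ring.
by move/eqP: E3; move/eqP: E4; rewrite !mulf_eq0 (negbTE D) !orbF !subr_eq0 => /eqP -> /eqP ->.
Qed.

(** In coordinates along the two strands at c the first strand is changed between -6 and -1/2 only,
    before it reaches c. Nothing lies over or under this part, so it can be rerouted along the
    finger whatever the heights at c are; afterwards the strand still passes c as before, which
    makes its third passage. *)
Lemma finger_move (S : seq (pt * pt)) c X2 X4 : closed_edges S -> good S -> mixed (shadow S) (c :: X2) X4 ->
  exists S', [/\ closed_edges S', good S', ambient_isotopic (support S) (support S') & mixed (shadow S') X2 (c :: X4)].
Proof.
move=> cS gS mT; have bal := shadow_balanced cS; set T := shadow S in mT bal; set XX := (c :: X2) ++ X4.
have cX : c \in XX by rewrite mem_head.
have startX g : g \in T -> g.1 \notin XX by exact: (mixed_start mT).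
have [e [f [T2 [pT /asboolP ec /asboolP fc oth]]]] := count2_split (mixed_double mT (mem_head _ _)).
have eT : e \in T by rewrite (perm_mem pT) mem_head.
have fT : f \in T by rewrite (perm_mem pT) !inE eqxx orbT.
have ut := mixed_uniq_edges mT; rewrite (perm_uniq pT) /= inE negb_or in ut.
case/and3P: ut => /andP[/eqP ef eT2] fT2 _.
have D0 : det2 (vec e) (vec f) != 0 by apply: (mixed_transverse mT cX).
have far g : g \in T2 -> ~ onc g c.
  move=> gT /oncE [/asboolP og|E]; first by have := oth g gT; rewrite og.
  have : g.2 \in map fst T by rewrite (perm_mem bal); apply: map_f; rewrite (perm_mem pT) !inE gT !orbT.
  by case/mapP => h hT hE; have := startX h hT; rewrite -hE -E cX.
have [[A B] [S1 [pS eE pS1]]] := lift_shadow pT.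
have ne := mixed_nondeg mT eT; have nf := mixed_nondeg mT fT.
have [tau [/andP[t0 t1] ce]] := ec; have [sig [/andP[s0 s1] cf]] := fc.
have {}t0 : 0 < tau.
  by rewrite lt0r t0 andbT; apply/eqP => E; have := startX e eT; rewrite -(lerp0 e.1 e.2) -E -ce cX.
have [r1 r10 Hr1] := edges_far T c; have [r2 r20 Hr2] := edges_far (map (fun x => (x, x)) XX) c.
have r0 : 0 < Num.min r1 r2 by rewrite lt_min r10.
have [k k0 Hk] := nbh_move c (vec e) (vec f) r0.
(* The unit of the finger: all coordinates in use are at most 6 in absolute value, so with 8 units
   the picture stays in the free square around c and within the edge e. *)
pose del := Num.min k (Num.min tau (1 - tau)) / 8.
have m0 : 0 < Num.min k (Num.min tau (1 - tau)) by rewrite !lt_min k0 t0 subr_gt0.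
have [mk [mt mt']] : 8 * del <= k /\ 8 * del <= tau /\ 8 * del <= 1 - tau.
  rewrite /del mulrC divfK ?pnatr_eq0 //; split; first by rewrite ge_min lexx.
  by split; rewrite !ge_min lexx !orbT.
have d0 : 0 < del by rewrite divr_gt0.
pose F (z : pl) : pl := move_by c (vec e) (vec f) (del * z.1) (del * z.2).
have Finj : injective F.
  move=> z w /(move_by_inj D0) [/mulfI E1 /mulfI E2]; apply/pl_eqP.
  by split; [apply: E1|apply: E2]; rewrite gt_eqF.
pose l := lerp e.1 e.2; have linj : injective l := lerp_inj ne.
have lF (t : R) : l t = F ((t - tau) / del, 0).
  have E : del * ((t - tau) / del) = t - tau by rewrite mulrC divfK // gt_eqF.
  by apply/pl_eqP; rewrite /F /move_by /= E {1 2}ce /l /lerp /vec /=; split; ring.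
have lF' (a : R) : l (tau + del * a) = F (a, 0).
  by rewrite lF; congr (F (_, _)); rewrite addrC addKr mulrC mulKf // gt_eqF.
have fF (t : R) : lerp f.1 f.2 t = F (0, (t - sig) / del).
  have E : del * ((t - sig) / del) = t - sig by rewrite mulrC divfK // gt_eqF.
  by apply/pl_eqP; rewrite /F /move_by /= E {1 2}cf /lerp /vec /=; split; ring.
have F0 : F (0, 0) = c by apply/pl_eqP; rewrite /F /move_by /=; split; ring.
have one z : onc e (F z) -> z.2 = 0 by move=> [t [_]]; rewrite -[lerp _ _ t]/(l t) lF => /Finj ->.
have onf z : onc f (F z) -> z.1 = 0 by move=> [t [_]]; rewrite fF => /Finj ->.
have near (z : pl) : -6 <= z.1 <= 6 -> -6 <= z.2 <= 6 -> nbh c r1 (F z) /\ nbh c r2 (F z).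
  move=> /andP[z1 z2] /andP[z3 z4]; apply: nbh_min; have [h1 h2 h3 h4] : [/\ 0 <= del * (6 - z.1), 0 <= del * (z.1 + 6), 0 <= del * (6 - z.2) & 0 <= del * (z.2 + 6)].
    by clear -z1 z2 z3 z4 d0; split; apply: mulr_ge0; lra.
  by apply: Hk; rewrite ler_norml; apply/andP; clear -h1 h2 h3 h4 mk d0; split; lra.
have away (z : pl) g : -6 <= z.1 <= 6 -> -6 <= z.2 <= 6 -> g \in T2 -> ~ onc g (F z).
  move=> h1 h2 gT; have [n1 _] := near z h1 h2; apply: (Hr1 g _ (far g gT)) => //.
  by rewrite (perm_mem pT) !inE gT !orbT.
have noX (z : pl) : -6 <= z.1 <= 6 -> -6 <= z.2 <= 6 -> F z \in XX -> z = (0, 0).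
  move=> h1 h2 zX; have [_ n2] := near z h1 h2; apply: Finj; rewrite F0; apply: contrapT => zc.
  apply: (Hr2 (F z, F z) (map_f _ zX) _ _ n2); last exact: onc_start.
  by move=> [t [_ E]]; apply: zc; rewrite E; clear; apply/pl_eqP; rewrite /lerp /=; split; ring.
have lerpF (z w : pl) t : lerp (F z) (F w) t = F (lerp z w t).
  by clear; apply/pl_eqP; rewrite /F /move_by /lerp /=; split; ring.
pose s (a : R) := tau + del * a.
have slt (a b : R) : a < b -> s a < s b by move=> ab; rewrite /s ltrD2l ltr_pM2l.
pose ws := map F [:: (-2, 2); (2, -2); (2, -1); (-2, 1)].
pose Fe (g : pl * pl) := (F g.1, F g.2).
have DeE : detour_edges (l (s (-4))) (l (s (-1))) ws = map Fe (consec finger).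
  by rewrite /s !lF' /detour_edges /ws /finger /=.
have onF g z : on (Fe g) (F z) <-> on g z.
  split=> -[t [t01 E]]; exists t; split => //; last by rewrite E -lerpF.
  by move: E; rewrite lerpF => /Finj.
have onceF g x : onc (Fe g) x -> exists2 z, x = F z & onc g z.
  by move=> [t [t01 ->]]; exists (lerp g.1 g.2 t); [rewrite -lerpF | exists t].
have cntF z : cnt (detour_edges (l (s (-4))) (l (s (-1))) ws) (F z) = cnt (consec finger) z.
  by rewrite DeE /cnt count_map; apply: eq_count => g /=; apply: asbool_equiv_eq; apply: onF.
have sE (a : R) : -6 <= a <= 6 -> 0 < s a < 1.
  move=> /andP[a1 a2]; have [h1 h2] : 0 <= del * (a + 6) /\ 0 <= del * (6 - a).
    by clear -a1 a2 d0; split; apply: mulr_ge0; lra.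
  by rewrite /s; apply/andP; clear -h1 h2 mt mt' d0; split; lra.
have six (a : R) : (a \in [:: -6; -5; -4; -1; -2^-1]) -> -6 <= a <= 6.
  by rewrite !inE => /or4P[/eqP ->|/eqP ->|/eqP ->|/orP[/eqP ->|/eqP ->]]; clear; apply/andP; split; lra.
have order5 : [/\ 0 < s (-6), s (-6) < s (-5), s (-5) < s (-4) & [/\ s (-4) < s (-1), s (-1) < s (- 2^-1) & s (- 2^-1) < 1]].
  have [i6 i2] : -6 <= (-6 : R) <= 6 /\ -6 <= - (2^-1 : R) <= 6 by clear; split; apply/andP; split; lra.
  have /andP[p6 _] := sE _ i6; have /andP[_ p2] := sE _ i2.
  by split; [|apply: slt; clear; lra|apply: slt; clear; lra|split; [apply: slt; clear; lra|apply: slt; clear; lra|]].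
have between (a b t : R) : s a <= t <= s b -> a <= (t - tau) / del <= b.
  by rewrite ler_pdivlMr // ler_pdivrMr // ![_ * del]mulrC => /andP[h1 h2]; rewrite lerBrDl h1 lerBlDl h2.
have S1T (g : pt * pt) : g \in S1 -> (proj g.1, proj g.2) \in f :: T2.
  by move=> gS1; rewrite -(perm_mem pS1); apply: (map_f (fun e : pt * pt => (proj e.1, proj e.2))).
have f2T g : g \in f :: T2 -> g \in T by rewrite (perm_mem pT) [in X in _ -> X]inE => ->; rewrite orbT.
have off_axis (a : R) g : -6 <= a <= 6 -> a != 0 -> g \in f :: T2 -> ~ onc g (F (a, 0)).
  move=> a6 a0; rewrite inE => /orP[/eqP -> /onf /= E|gT]; first by rewrite E eqxx in a0.
  by apply: away => //=; clear; apply/andP; split; lra.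
have over : (forall g : pt * pt, g \in S1 -> forall v, seg g.1 g.2 v -> forall t, s (-6) <= t <= s (- 2^-1) ->
     proj v = lerp (proj A) (proj B) t -> Z v < Z (lin A B t)) \/
  (forall g : pt * pt, g \in S1 -> forall v, seg g.1 g.2 v -> forall t, s (-6) <= t <= s (- 2^-1) ->
     proj v = lerp (proj A) (proj B) t -> Z (lin A B t) < Z v).
  left=> g gS1 v /seg_onc og t /between /andP[t2 t3] E; exfalso; move: og; rewrite E.
  have -> : lerp (proj A) (proj B) t = l t by rewrite /l eE.
  rewrite lF; apply: off_axis (S1T g gS1); first by clear -t2 t3; apply/andP; split; lra.
  by rewrite lt_eqF //; clear -t3; lra.
have avoid g : g \in consec (lerp (proj A) (proj B) (s (-4)) :: rcons ws (lerp (proj A) (proj B) (s (-1)))) -> forall x, onc g x ->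
    forall t, s (-6) <= t <= s (-5) -> x <> lerp (proj A) (proj B) t.
  have lE t : lerp (proj A) (proj B) t = l t by rewrite /l eE.
  rewrite !lE -/(detour_edges (l (s (-4))) (l (s (-1))) ws) DeE => /mapP [g0 gF ->] x /onceF [z -> oz] t /between /andP[_ t2].
  rewrite lE lF => /Finj E; have [/andP[z1 _] _] := finger_box gF oz; move: z1; rewrite E /= => z1; clear -z1 t2; lra.
have nAB : proj A <> proj B by have := ne; rewrite eE.
have [r1' r2' r3' [r4' r5' r6']] := order5.
have [xs [mx cx gx ix]] := reroute_side r1' r2' r3' r4' r5' r6' nAB over avoid (closed_edges_perm pS cS) (good_perm pS gS).
exists (consec (A :: rcons xs B) ++ S1); split => //; first by rewrite (support_perm pS).
pose N := rerouted e (s (-6)) (s (-5)) (s (-4)) (s (-1)) (s (- 2^-1)) ws.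
pose P := pieces e (s (-6)) (s (-5)) (s (-4)) (s (-1)) (s (- 2^-1)).
have pN : perm_eq (N ++ f :: T2) (shadow (consec (A :: rcons xs B) ++ S1)).
  by rewrite /shadow map_cat -!/(shadow _) shadow_consec mx /N eE perm_cat2l perm_sym.
apply: mixed_perm pN _.
pose J x := `[< exists t : R, (s (-4) <= t < s (-1))%R /\ x = l t >].
pose De := detour_edges (l (s (-4))) (l (s (-1))) ws.
have cN x : (cnt (N ++ f :: T2) x + J x = cnt T x + cnt De x)%N.
  have := rerouted_cnt ws ne order5 x; rewrite cnt_cat -/N -/l -/De -/(J x).
  have -> : cnt T x = (`[< on e x >] + cnt (f :: T2) x)%N by rewrite /cnt (permP pT).
  by move=> E; rewrite addnAC E addnAC.
have cP x : (cnt P x + J x = `[< on e x >])%N := pieces_cnt ne order5 x.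
have memN g : g \in N -> g \in De \/ exists t t', [/\ g \in P, g = (l t, l t'), t < t' & t = 0 \/ exists2 a, a \in [:: -6; -5; -4; -1; -2^-1] & t = s a].
  rewrite /N => gN; case: (mem_rerouted order5 gN) => [|[t [t' [gP gE tt H]]]]; [by left|right; exists t, t'; split => //].
  have inA (a : R) : a \in [:: -6; -5; -4; -1; - 2^-1] -> s a = 0 \/ exists2 a', a' \in [:: -6; -5; -4; -1; - 2^-1] & s a = s a'.
    by right; exists a.
  case: H => -[] + _; rewrite !inE; last by move=> /orP[]/eqP ->; apply: inA; rewrite !inE eqxx ?orbT.
  by move=> /or3P[]/eqP ->; [left|apply: inA; rewrite !inE eqxx ?orbT|apply: inA; rewrite !inE eqxx ?orbT].
have DeP x : (0 < cnt De x)%N -> exists2 z, x = F z & exists2 g, g \in consec finger & on g z.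
  move=> /cnt_gt0P [h]; rewrite /De DeE => /mapP [g gF ->] oh.
  by have [z E _] := onceF g x (on_onc oh); exists z => //; exists g => //; apply/onF; rewrite -E.
have box6 z g : g \in consec finger -> onc g z -> -6 <= z.1 <= 6 /\ -6 <= z.2 <= 6.
  by move=> gF /(finger_box gF) [/andP[z1 z2] /andP[z3 z4]]; clear -z1 z2 z3 z4; split; apply/andP; split; lra.
have DeX x : x \in XX -> x != c -> cnt De x = 0%N.
  move=> xX xc; apply/eqP; rewrite -leqn0 leqNgt; apply/negP => /DeP [z xE [g gF og]].
  have [b1 b2] := box6 z g gF (on_onc og); rewrite xE in xX; have z0 := noX z b1 b2 xX.
  by rewrite xE z0 F0 eqxx in xc.
have JX x : x \in XX -> J x = false.
  move=> xX; apply/asboolP => -[t [/andP[h1 h2] xE]]; have := between _ _ _ (introT andP (conj h1 (ltW h2))) => /andP[h3 h4].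
  rewrite xE lF in xX; have := noX _ _ _ xX; rewrite /= => /(_ _ _)/pl_eqP [].
  - by clear -h3 h4; apply/andP; split; lra.
  - by clear; apply/andP; split; lra.
  - by move=> /= E _; rewrite E in h4; clear -h4; lra.
have mXX x : x \in X2 ++ c :: X4 -> x \in XX by rewrite /XX !mem_cat !inE; case: (x == c); case: (x \in X2).
have cDe0 : cnt De c = 2%N by rewrite -F0 cntF finger_cnt0.
have uX : uniq (X2 ++ c :: X4).
  have pX : perm_eq (X2 ++ c :: X4) XX by rewrite -[c :: X4]cat1s perm_catCA.
  by rewrite (perm_uniq pX) (mixed_uniq mT).
split.
- move=> g; rewrite mem_cat => /orP[/memN [|[t [t' [_ -> tt _]]]]|/f2T /(mixed_nondeg mT) //].
    by rewrite /De DeE => /mapP [h hF ->] /= /Finj E; have [] := finger_starts hF.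
  by move=> /linj E; rewrite E ltxx in tt.
- move=> x; rewrite inE negb_or => x2 /andP[xc x4].
  have xX : x \notin XX by rewrite mem_cat inE !negb_or xc x2.
  have c1 := mixed_off mT (x := x) ltac:(by rewrite inE negb_or xc) x4.
  have := cN x; have [->|] := posnP (cnt De x); first by rewrite addn0; move: (J x) c1; clear; case; lia.
  move=> d1; have [z xE [g gF og]] := DeP x d1; have z0 : z <> (0, 0) by move=> z0; rewrite xE z0 F0 eqxx in xc.
  have dle : (cnt De x <= 1)%N by rewrite xE cntF finger_cnt1.
  have [->|] := posnP (cnt T x); first by move: (J x) dle; clear; case; lia.
  move=> /cnt_gt0P [h hT oh]; suff Jx : exists t : R, s (-4) <= t < s (-1) /\ x = l t.
    by have -> : J x; [apply/asboolP|move: c1 dle; clear; lia].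
  have [b1 b2] := box6 z g gF (on_onc og); have [ax1 ax2] := finger_axes gF og.
  move: hT; rewrite (perm_mem pT) !inE => /or3P[/eqP hE|/eqP hE|hT]; rewrite ?hE xE in oh.
  (* Besides the origin the finger meets the line of e only at its start (-4, 0), where the replaced
     part of e begins and the old point is taken away. *)
  + have [//|zE] := ax2 (one z (on_onc oh)).
    have l41 : s (-4) < s (-1) by apply: slt; clear; lra.
    by exists (s (-4)); rewrite lexx l41 xE zE /s lF'.
  + by case: z0; apply: ax1; apply: onf; apply: on_onc.
  + by case: (away z h b1 b2 hT); apply: on_onc.
- move=> x x2; have xX : x \in XX by rewrite mem_cat inE x2 orbT.
  have xc : x != c by apply: contraTneq uX => <-; rewrite cat_uniq /= x2 /= andbF.
  have := cN x; rewrite DeX // JX // !addn0 => ->; apply: (mixed_double mT); by rewrite inE x2 orbT.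
- move=> x; rewrite inE => /orP[/eqP ->|x4].
    by have := cN c; rewrite JX // cDe0 addn0 (mixed_double mT (mem_head _ _)).
  have xX : x \in XX by rewrite mem_cat x4 orbT.
  have xc : x != c by apply: contraTneq uX => <-; rewrite cat_uniq /= x4 /= !andbF.
  by have := cN x; rewrite DeX // JX // !addn0 => ->; apply: (mixed_quadruple mT).
- move=> g; rewrite mem_cat => gT; apply/negP => /mXX gX; case/orP: gT => [/memN [|[t [t' [_ gE _ ts]]]]|/f2T /startX].
  + rewrite /De DeE => /mapP [h hF gE]; rewrite gE /= in gX.
    by have [b1 b2] := box6 _ _ hF (onc_start h); have := noX _ b1 b2 gX; apply: (finger_starts hF).2.
  + rewrite gE /= in gX; case: ts => [t0'|[a a6 ta]]; first by have := startX e eT; rewrite -(lerp0 e.1 e.2) -/(l 0) -t0' gX.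
    rewrite ta /s lF' in gX; have /pl_eqP [/= a0 _] := noX (a, 0) (six a a6) ltac:(by clear; rewrite /=; apply/andP; split; lra) gX.
    by move: a6; rewrite a0 !inE; clear; case/or4P => [/eqP|/eqP|/eqP|/orP[]/eqP]; lra.
  + by rewrite gX.
- move=> x g h /mXX xX gT hT og oh gh.
  pose rep (a b : R) g := exists2 m : R, m != 0 & vec g = (m * (a * (vec e).1 + b * (vec f).1), m * (a * (vec e).2 + b * (vec f).2)).
  have piece t t' : t < t' -> exists2 m : R, m != 0 & vec (l t, l t') = (m * (vec e).1, m * (vec e).2).
    by move=> tt; exists (t' - t); [rewrite subr_eq0 gt_eqF | rewrite /l vec_lerp -surjective_pairing].
  have cPx : (cnt P x <= 1)%N by have := cP x; clear; case: (`[< on e x >]); lia.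
  have onP g' : g' \in P -> on g' x -> on e x.
    move=> gP og'; have c1 : (0 < cnt P x)%N by apply/cnt_gt0P; exists g'.
    by apply/asboolP; have := cP x; move: c1; clear; case: (`[< on e x >]); lia.
  have uP g' h' : g' \in P -> h' \in P -> on g' x -> on h' x -> g' = h'.
    by move=> gP hP og' oh'; apply: (count_le1_eq (P := fun e => `[< on e x >]) cPx gP hP); apply/asboolP.
  have nef h' : h' \in f :: T2 -> e <> h'.
    by rewrite inE => /orP[/eqP -> //|hT2 E]; rewrite E hT2 in eT2.
  have [xc|xc] := eqVneq x c; last first.
    have cls g' : g' \in N ++ f :: T2 -> on g' x -> g' \in f :: T2 \/ (g' \in P /\ exists2 m : R, m != 0 & vec g' = (m * (vec e).1, m * (vec e).2)).
      rewrite mem_cat => /orP[/memN [gD|[t [t' [gP gE tt _]]]]|] og'; [|by right; split; rewrite // gE; apply: piece|by left].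
      have : (0 < cnt De x)%N by apply/cnt_gt0P; exists g'.
      by rewrite DeX.
    have [g2|[gP [m m0' vg]]] := cls g gT og; have [h2|[hP [m' m0'' vh]]] := cls h hT oh.
    + by apply: (mixed_transverse mT xX) => //; apply: f2T.
    + rewrite vh det2Zr det2C mulf_neq0 // oppr_eq0; apply: (mixed_transverse mT xX) => //; [exact: f2T|exact: onP oh|exact: nef].
    + rewrite vg det2Zl mulf_neq0 //; apply: (mixed_transverse mT xX) => //; [exact: f2T|exact: onP og|exact: nef].
    + by case: gh; apply: uP.
  rewrite xc in og oh uP onP.
  (* The directions at c in the coordinates of the strands: (1, -1) and (-2, 1) from the finger, (1,
     0) from the rest of e, (0, 1) from f. They are pairwise independent. *)
  have cls g' : g' \in N ++ f :: T2 -> on g' c -> exists a b : R, rep a b g' /\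
     [\/ [/\ a = 1, b = -1 & g' = Fe ((-2, 2), (2, -2))], [/\ a = -2, b = 1 & g' = Fe ((2, -1), (-2, 1))], [/\ a = 1, b = 0 & g' \in P] |
       [/\ a = 0, b = 1 & g' = f]].
    rewrite mem_cat => /orP[/memN [gD|[t [t' [gP gE tt _]]]]|gf] og'.
    - move: gD og'; rewrite /De DeE => /mapP [g0 g0F ->]; rewrite -F0 => /onF og0.
      have vF g1 : vec (Fe g1) = (del * ((vec g1).1 * (vec e).1 + (vec g1).2 * (vec f).1), del * ((vec g1).1 * (vec e).2 + (vec g1).2 * (vec f).2)).
        by clear; apply/pl_eqP; rewrite /Fe /F /move_by /vec /=; split; ring.
      case: (finger_center g0F og0) => -> .
      + exists 1, (-1); split; last by constructor 1.
        exists (4 * del); first by rewrite mulf_neq0 ?pnatr_eq0 ?(gt_eqF d0).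
        by rewrite vF; apply/pl_eqP; clear; split => /=; ring.
      + exists (-2), 1; split; last by constructor 2.
        exists (2 * del); first by rewrite mulf_neq0 ?pnatr_eq0 ?(gt_eqF d0).
        by rewrite vF; apply/pl_eqP; clear; split => /=; ring.
    - exists 1, 0; split; last by constructor 3.
      have [m m0' E] := piece t t' tt; exists m => //.
      by rewrite gE E; apply/pl_eqP; split => /=; ring.
    - exists 0, 1; move: gf; rewrite inE => /orP[/eqP ->|gT2]; last by case: (far g' gT2); apply: on_onc.
      split; last by constructor 4.
      by exists 1; [exact: oner_neq0|apply/pl_eqP; clear; split => /=; ring].
  have [a [b [[m m0' vg] Hg]]] := cls g gT og; have [a' [b' [[m' m0'' vh] Hh]]] := cls h hT oh.
  rewrite vg vh det2_comb !mulf_neq0 //.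
  case: Hg Hh => -[-> -> gE] [] [-> -> hE]; try (exfalso; apply: gh; rewrite gE hE; reflexivity); try (exfalso; exact: (gh (uP _ _ gE hE og oh))); clear; apply/eqP; lra.
- exact: uX.
Qed.

End Finger.

(** * General position *)

Section GeneralPosition.
Variable R : realType.
Local Notation pt := 'M[R]_(1,3).
Local Notation pl := (R * R)%type.
Local Notation X v := (v ord0 i0).
Local Notation Y v := (v ord0 i1).
Local Notation Z v := (v ord0 i2).

(** The product of the nonzero polynomials among them cannot vanish at more points than its
    degree. *)
Lemma generic_parameter (cs : seq (seq R)) : exists t : R, forall c, c \in cs -> (Poly c).[t] = 0 -> forall i, c`_i = 0.
Proof.
pose ps := seq.filter (fun q : {poly R} => q != 0) (map (@Poly R) cs); pose p := \prod_(q <- ps) q.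
have p0 : p != 0 by rewrite prodf_seq_neq0; apply/allP => q; rewrite mem_filter => /andP[].
pose rs := [seq i%:R : R | i <- iota 0 (size p)].
have urs : uniq rs by rewrite map_inj_uniq ?iota_uniq // => i j /eqP; rewrite eqr_nat => /eqP.
have /allPn [t _ pt0] : ~~ all (root p) rs.
  by apply/negP => /(max_poly_roots p0) /(_ urs); rewrite size_map size_iota ltnn.
exists t => c cC ct i; have [E|nz] := eqVneq (Poly c) 0; first by rewrite -coef_Poly E coef0.
move: pt0; rewrite /root horner_prod prodf_seq_neq0 => /allP /(_ (Poly c)); rewrite ct eqxx.
by move=> /(_ ltac:(by rewrite mem_filter nz map_f)).
Qed.

Definition dot3 (a b : pt) : R := X a * X b + Y a * Y b + Z a * Z b.
Definition cross (a b : pt) : pt := mk3 (Y a * Z b - Z a * Y b) (Z a * X b - X a * Z b) (X a * Y b - Y a * X b).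

Definition shear (a b : R) (v : pt) : pt := mk3 (X v + a * Z v) (Y v + b * Z v) (Z v).
(** The projection along w = (-t, -t^3, 1). With the exponent 3 the six products of two coordinates
    of w are, up to sign, the different monomials 1, t, t^2, t^3, t^4, t^6. So a quadratic form
    whose value at w is the zero polynomial in t vanishes identically. *)
Definition slant (t : R) (v : pt) : pl := (X v + t * Z v, Y v + t ^+ 3 * Z v).

Definition linear_coefs (n : pt) : seq R := [:: Z n; - X n; 0; - Y n].

(* Three lines A i + R (u i) project along w to concurrent lines only when w is a zero of this form. *)
Definition concurrency (A1 u1 A2 u2 A3 u3 w : pt) : R :=
  dot3 (cross A1 u1) w * dot3 (cross u2 u3) w + dot3 (cross A2 u2) w * dot3 (cross u3 u1) w + dot3 (cross A3 u3) w * dot3 (cross u1 u2) w.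

(** The value of the form at w = (-t, -t^3, 1), as a polynomial in t. *)
Definition concurrency_coefs (A1 u1 A2 u2 A3 u3 : pt) : seq R :=
  let f (c d : pt -> R) := c (cross A1 u1) * d (cross u2 u3) + c (cross A2 u2) * d (cross u3 u1) + c (cross A3 u3) * d (cross u1 u2) in
  let x v := X v in let y v := Y v in let z v := Z v in
  [:: f z z; - (f x z + f z x); f x x; - (f y z + f z y); f x y + f y x; 0; f y y].

Lemma horner7 (a b c d e f g t : R) : (Poly [:: a; b; c; d; e; f; g]).[t] =
  a + b * t + c * t ^+ 2 + d * t ^+ 3 + e * t ^+ 4 + f * t ^+ 5 + g * t ^+ 6.
Proof. by rewrite horner_Poly /=; ring. Qed.

Lemma concurrency_zero A1 u1 A2 u2 A3 u3 w : (forall i, (concurrency_coefs A1 u1 A2 u2 A3 u3)`_i = 0) -> concurrency A1 u1 A2 u2 A3 u3 w = 0.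
Proof.
move=> H; have := (H 0%N, H 1%N, H 2%N, H 3%N, H 4%N, H 6%N); rewrite /concurrency_coefs /=.
rewrite /concurrency /dot3; move: (cross A1 u1) (cross A2 u2) (cross A3 u3) (cross u2 u3) (cross u3 u1) (cross u1 u2) => m1 m2 m3 n1 n2 n3.
move=> [] [] [] [] [] e1 e2 e3 e4 e5 e6.
transitivity ((X m1 * X n1 + X m2 * X n2 + X m3 * X n3) * X w ^+ 2 + (Y m1 * Y n1 + Y m2 * Y n2 + Y m3 * Y n3) * Y w ^+ 2
  + (Z m1 * Z n1 + Z m2 * Z n2 + Z m3 * Z n3) * Z w ^+ 2
  + (X m1 * Y n1 + X m2 * Y n2 + X m3 * Y n3 + (Y m1 * X n1 + Y m2 * X n2 + Y m3 * X n3)) * (X w * Y w)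
  - (- (X m1 * Z n1 + X m2 * Z n2 + X m3 * Z n3 + (Z m1 * X n1 + Z m2 * X n2 + Z m3 * X n3))) * (X w * Z w)
  - (- (Y m1 * Z n1 + Y m2 * Z n2 + Y m3 * Z n3 + (Z m1 * Y n1 + Z m2 * Y n2 + Z m3 * Y n3))) * (Y w * Z w)); first by ring.
by rewrite e1 e2 e3 e4 e5 e6 !mul0r !addr0 !subr0.
Qed.

Lemma dot3_gt0 (a b : pt) : dot3 a b != 0 -> dot3 b b != 0.
Proof.
apply: contraNneq; rewrite /dot3 => E.
have [e1 e2 e3] : [/\ X b = 0, Y b = 0 & Z b = 0].
  have := sqr_ge0 (X b); have := sqr_ge0 (Y b); have := sqr_ge0 (Z b); rewrite !expr2 => h1 h2 h3.
  by split; apply/eqP; rewrite -sqrf_eq0 expr2; apply/eqP; lra.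
by rewrite e1 e2 e3 !mulr0 !addr0.
Qed.

Lemma concurrency_neq0 (A1 u1 A2 u2 A3 u3 : pt) : dot3 (A1 - A2) (cross u1 u2) != 0 -> dot3 (A2 - A3) (cross u2 u3) != 0 ->
  dot3 (A1 - A3) (cross u3 u1) != 0 -> (forall w, concurrency A1 u1 A2 u2 A3 u3 w = 0) -> False.
Proof.
move=> R12 R23 R13 Q0; pose D := dot3 u1 (cross u2 u3).
have B (v w : pt) : concurrency A1 u1 A2 u2 A3 u3 (v + w) - concurrency A1 u1 A2 u2 A3 u3 v - concurrency A1 u1 A2 u2 A3 u3 w = 0.
  by rewrite !Q0 !subr0.
have [D0|D0] := eqVneq D 0; last first.
  have : D * dot3 (A1 - A2) (cross u1 u2) = 0.
    by rewrite -[RHS](B u1 u2) /D /concurrency /dot3 /cross !mk3E !mxE; ring.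
  by move/eqP; rewrite mulf_eq0 (negbTE D0) (negbTE R12).
have h1 : dot3 (A3 - A2) (cross u1 u2) * dot3 (cross u3 u1) (cross u3 u1) = 0.
  transitivity (concurrency A1 u1 A2 u2 A3 u3 (u1 + cross u3 u1) - concurrency A1 u1 A2 u2 A3 u3 u1 - concurrency A1 u1 A2 u2 A3 u3 (cross u3 u1)
    - D * (dot3 u1 (cross A3 (cross u3 u1)) + dot3 (cross A1 u1) (cross u3 u1))); last by rewrite B D0 mul0r subr0.
  by rewrite /D /concurrency /dot3 /cross !mk3E !mxE /=; ring.
move/eqP: h1; rewrite mulf_eq0 (negbTE (dot3_gt0 R13)) orbF => /eqP h1.
move/eqP: (R23); apply; apply: (mulIf (dot3_gt0 R12)); rewrite mul0r.
transitivity (dot3 (cross u2 u3) (cross u1 u2) * - dot3 (A3 - A2) (cross u1 u2) - D * dot3 u2 (cross (A2 - A3) (cross u1 u2))).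
  by rewrite /D /dot3 /cross !mk3E !mxE; ring.
by rewrite h1 D0 oppr0 mulr0 mul0r subr0.
Qed.

Lemma slant_det (t : R) u v : det2 (slant t u) (slant t v) = (Poly (linear_coefs (cross u v))).[t].
Proof. by rewrite horner_Poly /det2 /slant /= !mk3E; ring. Qed.

Lemma concurrency_det (t : R) A1 u1 A2 u2 A3 u3 : (Poly (concurrency_coefs A1 u1 A2 u2 A3 u3)).[t] =
  det2 (slant t A1) (slant t u1) * det2 (slant t u2) (slant t u3) + det2 (slant t A2) (slant t u2) * det2 (slant t u3) (slant t u1)
  + det2 (slant t A3) (slant t u3) * det2 (slant t u1) (slant t u2).
Proof.
rewrite /concurrency_coefs horner7 !slant_det /linear_coefs !horner_Poly /=.
by move: (cross A1 u1) (cross A2 u2) (cross A3 u3) (cross u2 u3) (cross u3 u1) (cross u1 u2) => m1 m2 m3 n1 n2 n3; ring.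
Qed.

Lemma slant_lin (t : R) a b s : slant t (lin a b s) = lerp (slant t a) (slant t b) s.
Proof. by apply/pl_eqP; rewrite /slant /lerp /lin !mxE /=; split; ring. Qed.

Lemma slant_vec (t : R) a b : vec (slant t a, slant t b) = slant t (b - a).
Proof. by apply/pl_eqP; rewrite /slant /vec !mxE /=; split; ring. Qed.

Lemma slant_parallel (t : R) d u : slant t d = (0, 0) -> d <> 0 -> cross d u = 0 -> slant t u = (0, 0).
Proof.
move=> /pl_eqP [/= e1 e2] d0 /pt_eqP; rewrite !mk3E !mxE => -[e3 e4 _].
have z0 : Z d != 0.
  apply/eqP => z0; apply: d0; apply/pt_eqP; rewrite !mxE; move: e1 e2.
  by rewrite z0 !mulr0 !addr0.
apply/pl_eqP; rewrite /slant /=; split; apply: (mulfI z0); rewrite mulr0.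
  transitivity (Z d * X u - X d * Z u + (X d + t * Z d) * Z u); first by ring.
  by rewrite e4 e1 mul0r addr0.
transitivity (- (Y d * Z u - Z d * Y u) + (Y d + t ^+ 3 * Z d) * Z u); first by ring.
by rewrite e3 e2 mul0r addr0 oppr0.
Qed.

Lemma lines_meet_once (e f : pl * pl) x y : det2 (vec e) (vec f) != 0 -> on e x -> on f x -> on e y -> on f y -> x = y.
Proof.
move=> D [s [_ xe]] [r [_ xf]] [s' [_ ye]] [r' [_ yf]].
have E : (s' - s) * det2 (vec e) (vec f) = 0.
  transitivity ((y.1 - x.1) * (vec f).2 - (y.2 - x.2) * (vec f).1); first by rewrite xe ye /det2 /lerp /vec /=; ring.
  by rewrite xf yf /lerp /vec /=; ring.
by move/eqP: E; rewrite mulf_eq0 (negbTE D) orbF subr_eq0 => /eqP E; rewrite xe ye E.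
Qed.

Section Generic.
Variable S : seq (pt * pt).
Hypothesis gS : good S.
Let u (e : pt * pt) : pt := e.2 - e.1.

(** The polynomials in t that vanish when an edge projects to a point, when two shadows are
    parallel, when the start of an edge lies on the line of another shadow, and when three shadows
    are concurrent. *)
Definition conditions : seq (seq R) :=
  [seq [:: X (u e); Z (u e)] | e <- S] ++ [seq [:: Y (u e); 0; 0; Z (u e)] | e <- S] ++
  [seq linear_coefs (cross (u e) (u f)) | e <- S, f <- S] ++
  [seq linear_coefs (cross (e.1 - f.1) (u e)) | e <- S, f <- S] ++ [seq linear_coefs (cross (e.1 - f.1) (u f)) | e <- S, f <- S] ++
  [seq concurrency_coefs p.1.1 (u p.1) p.2.1 (u p.2) g.1 (u g) | p <- [seq (e, f) | e <- S, f <- S], g <- S].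

Variable t : R.
Hypothesis generic : forall c, c \in conditions -> (Poly c).[t] = 0 -> forall i, c`_i = 0.

Let linear (n : pt) : linear_coefs n \in conditions -> (Poly (linear_coefs n)).[t] = 0 -> n = 0.
Proof.
move=> /generic H /H {}H; have := (H 0%N, H 1%N, H 3%N); rewrite /= => -[[/eqP h0 /eqP h1] /eqP h3].
by apply/pt_eqP; rewrite !mxE (eqP h0); move: h1 h3; rewrite !oppr_eq0 => /eqP -> /eqP ->.
Qed.

Lemma generic_nondeg e : e \in S -> slant t (u e) <> (0, 0).
Proof.
move=> eS /pl_eqP [/= h1 h2].
have H1 := generic (c := [:: X (u e); Z (u e)]); have H2 := generic (c := [:: Y (u e); 0; 0; Z (u e)]).
have {}H1 := H1 ltac:(rewrite /conditions !mem_cat map_f //).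
have {}H2 := H2 ltac:(rewrite /conditions !mem_cat (map_f (fun e => [:: Y (u e); 0; 0; Z (u e)])) ?orbT //).
have {}H1 := H1 ltac:(rewrite horner_Poly /= -[RHS]h1; ring).
have {}H2 := H2 ltac:(rewrite horner_Poly /= -[RHS]h2; ring).
case: gS => nd _; apply: (nd e eS); apply/eqP; rewrite eq_sym -subr_eq0; apply/eqP/pt_eqP; rewrite !mxE.
by have := (H1 0%N, H1 1%N, H2 0%N); rewrite /= /u !mxE => -[[-> ->] ->].
Qed.

(** The points a of e and b of f over x are different, so a - b is a nonzero multiple of w. If one
    of the linear conditions vanished identically, a - b would be parallel to an edge, and this edge
    would project to a point. *)
Lemma generic_pair e f x : e \in S -> f \in S -> e <> f -> on (slant t e.1, slant t e.2) x -> on (slant t f.1, slant t f.2) x ->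
  [/\ det2 (slant t (u e)) (slant t (u f)) != 0, x <> slant t e.1 & dot3 (e.1 - f.1) (cross (u e) (u f)) != 0].
Proof.
move=> eS fS ef [s [s01 xe]] [r [r01 xf]].
pose a := lin e.1 e.2 s; pose b := lin f.1 f.2 r.
have sd : slant t (a - b) = (0, 0).
  by move: xe; rewrite xf /= -!slant_lin -/a -/b => E; rewrite -slant_vec E /vec !subrr.
have d0 : a - b <> 0.
  move=> /eqP; rewrite subr_eq0 => /eqP ab; apply: ef.
  apply: (count_le1_eq (P := fun e => `[< hseg e a >]) (proj2 gS a) eS fS); apply/asboolP; first by exists s.
  by exists r; rewrite ab.
have contra v : cross (a - b) v = 0 -> slant t v <> (0, 0) -> False by move=> c0; apply; apply: slant_parallel c0.
have zero v : det2 (slant t (a - b)) (slant t v) = 0 by rewrite sd /det2 /= !mul0r subr0.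
have D : det2 (slant t (u e)) (slant t (u f)) != 0.
  apply/eqP; rewrite slant_det => /linear D0.
  have {}D0 : cross (u e) (u f) = 0 by apply: D0; rewrite /conditions !mem_cat (allpairs_f (fun e f => linear_coefs (cross (u e) (u f)))) ?orbT.
  have E : cross (a - b) (u e) = cross (e.1 - f.1) (u e).
    move/pt_eqP: D0; rewrite !mk3E !mxE => -[h1 h2 h3].
    apply/pt_eqP; rewrite /cross !mk3E /a /b /lin !mxE; split.
    - transitivity ((e.1 ord0 i1 - f.1 ord0 i1) * (e.2 ord0 i2 - e.1 ord0 i2) - (e.1 ord0 i2 - f.1 ord0 i2) * (e.2 ord0 i1 - e.1 ord0 i1) +
        r * ((e.2 ord0 i1 - e.1 ord0 i1) * (f.2 ord0 i2 - f.1 ord0 i2) - (e.2 ord0 i2 - e.1 ord0 i2) * (f.2 ord0 i1 - f.1 ord0 i1))); first by ring.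
      by rewrite h1 mulr0 addr0.
    - transitivity ((e.1 ord0 i2 - f.1 ord0 i2) * (e.2 ord0 i0 - e.1 ord0 i0) - (e.1 ord0 i0 - f.1 ord0 i0) * (e.2 ord0 i2 - e.1 ord0 i2) +
        r * ((e.2 ord0 i2 - e.1 ord0 i2) * (f.2 ord0 i0 - f.1 ord0 i0) - (e.2 ord0 i0 - e.1 ord0 i0) * (f.2 ord0 i2 - f.1 ord0 i2))); first by ring.
      by rewrite h2 mulr0 addr0.
    - transitivity ((e.1 ord0 i0 - f.1 ord0 i0) * (e.2 ord0 i1 - e.1 ord0 i1) - (e.1 ord0 i1 - f.1 ord0 i1) * (e.2 ord0 i0 - e.1 ord0 i0) +
        r * ((e.2 ord0 i0 - e.1 ord0 i0) * (f.2 ord0 i1 - f.1 ord0 i1) - (e.2 ord0 i1 - e.1 ord0 i1) * (f.2 ord0 i0 - f.1 ord0 i0))); first by ring.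
      by rewrite h3 mulr0 addr0.
  have := zero (u e); rewrite slant_det E => /linear F.
  apply: (contra (u e)); last exact: generic_nondeg.
  by rewrite E F // /conditions !mem_cat (allpairs_f (fun e f => linear_coefs (cross (e.1 - f.1) (u e)))) ?orbT.
split => //.
- move=> xA; have s0 : s = 0.
    have ne : slant t e.1 <> slant t e.2.
      move=> E; apply: (generic_nondeg eS); rewrite -slant_vec E /vec /=; apply/pl_eqP; split => /=; ring.
    by apply: (lerp_inj ne); rewrite lerp0; apply: etrans (esym xe) xA.
  have E : cross (a - b) (u f) = cross (e.1 - f.1) (u f).
    by apply/pt_eqP; rewrite /cross !mk3E /a /b /lin s0 !mxE; split; ring.
  have := zero (u f); rewrite slant_det E => /linear F.
  apply: (contra (u f)); last exact: generic_nondeg.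
  by rewrite E F // /conditions !mem_cat (allpairs_f (fun e f => linear_coefs (cross (e.1 - f.1) (u f)))) ?orbT.
- have -> : dot3 (e.1 - f.1) (cross (u e) (u f)) = dot3 (a - b) (cross (u e) (u f)).
    by rewrite /dot3 /cross !mk3E /a /b /lin !mxE; ring.
  have [h1 h2] : X (a - b) = - t * Z (a - b) /\ Y (a - b) = - t ^+ 3 * Z (a - b).
    by move/pl_eqP: sd => [/= h1 h2]; split; lra.
  have -> : dot3 (a - b) (cross (u e) (u f)) = Z (a - b) * det2 (slant t (u e)) (slant t (u f)).
    by rewrite /dot3 h1 h2 slant_det horner_Poly /=; ring.
  apply: mulf_neq0 => //; apply/eqP => z0; apply: d0; apply/pt_eqP.
  by rewrite h1 h2 z0 !mulr0 !mxE.
Qed.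

Lemma generic_triple e f g x : e \in S -> f \in S -> g \in S -> e <> f -> f <> g -> g <> e ->
  on (slant t e.1, slant t e.2) x -> on (slant t f.1, slant t f.2) x -> on (slant t g.1, slant t g.2) x -> False.
Proof.
move=> eS fS gS' ef fg ge xe xf xg.
have [_ _ R12] := generic_pair eS fS ef xe xf; have [_ _ R23] := generic_pair fS gS' fg xf xg.
have [_ _ R31] := generic_pair gS' eS ge xg xe.
have R13 : dot3 (e.1 - g.1) (cross (u g) (u e)) != 0.
  rewrite (_ : dot3 _ _ = - dot3 (g.1 - e.1) (cross (u g) (u e))) ?oppr_eq0 //.
  by rewrite /dot3 !mxE; ring.
apply: (concurrency_neq0 R12 R23 R13) => w; apply: concurrency_zero; apply: generic.
  have pS : (e, f) \in [seq (e, f) | e <- S, f <- S] by apply: (allpairs_f (fun e f => (e, f))).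
  by rewrite /conditions !mem_cat (allpairs_f (fun p g => concurrency_coefs p.1.1 (u p.1) p.2.1 (u p.2) g.1 (u g)) pS gS') !orbT.
have c (h : pt * pt) : on (slant t h.1, slant t h.2) x -> det2 (slant t h.1) (slant t (u h)) = det2 x (slant t (u h)).
  by move=> [s [_ ->]]; rewrite -slant_vec /det2 /lerp /vec /=; ring.
rewrite concurrency_det (c e xe) (c f xf) (c g xg) /det2.
by move: (slant t (u e)) (slant t (u f)) (slant t (u g)) => p q r; ring.
Qed.

Let slanted (e : pt * pt) := (slant t e.1, slant t e.2).

Lemma generic_mixed : exists Xs, mixed (map slanted S) Xs [::].
Proof.
set T := map slanted S; have uS := good_uniq gS.
have inT e : e \in T -> exists2 h, h \in S & e = slanted h by move=> /mapP [h hS ->]; exists h.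
have nd e : e \in T -> e.1 <> e.2.
  move=> /inT [h hS ->] /= E; apply: (generic_nondeg hS); rewrite -slant_vec E /vec /=; apply/pl_eqP; split => /=; ring.
have pair e f x : e \in T -> f \in T -> e <> f -> on e x -> on f x -> det2 (vec e) (vec f) != 0 /\ x <> e.1.
  move=> /inT [h hS ->] /inT [h' hS' ->] ne oe of_; rewrite !slant_vec.
  by have [|] := generic_pair hS hS' _ oe of_; first by move=> E; apply: ne; rewrite E.
have uT : uniq T.
  rewrite map_inj_in_uniq // => e f eS fS E; apply: contrapT => ef.
  have [D _ _] := generic_pair eS fS ef (on_start (slanted e)) ltac:(by rewrite -/(slanted f) -E; apply: on_start).
  by move: D; rewrite -[slant t (u e)]slant_vec -[slant t (u f)]slant_vec -!/(slanted _) E /det2 mulrC subrr eqxx.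
have le2 x : (cnt T x <= 2)%N.
  rewrite leqNgt; apply/negP => c3.
  have [e eT ex] := count_gt0 (leq_trans (ltn0Sn _) c3).
  have c2 : (2 <= count (fun e => `[< on e x >]) (rem e T))%N.
    by move: c3; rewrite /cnt (permP (perm_to_rem eT)) /= ex.
  have [f [g [fT gT /eqP fg /asboolP fx /asboolP gx]]] := count_ge2_ex (rem_uniq e uT) c2.
  move: fT gT; rewrite !mem_rem_uniq // !inE => /andP[/eqP fe fT] /andP[/eqP ge gT].
  move/asboolP in ex; move: fT gT eT fx gx ex fg fe ge => /inT [f' fS ->] /inT [g' gS' ->] /inT [e' eS ->] fx gx ex fg fe ge.
  by apply: (generic_triple eS fS gS' _ _ _ ex fx gx) => E; [apply: fe|apply: fg|apply: ge]; rewrite E.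
pose pt_ (p : (pl * pl) * (pl * pl)) := xget (0, 0) [set x | on p.1 x /\ on p.2 x].
pose Xs := undup (seq.filter (fun x => cnt T x == 2%N) (map pt_ [seq (e, f) | e <- T, f <- T])).
have two x : (2 <= cnt T x)%N -> exists e f, [/\ e \in T, f \in T, e <> f, on e x & on f x].
  by move=> /(count_ge2_ex uT) [e [f [eT fT /eqP ef /asboolP ex /asboolP fx]]]; exists e, f.
have XsP x : x \in Xs <-> cnt T x = 2%N.
  rewrite mem_undup mem_filter; split=> [/andP[/eqP //]|c2]; rewrite c2 eqxx /=.
  have [e [f [eT fT ef ex fx]]] := two x ltac:(by rewrite c2).
  apply/mapP; exists (e, f); first exact: (allpairs_f (fun e f => (e, f))).
  have : [set y | on e y /\ on f y] x by [].
  move/(xgetI (0, 0)) => [ey fy]; have [D _] := pair e f x eT fT ef ex fx.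
  exact: (lines_meet_once D ex fx ey fy).
exists Xs; split; rewrite ?cats0 ?undup_uniq //.
- move=> x xX _; rewrite leqNgt; apply/negP => c2; move/negP: xX; apply; apply/XsP.
  by apply/eqP; rewrite eqn_leq le2.
- by move=> x /XsP.
- move=> e eT; apply/negP => /XsP c2; have [f fT [fe fx]] : exists2 f, f \in T & f <> e /\ on f e.1.
    have [g [h [gT hT gh gx hx]]] := two e.1 ltac:(by rewrite c2).
    by have [ge|ge] := pselect (g = e); [exists h => //; split => // E; apply: gh; rewrite ge E | exists g].
  by have [_] := pair e f e.1 eT fT (not_eq_sym fe) (on_start e) fx.
- by move=> x e f _ eT fT ex fx ef; have [] := pair e f x eT fT ef ex fx.
Qed.

End Generic.

(** A shear turns the slanted projection into the vertical one, and it is isotopic to the identity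
    by scaling its coefficients. *)
Lemma general_position (S : seq (pt * pt)) : closed_edges S -> good S -> exists S' Xs,
  [/\ closed_edges S', good S', ambient_isotopic (support S) (support S') & mixed (shadow S') Xs [::]].
Proof.
move=> cS gS; have [t gen] := generic_parameter (conditions S).
pose Phi := shear t (t ^+ 3); pose S' := map (fun e : pt * pt => (Phi e.1, Phi e.2)) S.
have shearK (a b : R) : cancel (shear a b) (shear (- a) (- b)).
  by move=> v; apply/pt_eqP; rewrite /shear !mk3E; split => //; ring.
have [Xs mX] := generic_mixed gS gen; exists S', Xs.
pose P := map (fun e : pt * pt => (e, (Phi e.1, Phi e.2))) S.
have E1 : map fst P = S by rewrite -map_comp map_id_in.
have E2 : map snd P = S' by rewrite -map_comp.
have [||g' s'] := @good_image R Phi P _ _ ltac:(by rewrite E1).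
- exact: can_inj (shearK t (t ^+ 3)).
- by move=> p /mapP [e _ ->] s _ /=; apply/pt_eqP; rewrite /Phi /shear /lin !mk3E !mxE /=; split; ring.
rewrite E1 E2 in g' s'; split => //.
- exact: closed_edges_map.
- rewrite s'; have -> : Phi = (fun s => shear (s * t) (s * t ^+ 3)) 1 by rewrite /Phi /= !mul1r.
  apply: (@isotopic_by R (fun s => shear (s * t) (s * t ^+ 3)) (fun s => shear (- (s * t)) (- (s * t ^+ 3)))).
  + apply: continuous_mk3.
    * apply: continuous_add; first exact: continuous_coord1.
      apply: continuous_mul; last exact: continuous_coord1.
      by apply: continuous_mul; [exact: continuous_time|exact: continuous_cst].
    * apply: continuous_add; first exact: continuous_coord1.
      apply: continuous_mul; last exact: continuous_coord1.
      by apply: continuous_mul; [exact: continuous_time|exact: continuous_cst].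
    * exact: continuous_coord1.
  + move=> s; apply: continuous_mk3; [| |exact: continuous_coord].
    * by apply: continuous_add; [exact: continuous_coord|apply: continuous_mul; [exact: continuous_cst|exact: continuous_coord]].
    * by apply: continuous_add; [exact: continuous_coord|apply: continuous_mul; [exact: continuous_cst|exact: continuous_coord]].
  + by move=> s; apply: shearK.
  + by move=> s v; have := shearK (- (s * t)) (- (s * t ^+ 3)) v; rewrite !opprK.
  + by move=> v; apply/pt_eqP; rewrite /shear !mk3E !mul0r !addr0.
- have <- : map (fun e : pt * pt => (slant t e.1, slant t e.2)) S = shadow S' => //.
  by rewrite /shadow /S' -map_comp; apply: eq_map => e /=; rewrite /proj /Phi /shear !mk3E.
Qed.

End GeneralPosition.

(** * Projections without crossings *)

Section Flattening.
Variable R : realType.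
Local Notation pt := 'M[R]_(1,3).
Local Notation pl := (R * R)%type.
Local Notation X v := (v ord0 i0).
Local Notation Y v := (v ord0 i1).
Local Notation Z v := (v ord0 i2).

Lemma seg_compact (a b : pt) : compact (seg a b).
Proof.
have -> : seg a b = (fun t => lin a b t) @` `[0, 1].
  apply/seteqP; split => [v /segP [t [t01 ->]]|_ [t t01 <-]]; first by exists t; rewrite //= in_itv.
  by apply/segP; exists t; rewrite /= in_itv in t01.
apply: continuous_compact; last exact: segment_compact.
apply: continuous_subspaceT => t; rewrite /lin; apply: cvgD; first exact: cvg_cst.
by apply: cvgZ; [exact: cvg_id|exact: cvg_cst].
Qed.

Lemma seg_support (S : seq (pt * pt)) e v : closed_edges S -> e \in S -> seg e.1 e.2 v -> support S v.
Proof.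
move=> cS eS; rewrite seg_hseg -surjective_pairing => -[he|->]; first by exists e.
have : e.2 \in map fst S by rewrite (perm_mem (closed_balanced cS)); apply: map_f.
by case/mapP => -[a b] fS ->; exists (a, b) => //; apply: hseg0.
Qed.

Lemma support_compact (S : seq (pt * pt)) : closed_edges S -> compact (support S).
Proof.
move=> cS; have -> : support S = \big[setU/set0]_(e <- S) seg e.1 e.2.
  rewrite -bigcup_seq; apply/seteqP; split => [v [e eS he]|v [e eS]]; last exact: seg_support.
  by exists e => //; rewrite seg_hseg; left; rewrite -surjective_pairing.
by apply: bigsetU_compact => e _; apply: seg_compact.
Qed.

Lemma proj_continuous : continuous (fun v : pt => proj v).
Proof. by apply: continuous_pair; apply: continuous_coord. Qed.

Lemma shadow_inj (S : seq (pt * pt)) v w : good S -> mixed (shadow S) [::] [::] -> support S v -> support S w ->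
  proj v = proj w -> v = w.
Proof.
move=> gS mS [e eS he] [f fS hf] E.
have c1 := mixed_off mS (x := proj v) isT isT; rewrite /cnt /shadow count_map in c1.
have ef : e = f.
  by apply: (count_le1_eq c1 eS fS) => /=; apply/asboolP; [|rewrite E]; apply: hseg_shadow.
have nd : proj e.1 <> proj e.2 := mixed_nondeg mS (map_f (fun e : pt * pt => (proj e.1, proj e.2)) eS).
rewrite -ef in hf; case: he hf E => t [_ ->] [s [_ ->]]; rewrite !proj_lin.
by move=> /(lerp_inj nd) ->.
Qed.

Definition drop (h : pl -> R) (s : R) (v : pt) : pt := mk3 (X v) (Y v) (Z v - s * h (proj v)).

(** The projection is injective on the compact link, so the height is a continuous function on the
    shadow, which is closed; Tietze's theorem extends it to the plane. *)
Lemma height_extension (S : seq (pt * pt)) : closed_edges S -> good S -> mixed (shadow S) [::] [::] ->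
  exists h : pl -> R, continuous h /\ forall v, support S v -> h (proj v) = Z v.
Proof.
move=> cS gS mS; pose A : set pl := (fun v : pt => proj v) @` support S; have cK := support_compact cS.
pose g (x : pl) : R^o := Z (xget 0 [set v | support S v /\ proj v = x]).
have gE v : support S v -> g (proj v) = Z v.
  move=> Sv; rewrite /g; have : [set w | support S w /\ proj w = proj v] v by [].
  by move/(xgetI 0) => [Sw E]; rewrite (shadow_inj gS mS Sw Sv E).
have img (K : set pt) : compact K -> closed ((fun v : pt => proj v) @` K).
  move=> cK'; apply: (compact_closed (@norm_hausdorff _ (R^o * R^o)%type)).
  by apply: continuous_compact cK'; apply: continuous_subspaceT; exact: proj_continuous.
have contg : {within A, continuous g}.
  apply/continuous_closedP => D cD; apply/closed_subspaceP.
  exists ((fun v : pt => proj v) @` (support S `&` (fun v : pt => Z v) @^-1` D)).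
    apply: img; apply: compact_closedI => //.
    by have /continuous_closedP := @continuous_coord R i2; apply.
  apply/seteqP; split => x [].
    by move=> [v [Sv Dv] <-] Ax; split => //; change (D (g (proj v))); rewrite gE.
  move=> Dx [v Sv vx]; split; [exists v => //; split => // | by exists v].
  by change (D (Z v)); rewrite -gE // vx.
have [M M0 HM] := upper_bound_list (fun e : pt * pt => `|Z e.1| + `|Z e.2|) S.
have bnd x : A x -> `|g x| <= M + 1.
  move=> [v [e eS [t [/andP[t0 t1] ->]]] <-]; rewrite gE; last first.
    by exists e => //; exists t; rewrite t0 t1.
  have := HM e eS; rewrite -/(lin _ _ _) linZ.
  have -> : Z e.1 + t * (Z e.2 - Z e.1) = (1 - t) * Z e.1 + t * Z e.2 by ring.
  have := ler_normD ((1 - t) * Z e.1) (t * Z e.2); rewrite !normrM (ger0_norm t0) (ger0_norm (_ : 0 <= 1 - t)); last by rewrite subr_ge0 ltW.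
  have h1 : 0 <= t * `|Z e.1| by rewrite mulr_ge0.
  have h2 : 0 <= (1 - t) * `|Z e.2| by rewrite mulr_ge0 // subr_ge0 ltW.
  by move: h1 h2; lra.
have M1 : 0 < M + 1 by have := M0; lra.
have [h [Ah ch _]] := continuous_bounded_extension (@pseudometric_normal R (R * R)%type) (img _ cK) M1 contg bnd.
by exists h; split => // v Sv; rewrite -gE // Ah //; apply/mem_set; exists v.
Qed.

Lemma flat_trivial (S : seq (pt * pt)) : closed_edges S -> good S -> mixed (shadow S) [::] [::] -> trivial_link (support S).
Proof.
move=> cS gS mS; have [h [ch hE]] := height_extension cS gS mS.
pose flat (v : pt) : pt := mk3 (X v) (Y v) 0; pose S' := map (fun e : pt * pt => (flat e.1, flat e.2)) S.
have dropK s : cancel (drop h s) (drop h (- s)).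
  by move=> v; apply/pt_eqP; rewrite /drop /proj !mk3E; split => //; ring.
pose P := map (fun e : pt * pt => (e, (flat e.1, flat e.2))) S.
have E1 : map fst P = S by rewrite -map_comp map_id_in.
have E2 : map snd P = S' by rewrite -map_comp.
have [||g' s'] := @good_image R (drop h 1) P _ _ ltac:(by rewrite E1).
- exact: can_inj (dropK 1).
- move=> p /mapP [e eS ->] t t01 /=; have Sv : support S (lin e.1 e.2 t) by apply: (seg_support cS eS); apply/segP; exists t.
  by apply/pt_eqP; rewrite /drop /flat hE // !(linX, linY, linZ) !mk3E; split => //; ring.
rewrite E1 E2 in g' s'; have [L [pL pS' lL]] := closed_good_polygonal (closed_edges_map flat cS : closed_edges S') g'.
exists L; split => //.
- move=> v; rewrite lL => -[_ /mapP [e _ ->] [t [_ ->]]].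
  by rewrite -/(lin _ _ _) linZ /flat !mk3E subrr mulr0 addr0.
- rewrite lL s'; apply: (@isotopic_by R (drop h) (fun s => drop h (- s))).
  + apply: continuous_mk3; [exact: continuous_coord1|exact: continuous_coord1|].
    apply: continuous_add; first exact: continuous_coord1.
    apply: continuous_opp; apply: continuous_mul; first exact: continuous_time.
    apply: (@continuous_comp_fun _ _ _ (fun q : pt * R => proj q.1) h) => //.
    by apply: continuous_pair; apply: continuous_coord1.
  + move=> s; apply: continuous_mk3; [exact: continuous_coord|exact: continuous_coord|].
    apply: continuous_add; first exact: continuous_coord.
    apply: continuous_opp; apply: continuous_mul; first exact: continuous_cst.
    by apply: (@continuous_comp_fun _ _ _ (fun v : pt => proj v) h) => //; exact: proj_continuous.
  + exact: dropK.
  + by move=> s v; have := dropK (- s) v; rewrite opprK.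
  + by move=> v; apply/pt_eqP; rewrite /drop !mk3E mul0r subr0.
Qed.

End Flattening.

(** * Conclusion: comparing the minimal numbers *)

Section Minimum.

Lemma setminP (A : set nat) n : A n -> A (setmin A) /\ (setmin A <= n)%N.
Proof.
move=> An; have ex : exists n, `[< A n >] by exists n; apply/asboolP.
have [m /asboolP Am minm] := ex_minnP ex.
have : [set n | A n /\ forall m, A m -> (n <= m)%N] m by split => // k Ak; apply: minm; apply/asboolP.
by move=> /(xgetI 0%N) [h1 h2]; split; [exact: h1|exact: h2].
Qed.

End Minimum.

Section Fingers.
Variable R : realType.
Local Notation pt := 'M[R]_(1,3).

Lemma all_fingers (S : seq (pt * pt)) X2 X4 : closed_edges S -> good S -> mixed (shadow S) X2 X4 ->
  exists S' X, [/\ closed_edges S', good S', ambient_isotopic (support S) (support S'), mixed (shadow S') [::] X &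
    size X = (size X2 + size X4)%N].
Proof.
elim: X2 S X4 => [|c X2 IH] S X4 cS gS mS; first by exists S, X4; split => //; apply: isotopic_refl.
have [S1 [c1 g1 i1 m1]] := finger_move cS gS mS.
have [S' [X [c' g' i' m' sX]]] := IH S1 (c :: X4) c1 g1 m1.
by exists S', X; split => //; [exact: isotopic_trans i1 i' | rewrite sX /= addnS].
Qed.

Lemma mixed_projection (S : seq (pt * pt)) X m : (2 <= m)%N -> closed_edges S -> good S ->
  mixed (shadow S) X [::] /\ m = 2 \/ mixed (shadow S) [::] X /\ m = 4 ->
  exists L, [/\ polygonal_link L, linkset L = support S, num_singular L (size X) & forall x, singular L x -> multi_crossing L m x].
Proof.
move=> m2 cS gS mS; have [L [pL pS lL]] := closed_good_polygonal cS gS.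
have {}pS : perm_eq (shadow S) (shadow (link_edges L)) by rewrite perm_sym; apply: perm_map pS.
exists L; case: mS => -[/(mixed_perm pS) [h1 h2 h3 h4 h5 h6 h7] mE]; rewrite ?cats0 /= in h5 h6 h7.
  have [] := mixed_singular pL m2 h7 h1 _ _ h5 h6; last by split.
    by move=> x xX; apply: h2.
  by rewrite mE.
have [] := mixed_singular pL m2 h7 h1 _ _ h5 h6; last by split.
  by move=> x xX; apply: h2.
by rewrite mE.
Qed.

End Fingers.

Theorem theorem2p1 (R : realType) (L : seq (seq 'M[R]_(1,3))) :
  polygonal_link L -> ~ trivial_link (linkset L) ->
  (quadruple_crossing_number (linkset L) < crossing_number (linkset L))%N.
Proof.
move=> pL nontriv; have [cL gL] := conj (polygonal_closed pL) (polygonal_good pL).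
have sL : linkset L = support (link_edges L) by apply: linkset_support => k kL; case: pL => _ /(_ _ kL) [].
have [S [X [cS gS iS mS]]] := general_position cL gL.
have [L1 [p1 l1 n1 r1]] := mixed_projection (m := 2) isT cS gS (or_introl (conj mS erefl)).
have c1 : crossing_counts (linkset L) (size X).
  by exists L1; split => //; [rewrite sL l1 | split => //; exists (size X)].
(* The minimum of an empty set would be 0 by convention; a regular projection exists by general
   position, so the crossing number is attained by some L2. *)
have [[L2 [p2 i2 r2 n2]] _] := setminP c1.
have [Y sY mY] := regular_mixed p2 r2 n2; have [c2 g2] := conj (polygonal_closed p2) (polygonal_good p2).
have s2 : linkset L2 = support (link_edges L2) by apply: linkset_support => k kL; case: p2 => _ /(_ _ kL) [].
rewrite -/(crossing_number _) in sY; have [Y0|Y0] := posnP (size Y).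
  case: nontriv; move: mY; rewrite (size0nil Y0) => /(flat_trivial c2 g2) [L3 [p3 z3 i3]].
  by exists L3; split => //; apply: isotopic_trans i2 _; rewrite s2.
have [S3 [X2 [X4 [c3 g3 i3 m3 s3]]]] := reduction c2 g2 mY Y0.
have [S4 [X5 [c4 g4 i4 m4 s4]]] := all_fingers c3 g3 m3.
have [L5 [p5 l5 n5 r5]] := mixed_projection (m := 4) isT c4 g4 (or_intror (conj m4 erefl)).
have q5 : quadruple_counts (linkset L) (size X5).
  exists L5; split => //; last by split => //; exists (size X5).
  by apply: isotopic_trans i2 _; rewrite s2 l5; apply: isotopic_trans i3 i4.
have [_ le] := setminP q5; apply: (leq_ltn_trans le).
by rewrite s4 -sY -s3.
Qed.
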